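(* Let $\Omega,\Gamma,L,\nu,\kappa,d,N,g,G,h,\rho,H_\Omega,\mathcal H^1$ be as described in the context, and suppose that Assumption (A) of the context holds. Then there exist $\overline r>0$ and a $\mathcal C^1$ map $$(0,\overline r)\to\mathcal H^1,\qquad r\mapsto (T_r,z^{(r)})=\big(2\pi rL,(z_1^{(r)},\dots,z_N^{(r)})\big)$$ such that for each $r\in(0,\overline r)$ the function $z^{(r)}$ is a periodic solution of $$\dot z_j(t)=-i\nabla_{z_j}H_\Omega(z(t)),\qquad j=1,\dots,N,$$ with minimal period $T_r=2\pi rL$. Moreover, these solutions have the following properties. (1) $z_k^{(r)}(t)=z_1^{(r)}\big(t+\tfrac{(k-1)T_r}{N}\big)$ for every $k=1,\dots,N$ and $t\in\mathbb R$. (2) The rescaled function $v^{(r)}(t):=z_1^{(r)}(2\pi rt)$ converges in $H^1(\mathbb R/L\mathbb Z,\mathbb C)$ as $r\to0$ to a parametrization $\gamma$ of $\Gamma$ by arc-length. More precisely, $$v^{(r)}=\gamma-r\,(\nu\circ\gamma)+o(r)\quad\text{in }H^1(\mathbb R/L\mathbb Z,\mathbb C)\text{ as }r\to0,$$ and $$\dot v^{(r)}=\big(1-r\,(\kappa\circ\gamma)\big)\,i\,(\nu\circ\gamma)+o(r)\quad\text{as }r\to0\text{, uniformly in }t\in\mathbb R.$$ (3) $d(v^{(r)}(t))=r+\tfrac12\kappa(\gamma(t))\,r^2+o(r^2)$ as $r\to0$, uniformly in $t\in\mathbb R$.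
   Context: Identify $\mathbb C$ with $\mathbb R^2$; multiplication by $i$ is rotation by $\pi/2$; vectors are columns; $\nabla_{z_j}$ is the real gradient in $z_j\in\mathbb R^2$. Geometry. $\Omega\subset\mathbb C$ is a domain (not necessarily bounded) with nonempty boundary, and $\Gamma\subset\partial\Omega$ is a closed connected component of the boundary of class $\mathcal C^3$; $\Gamma$ is diffeomorphic to $S^1$. $L$ is the length of $\Gamma$, $\nu:\Gamma\to\mathbb R^2$ the exterior unit normal (pointing out of $\Omega$), and $\kappa:\Gamma\to\mathbb R$ the curvature of $\Gamma$ with respect to $\nu$, with sign such that the derivative of $\nu$ in the tangent direction $i\nu$ equals $\kappa\, i\nu$ (so $\kappa=1$ for the unit disc). Set $d(z)=\operatorname{dist}(z,\Gamma)$ and fix $\delta>0$ so small that the orthogonal projection $p:\Omega_\delta:=\{z\in\Omega: d(z)\le\delta\}\to\Gamma$ is well defined; one may assume $|\kappa|<1/\delta$ on $\Gamma$. Hamiltonian. $N\ge1$ is an integer, $g:\Omega\times\Omega\to\mathbb R$ is a symmetric $\mathcal C^3$ function, and $$G(w,z)=-\frac1{2\pi}\log|w-z|-g(w,z)\ (w\ne z),\qquad h(z)=g(z,z),\qquad \rho(z)=\exp(-2\pi h(z)).$$ On $\mathcal F_N(\Omega)=\{(z_1,\dots,z_N)\in\Omega^N: z_j\ne z_k\text{ for }j\ne k\}$ put $$H_\Omega(z)=\sum_{j,k=1,\,j\ne k}^N G(z_j,z_k)-\sum_{k=1}^N h(z_k).$$ Assumption (A). (i) $\rho$ extended by $\rho(q)=0$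 for $q\in\Gamma$ belongs to $\mathcal C^3(\Omega\cup\Gamma)$ (all derivatives up to order 3 extend continuously), and $\nabla\rho(q)=-2\nu(q)$, $\rho''(q)=-2\kappa(q)\cdot\mathrm{id}$ (Hessian) for every $q\in\Gamma$. (ii) For every $\varepsilon>0$, $$|\nabla_1G(w,z)|+|\nabla_1^2G(w,z)|=O(d(z)),\qquad \nabla_2\nabla_1G(w,z)=O(1)\,\nu(p(z))^T+O(d(z))$$ as $d(z)\to0$, uniformly on $\{(w,z)\in\Omega\times\Omega_\delta:|w-z|\ge\varepsilon\}$. Here $\nabla_1,\nabla_1^2$ are gradient and Hessian in the first variable, $\nabla_2\nabla_1G(w,z)$ is the $2\times2$ matrix obtained by differentiating $\nabla_1G(w,z)$ with respect to the second variable, and the last relation means that there are vectors $a(w,z)\in\mathbb R^2$, uniformly bounded, with $\nabla_2\nabla_1G(w,z)-a(w,z)\nu(p(z))^T=O(d(z))$ uniformly. Function space. $\mathcal H^1=\bigcup_{T>0}\{T\}\times H^1(\mathbb R/T\mathbb Z,\mathbb C^N)$, equipped with the global chart $\mathcal H^1\to\mathbb R\times H^1(\mathbb R/2\pi\mathbb Z,\mathbb C^N)$, $(T,u)\mapsto\big(T,u(\cdot\,\tfrac{T}{2\pi})\big)$; being of class $\mathcal C^1$ is understood with respect to this chart. *)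

(* Defs.v *)
(* MathComp-Analysis; points of the plane are columns 'cV[R]_2, and a
   configuration (z_1, ..., z_N) of C^N is the 2 x N matrix with columns z_j. *)
From HB Require Import structures.
From mathcomp Require Import all_boot all_order all_algebra.
From mathcomp Require Import all_classical all_reals all_analysis.

Set Implicit Arguments.
Unset Strict Implicit.
Unset Printing Implicit Defensive.
Import Order.TTheory GRing.Theory Num.Theory.
Import numFieldNormedType.Exports.
Local Open Scope classical_set_scope.
Local Open Scope ring_scope.

Section Plane.
Context {R : realType}.

(* The library norm on matrices is the sup norm; this one is Euclidean. *)
Definition enorm (m n : nat) (A : 'M[R]_(m, n)) : R :=
  Num.sqrt (\sum_i \sum_j A i j ^+ 2).

Definition rot90 (x : 'cV[R]_2) : 'cV[R]_2 :=
  \col_i (if i == 0 then - x 1 0 else x 0 0).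

Definition grad (f : 'cV[R]_2 -> R) (x : 'cV[R]_2) : 'cV[R]_2 :=
  \col_i 'D_(delta_mx i 0) f x.

(* Entry (i, j) is the j-th partial derivative of the i-th component of F. *)
Definition jac (F : 'cV[R]_2 -> 'cV[R]_2) (x : 'cV[R]_2) : 'M[R]_2 :=
  \matrix_(i, j) 'D_(delta_mx j 0) (fun y => F y i 0) x.

Definition hess (f : 'cV[R]_2 -> R) : 'cV[R]_2 -> 'M[R]_2 := jac (grad f).

Definition distE (A : set 'cV[R]_2) (z : 'cV[R]_2) : R :=
  inf [set enorm (z - q) | q in A].

End Plane.

Section Smoothness.
Context {R : realType} {V W : normedModType R}.

(* f is of class C^k on the open set U. *)
Fixpoint Ck (k : nat) (U : set V) (f : V -> W) : Prop :=
  match k with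
  | 0 => forall x, U x -> {for x, continuous f}
  | k'.+1 => (forall x, U x -> differentiable f x) /\
             (forall v, Ck k' U ('D_v f))
  end.

Definition extends_continuously (U S : set V) (f : V -> W) : Prop :=
  exists F : V -> W,
    (forall x, U x -> F x = f x) /\ {within U `|` S, continuous F}.

(* f is of class C^k on the open set U, and f and all its derivatives up to
   order k have continuous extensions to U `|` S. *)
Fixpoint Ck_upto (k : nat) (U S : set V) (f : V -> W) : Prop :=
  extends_continuously U S f /\
  match k with
  | 0 => True
  | k'.+1 => (forall x, U x -> differentiable f x) /\
             (forall v, Ck_upto k' U S ('D_v f))
  end.

End Smoothness.

Section Geometry.
Context {R : realType}.
Implicit Types Om Gam : set 'cV[R]_2.

Definition boundary Om : set 'cV[R]_2 := closure Om `\` interior Om.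

Definition is_component Gam (B : set 'cV[R]_2) : Prop :=
  exists2 q, B q & Gam = connected_component B q.

(* Om lies locally on one side of the regular C^3 curve {phi = 0}. *)
Definition defining_function Om (q : 'cV[R]_2) (U : set 'cV[R]_2)
    (phi : 'cV[R]_2 -> R) : Prop :=
  [/\ open_nbhs q U, Ck 3 U phi,
      forall x, U x -> grad phi x != 0 &
      forall x, U x -> (Om x <-> phi x < 0)].

Definition C3_boundary Om Gam : Prop :=
  forall q, Gam q -> exists U phi, defining_function Om q U phi.

Definition exterior_unit_normal Om Gam (nu : 'cV[R]_2 -> 'cV[R]_2) : Prop :=
  forall q U phi, Gam q -> defining_function Om q U phi ->
    nu q = (enorm (grad phi q))^-1 *: grad phi q.

(* nu is only meaningful on Gam, so that its derivative in the tangent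
   direction i nu is taken along curves contained in Gam. *)
Definition curvature Gam (nu : 'cV[R]_2 -> 'cV[R]_2) (kappa : 'cV[R]_2 -> R) :
    Prop :=
  forall (c : R -> 'cV[R]_2) (s : R), (forall t, Gam (c t)) ->
    is_derive s 1 c (rot90 (nu (c s))) ->
    is_derive s 1 (nu \o c) (kappa (c s) *: rot90 (nu (c s))).

Definition closed_parametrization Gam (P : R) (c : R -> 'cV[R]_2) : Prop :=
  [/\ 0 < P /\ periodic c P,
      set_inj `[0, P[ c,
      range c = Gam,
      Ck 3 [set: R] c &
      forall s, derive1 c s != 0].

(* Gam is C^3-diffeomorphic to the circle R / 2 pi Z, and has length L. *)
Definition circle_of_length Gam (L : R) : Prop :=
  exists2 c, closed_parametrization Gam (2 * pi) c &
    L = \int[lebesgue_measure]_(s in `[0, 2 * pi]) enorm (derive1 c s).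

Definition arclength_parametrization Gam (L : R) (c : R -> 'cV[R]_2) : Prop :=
  closed_parametrization Gam L c /\ (forall s, enorm (derive1 c s) = 1).

Definition collar Om Gam (delta : R) : set 'cV[R]_2 :=
  [set z | Om z /\ distE Gam z <= delta].

Definition orthogonal_projection (A Gam : set 'cV[R]_2)
    (p : 'cV[R]_2 -> 'cV[R]_2) : Prop :=
  forall z, A z ->
    [/\ Gam (p z), enorm (z - p z) = distE Gam z &
        forall q, Gam q -> enorm (z - q) = distE Gam z -> q = p z].

End Geometry.

Section Hamiltonian.
Context {R : realType}.
Variable g : 'cV[R]_2 -> 'cV[R]_2 -> R.

Definition Gfun (w z : 'cV[R]_2) : R :=
  - (2 * pi)^-1 * ln (enorm (w - z)) - g w z.

Definition hfun (z : 'cV[R]_2) : R := g z z.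

Definition rhofun (z : 'cV[R]_2) : R := expR (- (2 * pi) * hfun z).

Definition HOm (N : nat) (z : 'M[R]_(2, N)) : R :=
  \sum_(j < N) \sum_(k < N | k != j) Gfun (col j z) (col k z)
  - \sum_(k < N) hfun (col k z).

Definition set_col (N : nat) (z : 'M[R]_(2, N)) (j : 'I_N) (x : 'cV[R]_2) :
    'M[R]_(2, N) :=
  \matrix_(i, k) (if k == j then x i 0 else z i k).

Definition grad_col (N : nat) (H : 'M[R]_(2, N) -> R) (j : 'I_N)
    (z : 'M[R]_(2, N)) : 'cV[R]_2 :=
  grad (fun x => H (set_col z j x)) (col j z).

Definition FN (Om : set 'cV[R]_2) (N : nat) : set 'M[R]_(2, N) :=
  [set z | (forall j, Om (col j z)) /\
           (forall j k, j != k -> col j z != col k z)].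

Definition solution (Om : set 'cV[R]_2) (N : nat) (z : R -> 'M[R]_(2, N)) :
    Prop :=
  forall t, FN Om (z t) /\
    forall j : 'I_N,
      is_derive t 1 (fun s => col j (z s)) (- rot90 (grad_col (@HOm N) j (z t))).

Definition grad1 (w z : 'cV[R]_2) : 'cV[R]_2 := grad (Gfun ^~ z) w.
Definition hess1 (w z : 'cV[R]_2) : 'M[R]_2 := hess (Gfun ^~ z) w.
Definition grad2grad1 (w z : 'cV[R]_2) : 'M[R]_2 := jac (grad1 w) z.

Variables Om Gam : set 'cV[R]_2.
Variables (nu : 'cV[R]_2 -> 'cV[R]_2) (kappa : 'cV[R]_2 -> R).
Variables (delta : R) (p : 'cV[R]_2 -> 'cV[R]_2).

(* The values on Gam of the continuous extensions of rho, of its gradient and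
   of its Hessian are their limits from inside Om. *)
Definition assumption_Ai : Prop :=
  Ck_upto 3 Om Gam rhofun /\
  forall q, Gam q ->
    [/\ rhofun z @[z --> within Om (nbhs q)] --> (0 : R),
        grad rhofun z @[z --> within Om (nbhs q)] --> - (2 *: nu q) &
        hess rhofun z @[z --> within Om (nbhs q)] --> (- (2 * kappa q))%:M].

Definition assumption_Aii : Prop :=
  forall eps : R, 0 < eps ->
  exists (C eta : R) (a : 'cV[R]_2 -> 'cV[R]_2 -> 'cV[R]_2),
    0 < eta /\
    forall w z, Om w -> collar Om Gam delta z -> eps <= enorm (w - z) ->
      distE Gam z < eta ->
      [/\ enorm (grad1 w z) + enorm (hess1 w z) <= C * distE Gam z,
          enorm (a w z) <= C &
          enorm (grad2grad1 w z - a w z *m (nu (p z))^T) <= C * distE Gam z].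

Definition assumption_A : Prop := assumption_Ai /\ assumption_Aii.

End Hamiltonian.

Section PeriodicSobolev.
Context {R : realType} {m n : nat}.
Implicit Types (T : R) (u du : R -> 'M[R]_(m, n)).

Definition minimal_period T u : Prop :=
  [/\ 0 < T, periodic u T & forall S, 0 < S -> periodic u S -> T <= S].

Definition in_L2 T u : Prop :=
  (forall i j, measurable_fun `[0, T] (fun t => u t i j)) /\
  (\int[lebesgue_measure]_(t in `[0%R, T]) (enorm (u t) ^+ 2)%:E < +oo)%E.

Definition test_function T (phi : R -> R) : Prop :=
  (forall k, Ck k [set: R] phi) /\ periodic phi T.

Definition weak_derivative T u du : Prop :=
  forall phi, test_function T phi -> forall i j,
    \int[lebesgue_measure]_(t in `[0, T]) (u t i j * derive1 phi t) =
    - \int[lebesgue_measure]_(t in `[0, T]) (du t i j * phi t).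

Definition H1 T : set (R -> 'M[R]_(m, n)) :=
  [set u | [/\ periodic u T, in_L2 T u &
               exists2 du, in_L2 T du & weak_derivative T u du]].

(* Weak derivatives being unique up to null sets, the infimum is over a set
   with at most one element; it is +oo when u has no square-integrable weak
   derivative. *)
Definition H1norm T u : \bar R :=
  ereal_inf [set sqrte (\int[lebesgue_measure]_(t in `[0%R, T])
                          (enorm (u t) ^+ 2 + enorm (du t) ^+ 2)%:E)
            | du in [set du | [/\ in_L2 T u, in_L2 T du &
                                  weak_derivative T u du]]].

(* The union over T > 0 of {T} x H^1(R / T Z), and its global chart. *)
Definition calH1 : set (R * (R -> 'M[R]_(m, n))) :=
  [set Tu | 0 < Tu.1 /\ H1 Tu.1 Tu.2].

Definition chart (Tu : R * (R -> 'M[R]_(m, n))) : R * (R -> 'M[R]_(m, n)) :=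
  (Tu.1, fun s => Tu.2 (s * (Tu.1 / (2 * pi)))).

(* I is open; dF is the derivative of the second component of the chart, as a
   map into H^1(R / 2 pi Z). *)
Definition C1_into_calH1 (I : set R) (F : R -> R * (R -> 'M[R]_(m, n))) :
    Prop :=
  [/\ forall r, I r -> calH1 (F r),
      Ck 1 I (fun r => (chart (F r)).1) &
      exists dF : R -> R -> 'M[R]_(m, n),
        forall r, I r ->
          [/\ H1 (2 * pi) (dF r),
              H1norm (2 * pi)
                (fun t => h^-1 *: ((chart (F (r + h))).2 t - (chart (F r)).2 t)
                          - dF r t) @[h --> 0^'] --> 0%E &
              H1norm (2 * pi) (fun t => dF s t - dF r t) @[s --> r] --> 0%E]].

End PeriodicSobolev.

(* Submission.v *)
Require Import Defs.
From HB Require Import structures.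
From mathcomp Require Import all_boot all_order all_algebra.
From mathcomp Require Import all_classical all_reals all_analysis.
From mathcomp Require Import measurable_realfun ring lra zify.

Set Implicit Arguments.
Unset Strict Implicit.
Unset Printing Implicit Defensive.
Import Order.TTheory GRing.Theory Num.Theory.
Import numFieldNormedType.Exports.
Local Open Scope classical_set_scope.
Local Open Scope ring_scope.

(*PART 1*)
Section EpsilonDelta.
Context {R : realType}.

Lemma near_ballP (V : normedModType R) (x : V) (P : V -> Prop) :
  (\forall y \near x, P y) <->
  exists2 d : R, 0 < d & forall y, `|y - x| < d -> P y.
Proof.
rewrite nbhs_normP; split=> -[d d0 H]; exists d => // y Hy; apply: H;
  by move: Hy; rewrite /= distrC.
Qed.

Lemma continuous_atP (V W : normedModType R) (f : V -> W) (x : V) :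
  {for x, continuous f} <->
  forall e : R, 0 < e -> exists2 d : R, 0 < d &
    forall y, `|y - x| < d -> `|f y - f x| <= e.
Proof.
split=> [/cvgrPdist_le H e /H /near_ballP [d d0 Hd]|H].
  by exists d => // y /Hd; rewrite distrC.
apply/cvgrPdist_le => e /H [d d0 Hd]; apply/near_ballP; exists d => // y /Hd.
by rewrite distrC.
Qed.

Lemma continuous_pair (V W Z : normedModType R) (f : V -> W) (g : V -> Z) (x : V) :
  {for x, continuous f} -> {for x, continuous g} ->
  {for x, continuous (fun y => (f y, g y))}.
Proof.
move=> /continuous_atP cf /continuous_atP cg; apply/continuous_atP => e e0.
have [d1 d10 H1] := cf e e0; have [d2 d20 H2] := cg e e0.
exists (Num.min d1 d2); first by rewrite lt_min d10.
move=> y; rewrite lt_min prod_normE ge_max => /andP[/H1 h1 /H2 h2].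
by apply/andP.
Qed.

Lemma is_deriveP (W : normedModType R) (f : R -> W) (t : R) (l : W) :
  is_derive t 1 f l <->
  forall e : R, 0 < e -> exists2 d : R, 0 < d &
    forall s, `|s - t| < d -> `|f s - f t - (s - t) *: l| <= e * `|s - t|.
Proof.
split=> [[df <-] e e0|H].
- have /cvgrPdist_le /(_ _ e0) : (fun h : R => h^-1 *: ((f \o shift t) (h *: (1 : R)) - f t))
     @ 0^' --> 'D_1 f t by apply: df.
  rewrite near_withinE => /(@near_ballP R^o) [d d0 Hd]; exists d => // s sd.
  have [->|st] := eqVneq s t; first by rewrite !subrr scale0r subrr !normr0 mulr0.
  have s0 : s - t != 0 by rewrite subr_eq0.
  have := Hd (s - t); rewrite subr0 => /(_ sd s0) /=.
  rewrite /shift /= [_ *: 1]mulr1 subrK => H.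
  rewrite -[X in `|X - _|](scalerKV s0) -scalerBr normrZ mulrC.
  by apply: ler_wpM2r => //; rewrite distrC.
- have key : (fun h : R => h^-1 *: ((f \o shift t) (h *: (1 : R)) - f t)) @ 0^' --> l.
    apply/cvgrPdist_le => e /H [d d0 Hd]; rewrite near_withinE.
    apply/(@near_ballP R^o); exists d => // h; rewrite subr0 => hd h0.
    have := Hd (t + h); rewrite addrAC subrr add0r => /(_ hd).
    rewrite /= /shift /= [_ *: 1]mulr1 [h + t]addrC => H1.
    rewrite -(ler_pM2l (_ : 0 < `|h|)) ?normr_gt0// -normrZ scalerBr scalerA.
    by rewrite mulfV// scale1r distrC [_ * e]mulrC.
  by split; [apply/cvg_ex; exists l|apply/cvg_lim].
Qed.

Lemma is_derive_continuous (W : normedModType R) (f : R -> W) (t : R) (l : W) :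
  is_derive t 1 f l -> {for t, continuous f}.
Proof. by case=> /derivable1_diffP /differentiable_continuous. Qed.

Lemma differentiableE (V W : normedModType R) (f : V -> W) (x : V) :
  differentiable f x ->
  forall e : R, 0 < e -> exists2 d : R, 0 < d &
    forall y, `|y - x| < d -> `|f y - f x - 'd f x (y - x)| <= e * `|y - x|.
Proof.
move=> /diff_locallyP [_ /eqaddoP H] e e0.
have /near_ballP [d d0 Hd] := H e e0; exists d => // y yd.
have := Hd (y - x); rewrite subr0 => /(_ yd) /=.
by rewrite !fctE /= subrK opprD addrA.
Qed.
End EpsilonDelta.

Section MeanValue.
Context {R : realType}.
Implicit Types (f df u : R -> R).

Lemma mvt_le f df (a b M : R) : a <= b ->
  (forall x : R, a <= x <= b -> is_derive x 1 f (df x)) ->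
  (forall x, a <= x <= b -> `|df x| <= M) ->
  `|f b - f a| <= M * (b - a).
Proof.
move=> ab fd dM.
have [||c cab ->] := @MVT_segment R f df a b ab.
- by move=> x; rewrite in_itv /= => /andP[/ltW ax /ltW xb]; apply: fd; rewrite ax.
- apply: continuous_in_subspaceT => x; rewrite inE /= in_itv /= => xab.
  by apply: is_derive_continuous (fd x _).
rewrite normrM (ger0_norm (_ : 0 <= b - a)) ?subr_ge0//.
by apply: ler_wpM2r; rewrite ?subr_ge0//; apply: dM; move: cab; rewrite in_itv.
Qed.

Lemma mvt_le_sym f df (a b M : R) :
  (forall x, Num.min a b <= x <= Num.max a b -> is_derive x 1 f (df x)) ->
  (forall x, Num.min a b <= x <= Num.max a b -> `|df x| <= M) ->
  `|f b - f a| <= M * `|b - a|.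
Proof.
have [ab|/ltW ba] := leP a b => H1 H2.
  by rewrite [X in _ * X]ger0_norm ?subr_ge0//; exact: mvt_le H1 H2.
rewrite distrC [X in _ * X]distrC [X in _ * X]ger0_norm ?subr_ge0//.
exact: mvt_le H1 H2.
Qed.

Lemma primitive_on u (A : R) : 0 < A -> continuous u ->
  exists2 F : R -> R, F 0 = 0 & forall x : R, `|x| < A -> is_derive x 1 F (u x).
Proof.
move=> A0 cu.
pose G x := (\int[lebesgue_measure]_(t in [set` `[- A, x]]) u t)%R.
exists (fun x => G x - G 0); first by rewrite subrr.
move=> x; rewrite ltr_norml => /andP[Ax xA].
have iu : lebesgue_measure.-integrable `[- A, A] (EFin \o u).
  apply: continuous_compact_integrable; first exact: segment_compact.
  exact: continuous_subspaceT.
have [dG G'] := continuous_FTC1_closed xA iu Ax (cu x).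
have dG' : is_derive x 1 G (u x) :=
  DeriveDef dG (etrans (esym (derive1E _ _)) G').
by rewrite -[u x]subr0; apply: is_deriveB.
Qed.

Lemma primitive_unique u F G (A x : R) : `|x| < A ->
  (forall x : R, `|x| < A -> is_derive x 1 F (u x)) ->
  (forall x : R, `|x| < A -> is_derive x 1 G (u x)) ->
  F x - F 0 = G x - G 0.
Proof.
move=> xA dF dG.
have : `|(F x - G x) - (F 0 - G 0)| <= 0 * `|x - 0|.
  apply: (@mvt_le_sym (fun x => F x - G x) (fun => 0)) => y.
    move=> Hy; rewrite -(subrr (u y)).
    have yA : `|y| < A.
      move: xA Hy; rewrite !ltr_norml => /andP[? ?] /andP[].
      by case: (leP 0 x) => ? ? ?; apply/andP; split; lra.
    by apply: is_deriveB; [exact: dF|exact: dG].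
  by rewrite normr0.
by rewrite mul0r normr_le0 => /eqP H; lra.
Qed.

Lemma exists_primitive u : continuous u ->
  exists2 F : R -> R, F 0 = 0 & forall x : R, is_derive x 1 F (u x).
Proof.
move=> cu.
have H (n : nat) : exists F : R -> R, F 0 = 0 /\
    forall x : R, `|x| < n.+1%:R -> is_derive x 1 F (u x).
  by have [F F0 dF] := primitive_on (ltr0Sn R n) cu; exists F.
have [F HF] := choice H.
pose N (x : R) := Num.bound `|x|.
have Nx (x : R) : `|x| < (N x).+1%:R.
  apply: lt_trans (archi_boundP (normr_ge0 x)) _.
  by rewrite ltr_nat.
have agree m n x : `|x| < m.+1%:R -> `|x| < n.+1%:R -> F m x = F n x.
  move=> xm xn; have [Fm0 dFm] := HF m; have [Fn0 dFn] := HF n.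
  have := @primitive_unique u (F m) (F n) (Num.min m.+1%:R n.+1%:R) x.
  rewrite lt_min xm xn Fm0 Fn0 !subr0; apply=> // y; rewrite lt_min => /andP[? ?];
  by [exact: dFm|exact: dFn].
exists (fun x => F (N x) x); first by case: (HF (N 0)).
move=> x; have [_ dF] := HF (N x).
apply: near_eq_is_derive (dF x (Nx x)).
apply/(@near_ballP R R^o); exists ((N x).+1%:R - `|x|); first by rewrite subr_gt0.
move=> y Hy; apply: agree => //.
have : `|y| <= `|y - x| + `|x| by rewrite -{1}(subrK x y); exact: ler_normD.
by lra.
Qed.

End MeanValue.

Section Periodic.
Context {R : realType}.

Lemma periodic_int (T : Type) (f : R -> T) (L : R) (n : int) (t : R) :
  (forall t, f (t + L) = f t) -> f (t + n%:~R * L) = f t.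
Proof.
move=> fL.
have H (k : nat) s : f (s + k%:R * L) = f s.
  elim: k s => [|k IH] s; first by rewrite mul0r addr0.
  by rewrite -addn1 natrD mulrDl mul1r addrA fL IH.
case: n => n; first exact: H.
by rewrite NegzE mulrNz mulNr -{2}(subrK (n.+1%:R * L) t) H.
Qed.

Lemma periodic_reduce (L t : R) : 0 < L ->
  exists n : int, 0 <= t + n%:~R * L < L.
Proof.
move=> L0; exists (- Num.floor (t / L)).
have H1 := floor_le (t / L); have H2 := floorD1_gt (t / L).
move: H1 H2; rewrite ler_pdivlMr// ltr_pdivrMr// intrD mulrDl mul1r mulrNz mulNr.
by move=> H1 H2; apply/andP; split; lra.
Qed.

(** Compactness of a period, packaged so that every local bound along a closed
curve becomes a uniform one. *)
Lemma uniform_on_segment (L : R) (P : R -> R -> Prop) :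
  (forall t d d', 0 < d' -> d' <= d -> P t d -> P t d') ->
  (forall t, exists2 d, 0 < d & forall t', `|t' - t| < d -> P t' d) ->
  exists2 d, 0 < d & forall t, 0 <= t <= L -> P t d.
Proof.
move=> mono loc.
have /compact_near_coveringP/(_ _ (0^'+ : set_system R)
  (fun d t => P t d)) H := @segment_compact R 0 L.
have : \forall d \near (0 : R)^'+, forall t, `[0, L]%classic t -> P t d.
  apply: H => t _; have [d d0 Hd] := loc t.
  near=> t' e => /=.
  apply: (mono _ d) => //; last first.
    apply: Hd; near: t'; apply/(@near_ballP R R^o); by exists d.
  near: e; exact: nbhs_right_le.
move=> H1; near (0 : R)^'+ => d; exists d => // t tL.
have : forall t, `[0, L]%classic t -> P t d by near: d.
by apply; rewrite /= in_itv.
Unshelve. all: by end_near. Qed.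

Lemma uniform_periodic (L : R) (P : R -> R -> Prop) : 0 < L ->
  (forall t d, P (t + L) d <-> P t d) ->
  (forall t d d', 0 < d' -> d' <= d -> P t d -> P t d') ->
  (forall t, exists2 d, 0 < d & forall t', `|t' - t| < d -> P t' d) ->
  exists2 d, 0 < d & forall t, P t d.
Proof.
move=> L0 per mono loc; have [d d0 Hd] := uniform_on_segment L mono loc.
exists d => // t; have [n /andP[n0 nL]] := periodic_reduce t L0.
rewrite -(@periodic_int _ (P ^~ d) L n) => [|s]; last exact/propext/per.
by apply: Hd; rewrite n0 ltW.
Qed.

End Periodic.

(*PART 2*)
Section StrictDifferentiability.
Context {R : realType}.

Definition strict_deriv (V W : normedModType R) (f : V -> W) (p : V)
    (A : V -> W) : Prop :=
  [/\ linear A, exists C : R, forall h, `|A h| <= C * `|h| &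
      forall e : R, 0 < e -> exists2 d : R, 0 < d &
        forall p1 p2, `|p1 - p| < d -> `|p2 - p| < d ->
          `|f p1 - f p2 - A (p1 - p2)| <= e * `|p1 - p2|].

Definition sdiff (V W : normedModType R) (f : V -> W) (p : V) : Prop :=
  exists A, strict_deriv f p A.

Lemma linear_sub (V W : normedModType R) (A : V -> W) : linear A ->
  forall u v, A (u - v) = A u - A v.
Proof.
by move=> lA u v; rewrite addrC -scaleN1r lA scaleN1r addrC.
Qed.

Lemma linear_scal (V W : normedModType R) (A : V -> W) : linear A ->
  forall a u, A (a *: u) = a *: A u.
Proof.
move=> lA a u; have A0 : A 0 = 0 by have := linear_sub lA 0 0; rewrite !subrr.
by have := lA a u 0; rewrite !addr0 A0 addr0.
Qed.

Lemma sdiff_lip (V W : normedModType R) (f : V -> W) (p : V) : sdiff f p ->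
  exists C : R, exists2 d : R, 0 < d & 0 < C /\
    forall p1 p2, `|p1 - p| < d -> `|p2 - p| < d ->
      `|f p1 - f p2| <= C * `|p1 - p2|.
Proof.
move=> [A [_ [C AC] /(_ 1 ltr01)[d d0 Hd]]]; exists (`|C| + 1), d => //.
split=> [|p1 p2 h1 h2]; first by rewrite ltr_wpDl.
rewrite -(subrK (A (p1 - p2)) (f p1 - f p2)).
apply: le_trans (ler_normD _ _) _; rewrite addrC mulrDl lerD//; last exact: Hd.
by apply: le_trans (AC _) _; rewrite ler_wpM2r// ler_norm.
Qed.

Lemma sdiff_continuous (V W : normedModType R) (f : V -> W) (p : V) :
  sdiff f p -> {for p, continuous f}.
Proof.
move=> /sdiff_lip [C [d d0 [C0 H]]]; apply/continuous_atP => e e0.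
exists (Num.min d (e / C)); first by rewrite lt_min d0 divr_gt0.
move=> y; rewrite lt_min => /andP[yd ye].
apply: le_trans (H _ _ yd _) _; first by rewrite subrr normr0.
by rewrite mulrC -ler_pdivlMr// ltW.
Qed.

Lemma sdiff_near (V W : normedModType R) (f g : V -> W) (p : V) :
  (\forall x \near p, f x = g x) -> sdiff f p -> sdiff g p.
Proof.
move=> /near_ballP [d1 d10 fg] [A [lA bA H]]; exists A; split=> // e /H [d d0 Hd].
exists (Num.min d d1); first by rewrite lt_min d0.
move=> p1 p2; rewrite !lt_min => /andP[h1 h1'] /andP[h2 h2'].
by rewrite -!fg//; exact: Hd.
Qed.

Lemma sdiff_lin (V W : normedModType R) (A : V -> W) (p : V) (C : R) :
  linear A -> (forall h, `|A h| <= C * `|h|) -> sdiff A p.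
Proof.
move=> lA AC; exists A; split=> //; first by exists C.
move=> e e0; exists 1 => // p1 p2 _ _.
by rewrite (linear_sub lA) subrr normr0 mulr_ge0// ltW.
Qed.

Lemma sdiff_cst (V W : normedModType R) (a : W) (p : V) : sdiff (fun=> a) p.
Proof.
exists (fun=> 0); split.
- by move=> k u v; rewrite scaler0 addr0.
- by exists 0 => h; rewrite normr0 mul0r.
- by move=> e e0; exists 1 => // p1 p2 _ _; rewrite subrr subr0 normr0 mulr_ge0// ltW.
Qed.

Lemma sdiff_id (V : normedModType R) (p : V) : sdiff id p.
Proof. by apply: (@sdiff_lin V V id p 1) => // h; rewrite mul1r. Qed.

Lemma sdiff_comp (V W Z : normedModType R) (f : W -> Z) (g : V -> W) (p : V) :
  sdiff f (g p) -> sdiff g p -> sdiff (fun x => f (g x)) p.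
Proof.
move=> [A [lA [CA bA] HA]] sg; have [C [d1 d10 [C0 HC]]] := sdiff_lip sg.
have cg := sdiff_continuous sg.
move: sg => [B [lB [CB bB] HB]]; exists (A \o B); split.
- by move=> k u v; rewrite /= lB lA.
- exists (`|CA| * CB) => h; apply: le_trans (bA _) _.
  apply: (@le_trans _ _ (`|CA| * `|B h|)); first by rewrite ler_wpM2r// ler_norm.
  by rewrite -mulrA ler_wpM2l.
- move=> e e0; have CA0 : 0 < 2 * (`|CA| + 1) by rewrite mulr_gt0// ltr_wpDl.
  have [d2 d20 H2] := HA (e / (2 * C)) (divr_gt0 e0 (mulr_gt0 (ltr0Sn _ 1) C0)).
  have [d3 d30 H3] := HB (e / (2 * (`|CA| + 1))) (divr_gt0 e0 CA0).
  have [d4 d40 H4] := (continuous_atP _ _).1 cg (d2 / 2) (divr_gt0 d20 (ltr0Sn R 1)).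
  exists (Num.min (Num.min d1 d3) d4); first by rewrite !lt_min d10 d30.
  move=> p1 p2; rewrite !lt_min => /andP[/andP[a1 a3] a4] /andP[/andP[b1 b3] b4].
  have E : f (g p1) - f (g p2) - A (B (p1 - p2)) =
     (f (g p1) - f (g p2) - A (g p1 - g p2)) + A (g p1 - g p2 - B (p1 - p2)).
    by rewrite (linear_sub lA _ (B _)) addrA subrK.
  rewrite E; apply: le_trans (ler_normD _ _) _.
  have d2h x : x <= d2 / 2 -> x < d2 by move=> h; apply: le_lt_trans h _; lra.
  have := H2 _ _ (d2h _ (H4 _ a4)) (d2h _ (H4 _ b4)).
  have := HC _ _ a1 b1; have := H3 _ _ a3 b3; have := bA (g p1 - g p2 - B (p1 - p2)).
  set N := `|p1 - p2|; set X := `|A _|; set Y := `|g p1 - g p2 - _|.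
  set U := `|g p1 - g p2|; move=> h1 h2 h3 h4.
  rewrite [e in e * N]splitr mulrDl; apply: lerD.
    apply: le_trans h4 _; apply: le_trans (ler_wpM2l _ h3) _.
      by rewrite divr_ge0 ?ltW// mulr_gt0.
    by rewrite le_eqVlt; apply/orP; left; apply/eqP; field; rewrite gt_eqF.
  apply: le_trans h1 _; apply: (@le_trans _ _ ((`|CA| + 1) * Y)).
    by apply: ler_wpM2r; [exact: normr_ge0|have := ler_norm CA; lra].
  apply: le_trans (ler_wpM2l _ h2) _; first by rewrite addr_ge0.
  rewrite le_eqVlt; apply/orP; left; apply/eqP; field.
  by rewrite gt_eqF// ltr_wpDl.
Qed.

Lemma sdiff_pair (V W Z : normedModType R) (f : V -> W) (g : V -> Z) (p : V) :
  sdiff f p -> sdiff g p -> sdiff (fun x => (f x, g x)) p.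
Proof.
move=> [A [lA [CA bA] HA]] [B [lB [CB bB] HB]].
exists (fun h => (A h, B h)); split.
- by move=> k u v; rewrite lA lB.
- exists (Num.max CA CB) => h; rewrite prod_normE /= ge_max; apply/andP; split.
    by apply: le_trans (bA h) _; rewrite ler_wpM2r// le_max lexx.
  by apply: le_trans (bB h) _; rewrite ler_wpM2r// le_max lexx orbT.
- move=> e e0; have [d1 d10 H1] := HA e e0; have [d2 d20 H2] := HB e e0.
  exists (Num.min d1 d2); first by rewrite lt_min d10.
  move=> p1 p2; rewrite !lt_min => /andP[a1 a2] /andP[b1 b2].
  rewrite prod_normE /= ge_max; apply/andP; split; [exact: H1|exact: H2].
Qed.

Lemma sdiff_fst (V W : normedModType R) (p : V * W) : sdiff (fun x : V * W => x.1) p.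
Proof.
apply: (@sdiff_lin _ _ _ _ 1) => // h; rewrite mul1r prod_normE.
by rewrite le_max lexx.
Qed.

Lemma sdiff_snd (V W : normedModType R) (p : V * W) : sdiff (fun x : V * W => x.2) p.
Proof.
apply: (@sdiff_lin _ _ _ _ 1) => // h; rewrite mul1r prod_normE.
by rewrite le_max lexx orbT.
Qed.

Lemma sdiffD (V W : normedModType R) (f g : V -> W) (p : V) :
  sdiff f p -> sdiff g p -> sdiff (fun x => f x + g x) p.
Proof.
move=> sf sg.
apply: (@sdiff_comp _ _ _ (fun x : W * W => x.1 + x.2) _ _ _ (sdiff_pair sf sg)).
apply: (@sdiff_lin _ _ _ _ 2) => [k u v /=|h].
  by rewrite scalerDr addrACA.
apply: le_trans (ler_normD _ _) _; rewrite mulr_natl mulr2n prod_normE /=.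
by apply: lerD; rewrite le_max lexx ?orbT.
Qed.

Lemma sdiffZ (V W : normedModType R) (f : V -> R) (g : V -> W) (p : V) :
  sdiff f p -> sdiff g p -> sdiff (fun x => f x *: g x) p.
Proof.
move=> sf sg.
apply: (@sdiff_comp V (R^o * W)%type W (fun x : R^o * W => (x.1 : R) *: x.2) _ _ _
  (sdiff_pair sf sg)).
move: (f p) (g p) => a b.
exists (fun h : R^o * W => a *: h.2 + (h.1 : R) *: b); split.
- by move=> k u v /=; rewrite !scalerDr scalerDl !scalerA [k * a]mulrC addrACA.
- exists (`|a| + `|b|) => h; apply: le_trans (ler_normD _ _) _.
  rewrite !normrZ mulrDl lerD// prod_normE.
    by rewrite ler_wpM2l// le_max lexx orbT.
  by rewrite mulrC ler_wpM2l// le_max lexx.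
- move=> e e0; exists (e / 2); first by rewrite divr_gt0.
  move=> [a1 b1] [a2 b2] /=; rewrite !prod_normE /= !gt_max.
  move=> /andP[h1 h2] /andP[h3 h4].
  have -> : a1 *: b1 - a2 *: b2 - (a *: (b1 - b2) + (a1 - a2) *: b) =
     (a1 - a) *: (b1 - b2) + (a1 - a2) *: (b2 - b).
    rewrite [(a1 - a) *: _]scalerBl [(a1 - a2) *: (b2 - b)]scalerBr addrACA -opprD.
    by congr (_ - _); rewrite scalerBr scalerBl addrA subrK.
  apply: le_trans (ler_normD _ _) _; rewrite !normrZ [e in leRHS]splitr mulrDl.
  apply: lerD; first by apply: ler_pM => //; [exact: ltW|rewrite le_max lexx orbT].
  by rewrite mulrC; apply: ler_pM => //; [exact: ltW|rewrite le_max lexx].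
Qed.

End StrictDifferentiability.

Section StrictDifferentiabilityExamples.
Context {R : realType}.
Implicit Types V W : normedModType R.

Lemma sdiffM V (f g : V -> R) (p : V) :
  sdiff f p -> sdiff g p -> sdiff (fun x => f x * g x) p.
Proof. exact: (@sdiffZ R V R^o f g p). Qed.

Lemma sdiffN V W (f : V -> W) (p : V) : sdiff f p -> sdiff (fun x => - f x) p.
Proof.
move=> sf; apply: (@sdiff_near _ _ _ (fun x => (-1 : R) *: f x)).
  by apply: nearW => x; rewrite scaleN1r.
by apply: (@sdiffZ R V W (fun=> -1 : R) f) => //; exact: (@sdiff_cst R V R^o).
Qed.

Lemma sdiffB V W (f g : V -> W) (p : V) :
  sdiff f p -> sdiff g p -> sdiff (fun x => f x - g x) p.
Proof. by move=> sf sg; apply: sdiffD => //; exact: sdiffN. Qed.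

Lemma sdiff_sum V W (I : Type) (r : seq I) (P : pred I) (f : I -> V -> W) (p : V) :
  (forall i, P i -> sdiff (f i) p) -> sdiff (fun x => \sum_(i <- r | P i) f i x) p.
Proof.
move=> sf; elim: r => [|i r IH].
  by apply: sdiff_near (sdiff_cst 0 p); apply: nearW => x; rewrite big_nil.
have [Pi|nPi] := boolP (P i).
  apply: sdiff_near (sdiffD (sf i Pi) IH); apply: nearW => x.
  by rewrite big_cons Pi.
by apply: sdiff_near IH; apply: nearW => x; rewrite big_cons (negbTE nPi).
Qed.

Lemma sdiff_C1 (f df : R -> R) (p d0 : R) : 0 < d0 ->
  (forall x : R, `|x - p| < d0 -> is_derive x 1 f (df x)) ->
  {for p, continuous df} -> sdiff (f : R^o -> R^o) p.
Proof.
move=> d00 fd /(@continuous_atP R R^o R^o) cdf.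
exists (fun h => df p * h); split.
- by move=> k u v; rewrite mulrDr; congr (_ + _); exact: mulrCA.
- by exists `|df p| => h; rewrite normrM.
- move=> e /cdf [d1 d10 H1]; exists (Num.min d0 d1); first by rewrite lt_min d00.
  move=> p1 p2; rewrite !lt_min => /andP[a0 a1] /andP[b0 b1].
  have -> : f p1 - f p2 - df p * (p1 - p2) =
    (f p1 - df p * p1) - (f p2 - df p * p2) by ring.
  have near_p x : Num.min p2 p1 <= x <= Num.max p2 p1 -> `|x - p| < d0 /\ `|x - p| < d1.
    move: a0 a1 b0 b1; rewrite !ltr_norml.
    by case: (leP p2 p1) => _ /andP[? ?] /andP[? ?] /andP[? ?] /andP[? ?] /andP[? ?];
      split; apply/andP; split; lra.
  apply: (@mvt_le_sym R (fun x => f x - df p * x) (fun x => df x - df p)).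
    move=> x /near_p [x0 _]; apply: is_deriveB; first exact: fd.
    rewrite -[X in is_derive _ _ _ X]mulr1.
    by apply: (@is_deriveZ _ _ _ id (df p) x 1 1).
  by move=> x /near_p [_ x1]; exact: H1.
Qed.

Lemma sdiff_inv (p : R) : p != 0 -> sdiff (fun x : R^o => x^-1 : R^o) p.
Proof.
move=> p0; have np : 0 < `|p| by rewrite normr_gt0.
apply: (@sdiff_C1 _ (fun x => - x ^- 2) p `|p|) => //.
  move=> x xp; have x0 : x != 0.
    by apply: contraTneq xp => ->; rewrite sub0r normrN ltxx.
  rewrite -[- x ^- 2]mulr1; exact: is_deriveV.
apply: continuousN; apply: (@continuousV _ _ (fun x : R => x ^+ 2)).
  by rewrite expf_neq0.
exact: exprn_continuous.
Qed.

Lemma sdiffV V (f : V -> R) (p : V) : f p != 0 -> sdiff f p ->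
  sdiff (fun x => (f x)^-1) p.
Proof. by move=> f0 sf; apply: (sdiff_comp (sdiff_inv f0) sf). Qed.

Lemma sdiff_coord V (f : V -> 'cV[R]_2) (p : V) (i : 'I_2) : sdiff f p ->
  sdiff (fun x => f x i 0 : R^o) p.
Proof.
move=> sf; apply: (@sdiff_comp R V _ R^o (fun x : 'cV[R]_2 => x i 0)) => //.
apply: (@sdiff_lin _ _ _ _ _ 1) => [k u v|h]; first by rewrite !mxE.
rewrite mul1r [leRHS]/Num.Def.normr/= mx_normrE.
by apply: le_trans; last exact: (le_bigmax _ _ (i, 0)).
Qed.

Lemma ord2P (i : 'I_2) : i = 0 \/ i = 1.
Proof. by case: i => [[|[|//]] ?]; [left|right]; apply/val_inj. Qed.

Lemma col2E (x : 'cV[R]_2) :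
  x = x 0 0 *: delta_mx 0 0 + x 1 0 *: delta_mx 1 0.
Proof.
apply/matrixP => i j; rewrite !mxE !ord1 !eqxx !andbT.
by case: (ord2P i) => ->; rewrite !eqxx /= ?mulr1 ?mulr0 ?addr0 ?add0r.
Qed.

Lemma sdiff_col V (f : V -> 'cV[R]_2) (p : V) :
  (forall i, sdiff (fun x => f x i 0 : R^o) p) -> sdiff f p.
Proof.
move=> sf; apply: (@sdiff_near _ _ _
  (fun x => f x 0 0 *: delta_mx 0 0 + f x 1 0 *: delta_mx 1 0)).
  by apply: nearW => x; rewrite -col2E.
by apply: sdiffD; apply: sdiffZ => //; exact: sdiff_cst.
Qed.

Lemma is_derive_line V (p h : V) (s : R) :
  is_derive s 1 (fun u : R => p + u *: h) h.
Proof.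
apply/is_deriveP => e e0; exists 1 => // u _.
by rewrite opprD addrACA subrr add0r -scalerBl subrr normr0 mulr_ge0// ltW.
Qed.

Lemma is_derive_comp V W (f : V -> W) (x : R -> V) (t : R) (x' : V) :
  differentiable f (x t) -> is_derive t 1 x x' ->
  is_derive t 1 (fun s => f (x s)) ('d f (x t) x').
Proof.
move=> df [/derivable1_diffP dx xE].
have dfx : differentiable (f \o x) t by exact: differentiable_comp.
apply: DeriveDef; first exact/derivable1_diffP.
by rewrite -derive1E derive1E' // diff_comp //= -xE -derive1E derive1E'.
Qed.

(** A function differentiable near a point whose directional derivatives along
a basis are continuous at that point is strictly differentiable there. *)
Lemma sdiff_partials V (I : finType) (e : I -> V) (c : I -> V -> R)
    (f : V -> R) (p : V) :
  (forall h, h = \sum_i c i h *: e i) -> (forall i h, `|c i h| <= `|h|) ->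
  (\forall q \near p, differentiable f q) ->
  (forall i, {for p, continuous (fun q => 'D_(e i) f q : R^o)}) ->
  sdiff (f : V -> R^o) p.
Proof.
move=> hE cle df cD; have [d0 d00 Hd0] := (near_ballP _ _).1 df.
have dfp : differentiable f p by apply: Hd0; rewrite subrr normr0.
have dE q h : `|q - p| < d0 -> 'd f q h = \sum_i c i h * 'D_(e i) f q.
  move=> /Hd0 dfq; rewrite [in LHS](hE h) linear_sum; apply: eq_bigr => i _.
  by rewrite linearZ /= -deriveE.
have pp : `|p - p| < d0 by rewrite subrr normr0.
exists ('d f p); split.
- by move=> k u v; rewrite linearP.
- exists (\sum_i `|'D_(e i) f p|) => h; rewrite dE//.
  apply: le_trans (ler_norm_sum _ _ _) _; rewrite mulr_suml; apply: ler_sum => i _.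
  by rewrite normrM mulrC ler_wpM2l.
- move=> eps eps0; pose e1 := eps / #|I|.+1%:R.
  have e10 : 0 < e1 by rewrite divr_gt0.
  have [d1 d10 H1] : exists2 d1, 0 < d1 & forall q, `|q - p| < d1 ->
      forall i, `|'D_(e i) f q - 'D_(e i) f p| <= e1.
    have : \forall q \near p, forall i, `|'D_(e i) f q - 'D_(e i) f p| <= e1.
      apply: filter_forall => i.
      have [d d1 Hd] := (continuous_atP _ _).1 (cD i) _ e10.
      by apply/near_ballP; exists d.
    by move=> /near_ballP.
  exists (Num.min d0 d1); first by rewrite lt_min d00.
  move=> p1 p2 a b; set h := p1 - p2.
  pose phi (s : R) := f (p2 + s *: h) - 'd f p (s *: h).
  pose dphi (s : R) := 'd f (p2 + s *: h) h - 'd f p h.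
  have seg s : 0 <= s <= 1 -> `|p2 + s *: h - p| < Num.min d0 d1.
    move=> /andP[s0 s1].
    have -> : p2 + s *: h - p = s *: (p1 - p) + (1 - s) *: (p2 - p).
      rewrite scalerBl scale1r addrCA -scalerBr.
      have -> : p1 - p - (p2 - p) = h by rewrite opprB addrA subrK.
      by rewrite addrAC.
    apply: le_lt_trans (ler_normD _ _) _; rewrite !normrZ !ger0_norm ?subr_ge0//.
    have [->|sn0] := eqVneq s 0; first by rewrite mul0r add0r subr0 mul1r.
    have sp : 0 < s by rewrite lt_neqAle eq_sym sn0.
    have -> : Num.min d0 d1 = s * Num.min d0 d1 + (1 - s) * Num.min d0 d1 by ring.
    apply: ltr_leD; first by rewrite ltr_pM2l.
    by rewrite ler_wpM2l ?subr_ge0// ltW.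
  have -> : f p1 - f p2 - 'd f p h = phi 1 - phi 0.
    rewrite /phi scale1r scale0r addr0 linear0 subr0 /h [p2 + _]addrC subrK.
    by rewrite addrAC.
  rewrite (_ : eps * `|h| = eps * `|h| * (1 - 0)); last by rewrite subr0 mulr1.
  apply: (@mvt_le _ phi dphi) => // s s01; have := seg _ s01; rewrite lt_min => /andP[h0 h1].
    apply: is_deriveB.
      apply: is_derive_comp; first exact: Hd0.
      exact: is_derive_line.
    apply/is_deriveP => e' e'0; exists 1 => // u _.
    have lZ k : 'd f p (k *: h) = k * 'd f p h by rewrite linearZ.
    rewrite !lZ.
    have -> : u * 'd f p h - s * 'd f p h - (u - s) *: 'd f p h = 0.
      by rewrite -mulrBl; exact: subrr.
    by rewrite normr0 mulr_ge0// ltW.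
  rewrite /dphi !dE// -sumrB; apply: le_trans (ler_norm_sum _ _ _) _.
  apply: (@le_trans _ _ (\sum_(i : I) e1 * `|h|)).
    apply: ler_sum => i _; rewrite -mulrBr normrM mulrC; apply: ler_pM => //.
    exact: H1.
  rewrite sumr_const -mulrnAl; apply: ler_wpM2r => //.
  by rewrite -[e1 *+ _]mulr_natr /e1 mulrAC ler_pdivrMr// ler_pM2l// ler_nat.
Qed.

Lemma sdiff_differentiable V W (f : V -> W) (p : V) : sdiff f p -> differentiable f p.
Proof.
move=> [A [lA [C bA] HA]].
pose A' : {linear V -> W} := HB.pack A (GRing.isLinear.Build R V W *:%R A lA).
have cA : continuous A'.
  move=> x; apply/continuous_atP => e e0; have C1 : 0 < `|C| + 1 by rewrite ltr_wpDl.
  exists (e / (`|C| + 1)); first by rewrite divr_gt0.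
  move=> y yx; rewrite -linearB; apply: le_trans (bA _) _.
  apply: (@le_trans _ _ ((`|C| + 1) * `|y - x|)).
    by apply: ler_wpM2r => //; have := ler_norm C; lra.
  by rewrite mulrC -ler_pdivlMr// ltW.
have exp : f \o shift p = cst (f p) + A' +o_ 0 id.
  apply/eqaddoP => e e0; apply/near_ballP; have [d d0 Hd] := HA e e0; exists d => // h.
  rewrite subr0 => hd; rewrite !fctE /=.
  have := Hd (h + p) p; rewrite addrK subrr normr0 => /(_ hd d0).
  by rewrite opprD addrA.
by apply/diff_locallyP; rewrite (diff_unique cA exp).
Qed.

End StrictDifferentiabilityExamples.

(*PART 3*)
Section UniformStrictDifferentiability.
Context {R : realType} {P W : normedModType R}.
Implicit Types (K A B : P -> W) (p h : P).

Lemma strict_deriv_close K A B p (d e : R) : 0 < d -> strict_deriv K p A ->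
  linear B ->
  (forall p1 p2, `|p1 - p| < d -> `|p2 - p| < d ->
     `|K p1 - K p2 - B (p1 - p2)| <= e * `|p1 - p2|) ->
  forall h, `|A h - B h| <= e * `|h|.
Proof.
move=> d0 [lA _ HA] lB HB h; have [->|h0] := eqVneq h 0.
  have A0 : A 0 = 0 by have := linear_sub lA 0 0; rewrite !subrr.
  have B0 : B 0 = 0 by have := linear_sub lB 0 0; rewrite !subrr.
  by rewrite A0 B0 subrr !normr0 mulr0.
have nh : 0 < `|h| by rewrite normr_gt0.
apply/ler_addgt0Pr => e' e'0.
have [d1 d10 H1] := HA _ (divr_gt0 e'0 nh).
pose m := Num.min d d1 / 2; pose s := m / `|h|.
have m0 : 0 < m by rewrite divr_gt0// lt_min d0.
have s0 : 0 < s by rewrite divr_gt0.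
have sh : `|s *: h| = m by rewrite normrZ gtr0_norm// divfK// gt_eqF.
have [md md1] : m < d /\ m < d1.
  have mm : 0 < Num.min d d1 by rewrite lt_min d0.
  have : m < Num.min d d1 by rewrite /m; lra.
  by rewrite lt_min => /andP.
have pp x : 0 < x -> `|p - p| < x by rewrite subrr normr0.
have E : p + s *: h - p = s *: h by rewrite addrAC subrr add0r.
have := HB (p + s *: h) p; have := H1 (p + s *: h) p.
rewrite E sh => /(_ md1 (pp _ d10)) h1 /(_ md (pp _ d0)) h2.
have : s * `|A h - B h| <= (e + e' / `|h|) * m.
  rewrite -[s in leLHS](gtr0_norm s0) -normrZ.
  have -> : s *: (A h - B h) =
     (K (p + s *: h) - K p - B (s *: h)) - (K (p + s *: h) - K p - A (s *: h)).
    rewrite [in RHS]opprB [RHS]addrC [RHS]addrA subrK.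
    by rewrite (linear_scal lA) (linear_scal lB) scalerBr.
  by apply: le_trans (ler_normB _ _) _; rewrite mulrDl lerD.
rewrite -ler_pdivlMl// => /le_trans; apply.
rewrite le_eqVlt; apply/orP; left; apply/eqP; rewrite /s; field.
by rewrite !gt_eqF.
Qed.

Lemma strict_deriv_unique K A B p : strict_deriv K p A -> strict_deriv K p B ->
  A = B.
Proof.
move=> HA [lB _ HB]; apply/funext => h; apply/eqP; rewrite -subr_eq0 -normr_le0.
apply/ler_addgt0Pr => e e0; rewrite add0r.
have h1 : 0 < `|h| + 1 by rewrite ltr_wpDl.
have [d d0 Hd] := HB _ (divr_gt0 e0 h1).
apply: le_trans (strict_deriv_close d0 HA lB Hd h) _.
by rewrite mulrAC ler_pdivrMr// ler_pM2l// lerDl.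
Qed.

(** Along a closed curve, strict differentiability holds with the same
modulus at all points. *)
Lemma strict_deriv_curve K (c : R -> P) (l : P) (L : R) : 0 < L ->
  continuous c -> (forall t, c (t + L) = c t + l) ->
  (forall p, K (p + l) = K p) -> (forall t, sdiff K (c t)) ->
  exists A : R -> P -> W, [/\ forall t, linear (A t),
    exists C : R, forall t h, `|A t h| <= C * `|h| &
    forall e : R, 0 < e -> exists2 d : R, 0 < d &
      forall t p1 p2, `|p1 - c t| < d -> `|p2 - c t| < d ->
          `|K p1 - K p2 - A t (p1 - p2)| <= e * `|p1 - p2|].
Proof.
move=> L0 cc cL KL sK; have [A HA] := choice sK.
have AL t : A (t + L) = A t.
  apply: (strict_deriv_unique (HA (t + L))).
  have [lA bA HAt] := HA t; split=> // e /HAt [d d0 Hd]; exists d => // p1 p2.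
  rewrite cL => h1 h2; have := Hd (p1 - l) (p2 - l).
  have -> : p1 - l - c t = p1 - (c t + l) by rewrite opprD addrA addrAC.
  have -> : p2 - l - c t = p2 - (c t + l) by rewrite opprD addrA addrAC.
  rewrite opprB addrA subrK -!(KL (_ - l)) !subrK; exact.
have loc e t : 0 < e -> exists2 d, 0 < d & forall t', `|t' - t| < d ->
  (forall h, `|A t' h - A t h| <= e * `|h|) /\
  forall p1 p2, `|p1 - c t'| < d -> `|p2 - c t'| < d ->
    `|K p1 - K p2 - A t (p1 - p2)| <= e * `|p1 - p2|.
  move=> e0; have [lA _ /(_ _ e0)[d d0 Hd]] := HA t.
  have d20 : 0 < d / 2 by rewrite divr_gt0.
  have [d1 d10 Hd1] := (@continuous_atP R R^o _ _ _).1 (cc t) (d / 4) (divr_gt0 d0 (ltr0Sn _ 3)).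
  exists (Num.min d1 (d / 2)); first by rewrite lt_min d10.
  move=> t'; rewrite lt_min => /andP[/Hd1 ct' _].
  have tri p : `|p - c t'| < d / 2 -> `|p - c t| < d.
    move=> hp; have -> : p - c t = (p - c t') + (c t' - c t) by rewrite addrA subrK.
    by apply: le_lt_trans (ler_normD _ _) _; lra.
  split; last first.
    by move=> p1 p2; rewrite !lt_min => /andP[_ /tri h1] /andP[_ /tri h2]; exact: Hd.
  apply: (strict_deriv_close d20 (HA t') lA) => p1 p2 /tri h1 /tri h2.
  exact: Hd.
exists A; split; first by move=> t; case: (HA t).
- have [] := @uniform_periodic R L (fun t d => forall h, `|A t h| <= d^-1 * `|h|) L0.
  + by move=> t d; rewrite AL.
  + move=> t d d' d'0 d'd H h; apply: le_trans (H h) _; rewrite ler_wpM2r//.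
    by rewrite lef_pV2// posrE; exact: lt_le_trans d'd.
  + move=> t; have [lA [C HC] _] := HA t; have [d d0 Hd] := loc 1 t ltr01.
    have C0 : 0 < `|C| + 1 by rewrite ltr_wpDl.
    exists (Num.min d (`|C| + 1)^-1); first by rewrite lt_min d0 invr_gt0.
    move=> t'; rewrite lt_min => /andP[/Hd [H _] _] h.
    apply: (@le_trans _ _ ((`|C| + 1) * `|h|)).
      rewrite -(subrK (A t h) (A t' h)) addrC mulrDl.
      apply: le_trans (ler_normD _ _) _; apply: lerD; last exact: H.
      by apply: le_trans (HC h) _; rewrite ler_wpM2r// ler_norm.
    rewrite ler_wpM2r// -[leLHS]invrK lef_pV2 ?posrE ?invr_gt0//.
      by rewrite ge_min lexx orbT.
    by rewrite lt_min d0 invr_gt0.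
  + by move=> d d0 H; exists d^-1.
- move=> e e0; apply: (@uniform_periodic R L (fun t d => forall p1 p2,
    `|p1 - c t| < d -> `|p2 - c t| < d ->
    `|K p1 - K p2 - A t (p1 - p2)| <= e * `|p1 - p2|)) => //.
  + move=> t d; rewrite AL cL; split=> H p1 p2 h1 h2.
      have := H (p1 + l) (p2 + l).
      rewrite !KL !(addrC _ l) !opprD !addrA ![l + _ - l]addrAC !subrr !add0r; exact.
    have := H (p1 - l) (p2 - l).
    have -> : p1 - l - c t = p1 - (c t + l) by rewrite opprD addrA addrAC.
    have -> : p2 - l - c t = p2 - (c t + l) by rewrite opprD addrA addrAC.
    by rewrite opprB addrA subrK -!(KL (_ - l)) !subrK; exact.
  + by move=> t d d' d'0 d'd H p1 p2 h1 h2; apply: H; exact: lt_le_trans d'd.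
  + move=> t; have [d d0 Hd] := loc (e / 2) t (divr_gt0 e0 (ltr0Sn _ 1)).
    exists d => // t' /Hd [H1 H2] p1 p2 h1 h2.
    have -> : K p1 - K p2 - A t' (p1 - p2) =
      (K p1 - K p2 - A t (p1 - p2)) - (A t' (p1 - p2) - A t (p1 - p2)).
      by rewrite opprB addrA subrK.
    apply: le_trans (ler_normB _ _) _; rewrite [e in leRHS]splitr mulrDl.
    by apply: lerD; [exact: H2|exact: H1].
Qed.

End UniformStrictDifferentiability.

Section Contractions.
Context {R : realType} {T : Type}.
Implicit Types (u v f : T -> R) (Q X : set (T -> R)).

Lemma bound_contract f (q e M0 : R) : 0 <= q -> q < 1 -> (forall t, `|f t| <= M0) ->
  (forall M, (forall t, `|f t| <= M) -> forall t, `|f t| <= q * M + e) ->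
  forall t, `|f t| <= e / (1 - q).
Proof.
move=> q0 q1 fM H t.
pose S := sup [set `|f t| | t in setT].
have Sub : has_sup [set `|f t| | t in setT].
  by split; [exists `|f t|, t|exists M0 => _ [s _ <-]].
have fS s : `|f s| <= S by apply: ub_le_sup; [case: Sub|exists s].
have SS : S <= q * S + e.
  by apply: ge_sup; [case: Sub|move=> _ [s _ <-]; exact: H].
apply: le_trans (fS t) _; rewrite ler_pdivlMr ?subr_gt0//; lra.
Qed.

Lemma cauchy_at (f : R -> R) (a : R) :
  (forall e : R, 0 < e -> exists2 d : R, 0 < d & forall x y,
     0 < `|x - a| < d -> 0 < `|y - a| < d -> `|f x - f y| <= e) ->
  exists l : R, forall e : R, 0 < e -> exists2 d : R, 0 < d & forall x,
     0 < `|x - a| < d -> `|f x - l| <= e.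
Proof.
move=> H.
have cf : cvg (f x @[x --> a^']).
  apply/cauchy_cvgP/cauchy_ballP => e e0; rewrite near_map2.
  have [d d0 Hd] := H _ (divr_gt0 e0 (ltr0Sn R 1)).
  have nd : \forall x \near a^', 0 < `|x - a| < d.
    rewrite near_withinE; apply/(@near_ballP R R^o); exists d => // x xd xa.
    by rewrite normr_gt0 subr_eq0 xa.
  near=> x y => /=; rewrite -ball_normE /=.
  apply: (@le_lt_trans _ _ (e / 2)); last by lra.
  by apply: Hd; [near: x|near: y].
exists (lim (f x @[x --> a^'])) => e e0.
have /cvgrPdist_le /(_ _ e0) := cf; rewrite near_withinE => /(@near_ballP R R^o).
move=> [d d0 Hd]; exists d => // x /andP[x0 xd]; rewrite distrC; apply: Hd => //.
by rewrite -subr_eq0 -normr_gt0.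
Unshelve. all: by end_near. Qed.

Lemma fun_contraction (Q : set (T -> R)) (Phi : (T -> R) -> T -> R) u0 (M0 : R) :
  Q u0 -> (forall u, Q u -> Q (Phi u)) ->
  (forall l, (forall e : R, 0 < e -> exists2 v, Q v & forall t, `|v t - l t| <= e) ->
     Q l) ->
  (forall u v (M : R), Q u -> Q v -> (forall t, `|u t - v t| <= M) ->
     forall t, `|Phi u t - Phi v t| <= M / 2) ->
  (forall t, `|Phi u0 t - u0 t| <= M0) ->
  exists u, [/\ Q u, forall t, Phi u t = u t & forall t, `|u t - u0 t| <= 2 * M0].
Proof.
move=> Q0 QPhi Qcl ctr HM0.
pose s n := iter n Phi u0; have Qs n : Q (s n) by elim: n => //= n; exact: QPhi.
pose B n := 2 * M0 / 2 ^+ n.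
have BS n : B n = M0 / 2 ^+ n + B n.+1.
  by rewrite /B exprS; field; rewrite expf_neq0.
have step n t : `|s n.+1 t - s n t| <= M0 / 2 ^+ n.
  elim: n t => [|n IH] t; first by rewrite expr0 divr1; exact: HM0.
  have := ctr _ _ _ (Qs n.+1) (Qs n) IH t.
  by rewrite exprSr invfM mulrA.
have dist k n t : `|s (n + k)%N t - s n t| <= B n - B (n + k)%N.
  elim: k => [|k IH]; first by rewrite addn0 !subrr normr0.
  rewrite addnS -(subrK (s (n + k)%N t) (s _.+1 t)) -addrA.
  apply: le_trans (ler_normD _ _) _.
  have := step (n + k)%N t; have := BS (n + k)%N; lra.
have [[t0 _]|nT] := pselect (exists t : T, True); last first.
  exists u0; split=> // t; by case: nT; exists t.
have M00 : 0 <= M0 by apply: le_trans (HM0 t0).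
have Bsmall (e : R) : 0 < e -> exists n, B n <= e.
  move=> e0.
  exists (Num.bound (2 * M0 / e)); rewrite /B ler_pdivrMr ?exprn_gt0// [e * _]mulrC.
  rewrite -ler_pdivrMr//; apply: ltW; apply: lt_trans (archi_boundP _) _.
    by rewrite divr_ge0 ?mulr_ge0 ?(ltW e0).
  by rewrite -natrX ltr_nat ltn_expl.
have B0 n : 0 <= B n by rewrite /B divr_ge0 ?mulr_ge0 ?exprn_ge0.
have sc t : exists l : R, forall n, `|s n t - l| <= B n.
  have cs : cvgn (s ^~ t).
    apply/cauchy_cvgP/cauchy_exP => e e0.
    have [n Hn] := Bsmall _ (divr_gt0 e0 (ltr0Sn R 1)).
    exists (s n t); exists n => // m /= nm; rewrite /ball /= distrC.
    rewrite -(subnKC nm); apply: le_lt_trans (dist _ _ _) _.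
    have := B0 (n + (m - n))%N; lra.
  exists (limn (s ^~ t)) => n; apply/ler_addgt0Pr => e e0.
  have [N _ HN] := (cvgrPdist_le _ _).1 cs _ e0.
  have := HN (n + N)%N (leq_addl _ _); have := dist N n t; have := B0 (n + N)%N.
  set l := limn _ => h1 h2 /= h3.
  have -> : s n t - l = - (s (n + N)%N t - s n t) - (l - s (n + N)%N t) by ring.
  by apply: le_trans (ler_normB _ _) _; rewrite normrN; lra.
have [l Hl] := choice sc.
have Ql : Q l.
  apply: Qcl => e e0; have [n Hn] := Bsmall e e0; exists (s n) => // t.
  exact: le_trans Hn.
exists l; split=> // [t|t]; last first.
  by have := Hl t 0%N; rewrite /B expr0 divr1 distrC.
apply/eqP; rewrite -subr_eq0 -normr_le0; apply/ler_addgt0Pr => e e0; rewrite add0r.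
have [n Hn] := Bsmall (e / 2) (divr_gt0 e0 (ltr0Sn _ 1)).
have h1 : `|Phi (s n) t - Phi l t| <= B n / 2.
  by apply: ctr => // t'; exact: Hl.
have := Hl t n.+1; have := BS n; have : 0 <= M0 / 2 ^+ n.
  by rewrite divr_ge0 ?exprn_ge0.
move=> h2 h3 h4.
have -> : Phi l t - l t = (s n.+1 t - l t) - (Phi (s n) t - Phi l t) by rewrite /=; ring.
by apply: le_trans (ler_normB _ _) _; lra.
Qed.

Definition usd (W : normedModType R) (u : R -> T -> W) (r0 : R) (y : T -> W) : Prop :=
  forall e : R, 0 < e -> exists2 d : R, 0 < d &
    forall r1 r2, `|r1 - r0| < d -> `|r2 - r0| < d ->
      forall t, `|u r1 t - u r2 t - (r1 - r2) *: y t| <= e * `|r1 - r2|.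

(** Fixed points of a contraction depend differentiably on a parameter: their
difference quotients satisfy, up to a small error, one and the same contractive
linear equation, hence form a Cauchy family. *)
Lemma fixed_point_usd X (Phi : R -> (T -> R) -> T -> R) (u : R -> T -> R)
    (rb e0 r0 : R) (A : (T -> R) -> T -> R) (b : T -> R) (Bb : R) :
  let Q := [set v | X v /\ forall t, `|v t| <= e0] in
  0 < e0 -> 0 < r0 < rb ->
  (forall v w (k : R), X v -> X w -> X (fun t => v t + k * w t)) ->
  (forall r, 0 < r < rb -> [/\ X (u r), forall t, `|u r t| <= e0 / 2 &
     forall t, Phi r (u r) t = u r t]) ->
  (forall r v w (M : R), 0 < r < rb -> Q v -> Q w ->
     (forall t, `|v t - w t| <= M) ->
     forall t, `|Phi r v t - Phi r w t| <= M / 2) ->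
  (forall v w (k : R), X v -> X w -> forall t,
     A (fun t => v t + k * w t) t = A v t + k * A w t) ->
  (forall t, `|b t| <= Bb) ->
  (forall e : R, 0 < e -> exists2 d : R, 0 < d &
     forall r1 r2 v w (M : R), `|r1 - r0| < d -> `|r2 - r0| < d -> Q v -> Q w ->
     (forall t, `|v t - u r0 t| <= d) -> (forall t, `|w t - u r0 t| <= d) ->
     (forall t, `|v t - w t| <= M) ->
     forall t, `|Phi r1 v t - Phi r2 w t - (r1 - r2) * b t
                 - A (fun t => v t - w t) t| <= e * (`|r1 - r2| + M)) ->
  exists y, usd (W := R^o) u r0 y.
Proof.
move=> Q e00 r0b Xlin Hu ctr Alin HBb osd.
have [Xu0 u0b u0fix] := Hu r0 r0b.
have Qu r : 0 < r < rb -> Q (u r).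
  by move=> /Hu [Xu ub _]; split=> // t; apply: le_trans (ub t) _; lra.
have XB v w : X v -> X w -> X (fun t => v t - w t).
  move=> Xv Xw; suff -> : (fun t => v t - w t) = (fun t => v t + (-1) * w t) by exact: Xlin.
  by apply/funext => t; ring.
have [t1|nT] := pselect (inhabited T); last first.
  exists (fun=> 0) => e e1; exists 1 => // r1 r2 _ _ t.
  by case: nT; exists.
case: t1 => t1.
have Bb0 : 0 <= Bb by apply: le_trans (HBb t1).
(* the linearised map inherits a contraction constant *)
have Abound w (M : R) : X w -> (forall t, `|w t| <= M) -> forall t, `|A w t| <= 5 / 8 * M.
  move=> Xw wM t; have M0 : 0 <= M by apply: le_trans (wM t1).
  have [d d0 Hd] := osd (1 / 8) (divr_gt0 ltr01 (ltr0Sn _ 7)).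
  pose h := Num.min d (e0 / 2) / (M + 1).
  have m0 : 0 < Num.min d (e0 / 2) by rewrite lt_min d0 divr_gt0.
  have h0 : 0 < h by rewrite divr_gt0// ltr_wpDl.
  have hM : h * M <= Num.min d (e0 / 2).
    rewrite /h mulrAC ler_pdivrMr ?ltr_wpDl//; apply: ler_wpM2l; first exact: ltW.
    by rewrite lerDl.
  move: hM; rewrite le_min => /andP[hMd hMe].
  pose v t := u r0 t + h * w t.
  have vw t' : v t' - u r0 t' = h * w t' by rewrite /v addrAC subrr add0r.
  have hw t' : `|h * w t'| <= h * M by rewrite normrM gtr0_norm// ler_pM2l.
  have Qv : Q v.
    split; first exact: Xlin.
    move=> t'; apply: le_trans (ler_normD _ _) _; have := u0b t'; have := hw t'.
    lra.
  have rr : `|r0 - r0| < d by rewrite subrr normr0.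
  have H0 := Hd r0 r0 v (u r0) (h * M) rr rr Qv (Qu _ r0b).
  have {H0}: `|Phi r0 v t - Phi r0 (u r0) t - (r0 - r0) * b t
       - A (fun t => v t - u r0 t) t| <= 1 / 8 * (`|r0 - r0| + h * M).
    apply: H0 => t'; rewrite ?vw//; last by rewrite subrr normr0 ltW.
    exact: le_trans (hw t') hMd.
  have := ctr r0 v (u r0) (h * M) r0b Qv (Qu _ r0b).
  have -> : (fun t => v t - u r0 t) = (fun t => 0 * w t + h * w t).
    by apply/funext => t'; rewrite vw mul0r add0r.
  have -> : A (fun t => 0 * w t + h * w t) t = h * A w t.
    have X0 : X (fun t => 0 * w t).
      suff -> : (fun t => 0 * w t) = (fun t => w t - w t) by exact: XB.
      by apply/funext => t'; ring.
    rewrite (Alin (fun t => 0 * w t))//.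
    have := Alin (fun t => 0 * w t) (fun t => 0 * w t) 1 X0 X0 t.
    suff -> : (fun t => 0 * w t + 1 * (0 * w t)) = (fun t => 0 * w t) by lra.
    by apply/funext => t'; ring.
  rewrite subrr normr0 add0r mul0r subr0.
  have h8 t' : `|v t' - u r0 t'| <= h * M by rewrite vw.
  move=> /(_ h8 t) h1 h2.
  have : `|h * A w t| <= h * M / 2 + 1 / 8 * (h * M).
    have -> : h * A w t = (Phi r0 v t - Phi r0 (u r0) t) -
      (Phi r0 v t - Phi r0 (u r0) t - h * A w t) by ring.
    by apply: le_trans (ler_normB _ _) _; exact: lerD.
  rewrite normrM gtr0_norm// => h3; rewrite -(ler_pM2l h0).
  by apply: le_trans h3 _; lra.
(* Lipschitz dependence at r0 *)
have [d1 d10 Hd1] := osd (1 / 8) (divr_gt0 ltr01 (ltr0Sn _ 7)).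
pose C1 := 2 * (Bb + 1 / 8).
have C10 : 0 < C1 by rewrite /C1; lra.
have lip0 r : 0 < r < rb -> `|r - r0| < d1 -> forall t, `|u r t - u r0 t| <= C1 * `|r - r0|.
  move=> rb0 rd t; have rr : `|r0 - r0| < d1 by rewrite subrr normr0.
  have [_ urb ufix] := Hu r rb0.
  have -> : C1 * `|r - r0| = (Bb + 1 / 8) * `|r - r0| / (1 - 2^-1).
    by rewrite /C1; field.
  apply: (@bound_contract (fun t => u r t - u r0 t) (2^-1) _ e0); [lra|lra| |] => {t}.
    move=> t; apply: le_trans (ler_normB _ _) _; have := urb t; have := u0b t; lra.
  move=> M HM t.
  have h1 := ctr r (u r) (u r0) M rb0 (Qu _ rb0) (Qu _ r0b) HM t.
  have z t' : `|u r0 t' - u r0 t'| <= 0 by rewrite subrr normr0.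
  have z' t' : `|u r0 t' - u r0 t'| <= d1 by rewrite subrr normr0 ltW.
  have := Hd1 r r0 (u r0) (u r0) 0 rd rr (Qu _ r0b) (Qu _ r0b) z' z' z t.
  have -> : A (fun t => u r0 t - u r0 t) t = 0.
    have X0 := XB _ _ Xu0 Xu0.
    apply/eqP; rewrite -normr_le0 -(mulr0 (5 / 8)); apply: Abound => // t'.
  rewrite subr0 addr0 => h2.
  rewrite -ufix -u0fix.
  have -> : Phi r (u r) t - Phi r0 (u r0) t = (Phi r (u r) t - Phi r (u r0) t) +
     ((Phi r (u r0) t - Phi r0 (u r0) t - (r - r0) * b t) + (r - r0) * b t) by ring.
  apply: le_trans (ler_normD _ _) _; apply: lerD; first by rewrite mulrC in h1 *; lra.
  apply: le_trans (ler_normD _ _) _; rewrite normrM.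
  have : `|r - r0| * `|b t| <= `|r - r0| * Bb by rewrite ler_wpM2l.
  lra.
(* strict expansion along pairs *)
pose C2 := 4 * (Bb + 1 / 8).
have C20 : 0 < C2 by rewrite /C2; lra.
have pairs e : 0 < e -> e <= 1 / 8 -> exists2 d, 0 < d & forall r1 r2,
   `|r1 - r0| < d -> `|r2 - r0| < d ->
   [/\ 0 < r1 < rb, 0 < r2 < rb, forall t, `|u r1 t - u r2 t| <= C2 * `|r1 - r2| &
    forall t, `|u r1 t - u r2 t - (r1 - r2) * b t - A (fun t => u r1 t - u r2 t) t|
      <= e * (1 + C2) * `|r1 - r2|].
  move=> ep e8; have [d2 d20 Hd2] := osd e ep.
  have rbd : 0 < Num.min r0 (rb - r0).
    by case/andP: r0b => ? ?; rewrite lt_min subr_gt0; apply/andP.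
  pose d := Num.min (Num.min d1 d2) (Num.min (d2 / C1) (Num.min r0 (rb - r0))).
  exists d; first by rewrite !lt_min d10 d20 divr_gt0//= -lt_min.
  move=> r1 r2; rewrite !lt_min.
  move=> /andP[/andP[a1 a2] /andP[a3 /andP[a4 a5]]] /andP[/andP[b1 b2] /andP[b3 /andP[b4 b5]]].
  have rng r : `|r - r0| < r0 -> `|r - r0| < rb - r0 -> 0 < r < rb.
    by rewrite !ltr_norml => /andP[? ?] /andP[? ?]; apply/andP; split; lra.
  have R1 := rng _ a4 a5; have R2 := rng _ b4 b5.
  have near r : 0 < r < rb -> `|r - r0| < d1 -> `|r - r0| < d2 / C1 ->
      forall t, `|u r t - u r0 t| <= d2.
    move=> h1 h2 h3 t; apply: le_trans (lip0 r h1 h2 t) _.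
    by rewrite mulrC -ler_pdivlMr// ltW.
  have N1 := near _ R1 a1 a3; have N2 := near _ R2 b1 b3.
  have [X1 B1 F1] := Hu _ R1; have [X2 B2 F2] := Hu _ R2.
  have exp M : (forall t, `|u r1 t - u r2 t| <= M) -> forall t,
     `|u r1 t - u r2 t - (r1 - r2) * b t - A (fun t => u r1 t - u r2 t) t|
      <= e * (`|r1 - r2| + M).
    move=> HM t; rewrite -{1}F1 -{1}F2.
    exact: (Hd2 r1 r2 _ _ M a2 b2 (Qu _ R1) (Qu _ R2)).
  have L12 t : `|u r1 t - u r2 t| <= C2 * `|r1 - r2|.
    have -> : C2 * `|r1 - r2| = (Bb + 1 / 8) * `|r1 - r2| / (1 - 3 / 4).
      by rewrite /C2; field.
    apply: (@bound_contract (fun t => u r1 t - u r2 t) (3 / 4) _ e0); [lra|lra| |] => {t}.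
      move=> t; apply: le_trans (ler_normB _ _) _; have := B1 t; have := B2 t; lra.
    move=> M HM t.
    have M0 : 0 <= M by apply: le_trans (HM t1).
    have h1 := exp M HM t; have h2 := Abound _ M (XB _ _ X1 X2) HM t.
    have -> : u r1 t - u r2 t = (u r1 t - u r2 t - (r1 - r2) * b t -
      A (fun t => u r1 t - u r2 t) t) + ((r1 - r2) * b t + A (fun t => u r1 t - u r2 t) t).
      by ring.
    apply: le_trans (ler_normD _ _) _.
    have := ler_normD ((r1 - r2) * b t) (A (fun t => u r1 t - u r2 t) t).
    rewrite normrM; have : `|r1 - r2| * `|b t| <= `|r1 - r2| * Bb by rewrite ler_wpM2l.
    have : e * (`|r1 - r2| + M) <= 1 / 8 * (`|r1 - r2| + M).
      by rewrite ler_wpM2r// addr_ge0.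
    by lra.
  split=> // t.
  have -> : e * (1 + C2) * `|r1 - r2| = e * (`|r1 - r2| + C2 * `|r1 - r2|) by ring.
  exact: exp.
(* Cauchy difference quotients *)
pose D r1 r2 t := (u r1 t - u r2 t) / (r1 - r2).
have DC e : 0 < e -> exists2 d, 0 < d & forall r1 r2 r3 r4,
   `|r1 - r0| < d -> `|r2 - r0| < d -> `|r3 - r0| < d -> `|r4 - r0| < d ->
   r1 != r2 -> r3 != r4 -> forall t, `|D r1 r2 t - D r3 r4 t| <= e.
  move=> ep; pose e' := Num.min (1 / 8) (e * (3 / 8) / (2 * (1 + C2))).
  have C2p : 0 < 2 * (1 + C2) by lra.
  have e'0 : 0 < e' by rewrite lt_min !divr_gt0// mulr_gt0// divr_gt0.
  have [||d d0 Hd] := pairs e'; rewrite ?ge_min ?lexx//.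
  exists d => // r1 r2 r3 r4 a1 a2 a3 a4 n12 n34 t.
  have [R1 R2 L12 E12] := Hd _ _ a1 a2; have [R3 R4 L34 E34] := Hd _ _ a3 a4.
  have [X1 _ _] := Hu _ R1; have [X2 _ _] := Hu _ R2.
  have [X3 _ _] := Hu _ R3; have [X4 _ _] := Hu _ R4.
  have XD12 : X (D r1 r2).
    have -> : D r1 r2 = (fun t => (u r1 t - u r1 t) + (r1 - r2)^-1 * (u r1 t - u r2 t)).
      by apply/funext => t'; rewrite /D; ring.
    by apply: Xlin; exact: XB.
  have XD34 : X (D r3 r4).
    have -> : D r3 r4 = (fun t => (u r3 t - u r3 t) + (r3 - r4)^-1 * (u r3 t - u r4 t)).
      by apply/funext => t'; rewrite /D; ring.
    by apply: Xlin; exact: XB.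
  have Dlin r r' : r != r' -> X (u r) -> X (u r') -> X (D r r') -> forall t,
      A (fun t => u r t - u r' t) t = (r - r') * A (D r r') t.
    move=> nrr Xr Xr' XD t'.
    have -> : (fun t => u r t - u r' t) = (fun t => (D r r' t + (-1) * D r r' t) + (r - r') * D r r' t).
      by apply/funext => t''; rewrite /D; field; rewrite subr_eq0.
    by rewrite Alin//; [rewrite Alin//; ring|exact: Xlin].
  have Dexp r r' : r != r' -> X (u r) -> X (u r') -> X (D r r') ->
     (forall t, `|u r t - u r' t - (r - r') * b t - A (fun t => u r t - u r' t) t|
      <= e' * (1 + C2) * `|r - r'|) ->
     forall t, `|D r r' t - b t - A (D r r') t| <= e' * (1 + C2).
    move=> nrr Xr Xr' XD H t'; have := H t'; rewrite Dlin// => H'.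
    have n0 : 0 < `|r - r'| by rewrite normr_gt0 subr_eq0.
    rewrite -(ler_pM2r n0) -normrM; move: H'.
    suff -> : (D r r' t' - b t' - A (D r r') t') * (r - r') =
      u r t' - u r' t' - (r - r') * b t' - (r - r') * A (D r r') t' by [].
    by rewrite /D; field; rewrite subr_eq0.
  have G12 := Dexp _ _ n12 X1 X2 XD12 E12; have G34 := Dexp _ _ n34 X3 X4 XD34 E34.
  have Db r r' : r != r' -> (forall t, `|u r t - u r' t| <= C2 * `|r - r'|) ->
     forall t, `|D r r' t| <= C2.
    move=> nrr H t'; rewrite /D normrM normfV ler_pdivrMr ?H//.
    by rewrite normr_gt0 subr_eq0.
  have D12 := Db _ _ n12 L12; have D34 := Db _ _ n34 L34.
  have : e' * (1 + C2) * 2 / (1 - 5 / 8) <= e.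
    have : e' <= e * (3 / 8) / (2 * (1 + C2)) by rewrite ge_min lexx orbT.
    by rewrite ler_pdivlMr// => h; rewrite ler_pdivrMr; lra.
  apply: le_trans.
  apply: (@bound_contract (fun t => D r1 r2 t - D r3 r4 t) (5 / 8) _ (C2 + C2)); [lra|lra| |] => {t}.
    by move=> t; apply: le_trans (ler_normB _ _) _; exact: lerD.
  move=> M HM t.
  have h := Abound _ M (XB _ _ XD12 XD34) HM t.
  have AB : A (fun t => D r1 r2 t - D r3 r4 t) t = A (D r1 r2) t - A (D r3 r4) t.
    have -> : (fun t => D r1 r2 t - D r3 r4 t) = (fun t => D r1 r2 t + (-1) * D r3 r4 t).
      by apply/funext => t'; ring.
    by rewrite Alin//; ring.
  have -> : D r1 r2 t - D r3 r4 t = A (fun t => D r1 r2 t - D r3 r4 t) t +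
    ((D r1 r2 t - b t - A (D r1 r2) t) - (D r3 r4 t - b t - A (D r3 r4) t)).
    by rewrite AB; ring.
  apply: le_trans (ler_normD _ _) _; apply: lerD => //.
  apply: le_trans (ler_normB _ _) _; have := G12 t; have := G34 t; lra.
have lims t : exists l : R, forall e : R, 0 < e -> exists2 d : R, 0 < d & forall x,
     0 < `|x - r0| < d -> `|D x r0 t - l| <= e.
  apply: cauchy_at => e ep; have [d d0 Hd] := DC e ep; exists d => // x y.
  move=> /andP[x0 xd] /andP[yy yd].
  have rr : `|r0 - r0| < d by rewrite subrr normr0.
  by apply: Hd => //; rewrite -subr_eq0 -normr_gt0.
have [y Hy] := choice lims.
exists y => e ep; have e2 : 0 < e / 2 by rewrite divr_gt0.
have [d d0 Hd] := DC _ e2; exists d => // r1 r2 h1 h2 t.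
have [->|n12] := eqVneq r1 r2.
  by rewrite !subrr scale0r subrr !normr0 mulr0.
have [d3 d30 Hd3] := Hy t _ e2.
pose x := r0 + Num.min d d3 / 2.
have m0 : 0 < Num.min d d3 by rewrite lt_min d0.
have xr : `|x - r0| = Num.min d d3 / 2.
  by rewrite /x addrAC subrr add0r gtr0_norm// divr_gt0.
have [xd xd3] : `|x - r0| < d /\ `|x - r0| < d3.
  have : `|x - r0| < Num.min d d3 by rewrite xr; lra.
  by rewrite lt_min => /andP.
have xn : x != r0 by rewrite -subr_eq0 -normr_gt0 xr divr_gt0.
have rr : `|r0 - r0| < d by rewrite subrr normr0.
have g1 := Hd r1 r2 x r0 h1 h2 xd rr n12 xn t.
have g2 : `|D x r0 t - y t| <= e / 2.
  by apply: Hd3; rewrite xd3 andbT normr_gt0 subr_eq0.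
have n0 : r1 - r2 != 0 by rewrite subr_eq0.
have -> : u r1 t - u r2 t - (r1 - r2) *: y t =
    ((D r1 r2 t - D x r0 t) + (D x r0 t - y t)) * (r1 - r2).
  by rewrite [_ *: _]/(_ * _) addrA subrK mulrBl /D divfK// [y t * _]mulrC.
rewrite normrM; apply: ler_wpM2r => //.
by apply: le_trans (ler_normD _ _) _; lra.
Qed.

End Contractions.

(*PART 4*)
Section PeriodicPrimitive.
Context {R : realType}.
Implicit Types (u v : R -> R) (L t : R).

Definition prim u : R -> R :=
  if pselect (continuous u) is left cu then sval (cid2 (exists_primitive cu))
  else fun=> 0.

Lemma prim0 u : prim u 0 = 0.
Proof. by rewrite /prim; case: pselect => // cu; case: cid2. Qed.

Lemma is_derive_prim u t : continuous u -> is_derive t 1 (prim u) (u t).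
Proof. by move=> cu; rewrite /prim; case: pselect => // cu'; case: cid2. Qed.

Lemma eq_derive_eq (f g df : R -> R) (a : R) : f a = g a ->
  (forall t : R, is_derive t 1 f (df t)) -> (forall t : R, is_derive t 1 g (df t)) ->
  f = g.
Proof.
move=> fga fd gd; apply/funext => t.
have dd (x : R) : is_derive x 1 (fun x => f x - g x) 0.
  by rewrite -(subrr (df x)); exact: is_deriveB.
by have := is_derive_0_is_cst t a dd; rewrite fga => /eqP; rewrite subrr subr_eq0 => /eqP.
Qed.

Lemma continuousDM u v (k : R) : continuous u -> continuous v ->
  continuous (fun t => u t + k * v t).
Proof.
move=> cu cv t; apply: (@cvgD _ R^o); first exact: cu.
by apply: cvgM; [exact: cvg_cst|exact: cv].
Qed.

Lemma is_deriveDM (f g : R -> R) (k t a b : R) : is_derive t 1 f a -> is_derive t 1 g b ->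
  is_derive t 1 (fun t => f t + k * g t) (a + k * b).
Proof. by move=> df dg; apply: is_deriveD; exact: is_deriveZ. Qed.

Lemma prim_lin u v k : continuous u -> continuous v ->
  prim (fun t => u t + k * v t) = (fun t => prim u t + k * prim v t).
Proof.
move=> cu cv; apply: (@eq_derive_eq _ _ (fun t => u t + k * v t) 0).
- by rewrite !prim0 mulr0 addr0.
- by move=> t; apply: is_derive_prim; exact: continuousDM.
- by move=> t; apply: is_deriveDM; exact: is_derive_prim.
Qed.

Lemma prim_le u (M t : R) : continuous u -> (forall t, `|u t| <= M) ->
  `|prim u t| <= M * `|t|.
Proof.
move=> cu uM; rewrite -[prim u t]subr0 -(prim0 u) -[in X in _ <= X](subr0 t).
by apply: (@mvt_le_sym R (prim u) u) => x _ //; exact: is_derive_prim.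
Qed.

Lemma is_derive_shift1 (f : R -> R) (t c df : R) : is_derive (t + c) 1 f df ->
  is_derive t 1 (fun s => f (s + c)) df.
Proof.
move=> /is_deriveP H; apply/is_deriveP => e /H [d d0 Hd]; exists d => // s sd.
have E : s + c - (t + c) = s - t by rewrite opprD addrACA subrr addr0.
by have := Hd (s + c); rewrite E; exact.
Qed.

Lemma prim_shift u L t : continuous u -> (forall t, u (t + L) = u t) ->
  prim u (t + L) = prim u t + prim u L.
Proof.
move=> cu uL.
suff /(congr1 (fun f => f t)) : (fun t => prim u (t + L)) = (fun t => prim u t + prim u L) by [].
apply: (@eq_derive_eq _ _ u 0) => [|s|s]; first by rewrite add0r prim0 add0r.
  by apply: is_derive_shift1; rewrite -uL; exact: is_derive_prim.
by rewrite -[u s]addr0; apply: is_deriveD; exact: is_derive_prim.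
Qed.

Definition mean L u : R := prim u L / L.

Definition osc L u t : R := prim u t - t * mean L u.

Lemma mean_lin L u v k : continuous u -> continuous v ->
  mean L (fun t => u t + k * v t) = mean L u + k * mean L v.
Proof. by move=> cu cv; rewrite /mean prim_lin// mulrDl mulrA. Qed.

Lemma osc_lin L u v k t : continuous u -> continuous v ->
  osc L (fun t => u t + k * v t) t = osc L u t + k * osc L v t.
Proof. by move=> cu cv; rewrite /osc mean_lin// prim_lin//; ring. Qed.

Lemma mean_le L u (M : R) : 0 < L -> continuous u -> (forall t, `|u t| <= M) ->
  `|mean L u| <= M.
Proof.
move=> L0 cu uM; rewrite /mean normrM normfV (gtr0_norm L0) ler_pdivrMr//.
by rewrite -{2}(gtr0_norm L0); exact: prim_le.
Qed.

Lemma is_derive_osc L u t : continuous u ->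
  is_derive t 1 (osc L u) (u t - mean L u).
Proof.
move=> cu.
have -> : osc L u = (fun t => prim u t + (- mean L u) * t).
  by apply/funext => s; rewrite /osc; ring.
have -> : u t - mean L u = u t + - mean L u * 1 by ring.
by apply: is_deriveDM; exact: is_derive_prim.
Qed.

Lemma osc_periodic L u t : 0 < L -> continuous u -> (forall t, u (t + L) = u t) ->
  osc L u (t + L) = osc L u t.
Proof.
by move=> L0 cu uL; rewrite /osc prim_shift// /mean; field; rewrite gt_eqF.
Qed.

Lemma osc_le L u (M t : R) : 0 < L -> continuous u -> (forall t, u (t + L) = u t) ->
  (forall t, `|u t| <= M) -> `|osc L u t| <= 2 * L * M.
Proof.
move=> L0 cu uL uM; have [n /andP[n0 nL]] := periodic_reduce t L0.
rewrite -(@periodic_int R _ (osc L u) L n) => [|s]; last exact: osc_periodic.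
move: (t + _) n0 nL => s s0 sL; rewrite /osc.
apply: le_trans (ler_normB _ _) _; rewrite normrM.
have M0 : 0 <= M by apply: le_trans (uM 0).
have h1 := prim_le s cu uM; have h2 := mean_le L0 cu uM.
rewrite (ger0_norm s0) in h1 *.
have h3 : s * `|mean L u| <= s * M by rewrite ler_wpM2l.
have h4 : s * M <= L * M by rewrite ler_wpM2r// ltW.
lra.
Qed.

Lemma osc_continuous L u : continuous u -> continuous (osc L u).
Proof. by move=> cu t; exact: is_derive_continuous (is_derive_osc _ _ cu). Qed.

End PeriodicPrimitive.

(*PART 5*)
Section FiniteFamilies.
Context {R : realType}.

Lemma common_radius (I : finType) (P : I -> R -> Prop) :
  (forall i d d', 0 < d' -> d' <= d -> P i d -> P i d') ->
  (forall i, exists2 d, 0 < d & P i d) ->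
  exists2 d, 0 < d & forall i, P i d.
Proof.
move=> mono H.
have : \forall d \near (0 : R)^'+, forall i, P i d.
  apply: filter_forall => i; have [d d0 Pd] := H i.
  near=> e; apply: mono Pd => //; near: e; exact: nbhs_right_le.
move=> H1; near (0 : R)^'+ => d; exists d => //.
by near: d.
Unshelve. all: by end_near. Qed.

Lemma common_bound (I : finType) (P : I -> R -> Prop) :
  (forall i C C', C <= C' -> P i C -> P i C') ->
  (forall i, exists C, P i C) -> exists2 C, 0 < C & forall i, P i C.
Proof.
move=> mono H.
have [|i|d d0 Hd] := @common_radius I (fun i d => P i d^-1).
- move=> i d d' d'0 d'd; apply: mono.
  by rewrite lef_pV2// posrE; exact: lt_le_trans d'd.
- have [C HC] := H i; have C1 : 0 < `|C| + 1 by rewrite ltr_wpDl.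
  exists (`|C| + 1)^-1; first by rewrite invr_gt0.
  by rewrite invrK; apply: mono HC; have := ler_norm C; lra.
- by exists d^-1 => //; rewrite invr_gt0.
Qed.

Lemma prod3_norm_le (a b c M : R) : `|a| <= M -> `|b| <= M -> `|c| <= M ->
  `|(a, b, c) : (R * R * R)%type| <= M.
Proof. by move=> *; rewrite !prod_normE /= !ge_max; apply/andP; split=> //; apply/andP. Qed.

Lemma prod3_normP (x : (R * R * R)%type) (M : R) : `|x| <= M ->
  [/\ `|x.1.1| <= M, `|x.1.2| <= M & `|x.2| <= M].
Proof. by rewrite !prod_normE /= !ge_max => /andP[/andP[? ?] ?]. Qed.

End FiniteFamilies.

Section DelayEquation.
Context {R : realType}.
Variables (L : R) (n : nat) (tau : 'I_n -> R).
Hypothesis L0 : 0 < L.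
Local Notation S := (R * R * R)%type.
Local Notation P := (R * (S * S))%type.
Implicit Types (u v w : 'I_3 * R -> R).

Definition loops : set ('I_3 * R -> R) :=
  [set u | forall i, continuous (fun t => u (i, t)) /\
                     forall t, u (i, t + L) = u (i, t)].

Definition adev u : R -> R := osc L (fun t => u (1, t)).

Definition mdev u t : R := mean L (fun t => u (0, t)) + adev u t - mean L (adev u).

Definition phase u : R -> R := osc L (fun t => u (0, t) + (-1) * adev u t).

(** The orb (angle, rescaled distance to the curve, rescaled value of the
conserved quantity) built from the three source terms of the reduced system. *)
Definition dev u t : S := (phase u t, mdev u t - u (2, t), mdev u t).

Definition base (t : R) : S := (t, 1, 1).

Definition orb u t : S := base t + dev u t.

Definition dev_const : R := 2 + 6 * L + 4 * L ^+ 2.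

Lemma dev_const_gt0 : 0 < dev_const.
Proof. by rewrite /dev_const; move: (exprn_gt0 2 L0) L0; lra. Qed.

Lemma adev_continuous u : loops u -> continuous (adev u).
Proof. by move=> Xu; apply: osc_continuous; case: (Xu 1). Qed.

Lemma adev_periodic u t : loops u -> adev u (t + L) = adev u t.
Proof. by move=> Xu; have [cu pu] := Xu 1; exact: osc_periodic. Qed.

Lemma phase_source_continuous u : loops u ->
  continuous (fun t => u (0, t) + (-1) * adev u t).
Proof.
by move=> Xu; apply: continuousDM; [case: (Xu 0)|exact: adev_continuous].
Qed.

Lemma mdev_continuous u : loops u -> continuous (mdev u).
Proof.
move=> Xu; pose c := mean L (fun t => u (0, t)) - mean L (adev u).
have cc : continuous (fun _ : R => c : R) by move=> t; exact: cvg_cst.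
have := @continuousDM R _ (adev u) 1 cc (adev_continuous Xu); rewrite /c.
suff -> : mdev u = (fun t => mean L (fun t => u (0, t)) - mean L (adev u) + 1 * adev u t) by [].
by apply/funext => t; rewrite /mdev; ring.
Qed.

Lemma dev_continuous u : loops u -> continuous (dev u).
Proof.
move=> Xu t; have cm := mdev_continuous Xu.
apply: (@continuous_pair R R^o (R^o * R^o)%type R^o); last exact: cm.
apply: (@continuous_pair R R^o R^o R^o).
  exact: osc_continuous (phase_source_continuous Xu) t.
by apply: (@cvgB _ R^o); [exact: cm|case: (Xu 2) => cu _; exact: cu].
Qed.

Lemma dev_periodic u t : loops u -> dev u (t + L) = dev u t.
Proof.
move=> Xu; rewrite /dev /mdev adev_periodic//; case: (Xu 2) => _ ->.
congr (_, _, _); apply: osc_periodic => //; first exact: phase_source_continuous.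
by move=> s; rewrite adev_periodic//; case: (Xu 0) => _ ->.
Qed.

Lemma orb_periodic u t : loops u -> orb u (t + L) = orb u t + (L, 0, 0).
Proof.
move=> Xu; rewrite /orb dev_periodic// -!addrA [dev u t + _]addrC addrA.
by congr (_ + _); rewrite /base; congr (_, _, _); rewrite /= addr0.
Qed.

Lemma orb_continuous u : loops u -> continuous (orb u).
Proof.
move=> Xu t; apply: (@cvgD _ S); last exact: dev_continuous.
apply: (@continuous_pair R R^o (R^o * R^o)%type R^o); last exact: cvg_cst.
by apply: (@continuous_pair R R^o R^o R^o); [exact: cvg_id|exact: cvg_cst].
Qed.

Lemma adev_lin u w k : loops u -> loops w ->
  adev (fun t => u t + k * w t) = (fun t => adev u t + k * adev w t).
Proof.
move=> Xu Xw; apply/funext => t; have [cu _] := Xu 1; have [cw _] := Xw 1.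
exact: (@osc_lin R L _ _ k t cu cw).
Qed.

Lemma mdev_lin u w k t : loops u -> loops w ->
  mdev (fun t => u t + k * w t) t = mdev u t + k * mdev w t.
Proof.
move=> Xu Xw; rewrite /mdev adev_lin//.
rewrite (@mean_lin R L (adev u) (adev w) k (adev_continuous Xu) (adev_continuous Xw)).
have [cu _] := Xu 0; have [cw _] := Xw 0.
rewrite (@mean_lin R L _ _ k cu cw); ring.
Qed.

Lemma dev_lin u w k t : loops u -> loops w ->
  dev (fun t => u t + k * w t) t = dev u t + k *: dev w t.
Proof.
move=> Xu Xw; rewrite /dev mdev_lin//.
have -> : phase (fun t => u t + k * w t) t = phase u t + k * phase w t.
  rewrite /phase adev_lin//.
  rewrite -(@osc_lin R L _ _ k t (phase_source_continuous Xu) (phase_source_continuous Xw)).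
  by congr (osc L _ t); apply/funext => s; ring.
have -> : mdev u t + k * mdev w t - (u (2, t) + k * w (2, t)) =
  (mdev u t - u (2, t)) + k * (mdev w t - w (2, t)) by ring.
by [].
Qed.

Lemma mdev_le u (M t : R) : loops u -> (forall x, `|u x| <= M) ->
  `|mdev u t| <= (1 + 4 * L) * M.
Proof.
move=> Xu uM; have [cq pq] := Xu 0; have [ce pe] := Xu 1.
have h1 s : `|adev u s| <= 2 * L * M by apply: osc_le.
have h2 := mean_le L0 (adev_continuous Xu) h1.
have h3 := mean_le L0 cq (fun t => uM (0, t)); have h4 := h1 t.
apply: le_trans (ler_normB _ _) _.
have h5 := ler_normD (mean L (fun t => u (0, t))) (adev u t).
by move: h2 h3 h4 h5; clear; lra.
Qed.

Lemma dev_le u (M t : R) : loops u -> (forall x, `|u x| <= M) ->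
  `|dev u t| <= dev_const * M.
Proof.
move=> Xu uM; have [cq pq] := Xu 0; have [ce pe] := Xu 1.
have M0 : 0 <= M by apply: le_trans (uM (0, 0)).
have h1 s : `|adev u s| <= 2 * L * M by apply: osc_le.
have h2 := mdev_le t Xu uM; have LM : 0 <= L * M by rewrite mulr_ge0// ltW.
have LLM : 0 <= L ^+ 2 * M by rewrite mulr_ge0// sqr_ge0.
have h3 := uM (2, t).
have h4 : `|phase u t| <= 2 * L * (M + 2 * L * M).
  apply: osc_le => //; first exact: phase_source_continuous.
    by move=> s; rewrite pq adev_periodic.
  move=> s; rewrite mulN1r; apply: le_trans (ler_normB _ _) _; exact: lerD.
have h5 := ler_normB (mdev u t) (u (2, t)).
rewrite /dev_const; move: M0 h2 LM LLM h3 h4 h5; clear => M0 h2 LM LLM h3 h4 h5.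
apply: prod3_norm_le.
- by apply: le_trans h4 _; rewrite expr2; rewrite expr2 in LLM; lra.
- by apply: le_trans h5 _; rewrite expr2; rewrite expr2 in LLM; lra.
- by apply: le_trans h2 _; rewrite expr2; rewrite expr2 in LLM; lra.
Qed.

Lemma loops_lin u w k : loops u -> loops w -> loops (fun t => u t + k * w t).
Proof.
move=> Xu Xw i; have [cu pu] := Xu i; have [cw pw] := Xw i; split.
  exact: (@continuousDM R (fun t => u (i, t)) (fun t => w (i, t)) k cu cw).
by move=> t; rewrite pu pw.
Qed.

Lemma loops0 : loops (fun=> 0).
Proof. by move=> i; split=> // t; exact: cvg_cst. Qed.

Lemma dev0 t : dev (fun=> 0) t = 0.
Proof.
have H : `|dev (fun=> 0) t| <= dev_const * 0.
  by apply: (dev_le t loops0) => x; rewrite normr0.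
by apply/eqP; rewrite -normr_le0; apply: le_trans H _; rewrite mulr0.
Qed.

Lemma loops_uniform_limit u : (forall e : R, 0 < e ->
  exists2 v, loops v & forall x, `|v x - u x| <= e) -> loops u.
Proof.
move=> H i; split=> t.
  apply/(@continuous_atP R R^o R^o) => e e0.
  have e3 : 0 < e / 3 by rewrite divr_gt0.
  have [v Xv vu] := H _ e3; have [cv _] := Xv i.
  have [d d0 Hd] := (@continuous_atP R R^o R^o _ _).1 (cv t) _ e3.
  exists d => // y /Hd h1; have h2 := vu (i, y); have h3 := vu (i, t).
  have -> : u (i, y) - u (i, t) = (v (i, y) - v (i, t)) - (v (i, y) - u (i, y)) +
    (v (i, t) - u (i, t)) by ring.
  apply: le_trans (ler_normD _ _) _; have := ler_normB (v (i, y) - v (i, t)) (v (i, y) - u (i, y)).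
  by move: h1 h2 h3; clear; lra.
apply/eqP; rewrite -subr_eq0 -normr_le0; apply/ler_addgt0Pr => e e0; rewrite add0r.
have e2 : 0 < e / 2 by rewrite divr_gt0.
have [v Xv vu] := H _ e2; have [_ pv] := Xv i.
have h1 := vu (i, t); have h2 := vu (i, t + L); rewrite pv in h2.
have -> : u (i, t + L) - u (i, t) = (v (i, t) - u (i, t)) - (v (i, t) - u (i, t + L)) by ring.
by apply: le_trans (ler_normB _ _) _; move: h1 h2; clear; lra.
Qed.

End DelayEquation.

(*PART 6*)
Section DelayFixedPoint.
Context {R : realType}.
Variables (L : R) (n : nat) (tau : 'I_n -> R).
Local Notation S := (R * R * R)%type.
Local Notation P := (R * (S * S))%type.
Variable K : 'I_3 -> 'I_n -> P -> R.
Implicit Types (u v w : 'I_3 * R -> R).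

Definition sources (r : R) u (x : 'I_3 * R) : R :=
  \sum_k K x.1 k (r, (orb L u x.2, orb L u (x.2 + tau k))).

Definition sources_lipschitz : Prop :=
  forall c : R, 0 < c -> exists2 eta : R, 0 < eta & forall r i k t y1 y1' y2 y2',
    0 < r < eta ->
    `|y1 - base t| <= eta -> `|y2 - base t| <= eta ->
    `|y1' - base (t + tau k)| <= eta -> `|y2' - base (t + tau k)| <= eta ->
    `|K i k (r, (y1, y1')) - K i k (r, (y2, y2'))| <=
      c * Num.max `|y1 - y2| `|y1' - y2'|.

Definition sources_small : Prop :=
  forall e : R, 0 < e -> exists2 r1 : R, 0 < r1 & forall r i k t, 0 < r < r1 ->
    `|K i k (r, (base t, base (t + tau k)))| <= e.

Definition sources_smooth : Prop :=
  exists2 eta : R, 0 < eta & forall r i k t y y', 0 < r < eta ->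
    `|y - base t| <= eta -> `|y' - base (t + tau k)| <= eta ->
    sdiff (K i k : P -> R^o) (r, (y, y')).

Hypothesis L0 : 0 < L.
Hypothesis Kper : forall i k p, K i k (p + (0, ((L, 0, 0), (L, 0, 0)))) = K i k p.

Let orb_base u t : orb L u t - base t = dev L u t.
Proof. by rewrite /orb addrAC subrr add0r. Qed.

Let orbB u v t : loops L u -> loops L v ->
  orb L u t - orb L v t = dev L (fun x => u x - v x) t.
Proof.
move=> Xu Xv; rewrite /orb opprD addrACA subrr add0r.
have -> : (fun x => u x - v x) = (fun x => u x + (-1) * v x).
  by apply/funext => x; ring.
by rewrite dev_lin// scaleN1r.
Qed.

Let sources_periodic r u i t : loops L u -> sources r u (i, t + L) = sources r u (i, t).
Proof.
move=> Xu; apply: eq_bigr => k _ /=; rewrite [t + L + _]addrAC !orb_periodic//.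
by rewrite -(Kper i k (_, (orb L u t, _))); congr (K _ _ (_, _)); rewrite /= addr0.
Qed.

Let point_norm (a M : R) (x y : S) : `|a| <= M -> `|x| <= M -> `|y| <= M ->
  `|(a, (x, y)) : P| <= M.
Proof.
move=> ha hx hy; rewrite prod_normE ge_max; apply/andP; split=> //.
by rewrite /= prod_normE ge_max; apply/andP.
Qed.

Let shift_continuous (V : normedModType R) (f : R -> V) (c : R) : continuous f ->
  continuous (fun t => f (t + c)).
Proof.
move=> cf t; apply/(@continuous_atP R R^o V) => e e0.
have [d d0 Hd] := (@continuous_atP R R^o V _ _).1 (cf (t + c)) e e0.
exists d => // s sd; apply: Hd.
rewrite opprD addrACA subrr addr0; exact: sd.
Qed.

Let state_continuous r u k : loops L u ->
  continuous (fun t => (r, (orb L u t, orb L u (t + tau k))) : P).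
Proof.
move=> Xu t; apply: (@continuous_pair R R^o R^o (S * S)%type); first exact: cvg_cst.
apply: (@continuous_pair R R^o S S); first exact: orb_continuous.
exact: (@shift_continuous S _ (tau k) (orb_continuous Xu) t).
Qed.

Let continuous_sum (I : Type) (s : seq I) (f : I -> R -> R) :
  (forall i, continuous (f i)) -> continuous (fun t => \sum_(i <- s) f i t).
Proof.
move=> cf; elim: s => [|i s IH].
  suff -> : (fun t => \sum_(i <- [::]) f i t) = (fun=> 0) by move=> t; exact: cvg_cst.
  by apply/funext => t; rewrite big_nil.
suff -> : (fun t => \sum_(j <- i :: s) f j t) = (fun t => f i t + \sum_(j <- s) f j t).
  by move=> t; apply: (@cvgD _ R^o); [exact: cf|exact: IH].
by apply/funext => t; rewrite big_cons.
Qed.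

Theorem delay_fixed_point (eta : R) : sources_lipschitz -> sources_small ->
  sources_smooth -> 0 < eta ->
  exists (rb : R) (u : R -> 'I_3 * R -> R), 0 < rb /\
   forall r, 0 < r < rb ->
    [/\ loops L (u r), forall x, sources r (u r) x = u r x,
        forall t, `|dev L (u r) t| <= eta,
        forall M, (forall x, `|sources r (fun=> 0) x| <= M) -> forall x, `|u r x| <= 2 * M &
        exists y, usd (W := R^o) u r y].
Proof.
move=> Klip Ksmall [eta1 eta10 Ksd] eta0.
pose C := dev_const L; have C0 : 0 < C by exact: dev_const_gt0.
pose m : R := n.+1%:R; have m0 : 0 < m by rewrite ltr0n.
have c0 : 0 < (2 * m * C)^-1 by rewrite invr_gt0 !mulr_gt0.
have [eta2 eta20 Hlip] := Klip _ c0.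
pose et := Num.min eta (Num.min eta1 eta2).
have et0 : 0 < et by rewrite !lt_min eta0 eta10.
have [ete ete1 ete2] : [/\ et <= eta, et <= eta1 & et <= eta2].
  by rewrite /et !ge_min !lexx !orbT.
pose e0 := et / C; have e00 : 0 < e0 by rewrite divr_gt0.
have e4 : 0 < e0 / (4 * m) by rewrite divr_gt0// mulr_gt0.
have [r1 r10 Hsm] := Ksmall _ e4.
pose rb := Num.min r1 et; have rb0 : 0 < rb by rewrite lt_min r10.
pose Q := [set v | loops L v /\ forall x, `|v x| <= e0].
have Qdev v t : Q v -> `|dev L v t| <= et.
  move=> [Xv vb]; apply: le_trans (dev_le L0 t Xv vb) _.
  by rewrite /e0 -/C mulrC divfK ?gt_eqF.
have rng r : 0 < r < rb -> [/\ 0 < r < r1, 0 < r < eta1 & 0 < r < eta2].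
  move=> /andP[r0]; rewrite lt_min => /andP[h1 h2]; rewrite r0 h1.
  by rewrite !(lt_le_trans h2).
have Qctr r v w (M : R) : 0 < r < rb -> Q v -> Q w ->
   (forall x, `|v x - w x| <= M) -> forall x, `|sources r v x - sources r w x| <= M / 2.
  move=> /rng [_ _ rr] Qv Qw vw [i t]; rewrite /sources /= -sumrB.
  have [Xv _] := Qv; have [Xw _] := Qw.
  have M0 : 0 <= M by apply: le_trans (vw (i, t)).
  have Xvw : loops L (fun x => v x - w x).
    have -> : (fun x => v x - w x) = (fun x => v x + (-1) * w x).
      by apply/funext => x; ring.
    exact: loops_lin.
  have D s : `|orb L v s - orb L w s| <= C * M by rewrite orbB//; exact: dev_le.
  apply: le_trans (ler_norm_sum _ _ _) _.
  apply: (@le_trans _ _ (\sum_(k < n) M / (2 * m))).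
    apply: ler_sum => k _.
    apply: le_trans (Hlip r i k t _ _ _ _ rr _ _ _ _) _; rewrite ?orb_base//;
      try (by apply: le_trans ete2; exact: Qdev).
    have -> : M / (2 * m) = (2 * m * C)^-1 * (C * M).
      by field; rewrite !gt_eqF.
    by apply: ler_wpM2l; [exact: ltW|rewrite ge_max !D].
  rewrite sumr_const card_ord -(mulr_natr (M / (2 * m))) mulrAC ler_pdivrMr ?mulr_gt0//.
  have -> : M / 2 * (2 * m) = M * m by field.
  by rewrite ler_wpM2l// ler_nat.
have sdQ r v i k t : 0 < r < rb -> Q v ->
   sdiff (K i k : P -> R^o) (r, (orb L v t, orb L v (t + tau k))).
  move=> /rng [_ rr _] Qv; apply: (Ksd r i k t) => //; rewrite orb_base;
  by apply: le_trans ete1; exact: Qdev.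
have base_small r x : 0 < r < rb -> `|sources r (fun=> 0) x| <= e0 / 4.
  move=> /rng [rr _ _]; case: x => i t; rewrite /sources /=.
  apply: le_trans (ler_norm_sum _ _ _) _.
  apply: (@le_trans _ _ (\sum_(k < n) e0 / (4 * m))).
    by apply: ler_sum => k _; rewrite /orb !dev0// !addr0; exact: Hsm.
  rewrite sumr_const card_ord -(mulr_natr (e0 / (4 * m))) mulrAC ler_pdivrMr ?mulr_gt0//.
  have -> : e0 / 4 * (4 * m) = e0 * m by field.
  by rewrite ler_pM2l// ler_nat.
have Q0 : Q (fun=> 0) by split=> [|x]; [exact: loops0|rewrite normr0 ltW].
have QPhi r v : 0 < r < rb -> Q v -> Q (sources r v).
  move=> rr Qv; have [Xv vb] := Qv; split.
    move=> i; split; last by move=> t; exact: sources_periodic.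
    apply: continuous_sum => k t.
    apply: (@continuous_comp R P R (fun t => (r, (orb L v t, orb L v (t + tau k))))
      (K i k)); first exact: state_continuous.
    exact: (sdiff_continuous (sdQ r v i k t rr Qv)).
  move=> x; rewrite -(subrK (sources r (fun=> 0) x) (sources r v x)).
  apply: le_trans (ler_normD _ _) _; have h1 := base_small r x rr.
  have h2 : `|sources r v x - sources r (fun=> 0) x| <= e0 / 2.
    by apply: Qctr => // z; rewrite subr0; exact: vb.
  by move: e00 h1 h2; lra.
have Qcl l : (forall e : R, 0 < e -> exists2 v, Q v & forall x, `|v x - l x| <= e) -> Q l.
  move=> H; split.
    by apply: loops_uniform_limit => e /H [v [Xv _] vl]; exists v.
  move=> x; apply/ler_addgt0Pr => e /H [v [_ vb] vl].
  have -> : l x = v x - (v x - l x) by ring.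
  by apply: le_trans (ler_normB _ _) _; apply: lerD.
have ex r : exists u, 0 < r < rb -> [/\ Q u, forall x, sources r u x = u x &
   forall M, (forall x, `|sources r (fun=> 0) x| <= M) -> forall x, `|u x| <= 2 * M].
  have [rr|nr] := boolP (0 < r < rb); last by exists (fun=> 0).
  have H M : (forall x, `|sources r (fun=> 0) x| <= M) -> exists u,
     [/\ Q u, forall x, sources r u x = u x & forall x, `|u x| <= 2 * M].
    move=> HM.
    have [|||u [Qu ufix ub]] := @fun_contraction R _ Q (sources r) (fun=> 0) M Q0 _ Qcl.
    - by move=> v; exact: QPhi.
    - by move=> v w N Qv Qw; exact: Qctr.
    - by move=> x; rewrite subr0.
    - by exists u; split=> // x; have := ub x; rewrite subr0.
  pose M1 := sup [set `|sources r (fun=> 0) x| | x in setT].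
  have hs : has_sup [set `|sources r (fun=> 0) x| | x in setT].
    split; first by exists `|sources r (fun=> 0) (0, 0)|, (0, 0).
    by exists (e0 / 4) => _ [x _ <-]; exact: base_small.
  have [u [Qu ufix ub]] := H M1 (fun x => ub_le_sup hs.2 (ex_intro2 _ _ x I erefl)).
  exists u => _; split=> // M HM x; apply: le_trans (ub x) _; rewrite ler_pM2l//.
  by apply: ge_sup; [case: hs|move=> _ [z _ <-]].
have [u Hu] := choice ex.
have ub r x : 0 < r < rb -> `|u r x| <= e0 / 2.
  move=> rr; have [_ _ H] := Hu r rr.
  have -> : e0 / 2 = 2 * (e0 / 4) by field.
  by apply: H => z; exact: base_small.
exists rb, u; split=> // r0 r0b; have [Qu ufix uM] := Hu r0 r0b.
split=> //; first by case: Qu.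
  by move=> t; apply: le_trans ete; exact: Qdev.
(* strict differentiability of the superposition operator *)
pose c k t : P := (r0, (orb L (u r0) t, orb L (u r0) (t + tau k))).
pose l : P := (0, ((L, 0, 0), (L, 0, 0))).
have Xu := Qu.1.
have cl k t : c k (t + L) = c k t + l.
  rewrite /c [t + L + _]addrAC !orb_periodic//; congr (_, _) => /=.
  by rewrite addr0.
have ctc k : continuous (c k) by exact: state_continuous.
have HK i k := @strict_deriv_curve R P R^o (K i k) (c k) l L L0 (ctc k) (cl k) (Kper i k)
   (fun t => sdQ r0 (u r0) i k t r0b Qu).
have [A HA] := choice (fun ik : 'I_3 * 'I_n => HK ik.1 ik.2).
have Alin i k t : linear (A (i, k) t) by case: (HA (i, k)) => + _ _; exact.
have [CA CA0 HCA] : exists2 CA : R, 0 < CA & forall ik t h, `|A ik t h| <= CA * `|h|.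
  have [|ik|CA CA0 H] := @common_bound R ('I_3 * 'I_n)%type
    (fun ik CA => forall t h, `|A ik t h| <= CA * `|h|).
  - by move=> ik D D' DD H t h; apply: le_trans (H t h) _; rewrite ler_wpM2r.
  - by case: (HA ik) => _ + _.
  - by exists CA.
pose dl w k t : P := (0, (dev L w t, dev L w (t + tau k))).
pose AA w (x : 'I_3 * R) := \sum_k A (x.1, k) x.2 (dl w k x.2).
pose b (x : 'I_3 * R) := \sum_k A (x.1, k) x.2 ((1, 0) : P).
apply: (@fixed_point_usd R _ (loops L) sources u rb e0 r0 AA b (m * CA)) => //.
- by move=> v w k; exact: loops_lin.
- move=> r rr; have [Qr rfix _] := Hu r rr; split=> //; first by case: Qr.
  by move=> x; exact: ub.
- move=> v w k Xv Xw [i t]; rewrite /AA /= mulr_sumr -big_split /=.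
  apply: eq_bigr => j _.
  have -> : dl (fun x => v x + k * w x) j t = k *: dl w j t + dl v j t.
    rewrite /dl !dev_lin// [RHS]addrC; congr (_, _).
    by rewrite /= [_ *: _]mulr0 addr0.
  by rewrite Alin addrC.
- move=> [i t]; rewrite /b /=; apply: le_trans (ler_norm_sum _ _ _) _.
  apply: (@le_trans _ _ (\sum_(k < n) CA)).
    apply: ler_sum => k _; apply: le_trans (HCA _ _ _) _.
    rewrite -[leRHS]mulr1 ler_pM2l// prod_normE /= normr1 normr0.
    by rewrite ge_max lexx ler01.
  by rewrite sumr_const card_ord -(mulr_natl CA) ler_pM2r// ler_nat.
- move=> e ep; pose e' := e / (m * (1 + C)).
  have e'0 : 0 < e' by rewrite divr_gt0// mulr_gt0// addr_gt0.
  have [|ik|d d0 Hd] := @common_radius R ('I_3 * 'I_n)%type (fun ik d => forall t p1 p2,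
     `|p1 - c ik.2 t| < d -> `|p2 - c ik.2 t| < d ->
     `|K ik.1 ik.2 p1 - K ik.1 ik.2 p2 - A ik t (p1 - p2)| <= e' * `|p1 - p2|).
  + move=> ik d d' d'0 d'd H t p1 p2 h1 h2.
    by apply: H; exact: lt_le_trans d'd.
  + by case: (HA ik) => _ _ /(_ e' e'0).
  exists (Num.min d (d / (2 * C))).
    by rewrite lt_min d0 divr_gt0// mulr_gt0.
  move=> r1' r2 v w M; rewrite !lt_min => /andP[h1 _] /andP[h2 _] Qv Qw vd wd vw [i t].
  have M0 : 0 <= M by apply: le_trans (vw (i, t)).
  have [Xv _] := Qv; have [Xw _] := Qw.
  have Xd v1 w1 : loops L v1 -> loops L w1 -> loops L (fun x => v1 x - w1 x).
    move=> X1 X2; have -> : (fun x => v1 x - w1 x) = (fun x => v1 x + (-1) * w1 x).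
      by apply/funext => x; ring.
    exact: loops_lin.
  pose pt r v1 k : P := (r, (orb L v1 t, orb L v1 (t + tau k))).
  have near r v1 k : `|r - r0| < d -> Q v1 ->
      (forall x, `|v1 x - u r0 x| <= Num.min d (d / (2 * C))) -> `|pt r v1 k - c k t| < d.
    move=> hr Qv1 hv; have [Xv1 _] := Qv1.
    have D s : `|orb L v1 s - orb L (u r0) s| <= d / 2.
      rewrite orbB//; apply: (@le_trans _ _ (C * (d / (2 * C)))).
        apply: dev_le => //; first exact: Xd.
        by move=> x; apply: le_trans (hv x) _; rewrite ge_min lexx orbT.
      by rewrite le_eqVlt; apply/orP; left; apply/eqP; field; rewrite gt_eqF.
    have D' s : `|orb L v1 s - orb L (u r0) s| < d.
      by apply: le_lt_trans (D s) _; rewrite ltr_pdivrMr// mulr2n mulrDr mulr1 ltrDl.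
    rewrite prod_normE gt_max; apply/andP; split=> //=.
    by rewrite prod_normE gt_max; apply/andP; split; exact: D'.
  have E k : pt r1' v k - pt r2 w k = (r1' - r2) *: ((1, 0) : P) + dl (fun x => v x - w x) k t.
    rewrite /pt /dl -!orbB//; congr (_, _); first by rewrite /= addr0 [RHS]mulr1.
    by rewrite /= scaler0 add0r.
  rewrite /sources /b /AA /= mulr_sumr -!sumrB.
  apply: le_trans (ler_norm_sum _ _ _) _.
  apply: (@le_trans _ _ (\sum_(k < n) e' * ((1 + C) * (`|r1' - r2| + M)))).
    apply: ler_sum => k _.
    have := Hd (i, k) t _ _ (near r1' v k h1 Qv vd) (near r2 w k h2 Qw wd).
    rewrite /= {1}E Alin opprD addrA => H; apply: le_trans H _.
    rewrite ler_pM2l// mulrDl mul1r.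
    have D s : `|orb L v s - orb L w s| <= C * M.
      by rewrite orbB//; apply: dev_le => //; exact: Xd.
    have nn : 0 <= C * `|r1' - r2| by rewrite mulr_ge0// ltW.
    have CM : 0 <= C * M by rewrite mulr_ge0// ltW.
    have D' s : `|orb L v s - orb L w s| <= `|r1' - r2| + M + C * (`|r1' - r2| + M).
      by apply: le_trans (D s) _; move: (normr_ge0 (r1' - r2)) M0 nn CM; lra.
    apply: point_norm; [|exact: D'|exact: D'].
    by move: (normr_ge0 (r1' - r2)) M0 nn CM; lra.
  rewrite sumr_const card_ord -(mulr_natl (e' * _)) /e'.
  apply: (@le_trans _ _ (m * (e / (m * (1 + C)) * ((1 + C) * (`|r1' - r2| + M))))).
    apply: ler_wpM2r; last by rewrite ler_nat.
    apply: mulr_ge0; first by rewrite ltW.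
    by apply: mulr_ge0; apply: addr_ge0 => //; exact: ltW.
  rewrite le_eqVlt; apply/orP; left; apply/eqP; field.
  by rewrite !gt_eqF// addr_gt0.
Qed.

End DelayFixedPoint.

(*PART 7*)
Section PeriodicSobolev.
Context {R : realType} {m n : nat}.
Implicit Types (T M : R) (u du : R -> 'M[R]_(m, n)).
Local Notation mu := (@lebesgue_measure R).

Definition C1loop T u du : Prop :=
  [/\ forall i j (t : R), is_derive t 1 (fun s => u s i j) (du t i j),
      forall i j, continuous (fun t => du t i j) & periodic u T].

Lemma C1loop_continuous T u du i j : C1loop T u du -> continuous (fun t => u t i j).
Proof. by move=> [du1 _ _] t; exact: is_derive_continuous (du1 i j t). Qed.

Lemma enorm_sqr (A : 'M[R]_(m, n)) : enorm A ^+ 2 = \sum_i \sum_j A i j ^+ 2.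
Proof. by rewrite sqr_sqrtr// sumr_ge0// => i _; rewrite sumr_ge0// => j _; exact: sqr_ge0. Qed.

Lemma enorm_sqr_le (A : 'M[R]_(m, n)) M : (forall i j, `|A i j| <= M) ->
  enorm A ^+ 2 <= (m * n)%:R * M ^+ 2.
Proof.
move=> AM; rewrite enorm_sqr.
apply: (@le_trans _ _ (\sum_(i < m) \sum_(j < n) M ^+ 2)).
  apply: ler_sum => i _; apply: ler_sum => j _.
  by rewrite -(@real_normK _ (A i j)) ?num_real// ler_pXn2r// ?nnegrE// (le_trans _ (AM i j)).
by rewrite !sumr_const !card_ord -mulrnA -(mulr_natl (M ^+ 2)) mulnC.
Qed.

Lemma measurable_enorm_sqr T u : (forall i j, continuous (fun t => u t i j)) ->
  measurable_fun `[0, T] (fun t => enorm (u t) ^+ 2).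
Proof.
move=> cu; apply: (@measurable_funS _ _ _ _ setT) => //.
have -> : (fun t => enorm (u t) ^+ 2) = (fun t => \sum_i \sum_j u t i j ^+ 2).
  by apply/funext => t; exact: enorm_sqr.
apply: measurable_sum => i; apply: measurable_sum => j.
apply: continuous_measurable_fun => t.
by apply: (@continuous_comp _ _ _ (fun t => u t i j) (fun x : R => x ^+ 2));
  [exact: cu|exact: exprn_continuous].
Qed.

Lemma integral_bounded T (f : R -> R) M : 0 <= T ->
  measurable_fun `[0, T] f -> (forall t, 0 <= f t <= M) ->
  (\int[mu]_(t in `[0%R, T]) (f t)%:E <= (T * M)%:E)%E.
Proof.
move=> T0 mf fM.
have fE : (\int[mu]_(t in `[0%R, T]) M%:E = (T * M)%:E)%E.
  rewrite integral_cst//= lebesgue_measure_itv /= lte_fin.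
  case: ltP => [_|T0']; first by rewrite -EFinD subr0 -EFinM mulrC.
  by rewrite mule0 (_ : T = 0) ?mul0r//; apply/eqP; rewrite eq_le T0 T0'.
rewrite -fE; apply: ge0_le_integral => //=.
- by move=> t _; rewrite lee_fin; case/andP: (fM t).
- exact/measurable_EFinP.
- by move=> t _; rewrite lee_fin; case/andP: (fM t).
Qed.

Lemma in_L2_bounded T u M : 0 <= T -> (forall i j, continuous (fun t => u t i j)) ->
  (forall t i j, `|u t i j| <= M) -> in_L2 T u.
Proof.
move=> T0 cu uM; split.
  move=> i j; apply: (@measurable_funS _ _ _ _ setT) => //.
  exact: continuous_measurable_fun.
apply: le_lt_trans (@integral_bounded T (fun t => enorm (u t) ^+ 2)
  ((m * n)%:R * M ^+ 2) T0 (measurable_enorm_sqr cu) _) _; last exact: ltry.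
by move=> t; rewrite sqr_ge0 enorm_sqr_le.
Qed.

Lemma periodic_bounded T (f : R -> R) : 0 < T -> continuous f ->
  (forall t, f (t + T) = f t) -> exists M, forall t, `|f t| <= M.
Proof.
move=> T0 cf pf.
have [|||d d0 Hd] := @uniform_periodic R T (fun t d => `|f t| <= d^-1) T0.
- by move=> t d; rewrite pf.
- move=> t d d' d'0 d'd /le_trans; apply; rewrite lef_pV2// posrE.
  exact: lt_le_trans d'd.
- move=> t; have [d d0 Hd] := (@continuous_atP R R^o R^o _ _).1 (cf t) 1 ltr01.
  have C0 : 0 < `|f t| + 1 by rewrite ltr_wpDl.
  exists (Num.min d (`|f t| + 1)^-1); first by rewrite lt_min d0 invr_gt0.
  move=> s; rewrite lt_min => /andP[/Hd h1 _].
  apply: (@le_trans _ _ (`|f t| + 1)).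
    by have := ler_normD (f t) (f s - f t); rewrite addrC subrK; lra.
  rewrite -[leLHS]invrK lef_pV2 ?posrE ?invr_gt0//; last by rewrite lt_min d0 invr_gt0.
  by rewrite ge_min lexx orbT.
- by exists d^-1.
Qed.

Lemma C1loop_derive_periodic T u du : C1loop T u du -> periodic du T.
Proof.
move=> [du1 _ pu] t; apply/matrixP => i j.
have h : is_derive t 1 (fun s => u (s + T) i j) (du (t + T) i j).
  have /is_deriveP H := du1 i j (t + T).
  apply/is_deriveP => e /H [d d0 Hd]; exists d => // s sd.
  have E : s + T - (t + T) = s - t by rewrite opprD addrACA subrr addr0.
  by have := Hd (s + T); rewrite E; exact.
have E : (fun s => u (s + T) i j) = (fun s => u s i j) by apply/funext => s; rewrite pu.
by rewrite E in h; rewrite -(@derive_val _ _ _ _ _ _ _ h) (@derive_val _ _ _ _ _ _ _ (du1 i j t)).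
Qed.

Lemma C1loop_entries_bounded T u : 0 < T -> periodic u T ->
  (forall i j, continuous (fun t => u t i j)) ->
  exists M, forall t i j, `|u t i j| <= M.
Proof.
move=> T0 pu cu.
have H i j : exists M, forall t, `|u t i j| <= M.
  by apply: (@periodic_bounded T) => // t; rewrite pu.
have [f Hf] := choice (fun ij : 'I_m * 'I_n => H ij.1 ij.2).
exists (\sum_ij `|f ij|) => t i j.
apply: le_trans (Hf (i, j) t) _; apply: le_trans (ler_norm _) _.
by rewrite (bigD1 (i, j))//= lerDl sumr_ge0.
Qed.

Lemma C1loop_weak T u du : 0 < T -> C1loop T u du -> weak_derivative T u du.
Proof.
move=> T0 Hu phi [phiC pphi] i j; have [du1 cdu pu] := Hu.
have dphi (t : R) : is_derive t 1 phi (derive1 phi t).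
  have [dp _] := phiC 1%N.
  by rewrite derive1E; apply: derivableP; apply/derivable1_diffP; exact: dp.
have cdphi : continuous (derive1 phi).
  have [_ H2] := phiC 2%N; have [H3 _] := H2 1.
  move=> t; have -> : derive1 phi = 'D_1 phi by apply/funext => s; rewrite derive1E.
  by apply: differentiable_continuous; exact: H3.
have LR (F f : R -> R) : (forall t : R, is_derive t 1 F (f t)) ->
    derivable_oo_LRcontinuous F 0 T /\ {in `]0, T[%R, derive1 F =1 f}.
  move=> dF; have cF : continuous F by move=> t; exact: is_derive_continuous (dF t).
  split; last first.
    by move=> t _; rewrite derive1E; exact: (@derive_val _ _ _ _ _ _ _ (dF t)).
  split; first by move=> t _; case: (dF t).
    by apply: cvg_at_right_filter; exact: cF.
  by apply: cvg_at_left_filter; exact: cF.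
have [LU EU] := LR _ _ (du1 i j); have [LP EP] := LR _ _ dphi.
have := Rintegration_by_parts T0 (continuous_subspaceT (cdu i j)) LU EU
  (continuous_subspaceT cdphi) LP EP.
have uT : u T = u 0 by rewrite -(pu 0) add0r.
have pT : phi T = phi 0 by rewrite -(pphi 0) add0r.
by rewrite uT pT subrr sub0r.
Qed.

Lemma C1loop_H1 T u du : 0 < T -> C1loop T u du ->
  [/\ in_L2 T u, in_L2 T du & weak_derivative T u du].
Proof.
move=> T0 Hu; have [du1 cdu pu] := Hu.
have cu i j := @C1loop_continuous T u du i j Hu.
have [M HM] := C1loop_entries_bounded T0 pu cu.
have [M' HM'] := C1loop_entries_bounded T0 (C1loop_derive_periodic Hu) cdu.
split; [exact: (in_L2_bounded (ltW T0) cu HM)|exact: (in_L2_bounded (ltW T0) cdu HM')|].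
exact: C1loop_weak.
Qed.

Lemma C1loop_in_H1 T u du : 0 < T -> C1loop T u du -> H1 T u.
Proof.
move=> T0 Hu; have [L2u L2du wd] := C1loop_H1 T0 Hu; have [_ _ pu] := Hu.
by split=> //; exists du.
Qed.

Definition H1const T : R := Num.sqrt (T * (2 * (m * n)%:R)).

Lemma H1norm_le T u du M : 0 < T -> C1loop T u du -> 0 <= M ->
  (forall t i j, `|u t i j| <= M) -> (forall t i j, `|du t i j| <= M) ->
  (H1norm T u <= (H1const T * M)%:E)%E.
Proof.
move=> T0 Hu M0 uM duM; have [L2u L2du wd] := C1loop_H1 T0 Hu.
have [du1 cdu pu] := Hu; have cu i j := @C1loop_continuous T u du i j Hu.
apply: (@le_trans _ _ (sqrte (\int[mu]_(t in `[0%R, T])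
   (enorm (u t) ^+ 2 + enorm (du t) ^+ 2)%:E))%E).
  by apply: ereal_inf_lbound; exists du.
have -> : (H1const T * M)%:E = sqrte (T * (2 * ((m * n)%:R * M ^+ 2)))%:E.
  rewrite /= /H1const -[M in LHS](ger0_norm M0) -sqrtr_sqr -sqrtrM.
    by congr (Num.sqrt _)%:E; ring.
  by rewrite !mulr_ge0// ltW.
rewrite lee_sqrt ?lee_fin; last by rewrite !mulr_ge0 ?sqr_ge0// ltW.
apply: integral_bounded; first exact: ltW.
  by apply: measurable_funD; exact: measurable_enorm_sqr.
move=> t; rewrite addr_ge0 ?sqr_ge0//= mulr_natl mulr2n.
by apply: lerD; exact: enorm_sqr_le.
Qed.

Lemma H1norm_ge0 T u : (0 <= H1norm T u)%E.
Proof. by apply: le_ereal_inf_tmp => _ [du _ <-]; exact: sqrte_ge0. Qed.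

Lemma cvg_H1norm (F : set_system R) (FF : Filter F) T (w dw : R -> R -> 'M[R]_(m, n)) :
  0 < T ->
  (forall e : R, 0 < e -> \forall h \near F, [/\ C1loop T (w h) (dw h),
     forall t i j, `|w h t i j| <= e & forall t i j, `|dw h t i j| <= e]) ->
  H1norm T (w h) @[h --> F] --> 0%E.
Proof.
move=> T0 H.
have C0 : 0 < H1const T + 1 by rewrite ltr_wpDl// sqrtr_ge0.
have key e : 0 < e -> \forall h \near F, (0 <= H1norm T (w h) <= e%:E)%E.
  move=> e0; have e1 : 0 < e / (H1const T + 1) by rewrite divr_gt0.
  near=> h; rewrite H1norm_ge0 /=.
  have [Hw wM dwM] : [/\ C1loop T (w h) (dw h),
     forall t i j, `|w h t i j| <= e / (H1const T + 1) &
     forall t i j, `|dw h t i j| <= e / (H1const T + 1)] by near: h; exact: H.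
  apply: le_trans (H1norm_le T0 Hw (ltW e1) wM dwM) _.
  rewrite lee_fin mulrA ler_pdivrMr// mulrC.
  by apply: ler_wpM2l; [exact: ltW|lra].
apply/fine_cvgP; split.
  have := key 1 ltr01; apply: filterS => h /andP[h0 h1].
  by rewrite ge0_fin_numE//; apply: le_lt_trans h1 _; exact: ltry.
apply/cvgr0Pnorm_le => e e0; have := key e e0; apply: filterS => h /andP[h0 h1] /=.
rewrite ger0_norm ?fine_ge0// -lee_fin fineK//.
by rewrite ge0_fin_numE//; apply: le_lt_trans h1 _; exact: ltry.
Unshelve. all: by end_near. Qed.

End PeriodicSobolev.

(*PART 8*)
Section SmoothFunctionsOfOneVariable.
Context {R : realType}.
Implicit Types (f g : R -> R) (k : nat).

Fixpoint Cn k f : Prop :=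
  match k with
  | 0 => continuous f
  | k'.+1 => exists2 df, forall t : R, is_derive t 1 f (df t) & Cn k' df
  end.

Lemma Cn_continuous k f : Cn k f -> continuous f.
Proof. by case: k => //= k [df fd _] t; exact: is_derive_continuous (fd t). Qed.

Lemma Cn_pred k f : Cn k.+1 f -> Cn k f.
Proof.
elim: k f => [|k IH] f; first exact: Cn_continuous.
by move=> [df fd /IH dfk]; exists df.
Qed.

Lemma Cn_cst k (c : R) : Cn k (fun=> c).
Proof.
elim: k c => [|k IH] c; first by move=> t; exact: cvg_cst.
by exists (fun=> 0) => // t; exact: is_derive_cst.
Qed.

Lemma CnD k f g : Cn k f -> Cn k g -> Cn k (fun t => f t + g t).
Proof.
elim: k f g => [|k IH] f g; first by move=> cf cg t; apply: (@cvgD _ R^o); [exact: cf|exact: cg].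
move=> [df fd dfk] [dg gd dgk]; exists (fun t => df t + dg t); last exact: IH.
by move=> t; exact: is_deriveD.
Qed.

Lemma is_deriveM1 f g (t a b : R) : is_derive t 1 f a -> is_derive t 1 g b ->
  is_derive t 1 (fun s => f s * g s) (f t * b + a * g t).
Proof.
move=> fd gd; have := is_deriveM fd gd.
by rewrite [g t *: a]mulrC.
Qed.

Lemma CnM k f g : Cn k f -> Cn k g -> Cn k (fun t => f t * g t).
Proof.
elim: k f g => [|k IH] f g; first by move=> cf cg t; apply: cvgM; [exact: cf|exact: cg].
move=> fk gk; have [df fd dfk] := fk; have [dg gd dgk] := gk.
exists (fun t => f t * dg t + df t * g t); first by move=> t; exact: is_deriveM1.
by apply: CnD; apply: IH => //; exact: Cn_pred.
Qed.

Lemma CnN k f : Cn k f -> Cn k (fun t => - f t).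
Proof.
move=> fk; have -> : (fun t => - f t) = (fun t => (-1) * f t).
  by apply/funext => t; rewrite mulN1r.
by apply: CnM => //; exact: Cn_cst.
Qed.

Lemma Cn_comp k f g : Cn k f -> Cn k g -> Cn k (fun t => f (g t)).
Proof.
elim: k f g => [|k IH] f g.
  by move=> cf cg t; apply: continuous_comp; [exact: cg|exact: cf].
move=> [df fd dfk] gk; have [dg gd dgk] := gk.
exists (fun t => df (g t) * dg t); first by move=> t; exact: is_derive1_comp.
by apply: CnM => //; apply: IH => //; exact: Cn_pred.
Qed.

Lemma is_deriveV1 f (t df : R) : f t != 0 -> is_derive t 1 f df ->
  is_derive t 1 (fun s => (f s)^-1) (- (df * ((f t)^-1 * (f t)^-1))).
Proof.
move=> f0 fd; have := is_deriveV f0 fd.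
suff -> : - f t ^- 2 *: df = - (df * ((f t)^-1 * (f t)^-1)) by [].
by rewrite [_ *: _]mulNr mulrC -invfM expr2.
Qed.

Lemma CnV k f : (forall t, f t != 0) -> Cn k f -> Cn k (fun t => (f t)^-1).
Proof.
move=> f0; elim: k => [|k IH].
  by move=> cf t; apply: (@cvgV _ _ _ _ f) => //; exact: cf.
move=> fk; have [df fd dfk] := fk.
exists (fun t => - (df t * ((f t)^-1 * (f t)^-1))); first by move=> t; exact: is_deriveV1.
have fi : Cn k (fun t => (f t)^-1) by apply: IH; exact: Cn_pred.
by apply: CnN; apply: CnM => //; exact: CnM.
Qed.

Lemma is_derive_sqrt1 f (t df : R) : 0 < f t -> is_derive t 1 f df ->
  is_derive t 1 (fun s => Num.sqrt (f s)) (2^-1 * (Num.sqrt (f t))^-1 * df).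
Proof.
move=> f0 fd; rewrite -invfM; apply: (@is_derive1_comp _ Num.sqrt f) => //.
exact: is_derive1_sqrt.
Qed.

Lemma Cn_sqrt k f : (forall t, 0 < f t) -> Cn k f -> Cn k (fun t => Num.sqrt (f t)).
Proof.
move=> f0; elim: k => [|k IH].
  by move=> cf t; apply: continuous_comp; [exact: cf|exact: sqrt_continuous].
move=> fk; have [df fd dfk] := fk.
exists (fun t => 2^-1 * (Num.sqrt (f t))^-1 * df t); first by move=> t; exact: is_derive_sqrt1.
apply: CnM => //; apply: CnM; first exact: Cn_cst.
apply: CnV; last by apply: IH; exact: Cn_pred.
by move=> t; rewrite gt_eqF// sqrtr_gt0.
Qed.

End SmoothFunctionsOfOneVariable.

Section PlaneCurves.
Context {R : realType}.
Implicit Types (c : R -> 'cV[R]_2).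

Lemma is_derive_col c (t : R) (c' : 'cV[R]_2) :
  is_derive t 1 c c' <-> forall i, is_derive t 1 (fun s => c s i 0) (c' i 0).
Proof.
split=> [[dc <-] i|H].
  have H := (derivable_mxP c t 1).1 dc i 0.
  by rewrite derive_mx// mxE; exact: derivableP.
have dc : derivable c t 1.
  by apply/derivable_mxP => i j; rewrite ord1; case: (H i).
split=> //; rewrite derive_mx//; apply/matrixP => i j; rewrite mxE ord1.
exact: (@derive_val _ _ _ _ _ _ _ (H i)).
Qed.

Lemma Ck_components k c : Ck k [set: R] c -> forall i, Cn k (fun t => c t i 0).
Proof.
elim: k c => [|k IH] c /=.
  move=> cc i t; apply: (@continuous_comp _ _ _ c (fun x : 'cV[R]_2 => x i 0)).
    exact: cc.
  exact: coord_continuous.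
move=> [dc H] i; exists (fun t => 'D_1 c t i 0); last exact: IH (H 1) i.
move=> t; apply: ((is_derive_col c t _).1 _ i).
by apply: derivableP; apply/derivable1_diffP; exact: dc.
Qed.

Lemma continuous_col c (t : R) : (forall i, {for t, continuous (fun s => c s i 0)}) ->
  {for t, continuous c}.
Proof.
move=> H; apply/(@continuous_atP R R^o _) => e e0.
have [|i|d d0 Hd] := @common_radius R 'I_2 (fun i d => forall s, `|s - t| < d ->
   `|c s i 0 - c t i 0| <= e).
- by move=> i d d' d'0 d'd Hd s sd; apply: Hd; exact: lt_le_trans d'd.
- exact: (@continuous_atP R R^o R^o _ _).1 (H i) e e0.
- exists d => // s sd; rewrite /Num.Def.normr/= mx_normrE.
  apply: bigmax_le; first exact: ltW.
  move=> [i j] _ /=; rewrite !mxE ord1; exact: Hd.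
Qed.

Lemma components_Ck k c : (forall i, Cn k (fun t => c t i 0)) -> Ck k [set: R] c.
Proof.
elim: k c => [|k IH] c H /=.
  by move=> t _; apply: continuous_col => i; exact: H.
pose f i := sval (cid2 (H i)).
have fd i (t : R) : is_derive t 1 (fun s => c s i 0) (f i t).
  by rewrite /f; case: cid2.
have fk i : Cn k (f i) by rewrite /f; case: cid2.
have cd (t : R) : is_derive t 1 c (\col_i f i t).
  by apply/is_derive_col => i; rewrite mxE.
split=> [t _|v]; first by apply/derivable1_diffP; case: (cd t).
apply: IH => i.
have -> : (fun t => 'D_v c t i 0) = (fun t => v * f i t).
  apply/funext => t.
  have dc : differentiable c t by apply/derivable1_diffP; case: (cd t).
  have -> : 'D_v c t = v *: 'D_1 c t.
    by rewrite !deriveE// -linearZ; congr ('d c t _); rewrite [RHS]mulr1.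
  by rewrite (@derive_val _ _ _ _ _ _ _ (cd t)) !mxE.
by apply: CnM => //; exact: Cn_cst.
Qed.

Definition dot (x y : 'cV[R]_2) : R := x 0 0 * y 0 0 + x 1 0 * y 1 0.

Lemma sum_ord2 (F : 'I_2 -> R) : \sum_i F i = F 0 + F 1.
Proof. by rewrite big_ord_recl big_ord1; congr (_ + F _); apply/val_inj. Qed.

Lemma enormE (x : 'cV[R]_2) : enorm x = Num.sqrt (dot x x).
Proof.
by congr Num.sqrt; rewrite sum_ord2 !big_ord1 /dot -!expr2.
Qed.

Lemma dot_ge0 (x : 'cV[R]_2) : 0 <= dot x x.
Proof. by rewrite /dot addr_ge0// -expr2 sqr_ge0. Qed.

Lemma dot_gt0 (x : 'cV[R]_2) : x != 0 -> 0 < dot x x.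
Proof.
move=> x0; rewrite lt_neqAle dot_ge0 andbT eq_sym /dot -!expr2.
apply: contra x0; rewrite paddr_eq0 ?sqr_ge0// !sqrf_eq0 => /andP[/eqP h0 /eqP h1].
apply/eqP/matrixP => i j; rewrite ord1 mxE; by case: (ord2P i) => ->.
Qed.

Lemma col2P (x y : 'cV[R]_2) : x 0 0 = y 0 0 -> x 1 0 = y 1 0 -> x = y.
Proof.
by move=> h0 h1; apply/matrixP => i j; rewrite ord1; case: (ord2P i) => ->.
Qed.

Lemma periodic_inj_int (T : eqType) (f : R -> T) (L : R) : 0 < L ->
  (forall t, f (t + L) = f t) -> set_inj `[0, L[ f ->
  forall s t, f s = f t -> exists n : int, s = t + n%:~R * L.
Proof.
move=> L0 fL finj s t fst.
have [n nL] := periodic_reduce s L0; have [m mL] := periodic_reduce t L0.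
have E : s + n%:~R * L = t + m%:~R * L.
  apply: finj; rewrite ?inE /= ?in_itv //=.
  by rewrite !(@periodic_int R _ f L).
exists (m - n); rewrite intrD mulrNz mulrDl mulNr addrA -E; ring.
Qed.

Lemma int_periodic_inj (T : eqType) (f : R -> T) (L : R) : 0 < L ->
  (forall s t, f s = f t -> exists n : int, s = t + n%:~R * L) ->
  set_inj `[0, L[ f.
Proof.
move=> L0 H s t; rewrite !inE /= !in_itv /= => /andP[s0 sL] /andP[t0 tL] /H [n E].
suff n0 : n = 0 by rewrite E n0 mul0r addr0.
have h1 : n%:~R * L < 1 * L by lra.
have h2 : (-1) * L < n%:~R * L by lra.
rewrite !(ltr_pM2r L0) in h1 h2.
have : (n < 1)%R by rewrite -(ltr_int R).
have : (- 1 < n)%R by rewrite -(ltr_int R).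
by lia.
Qed.

Lemma reverse_arclength Gam (L : R) c : arclength_parametrization Gam L c ->
  arclength_parametrization Gam L (fun t => c (- t)).
Proof.
move=> [[[L0 pc] ic rc Cc c0] c1].
have dc (t : R) : is_derive t 1 c (derive1 c t).
  rewrite derive1E; apply: derivableP; apply/derivable1_diffP; exact: Cc.1.
have dr (t : R) : derive1 (fun t => c (- t)) t = - derive1 c (- t).
  rewrite derive1E; apply: (@derive_val _ _ _ _ _ _ _ _).
  apply/is_derive_col => i; rewrite mxE -mulN1r mulrC.
  apply: (@is_derive1_comp _ (fun s => c s i 0) -%R); first exact: (is_derive_col _ _ _).1 (dc _) i.
have ipc := periodic_inj_int L0 pc ic.
split; last first.
  move=> t; rewrite dr enormE.
  have -> : dot (- derive1 c (- t)) (- derive1 c (- t)) = dot (derive1 c (- t)) (derive1 c (- t)).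
    by rewrite /dot !mxE; ring.
  by rewrite -enormE.
split; first by split=> // t; have := pc (- t - L); rewrite subrK opprD.
- apply: int_periodic_inj => // s t /ipc [n E]; exists (- n).
  by rewrite mulrNz; lra.
- rewrite -rc; apply/seteqP; split=> _ [t _ <-]; first by exists (- t).
  by exists (- t); rewrite ?opprK.
- apply: components_Ck => i; apply: (@Cn_comp R 3 (fun t => c t i 0)).
    exact: Ck_components.
  by apply: (@CnN R 3 id); exists (fun=> 1); [move=> t; exact: is_derive_id|exact: Cn_cst].
- by move=> t; rewrite dr oppr_eq0.
Qed.

End PlaneCurves.

Section ArcLength.
Context {R : realType}.

Lemma continuous_onto (A : R -> R) (P L : R) : 0 < P -> 0 < L -> continuous A ->
  (forall t, A (t + P) = A t + L) -> forall x, exists t, A t = x.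
Proof.
move=> P0 L0 cA AP x.
have per (t : R) (n : int) : A (t + n%:~R * P) = A t + n%:~R * L.
  have := @periodic_int R _ (fun t => A t - t / P * L) P n t.
  have np : P != 0 by rewrite gt_eqF.
  move=> H; have E : A (t + n%:~R * P) - (t + n%:~R * P) / P * L = A t - t / P * L.
    by apply: H => s; rewrite AP; field.
  have E2 : (t + n%:~R * P) / P * L = t / P * L + n%:~R * L by field.
  by rewrite E2 in E; lra.
have [n /andP[n0 nL]] := periodic_reduce (x - A 0) L0.
have AP' : A P = A 0 + L by rewrite -[P in A P]add0r AP.
have [||c _ Ac] := @IVT R A 0 P (x + n%:~R * L) (ltW P0).
- exact: continuous_subspaceT.
- rewrite AP'; have -> : Num.min (A 0) (A 0 + L) = A 0.
    by apply/min_idPl; lra.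
  have -> : Num.max (A 0) (A 0 + L) = A 0 + L by apply/max_idPr; lra.
  by apply/andP; split; lra.
- exists (c + (- n)%:~R * P); rewrite per Ac mulrNz; ring.
Qed.

Lemma increasing_lt (A w : R -> R) : (forall t : R, is_derive t 1 A (w t)) ->
  (forall t, 0 < w t) -> forall s t, s < t -> A s < A t.
Proof.
move=> dA w0 s t st.
have cA : continuous A by move=> x; exact: is_derive_continuous (dA x).
have [|c _ E] := @MVT R A w s t st (fun x _ => dA x).
  exact: continuous_subspaceT.
by rewrite -subr_gt0 E mulr_gt0// subr_gt0.
Qed.

(** Arc length is a strictly increasing function of any regular parameter, and
its inverse has one derivative more than the inverse speed. *)
Lemma inverse_of_primitive (A w : R -> R) (P L : R) : 0 < P -> 0 < L ->
  (forall t : R, is_derive t 1 A (w t)) -> continuous w -> (forall t, 0 < w t) ->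
  (forall t, A (t + P) = A t + L) ->
  exists B : R -> R, [/\ forall x, A (B x) = x, forall t, B (A t) = t,
    forall x : R, is_derive x 1 B ((w (B x))^-1) &
    forall x, B (x + L) = B x + P].
Proof.
move=> P0 L0 dA cw w0 AP.
have cA : continuous A by move=> x; exact: is_derive_continuous (dA x).
have [B AB] := choice (continuous_onto P0 L0 cA AP).
have inc := increasing_lt dA w0.
have Ainj s t : A s = A t -> s = t.
  by move=> E; case: (ltgtP s t) => // /inc; rewrite E ltxx.
have BA t : B (A t) = t by apply: Ainj; rewrite AB.
exists B; split=> // [x|x]; last by apply: Ainj; rewrite AP !AB.
have : is_derive (A (B x)) 1 B ((w (B x))^-1).
  apply: (@is_derive_inverse R A B (w (B x)) (B x) _ _ (dA (B x))).
  - by apply/(@near_ballP R R^o); exists 1 => // y _; exact: BA.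
  - by apply/(@near_ballP R R^o); exists 1 => // y _; exact: cA.
  - by rewrite gt_eqF.
by rewrite AB.
Qed.

Lemma derive1_periodic (c : R -> 'cV[R]_2) (P : R) : (forall t, c (t + P) = c t) ->
  (forall t : R, is_derive t 1 c (derive1 c t)) ->
  forall t, derive1 c (t + P) = derive1 c t.
Proof.
move=> pc dc t; apply/esym; rewrite [LHS]derive1E; apply: (@derive_val _ _ _ _ _ _ _ _).
have /is_deriveP H := dc (t + P); apply/is_deriveP => e /H [d d0 Hd].
exists d => // s sd; have E : s + P - (t + P) = s - t by rewrite opprD addrACA subrr addr0.
by have := Hd (s + P); rewrite E !pc; exact.
Qed.

Lemma exists_arclength (Gam : set 'cV[R]_2) (L : R) : circle_of_length Gam L ->
  0 < L /\ exists c, arclength_parametrization Gam L c.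
Proof.
move=> [c [[P0 pc] ic rc Cc c0] LE]; pose P : R := 2 * pi; rewrite -/P in P0 pc ic LE.
have dc (t : R) : is_derive t 1 c (derive1 c t).
  rewrite derive1E; apply: derivableP; apply/derivable1_diffP; exact: Cc.1.
pose w (t : R) := enorm (derive1 c t).
have dcomp i := Ck_components Cc i.
have dcomp1 i : Cn 2 (fun t => derive1 c t i 0).
  have C2 : Ck 2 [set: R] ('D_1 c) := Cc.2 1; have := Ck_components C2 i.
  by congr (Cn 2 _); apply/funext => t; rewrite derive1E.
have w0 t : 0 < w t by rewrite /w enormE sqrtr_gt0 dot_gt0.
have wC : Cn 2 w.
  have -> : w = (fun t => Num.sqrt (dot (derive1 c t) (derive1 c t))).
    by apply/funext => t; rewrite /w enormE.
  apply: Cn_sqrt; first by move=> t; exact: dot_gt0.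
  by apply: CnD; apply: CnM.
have cw := Cn_continuous wC.
have dA (t : R) := is_derive_prim t cw.
have wP t : w (t + P) = w t by rewrite /w derive1_periodic.
have LA : prim w P = L.
  rewrite LE /Rintegral (@continuous_FTC2 _ w (prim w) 0 P P0) /=.
  - by rewrite prim0 subr0.
  - exact: continuous_subspaceT.
  - have cA : continuous (prim w) by move=> t; exact: is_derive_continuous (dA t).
    split; first by move=> t _; case: (dA t).
      by apply: cvg_at_right_filter; exact: cA.
    by apply: cvg_at_left_filter; exact: cA.
  - by move=> t _; rewrite derive1E; exact: (@derive_val _ _ _ _ _ _ _ (dA t)).
have L0 : 0 < L by rewrite -LA -(prim0 w); exact: (increasing_lt dA w0).
split=> //.
have AP t : prim w (t + P) = prim w t + L by rewrite prim_shift// LA.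
have [B [AB BA dB BP]] := inverse_of_primitive P0 L0 dA cw w0 AP.
have wi : Cn 2 (fun t => (w t)^-1) by apply: CnV => // t; rewrite gt_eqF.
have B0 : Cn 0 B by move=> t; exact: is_derive_continuous (dB t).
have Bstep k : Cn k (fun t => (w t)^-1) -> Cn k B -> Cn k.+1 B.
  by move=> wk Bk; exists (fun t => (w (B t))^-1); [exact: dB|exact: Cn_comp wk Bk].
have wi1 := Cn_pred wi; have wi0 := Cn_pred wi1.
have B3 : Cn 3 B by exact: (Bstep _ wi (Bstep _ wi1 (Bstep _ wi0 B0))).
have dg (t : R) : is_derive t 1 (fun t => c (B t)) ((w (B t))^-1 *: derive1 c (B t)).
  apply/is_derive_col => i; rewrite mxE mulrC.
  apply: (@is_derive1_comp _ (fun s => c s i 0) B).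
  exact: (is_derive_col _ _ _).1 (dc _) i.
have dgE t : derive1 (fun t => c (B t)) t = (w (B t))^-1 *: derive1 c (B t).
  by rewrite derive1E; exact: (@derive_val _ _ _ _ _ _ _ (dg t)).
have ipc := periodic_inj_int P0 pc ic.
have nw (t : R) : (w t)^-1 != 0 by rewrite invr_eq0 gt_eqF.
exists (fun t => c (B t)); split; last first.
  move=> t; rewrite dgE enormE.
  have -> : dot ((w (B t))^-1 *: derive1 c (B t)) ((w (B t))^-1 *: derive1 c (B t)) =
    ((w (B t))^-1) ^+ 2 * dot (derive1 c (B t)) (derive1 c (B t)).
    by rewrite /dot !mxE; ring.
  rewrite sqrtrM ?sqr_ge0// sqrtr_sqr -enormE -/(w (B t)) ger0_norm ?invr_ge0 ?ltW//.
  by rewrite mulVf// gt_eqF.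
split; first by split=> // t; rewrite BP pc.
- apply: int_periodic_inj => // s t /ipc [n E]; exists n.
  rewrite -[LHS]AB E -[t in RHS]AB.
  have := @periodic_int R _ (fun t => prim w t - t / P * L) P n (B t).
  have np : P != 0 by rewrite gt_eqF.
  move=> H; have : prim w (B t + n%:~R * P) - (B t + n%:~R * P) / P * L = prim w (B t) - B t / P * L.
    by apply: H => x; rewrite AP; field.
  have -> : (B t + n%:~R * P) / P * L = B t / P * L + n%:~R * L by field.
  by rewrite AB; lra.
- rewrite -rc; apply/seteqP; split=> _ [t _ <-]; first by exists (B t).
  by exists (prim w t); rewrite ?BA.
- by apply: components_Ck => i; apply: (@Cn_comp R 3 (fun t => c t i 0)).
- by move=> t; rewrite dgE scaler_eq0 negb_or nw c0.
Qed.

End ArcLength.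

(*PART 9*)
Section PlaneCalculus.
Context {R : realType}.
Implicit Types (x y : 'cV[R]_2) (f : 'cV[R]_2 -> R).

Lemma diff_grad f x h : differentiable f x -> 'd f x h = dot (grad f x) h.
Proof.
move=> df; rewrite {1}(col2E h) linearD !linearZ /= -!deriveE// /dot !mxE.
by rewrite [_ *: _]mulrC [X in _ + X]mulrC.
Qed.

Lemma is_derive_grad f (x : R -> 'cV[R]_2) (t : R) x' : differentiable f (x t) ->
  is_derive t 1 x x' -> is_derive t 1 (fun s => f (x s)) (dot (grad f (x t)) x').
Proof. by move=> df dx; rewrite -diff_grad//; exact: is_derive_comp. Qed.

Lemma is_derive_dot (x y : R -> 'cV[R]_2) (t : R) x' y' :
  is_derive t 1 x x' -> is_derive t 1 y y' ->
  is_derive t 1 (fun s => dot (x s) (y s)) (dot x' (y t) + dot (x t) y').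
Proof.
move=> /is_derive_col dx /is_derive_col dy.
have := is_deriveD (is_deriveM1 (dx 0) (dy 0)) (is_deriveM1 (dx 1) (dy 1)).
suff -> : x t 0 0 * y' 0 0 + x' 0 0 * y t 0 0 + (x t 1 0 * y' 1 0 + x' 1 0 * y t 1 0) =
  dot x' (y t) + dot (x t) y' by [].
by rewrite /dot; ring.
Qed.

Lemma rot90E x : (rot90 x 0 0 = - x 1 0) * (rot90 x 1 0 = x 0 0).
Proof. by rewrite !mxE. Qed.

Lemma coord_le_norm x i : `|x i 0| <= `|x|.
Proof.
rewrite [leRHS]/Num.Def.normr/= mx_normrE.
by apply: le_trans; last exact: (le_bigmax _ _ (i, 0)).
Qed.

Lemma norm_le_coord x (M : R) : `|x 0 0| <= M -> `|x 1 0| <= M -> `|x| <= M.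
Proof.
move=> h0 h1; rewrite /Num.Def.normr/= mx_normrE.
apply: bigmax_le; first exact: le_trans h0.
by move=> [i j] _ /=; rewrite ord1; case: (ord2P i) => ->.
Qed.

Lemma coord_le_enorm x i : `|x i 0| <= enorm x.
Proof.
rewrite enormE -sqrtr_sqr ler_sqrt ?dot_ge0// /dot -!expr2.
by case: (ord2P i) => ->; rewrite ?lerDl ?lerDr sqr_ge0.
Qed.

Lemma norm_le_enorm x : `|x| <= enorm x.
Proof. by apply: norm_le_coord; exact: coord_le_enorm. Qed.

Lemma enorm_ge0 m n (A : 'M[R]_(m, n)) : 0 <= enorm A.
Proof. exact: sqrtr_ge0. Qed.

Lemma enorm_le_coord x : enorm x <= `|x 0 0| + `|x 1 0|.
Proof.
rewrite enormE -[leRHS]ger0_norm ?addr_ge0// -sqrtr_sqr ler_sqrt ?sqr_ge0//.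
rewrite -subr_ge0.
have -> : (`|x 0 0| + `|x 1 0|) ^+ 2 - dot x x = 2 * (`|x 0 0| * `|x 1 0|).
  by rewrite sqrrD !real_normK ?num_real// /dot; ring.
by rewrite !mulr_ge0.
Qed.

Lemma enorm_le_norm x : enorm x <= 2 * `|x|.
Proof.
apply: le_trans (enorm_le_coord x) _.
by have := coord_le_norm x 0; have := coord_le_norm x 1; lra.
Qed.

Lemma enorm_sq x : enorm x ^+ 2 = dot x x.
Proof. by rewrite enormE sqr_sqrtr// dot_ge0. Qed.

Lemma le_enorm x (s : R) : 0 <= s -> (s <= enorm x) = (s ^+ 2 <= dot x x).
Proof. by move=> s0; rewrite -enorm_sq ler_pXn2r// nnegrE// enorm_ge0. Qed.

Lemma enorm_le x (s : R) : 0 <= s -> (enorm x <= s) = (dot x x <= s ^+ 2).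
Proof. by move=> s0; rewrite -enorm_sq ler_pXn2r// nnegrE// enorm_ge0. Qed.

Lemma enorm_unit x : dot x x = 1 -> enorm x = 1.
Proof. by rewrite enormE => ->; rewrite sqrtr1. Qed.

Lemma dot_le x y : `|dot x y| <= enorm x * enorm y.
Proof.
rewrite -[leRHS]ger0_norm ?mulr_ge0 ?enorm_ge0// -ler_sqr ?nnegrE//.
rewrite !(real_normK (num_real _)) exprMn !enorm_sq /dot -subr_ge0.
have -> : (x 0 0 * x 0 0 + x 1 0 * x 1 0) * (y 0 0 * y 0 0 + y 1 0 * y 1 0) -
  (x 0 0 * y 0 0 + x 1 0 * y 1 0) ^+ 2 = (x 0 0 * y 1 0 - x 1 0 * y 0 0) ^+ 2 by ring.
exact: sqr_ge0.
Qed.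

Lemma enorm_triangle x y : enorm (x + y) <= enorm x + enorm y.
Proof.
rewrite enorm_le ?addr_ge0 ?enorm_ge0//.
have -> : dot (x + y) (x + y) = dot x x + dot y y + 2 * dot x y by rewrite /dot !mxE; ring.
rewrite sqrrD !enorm_sq; have := dot_le x y; have := ler_norm (dot x y).
rewrite -mulr_natl; lra.
Qed.

Lemma enormN x : enorm (- x) = enorm x.
Proof. by rewrite !enormE; congr Num.sqrt; rewrite /dot !mxE; ring. Qed.

Lemma enormZ (a : R) x : enorm (a *: x) = `|a| * enorm x.
Proof.
rewrite !enormE -sqrtr_sqr -sqrtrM ?sqr_ge0//; congr Num.sqrt.
by rewrite /dot !mxE; ring.
Qed.

Lemma enorm_triangleB x y : enorm x - enorm y <= enorm (x - y).
Proof. by have := enorm_triangle (x - y) y; rewrite subrK; lra. Qed.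

(** A unit vector and its rotation form an orthonormal frame. *)
Lemma frame_decomp (n x : 'cV[R]_2) : dot n n = 1 ->
  x = dot x n *: n + dot x (rot90 n) *: rot90 n.
Proof.
rewrite /dot => H; apply: col2P; rewrite !mxE /=.
  rewrite -[LHS]mulr1 -H; ring.
rewrite -[LHS]mulr1 -H; ring.
Qed.

Lemma enorm_frame_le (n x : 'cV[R]_2) : dot n n = 1 ->
  enorm x <= `|dot x n| + `|dot x (rot90 n)|.
Proof.
move=> n1; have t1 : dot (rot90 n) (rot90 n) = 1 by rewrite -n1 /dot !rot90E; ring.
rewrite {1}(frame_decomp x n1); apply: le_trans (enorm_triangle _ _) _.
by rewrite !enormZ !enorm_unit// !mulr1.
Qed.

Lemma is_derive_rot90 (x : R -> 'cV[R]_2) (t : R) x' : is_derive t 1 x x' ->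
  is_derive t 1 (fun s => rot90 (x s)) (rot90 x').
Proof.
move=> /is_derive_col dx; apply/is_derive_col => i.
case: (ord2P i) => ->.
  have -> : (fun s => rot90 (x s) 0 0) = (fun s => - x s 1 0) by apply/funext => s; rewrite rot90E.
  by rewrite rot90E; exact: is_deriveN.
have -> : (fun s => rot90 (x s) 1 0) = (fun s => x s 0 0) by apply/funext => s; rewrite rot90E.
by rewrite rot90E.
Qed.

Lemma continuous_dot (x y : R -> 'cV[R]_2) (t : R) :
  {for t, continuous x} -> {for t, continuous y} ->
  {for t, continuous (fun s => dot (x s) (y s))}.
Proof.
move=> cx cy.
have c (z : R -> 'cV[R]_2) i : {for t, continuous z} -> {for t, continuous (fun s : R => z s i 0 : R)}.
  move=> cz; apply: (@continuous_comp _ _ _ z (fun u : 'cV[R]_2 => u i 0)) => //.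
  exact: coord_continuous.
by apply: (@cvgD _ R^o); apply: cvgM; exact: c.
Qed.

End PlaneCalculus.

Section Frames.
Context {R : realType}.
Implicit Types (Om Gam : set 'cV[R]_2) (gam nrm : R -> 'cV[R]_2) (k : R -> R).

(** What is used of the geometry: an arc-length parametrization by R, with the
Frenet equations of the unit normal, and the local position of the domain. *)
Record frame Om Gam (L : R) gam nrm k : Prop := {
  frame_L : 0 < L;
  frame_gamL : forall t, gam (t + L) = gam t;
  frame_nrmL : forall t, nrm (t + L) = nrm t;
  frame_kL : forall t, k (t + L) = k t;
  frame_inj : forall s t, gam s = gam t -> exists n : int, s = t + n%:~R * L;
  frame_range : range gam = Gam;
  frame_dgam : forall t : R, is_derive t 1 gam (rot90 (nrm t));
  frame_dnrm : forall t : R, is_derive t 1 nrm (k t *: rot90 (nrm t));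
  frame_unit : forall t, dot (nrm t) (nrm t) = 1;
  frame_k : Cn 1 k;
  frame_side : forall t0 : R, exists2 d : R, 0 < d & forall t s,
    `|t - t0| < d -> 0 < s < d -> Om (gam t - s *: nrm t) }.

Lemma sign_constant (e : R -> R) : continuous e -> (forall t, e t = 1 \/ e t = -1) ->
  (forall t, e t = 1) \/ (forall t, e t = -1).
Proof.
move=> ce e1.
have key a b : a <= b -> e a = - e b -> False.
  move=> ab E; have [||c _ ec] := @IVT R e a b 0 ab; first exact: continuous_subspaceT.
    rewrite E ge_min le_max; case: (e1 b) => ->; rewrite ?opprK ?oppr_le0 ?oppr_ge0 ler01;
    by rewrite ?orbT.
  by case: (e1 c); rewrite ec => /eqP; rewrite eq_sym ?oppr_eq0 oner_eq0.
case: (e1 0) => e0; [left|right] => t; case: (e1 t) => // et; exfalso;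
  case: (leP 0 t) => [t0|/ltW t0];
  by apply: (key _ _ t0); rewrite e0 et ?opprK.
Qed.

Section ConstructFrame.
Variables (Om Gam : set 'cV[R]_2) (L : R) (nu : 'cV[R]_2 -> 'cV[R]_2)
  (kappa : 'cV[R]_2 -> R).
Hypothesis oOm : open Om.
Hypothesis GB : is_component Gam (boundary Om).
Hypothesis C3 : C3_boundary Om Gam.
Hypothesis nuE : exterior_unit_normal Om Gam nu.
Hypothesis kappaE : curvature Gam nu kappa.

Lemma component_boundary q : Gam q -> closure Om q /\ ~ Om q.
Proof.
case: GB => q0 _ -> /connected_component_sub [cq iq]; split=> // Oq.
by apply: iq; have H := oOm; rewrite openE in H; exact: H.
Qed.

Lemma defining_function_zero q U phi : Gam q -> defining_function Om q U phi ->
  phi q = 0.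
Proof.
move=> Gq [[oU Uq] Cphi _ side]; have [clq nOq] := component_boundary Gq.
have cphi : {for q, continuous phi}.
  by apply: differentiable_continuous; exact: Cphi.1.
apply/eqP; rewrite eq_le; apply/andP; split; last first.
  by rewrite leNgt; apply/negP => /(side q Uq).2.
rewrite leNgt; apply/negP => p0.
have : nbhs q (U `&` [set x | 0 < phi x]).
  apply: filterI; first exact: open_nbhs_nbhs.
  exact: (@cvgr_gt R _ (nbhs q) _ phi (phi q) cphi 0 p0).
move=> /clq [x [Ox [Ux /= px]]].
by have := (side x Ux).1 Ox; rewrite ltNge ltW.
Qed.

Lemma defining_function_near q q' U phi : defining_function Om q U phi -> U q' ->
  defining_function Om q' U phi.
Proof. by move=> [[oU Uq] Cphi gphi side] Uq'. Qed.

Lemma Ck_pred (V W : normedModType R) j (U : set V) (f : V -> W) :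
  Ck j.+1 U f -> Ck j U f.
Proof.
elim: j f => [|j IH] f [df H] /=.
  by move=> x Ux; apply: differentiable_continuous; exact: df.
by split=> // v; apply: IH; exact: H.
Qed.

Lemma grad_continuous U (phi : 'cV[R]_2 -> R) x : Ck 2 U phi -> U x ->
  forall i, {for x, continuous (fun y => grad phi y i 0)}.
Proof.
move=> [_ H] Ux i; have [H1 _] := H (delta_mx i 0).
have -> : (fun y => grad phi y i 0) = 'D_(delta_mx i 0) phi.
  by apply/funext => y; rewrite mxE.
exact: differentiable_continuous (H1 x Ux).
Qed.

Lemma exists_frame : circle_of_length Gam L ->
  exists gam, arclength_parametrization Gam L gam /\
    frame Om Gam L gam (nu \o gam) (kappa \o gam).
Proof.
move=> /exists_arclength [L0 [c0 Hc0]].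
have base c : arclength_parametrization Gam L c ->
  [/\ forall t : R, is_derive t 1 c (derive1 c t), forall t, Gam (c t) &
      forall t, dot (derive1 c t) (derive1 c t) = 1].
  move=> [[[_ pc] ic rc Cc _] c1]; split=> t.
  - by rewrite derive1E; apply: derivableP; apply/derivable1_diffP; exact: Cc.1.
  - by rewrite -rc; exists t.
  - by rewrite -enorm_sq c1 expr1n.
have unit_nu q : Gam q -> dot (nu q) (nu q) = 1.
  move=> Gq; have [U [phi D]] := C3 Gq; rewrite (nuE Gq D).
  have [[_ Uq] _ g0 _] := D.
  have -> (a : R) x : dot (a *: x) (a *: x) = (a * enorm x) ^+ 2.
    by rewrite exprMn enorm_sq /dot !mxE; ring.
  by rewrite mulVf ?expr1n// gt_eqF// enormE sqrtr_gt0 dot_gt0// g0.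
have tang c : arclength_parametrization Gam L c -> forall t,
    dot (nu (c t)) (derive1 c t) = 0.
  move=> Hc t; have [dc Gc _] := base c Hc.
  have [U [phi D]] := C3 (Gc t); have [[oU Uq] Cphi _ _] := D.
  rewrite (nuE (Gc t) D).
  have -> (a : R) x y : dot (a *: x) y = a * dot x y by rewrite /dot !mxE; ring.
  have : is_derive t 1 (fun s => phi (c s)) (dot (grad phi (c t)) (derive1 c t)).
    by apply: is_derive_grad => //; exact: Cphi.1.
  have : is_derive t 1 (fun s => phi (c s)) 0.
    apply: (@near_eq_is_derive R R^o R^o (fun=> 0) _ t 1 0 _ (is_derive_cst 0 t 1)).
    have cc : {for t, continuous c} by exact: is_derive_continuous (dc t).
    have /(@near_ballP R R^o) [d d0 Hd] : \forall s \near t, U (c s).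
      by apply: cc; exact: open_nbhs_nbhs.
    apply/(@near_ballP R R^o); exists d => // s /Hd Us; apply/esym.
    exact: defining_function_zero (Gc s) (defining_function_near D Us).
  move=> h0 h1; rewrite -(@derive_val _ _ _ _ _ _ _ h1).
  by rewrite (@derive_val _ _ _ _ _ _ _ h0) mulr0.
have cnu c : arclength_parametrization Gam L c -> continuous (nu \o c).
  move=> Hc t; have [dc Gc _] := base c Hc.
  have [U [phi D]] := C3 (Gc t); have [[oU Uq] Cphi g0 _] := D.
  have cc : {for t, continuous c} by exact: is_derive_continuous (dc t).
  have nU : \forall s \near t, U (c s).
    by apply: cc; exact: open_nbhs_nbhs.
  have E : \forall s \near t, (enorm (grad phi (c s)))^-1 *: grad phi (c s) = (nu \o c) s.
    apply: filterS nU => s Us; apply/esym.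
    exact: nuE (Gc s) (defining_function_near D Us).
  have Et := nbhs_singleton E.
  rewrite /continuous_at -Et; apply: (@cvg_trans _ ((fun s => (enorm (grad phi (c s)))^-1 *: grad phi (c s)) @ t)).
    exact: near_eq_cvg.
  have cg : {for t, continuous (fun s => grad phi (c s))}.
    apply: continuous_col => i.
    apply: (@continuous_comp _ _ _ c (fun y => grad phi y i 0)) => //.
    by apply: (@grad_continuous U phi) => //; exact: Ck_pred Cphi.
  suff ci : {for t, continuous (fun s => (enorm (grad phi (c s)))^-1)} by exact: (continuousZ ci cg).
  apply: continuousV; first by rewrite gt_eqF// enormE sqrtr_gt0 dot_gt0// g0.
  have -> : (fun s => enorm (grad phi (c s))) =
     (fun s => Num.sqrt (dot (grad phi (c s)) (grad phi (c s)))).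
    by apply/funext => s; rewrite enormE.
  apply: (@continuous_comp _ _ _ (fun s => dot (grad phi (c s)) (grad phi (c s))) Num.sqrt).
    exact: continuous_dot.
  exact: sqrt_continuous.
pose e c t := dot (rot90 (nu (c t))) (derive1 c t).
have e2 c t : arclength_parametrization Gam L c -> e c t = 1 \/ e c t = -1.
  move=> Hc; have [_ Gc c1] := base c Hc.
  have : e c t ^+ 2 = 1.
    have h1 := tang c Hc t; have h2 := unit_nu _ (Gc t); have h3 := c1 t.
    have : e c t ^+ 2 + dot (nu (c t)) (derive1 c t) ^+ 2 =
      dot (nu (c t)) (nu (c t)) * dot (derive1 c t) (derive1 c t).
      by rewrite /e /dot !rot90E; ring.
    by rewrite h1 h2 h3 expr0n addr0 mulr1.
  by move/eqP; rewrite sqrf_eq1 => /orP[/eqP|/eqP] ->; [left|right].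
have ce c : arclength_parametrization Gam L c -> continuous (e c).
  move=> Hc t; apply: continuous_dot.
    apply: continuous_col => i; have := cnu c Hc t.
    have ci j : {for t, continuous (nu \o c)} -> {for t, continuous (fun s => nu (c s) j 0 : R)}.
      move=> cz; apply: (@continuous_comp _ _ _ (nu \o c) (fun u : 'cV[R]_2 => u j 0)) => //.
      exact: coord_continuous.
    move=> H; case: (ord2P i) => ->.
      have -> : (fun s => rot90 (nu (c s)) 0 0) = (fun s => - nu (c s) 1 0).
        by apply/funext => s; rewrite rot90E.
      by apply: continuousN; exact: ci.
    have -> : (fun s => rot90 (nu (c s)) 1 0) = (fun s => nu (c s) 0 0).
      by apply/funext => s; rewrite rot90E.
    exact: ci.
  have [[[_ pc] ic rc [_ Cc] _] c1] := Hc.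
  have C2 : Ck 2 [set: R] ('D_1 c) := Cc 1.
  have -> : derive1 c = 'D_1 c by apply/funext => s; rewrite derive1E.
  by apply: differentiable_continuous; exact: C2.1.
have [c [Hc ec]] : exists c, arclength_parametrization Gam L c /\ forall t, e c t = 1.
  have [H|H] := sign_constant (ce _ Hc0) (fun t => e2 _ t Hc0); first by exists c0.
  have Hr := reverse_arclength Hc0; exists (fun t => c0 (- t)); split=> // t.
  have [dc _ _] := base _ Hc0.
  rewrite /e; suff -> : derive1 (fun t => c0 (- t)) t = - derive1 c0 (- t).
    have := H (- t); rewrite /e => E; rewrite -[RHS]opprK -E /dot !mxE; ring.
  rewrite derive1E; apply: (@derive_val _ _ _ _ _ _ _ _).
  apply/is_derive_col => i; rewrite mxE -mulN1r mulrC.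
  apply: (@is_derive1_comp _ (fun s => c0 s i 0) -%R); exact: (is_derive_col _ _ _).1 (dc _) i.
have [dc Gc c1] := base c Hc.
have tgE t : derive1 c t = rot90 (nu (c t)).
  rewrite (frame_decomp (derive1 c t) (unit_nu _ (Gc t))).
  have -> : dot (derive1 c t) (nu (c t)) = 0 by rewrite -(tang c Hc t) /dot; ring.
  have -> : dot (derive1 c t) (rot90 (nu (c t))) = 1 by rewrite -(ec t) /e /dot; ring.
  by rewrite scale0r add0r scale1r.
have dgam (t : R) : is_derive t 1 c (rot90 (nu (c t))) by rewrite -tgE.
have dnrm (t : R) : is_derive t 1 (nu \o c) (kappa (c t) *: rot90 (nu (c t))).
  exact: kappaE.
have [[[_ pc] ic rc Cc _] _] := Hc.
have C2 : Ck 2 [set: R] ('D_1 c) := Cc.2 1.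
have nuC i : Cn 2 (fun t => nu (c t) i 0).
  have Ht j : Cn 2 (fun t => rot90 (nu (c t)) j 0).
    have := Ck_components C2 j; congr (Cn 2 _).
    by apply/funext => t; rewrite -tgE derive1E.
  case: (ord2P i) => ->.
    by have := Ht 1; congr (Cn 2 _); apply/funext => t; rewrite rot90E.
  have := CnN (Ht 0); congr (Cn 2 _); apply/funext => t.
  by rewrite rot90E opprK.
exists c; split=> //; split=> //=.
- by move=> t; rewrite pc.
- by move=> t; rewrite pc.
- exact: periodic_inj_int.
- by move=> t; exact: unit_nu.
- have [d0 D0 K0] := nuC 0; have [d1 D1 K1] := nuC 1.
  have -> : kappa \o c = (fun t => d0 t * rot90 (nu (c t)) 0 0 + d1 t * rot90 (nu (c t)) 1 0).
    apply/funext => t /=.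
    have h0 := (is_derive_col _ _ _).1 (dnrm t) 0.
    have h1 := (is_derive_col _ _ _).1 (dnrm t) 1.
    rewrite -(@derive_val _ _ _ _ _ _ _ (D0 t)) (@derive_val _ _ _ _ _ _ _ h0).
    rewrite -(@derive_val _ _ _ _ _ _ _ (D1 t)) (@derive_val _ _ _ _ _ _ _ h1).
    rewrite !mxE /= -[LHS]mulr1 -(unit_nu _ (Gc t)) /dot; ring.
  have Ht j : Cn 1 (fun t => rot90 (nu (c t)) j 0).
    have := Cn_pred (Ck_components C2 j); congr (Cn 1 _).
    by apply/funext => t; rewrite -tgE derive1E.
  exact: (@CnD R 1 _ _ (@CnM R 1 _ _ K0 (Ht 0)) (@CnM R 1 _ _ K1 (Ht 1))).
- move=> t0; have [U [phi D]] := C3 (Gc t0); have [[oU Uq] Cphi g0 side] := D.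
  pose X (p : R * R) := c p.1 - p.2 *: nu (c p.1).
  pose h (p : R * R) := dot (grad phi (X p)) (nu (c p.1)).
  have cX : {for (t0, 0), continuous X}.
    apply: (@cvgB _ _ _ (nbhs ((t0, 0) : R * R))).
      apply: (@continuous_comp _ _ _ fst c); first exact: cvg_fst.
      exact: is_derive_continuous (dgam t0).
    have c2 : {for (t0, 0), continuous (fun p : R * R => nu (c p.1))}.
      apply: (@continuous_comp _ _ _ fst (nu \o c)); first exact: cvg_fst.
      exact: is_derive_continuous (dnrm t0).
    exact: (continuousZ (x := ((t0, 0) : R * R)) (s := snd) cvg_snd c2).
  have X0 : X (t0, 0) = c t0 by rewrite /X /= scale0r subr0.
  have gp0 : 0 < enorm (grad phi (c t0)) by rewrite enormE sqrtr_gt0 dot_gt0// g0.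
  have ch i : {for (t0, 0), continuous (fun p : R * R => grad phi (X p) i 0)}.
    apply: (@continuous_comp _ _ _ X (fun y => grad phi y i 0)) => //.
    by rewrite X0; apply: (@grad_continuous U phi) => //; exact: Ck_pred Cphi.
  have cn i : {for (t0, 0), continuous (fun p : R * R => nu (c p.1) i 0)}.
    apply: (@continuous_comp _ _ _ fst (fun t => nu (c t) i 0)); first exact: cvg_fst.
    exact: Cn_continuous (nuC i) t0.
  have chh : {for (t0, 0), continuous h}.
    by apply: (@cvgD _ R^o); apply: cvgM; [exact: ch|exact: cn|exact: ch|exact: cn].
  have h0 : 0 < h (t0, 0).
    rewrite /h X0 /= (nuE (Gc t0) D).
    have -> (a : R) x y : dot x (a *: y) = a * dot x y by rewrite /dot !mxE; ring.
    by rewrite -enorm_sq expr2 mulrA mulVf ?mul1r// gt_eqF.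
  have : \forall p \near ((t0, 0) : R * R), U (X p) /\ 0 < h p.
    have N1 : \forall p \near ((t0, 0) : R * R), U (X p).
      by apply: cX; rewrite X0; exact: open_nbhs_nbhs.
    have N2 : \forall p \near ((t0, 0) : R * R), 0 < h p.
      exact: (@cvgr_gt R _ (nbhs ((t0, 0) : R * R)) _ h (h (t0, 0)) chh 0 h0).
    by apply: filterS2 N1 N2.
  move=> /near_ballP [d d0 Hd]; exists d => // t s td /andP[s0 sd].
  have Hs s' : 0 <= s' <= s -> U (X (t, s')) /\ 0 < h (t, s').
    move=> /andP[s'0 s's]; apply: Hd; rewrite prod_normE gt_max /= td subr0.
    by rewrite ger0_norm//; exact: le_lt_trans sd.
  have Us : U (X (t, s)) by have [] := Hs s; rewrite ?lexx ?ltW.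
  apply/(side _ Us).
  have UX0 : U (c t).
    by have [] := Hs 0; rewrite ?lexx ?(ltW s0)// /X /= scale0r subr0.
  have z := defining_function_zero (Gc t) (defining_function_near D UX0).
  pose f s' := phi (X (t, s')).
  have df (s' : R) : s' \in `]0, s[%R -> is_derive s' 1 f (- h (t, s')).
    rewrite in_itv /= => /andP[/ltW a1 /ltW a2].
    have [Us' _] : U (X (t, s')) /\ 0 < h (t, s') by apply: Hs; rewrite a1 a2.
    have -> : - h (t, s') = dot (grad phi (X (t, s'))) (- nu (c t)).
      by rewrite /h /dot !mxE /=; ring.
    apply: is_derive_grad; first exact: Cphi.1.
    have -> : (fun s => X (t, s)) = (fun s => c t + s *: (- nu (c t))).
      by apply/funext => s''; rewrite /X /= scalerN.
    exact: is_derive_line.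
  have cf : {within `[0, s], continuous f}.
    apply: continuous_in_subspaceT => s'; rewrite inE /= in_itv /= => ss.
    have [Us' _] := Hs s' ss.
    apply: (@continuous_comp _ _ _ (fun s' => X (t, s')) phi); last first.
      by apply: differentiable_continuous; exact: Cphi.1.
    have -> : (fun s => X (t, s)) = (fun s => c t + s *: (- nu (c t))).
      by apply/funext => s''; rewrite /X /= scalerN.
    exact: is_derive_continuous (is_derive_line _ _ _).
  have [c' cs E] := MVT s0 df cf.
  have f0 : f 0 = 0 by rewrite /f /X /= scale0r subr0.
  have -> : phi (c t - s *: nu (c t)) = - (h (t, c') * s).
    by have := E; rewrite f0 !subr0 mulNr.
  rewrite oppr_lt0.
  apply: mulr_gt0 => //; move: cs; rewrite in_itv /= => /andP[/ltW a1 /ltW a2].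
  by apply: (Hs c' _).2; rewrite a1 a2.
Qed.

End ConstructFrame.

End Frames.

(*PART 10*)
Section Tube.
Context {R : realType}.
Variables (Om Gam : set 'cV[R]_2) (L : R) (gam nrm : R -> 'cV[R]_2) (k : R -> R).
Hypothesis F : frame Om Gam L gam nrm k.
Let L0 := frame_L F.
Local Notation tg t := (rot90 (nrm t)).

Definition tube (t s : R) : 'cV[R]_2 := gam t - s *: nrm t.

Lemma curvature_bounds : exists dk : R -> R, exists2 Km : R, 0 < Km &
  [/\ forall t : R, is_derive t 1 k (dk t), continuous dk, forall t, `|k t| <= Km &
      forall t, `|dk t| <= Km].
Proof.
have [dk Dk ck] := frame_k F.
have kc : continuous k by move=> t; exact: is_derive_continuous (Dk t).
have dkL t : dk (t + L) = dk t.
  have h : is_derive t 1 k (dk (t + L)).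
    have := is_derive_shift1 (Dk (t + L)).
    by have -> : (fun s => k (s + L)) = k by apply/funext => s; exact: frame_kL F s.
  by rewrite -(@derive_val _ _ _ _ _ _ _ h) (@derive_val _ _ _ _ _ _ _ (Dk t)).
have [M1 H1] := periodic_bounded L0 kc (frame_kL F).
have [M2 H2] := periodic_bounded L0 ck dkL.
have M10 : 0 <= M1 by apply: le_trans (H1 0).
have M20 : 0 <= M2 by apply: le_trans (H2 0).
exists dk, (M1 + M2 + 1); first by lra.
split=> // t; [have := H1 t|have := H2 t]; lra.
Qed.

Lemma unit_tg t : dot (tg t) (tg t) = 1.
Proof. by rewrite -(frame_unit F t) /dot !rot90E; ring. Qed.

Lemma is_derive_tg (t : R) : is_derive t 1 (fun t => tg t) (- k t *: nrm t).
Proof.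
have := is_derive_rot90 (frame_dnrm F t).
suff -> : rot90 (k t *: tg t) = - k t *: nrm t by [].
by apply: col2P; rewrite !rot90E !mxE /=; ring.
Qed.

Lemma unit_coord (x : 'cV[R]_2) i : dot x x = 1 -> `|x i 0| <= 1.
Proof. by move=> x1; rewrite -(enorm_unit x1); exact: coord_le_enorm. Qed.

Lemma vec_lipschitz (x x' : R -> 'cV[R]_2) (M : R) :
  (forall t : R, is_derive t 1 x (x' t)) -> (forall t i, `|x' t i 0| <= M) ->
  forall s t, enorm (x t - x s) <= 2 * M * `|t - s|.
Proof.
move=> dx xM s t; apply: le_trans (enorm_le_coord _) _.
have H i : `|(x t - x s) i 0| <= M * `|t - s|.
  rewrite !mxE; apply: (@mvt_le_sym R (fun t => x t i 0) (fun t => x' t i 0)) => u _ //.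
  exact: (is_derive_col _ _ _).1 (dx u) i.
by have := H 0; have := H 1; lra.
Qed.

Lemma gam_lipschitz s t : enorm (gam t - gam s) <= 2 * `|t - s|.
Proof.
rewrite -[2]mulr1; apply: (vec_lipschitz (frame_dgam F)) => u i.
exact/unit_coord/unit_tg.
Qed.

Lemma tg_lipschitz (Km : R) : (forall t, `|k t| <= Km) ->
  forall s t, enorm (tg t - tg s) <= 2 * Km * `|t - s|.
Proof.
move=> kM; apply: (vec_lipschitz is_derive_tg) => u i.
rewrite mxE normrM normrN -[Km]mulr1; apply: ler_pM => //.
exact/unit_coord/(frame_unit F).
Qed.

Lemma enorm_continuous (V : normedModType R) (x : V -> 'cV[R]_2) (t : V) :
  {for t, continuous x} -> {for t, continuous (fun s => enorm (x s) : R^o)}.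
Proof.
move=> /continuous_atP cx; apply/continuous_atP => e e0.
have [d d0 Hd] := cx (e / 2) (divr_gt0 e0 (ltr0Sn _ 1)); exists d => // s /Hd h.
have h1 := enorm_triangleB (x s) (x t); have h2 := enorm_triangleB (x t) (x s).
have h3 := enorm_le_norm (x s - x t).
have h4 : enorm (x t - x s) = enorm (x s - x t) by rewrite -enormN opprB.
rewrite h4 in h2; rewrite ler_norml; apply/andP; split; lra.
Qed.

(** Parameters that stay away from each other modulo the period give points
of the curve that stay away from each other. *)
Lemma curve_separated (d : R) : 0 < d -> exists2 c : R, 0 < c &
  forall t u, d <= u <= L - d -> c <= enorm (gam (t + u) - gam t).
Proof.
move=> d0; pose f t u := enorm (gam (t + u) - gam t).
have cg : continuous gam by move=> t; exact: is_derive_continuous (frame_dgam F t).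
have fpos t u : d <= u <= L - d -> 0 < f t u.
  move=> /andP[u1 u2]; rewrite lt_neqAle enorm_ge0 andbT eq_sym; apply/negP => /eqP E.
  have : gam (t + u) = gam t.
    apply/eqP; rewrite -subr_eq0 -normr_le0 -E; exact: norm_le_enorm.
  move=> /(frame_inj F) [n En].
  have h1 : 0 < n%:~R * L by lra.
  have h2 : n%:~R * L < 1 * L by lra.
  rewrite pmulr_lgt0// ltr0z in h1; rewrite (ltr_pM2r L0) ltrz1 in h2.
  by move: h1 h2; case: n {En} => // -[].
have H t : exists2 c, 0 < c & forall u, 0 <= u <= L -> (d <= u <= L - d -> c <= f t u).
  apply: (@uniform_on_segment R L (fun u c => d <= u <= L - d -> c <= f t u)).
    by move=> u c c' c'0 c'c Hc uu; apply: le_trans c'c _; exact: Hc.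
  move=> u.
  have [u1|u1] := ltP u d.
    exists (d - u); first by rewrite subr_gt0.
    move=> u'; rewrite ltr_norml => /andP[_ h] /andP[h' _]; lra.
  have [u2|u2] := ltP (L - d) u.
    exists (u - (L - d)); first by rewrite subr_gt0.
    move=> u'; rewrite ltr_norml => /andP[h _] /andP[_ h']; lra.
  have f0 : 0 < f t u by apply: fpos; rewrite u1.
  exists (f t u / 4); first by rewrite divr_gt0.
  move=> u' hu _.
  have h := gam_lipschitz (t + u') (t + u).
  have E : t + u - (t + u') = u - u' by ring.
  rewrite E distrC in h.
  have := enorm_triangleB (gam (t + u) - gam t) (gam (t + u') - gam t).
  rewrite -/(f t u) -/(f t u').
  have -> : gam (t + u) - gam t - (gam (t + u') - gam t) = gam (t + u) - gam (t + u').
    by rewrite opprB addrA subrK.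
  lra.
have [|||c c0 Hc] := @uniform_periodic R L (fun t c => forall u, d <= u <= L - d -> c <= f t u) L0.
- move=> t c; have E u : f (t + L) u = f t u.
    by rewrite /f addrAC !(frame_gamL F).
  by split=> Hc u /Hc; rewrite E.
- by move=> t c c' c'0 c'c Hc u /Hc; exact: le_trans.
- move=> t; have [c c0 Hc] := H t; exists (c / 8); first by rewrite divr_gt0.
  move=> t' ht u du; have {}Hc : c <= f t u.
    by apply: Hc => //; move: du d0 => /andP[? ?] ?; apply/andP; split; lra.
  have h1 := gam_lipschitz (t' + u) (t + u); have h2 := gam_lipschitz t t'.
  have E : t + u - (t' + u) = t - t' by ring.
  rewrite E distrC in h1.
  have := enorm_triangleB (gam (t + u) - gam t) (gam (t' + u) - gam t').
  rewrite -/(f t u) -/(f t' u).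
  have -> : gam (t + u) - gam t - (gam (t' + u) - gam t') =
    (gam (t + u) - gam (t' + u)) + (gam t' - gam t).
    by apply: col2P; rewrite !mxE; ring.
  have := enorm_triangle (gam (t + u) - gam (t' + u)) (gam t' - gam t); lra.
- by exists c => // t u; exact: Hc.
Qed.

Lemma normal_deviation : exists2 C : R, 0 < C & forall t t',
  `|dot (nrm t) (gam t' - gam t)| <= C * enorm (gam t' - gam t) ^+ 2.
Proof.
have [dk [Km Km0 [Dk ck kM dkM]]] := curvature_bounds.
pose d := Num.min (1 / (4 * Km)) (L / 4).
have d0 : 0 < d by rewrite lt_min !divr_gt0// mulr_gt0.
have [c c0 Hc] := curve_separated d0.
have close t t' : `|t' - t| <= d ->
    `|dot (nrm t) (gam t' - gam t)| <= 8 * Km * enorm (gam t' - gam t) ^+ 2.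
  move=> h.
  have dK : 2 * Km * d <= 1 / 2.
    have : d <= 1 / (4 * Km) by rewrite ge_min lexx.
    by rewrite ler_pdivlMr ?mulr_gt0//; lra.
  have between u : Num.min t t' <= u <= Num.max t t' -> `|u - t| <= `|t' - t|.
    case: (leP t t') => tt' /andP[u1 u2].
      by rewrite !ger0_norm ?subr_ge0// lerD2r.
    by rewrite !ler0_norm ?subr_le0// ?lerN2 ?lerD2r// ltW.
  have tgd u : `|u - t| <= `|t' - t| -> enorm (tg u - tg t) <= 2 * Km * `|t' - t|.
    move=> hu; apply: le_trans (tg_lipschitz kM _ _) _.
    by rewrite ler_pM2l// mulr_gt0.
  have deriv (x : 'cV[R]_2) (u : R) :
      is_derive u 1 (fun s => dot x (gam s - gam t)) (dot x (tg u)).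
    have := is_derive_dot (is_derive_cst x u 1) (is_deriveB (frame_dgam F u) (is_derive_cst (gam t) u 1)).
    suff -> : dot 0 (gam u - gam t) + dot x (tg u - 0) = dot x (tg u) by [].
    by rewrite /dot !mxE; ring.
  have f1 : `|dot (nrm t) (gam t' - gam t)| <= 2 * Km * `|t' - t| * `|t' - t|.
    have z : dot (nrm t) (gam t - gam t) = 0 by rewrite subrr /dot !mxE; ring.
    rewrite -[dot _ _]subr0 -z.
    apply: (@mvt_le_sym R (fun s => dot (nrm t) (gam s - gam t)) (fun u => dot (nrm t) (tg u))) => u hu.
    have -> : dot (nrm t) (tg u) = dot (nrm t) (tg u - tg t).
      by rewrite /dot !mxE /=; ring.
    apply: le_trans (dot_le _ _) _; rewrite enorm_unit ?mul1r; last exact: frame_unit F t.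
    exact/tgd/between.
  have f2 : `|dot (tg t) (gam t' - gam t) - (t' - t)| <= 1 / 2 * `|t' - t|.
    have z : dot (tg t) (gam t - gam t) - (t - t) = 0 by rewrite !subrr /dot !mxE; ring.
    rewrite -[dot _ _ - _]subr0 -z.
    apply: (@mvt_le_sym R (fun s => dot (tg t) (gam s - gam t) - (s - t))
       (fun u => dot (tg t) (tg u) - (1 - 0))) => u hu.
    have -> : dot (tg t) (tg u) - (1 - 0) = dot (tg t) (tg u - tg t).
      by rewrite -(unit_tg t) /dot !mxE /=; ring.
    apply: le_trans (dot_le _ _) _; rewrite (enorm_unit (unit_tg t)) [1 * enorm _]mul1r.
    apply: le_trans (tgd _ (between _ hu)) _; apply: le_trans dK.
    by rewrite ler_pM2l// mulr_gt0.
  have f3 : `|t' - t| <= 2 * enorm (gam t' - gam t).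
    have := dot_le (tg t) (gam t' - gam t); rewrite enorm_unit ?mul1r; last exact: unit_tg.
    have h1 := ler_normB (dot (tg t) (gam t' - gam t)) (dot (tg t) (gam t' - gam t) - (t' - t)).
    rewrite opprB addrC subrK in h1; lra.
  apply: le_trans f1 _; rewrite -mulrA -expr2.
  have -> : 8 * Km * enorm (gam t' - gam t) ^+ 2 = 2 * Km * (2 * enorm (gam t' - gam t)) ^+ 2 by ring.
  rewrite ler_pM2l ?mulr_gt0// ler_pXn2r// nnegrE// mulr_ge0// enorm_ge0//.
have ci0 : 0 < c^-1 by rewrite invr_gt0.
exists (8 * Km + c^-1); first by rewrite addr_gt0// mulr_gt0.
move=> t t'; have [n /andP[n0 nL]] := periodic_reduce (t' - t) L0.
set u := t' - t + n%:~R * L in n0 nL.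
have E1 : gam t' = gam (t + u).
  rewrite -(@periodic_int R _ gam L n t' (frame_gamL F)) /u; congr gam; ring.
have sq0 : 0 <= enorm (gam t' - gam t) ^+ 2 by rewrite sqr_ge0.
have [ud|ud] := leP u d.
  have := close t (t + u); rewrite addrAC subrr add0r ger0_norm// -E1 => /(_ ud) h.
  apply: le_trans h _; rewrite ler_wpM2r//; lra.
have [uL|uL] := leP (L - d) u.
  have := close t (t + (u - L)); rewrite addrAC subrr add0r ler0_norm; last lra.
  have -> : gam (t + (u - L)) = gam t'.
    by rewrite E1 -(frame_gamL F (t + (u - L))); congr gam; ring.
  have h1 : - (u - L) <= d by lra.
  move=> /(_ h1) h; apply: le_trans h _; rewrite ler_wpM2r//; lra.
have := Hc t u; rewrite -E1 (ltW ud) (ltW uL) => /(_ isT) h.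
have := dot_le (nrm t) (gam t' - gam t); rewrite enorm_unit ?mul1r; last exact: frame_unit F t.
move=> h2; apply: le_trans h2 _.
apply: (@le_trans _ _ (c^-1 * enorm (gam t' - gam t) ^+ 2)).
  rewrite expr2 mulrA ler_peMl ?enorm_ge0//.
  by rewrite mulrC -ler_pdivrMr ?invr_gt0// invrK mul1r.
by rewrite ler_wpM2r// lerDr mulr_ge0// ltW.
Qed.

Lemma Gam_gam q : Gam q <-> exists t, q = gam t.
Proof.
by rewrite -(frame_range F); split=> [[t _ <-]|[t ->]]; exists t.
Qed.

Lemma tube_distE : exists2 s0 : R, 0 < s0 & forall t s, 0 <= s <= s0 ->
  distE Gam (tube t s) = s.
Proof.
have [C C0 HC] := normal_deviation.
exists (1 / (2 * C)); first by rewrite divr_gt0// mulr_gt0.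
move=> t s /andP[s0 sC].
have E : enorm (tube t s - gam t) = s.
  have -> : tube t s - gam t = - (s *: nrm t) by apply: col2P; rewrite !mxE; ring.
  by rewrite enormN enormZ enorm_unit ?mulr1 ?ger0_norm//; exact: frame_unit F t.
have lb t' : s <= enorm (tube t s - gam t').
  rewrite le_enorm//; have h := HC t t'; rewrite enorm_sq in h.
  have -> : dot (tube t s - gam t') (tube t s - gam t') =
     dot (gam t' - gam t) (gam t' - gam t) + s ^+ 2 * dot (nrm t) (nrm t) +
     2 * (s * dot (nrm t) (gam t' - gam t)).
    by rewrite /tube /dot !mxE; ring.
  rewrite (frame_unit F t) mulr1.
  have D0 := dot_ge0 (gam t' - gam t); set D := dot (gam t' - gam t) (gam t' - gam t) in h D0 *.
  set e := dot (nrm t) (gam t' - gam t) in h *.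
  have h1 : - (s * (C * D)) <= s * e.
    by rewrite -mulrN ler_wpM2l//; move: h; rewrite ler_norml => /andP[].
  have h2 : s * (C * D) <= D / 2.
    rewrite mulrA [D / 2]mulrC; apply: ler_wpM2r => //.
    have C2 : 0 < 2 * C by rewrite mulr_gt0.
    have := sC; rewrite (ler_pdivlMr _ _ C2) => h2.
    lra.
  lra.
apply/eqP; rewrite eq_le; apply/andP; split.
  rewrite -[X in _ <= X]E; apply: ge_inf; last first.
    by exists (gam t) => //; apply/Gam_gam; exists t.
  by exists 0 => _ [q _ <-]; exact: enorm_ge0.
apply: lb_le_inf.
  by exists (enorm (tube t s - gam t)), (gam t) => //; apply/Gam_gam; exists t.
by move=> _ [q /Gam_gam [t' ->] <-]; exact: lb.
Qed.

Lemma tube_inside : exists2 s1 : R, 0 < s1 & forall t s, 0 < s < s1 -> Om (tube t s).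
Proof.
apply: (@uniform_periodic R L (fun t d => forall s, 0 < s < d -> Om (tube t s)) L0).
- by move=> t d; rewrite /tube (frame_gamL F) (frame_nrmL F).
- move=> t d d' d'0 d'd H s /andP[s0 sd]; apply: H; rewrite s0.
  exact: lt_le_trans d'd.
- by move=> t; have [d d0 Hd] := frame_side F t; exists d => // t' ht s hs; exact: Hd.
Qed.

End Tube.

(*PART 11*)
Section MoreCalculus.
Context {R : realType}.

Lemma sdiff_expR (p : R) : sdiff (expR : R^o -> R^o) p.
Proof.
apply: (@sdiff_C1 R expR expR p 1 ltr01); last exact: continuous_expR.
Qed.

Lemma sdiff_expR_comp (V : normedModType R) (f : V -> R) (p : V) : sdiff (f : V -> R^o) p ->
  sdiff (fun x => expR (f x) : R^o) p.
Proof. by move=> sf; apply: (sdiff_comp (sdiff_expR _) sf). Qed.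

Lemma sdiff_plane (f : 'cV[R]_2 -> R) (U : set 'cV[R]_2) (p : 'cV[R]_2) :
  open U -> U p -> (forall q, U q -> differentiable f q) ->
  (forall i, {for p, continuous (fun q => 'D_(delta_mx i 0) f q : R^o)}) ->
  sdiff (f : 'cV[R]_2 -> R^o) p.
Proof.
move=> oU Up df cD.
apply: (@sdiff_partials R _ 'I_2 (fun i => delta_mx i 0) (fun i h => h i 0)) => //.
- move=> h; rewrite {1}(col2E h) big_ord_recl big_ord1; congr (_ + _ *: delta_mx _ _).
    by congr (h _ _); apply/val_inj.
  exact/val_inj.
- move=> i h; rewrite [leRHS]/Num.Def.normr/= mx_normrE.
  by apply: le_trans; last exact: (le_bigmax _ _ (i, 0)).
- have : nbhs p U by exact: open_nbhs_nbhs.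
  by apply: filterS => q; exact: df.
Qed.

Lemma sdiff_plane2 (f : 'cV[R]_2 * 'cV[R]_2 -> R) (U : set ('cV[R]_2 * 'cV[R]_2))
    (p : 'cV[R]_2 * 'cV[R]_2) :
  open U -> U p -> (forall q, U q -> differentiable f q) ->
  (forall v, {for p, continuous (fun q => 'D_v f q : R^o)}) ->
  sdiff (f : 'cV[R]_2 * 'cV[R]_2 -> R^o) p.
Proof.
move=> oU Up df cD.
pose e (bi : bool * 'I_2) : 'cV[R]_2 * 'cV[R]_2 :=
  if bi.1 then (delta_mx bi.2 0, 0) else (0, delta_mx bi.2 0).
pose c (bi : bool * 'I_2) (h : 'cV[R]_2 * 'cV[R]_2) : R :=
  if bi.1 then h.1 bi.2 0 else h.2 bi.2 0.
have cle (x : 'cV[R]_2) i : `|x i 0| <= `|x|.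
  rewrite [leRHS]/Num.Def.normr/= mx_normrE.
  by apply: le_trans; last exact: (le_bigmax _ _ (i, 0)).
have sumE (V : zmodType) (F : 'I_2 -> V) : \sum_i F i = F 0 + F 1.
  by rewrite big_ord_recl big_ord1; congr (_ + F _); apply/val_inj.
apply: (@sdiff_partials R _ (bool * 'I_2)%type e c) => //.
- move=> h; rewrite -(pair_bigA _ (fun b i => c (b, i) h *: e (b, i))) /=.
  rewrite big_bool /= !sumE /c /e /=.
  case: h => h1 h2 /=; rewrite {1}(col2E h1) {1}(col2E h2).
  by congr (_, _) => /=; rewrite !scaler0 ?addr0 ?add0r.
- move=> [[] i] h; rewrite /c /=; apply: le_trans (cle _ _) _;
  by rewrite prod_normE le_max lexx ?orbT.
- have : nbhs p U by exact: open_nbhs_nbhs.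
  by apply: filterS => q; exact: df.
Qed.

End MoreCalculus.

Section Regularity.
Context {R : realType}.
Local Notation E := ('cV[R]_2).
Variables (Om : set E) (g : E -> E -> R).
Hypothesis oOm : open Om.
Hypothesis gC3 : Ck 3 (Om `*` Om) (fun wz : E * E => g wz.1 wz.2).
Let U := Om `*` Om.
Let g2 := fun wz : E * E => g wz.1 wz.2.

Lemma open_UU : open U.
Proof.
rewrite openE => -[a b] [/= Oa Ob]; exists (Om, Om); last by move=> [].
by split; exact: open_nbhs_nbhs.
Qed.

Lemma g_sdiff p : U p -> sdiff (g2 : _ -> R^o) p.
Proof.
move=> Up; apply: (sdiff_plane2 open_UU Up gC3.1) => v.
by apply: differentiable_continuous; case: (gC3.2 v) => + _; exact.
Qed.

Lemma Dg_sdiff v p : U p -> sdiff ('D_v g2 : _ -> R^o) p.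
Proof.
move=> Up; apply: (sdiff_plane2 open_UU Up (gC3.2 v).1) => w.
by apply: differentiable_continuous; case: ((gC3.2 v).2 w) => + _; exact.
Qed.

Lemma DDg_continuous v w p : U p -> {for p, continuous ('D_w ('D_v g2) : _ -> R^o)}.
Proof.
by move=> Up; apply: differentiable_continuous; case: ((gC3.2 v).2 w) => + _; exact.
Qed.

Local Notation rho := (rhofun g).
Local Notation h := (hfun g).

Lemma hfun_sdiff z : Om z -> sdiff (h : E -> R^o) z.
Proof.
move=> Oz; apply: (@sdiff_comp R E _ R^o g2 (fun z => (z, z))).
  exact: g_sdiff.
by apply: sdiff_pair; exact: sdiff_id.
Qed.

Lemma hfun_derive z v : Om z -> 'D_v h z = 'D_((v, 0)) g2 (z, z) + 'D_((0, v)) g2 (z, z).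
Proof.
move=> Oz; have dg : differentiable g2 (z, z) by apply: gC3.1.
have dh := sdiff_differentiable (hfun_sdiff Oz).
have p0 : z + (0 : R) *: v = z by rewrite scale0r addr0.
have l1 : is_derive (0 : R) 1 (fun s : R => h (z + s *: v)) ('d h z v).
  have := @is_derive_comp R _ _ h (fun s => z + s *: v) 0 v.
  by rewrite p0; apply=> //; exact: is_derive_line.
have l2 : is_derive (0 : R) 1 (fun s : R => g2 ((z, z) + s *: (v, v))) ('d g2 (z, z) (v, v)).
  have := @is_derive_comp R _ _ g2 (fun s => (z, z) + s *: (v, v)) 0 (v, v).
  rewrite scale0r addr0; apply=> //; exact: is_derive_line.
rewrite !deriveE// -(@derive_val _ _ _ _ _ _ _ l1).
have -> : (fun s => h (z + s *: v)) = (fun s => g2 ((z, z) + s *: (v, v))) by [].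
rewrite (@derive_val _ _ _ _ _ _ _ l2) -linearD; congr ('d g2 _ _).
by congr (_, _); rewrite /= ?addr0 ?add0r.
Qed.

Lemma rhofun_sdiff z : Om z -> sdiff (rho : E -> R^o) z.
Proof.
move=> Oz; apply: sdiff_expR_comp; apply: sdiffM; last exact: hfun_sdiff.
exact: (@sdiff_cst R E R^o).
Qed.

Lemma rhofun_gt0 z : 0 < rho z.
Proof. exact: expR_gt0. Qed.

Lemma rhofun_derive z v : Om z -> 'D_v rho z = - (2 * pi) * rho z * 'D_v h z.
Proof.
move=> Oz; have dh := sdiff_differentiable (hfun_sdiff Oz).
have dr := sdiff_differentiable (rhofun_sdiff Oz).
have p0 : z + (0 : R) *: v = z by rewrite scale0r addr0.
have l1 : is_derive (0 : R) 1 (fun s : R => h (z + s *: v)) ('d h z v).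
  have := @is_derive_comp R _ _ h (fun s => z + s *: v) 0 v.
  by rewrite p0; apply=> //; exact: is_derive_line.
have l2 : is_derive (0 : R) 1 (fun s : R => rho (z + s *: v)) ('d rho z v).
  have := @is_derive_comp R _ _ rho (fun s => z + s *: v) 0 v.
  by rewrite p0; apply=> //; exact: is_derive_line.
have l3 : is_derive (0 : R) 1 (fun s : R => rho (z + s *: v))
   (rho z * (- (2 * pi) * 'd h z v)).
  have l4 : is_derive (0 : R) 1 (fun s : R => - (2 * pi) * h (z + s *: v)) (- (2 * pi) * 'd h z v).
    exact: is_deriveZ.
  have := @is_derive1_comp R expR (fun s => - (2 * pi) * h (z + s *: v)) 0 _ _ (is_derive_expR _) l4.
  by rewrite p0.
rewrite !deriveE// -(@derive_val _ _ _ _ _ _ _ l2) (@derive_val _ _ _ _ _ _ _ l3); ring.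
Qed.

Lemma grad_rho_sdiff z i : Om z -> sdiff (fun y => grad rho y i 0 : R^o) z.
Proof.
move=> Oz.
have nO : nbhs z Om by exact: open_nbhs_nbhs.
pose v : E := delta_mx i 0.
apply: (@sdiff_near R _ _ (fun y => - (2 * pi) * rho y *
   ('D_((v, 0)) g2 (y, y) + 'D_((0, v)) g2 (y, y)))).
  by apply: filterS nO => y Oy; rewrite mxE rhofun_derive// hfun_derive.
have sd : sdiff (fun y : E => (y, y)) z by apply: sdiff_pair; exact: sdiff_id.
apply: sdiffM.
  by apply: sdiffM; [exact: (@sdiff_cst R E R^o)|exact: rhofun_sdiff].
apply: (@sdiffD R E R^o).
  by apply: (@sdiff_comp R E _ R^o ('D_((v, 0)) g2) (fun y => (y, y))) => //; exact: Dg_sdiff.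
by apply: (@sdiff_comp R E _ R^o ('D_((0, v)) g2) (fun y => (y, y))) => //; exact: Dg_sdiff.
Qed.

End Regularity.

(*PART 12*)
Section OneSided.
Context {R : realType}.

Lemma mvt_right (f df : R -> R) (s M : R) : 0 < s -> 0 <= M ->
  (forall x : R, 0 < x <= s -> is_derive x 1 f (df x)) ->
  (forall x, 0 < x <= s -> `|df x| <= M) ->
  (forall e : R, 0 < e -> exists2 d : R, 0 < d & forall x, 0 < x < d -> `|f x| <= e) ->
  `|f s| <= M * s.
Proof.
move=> s0 M0 fd dM f0; apply/ler_addgt0Pr => e e0; have [d d0 Hd] := f0 e e0.
pose x := Num.min d s / 2; have m0 : 0 < Num.min d s by rewrite lt_min d0.
have [xd xs] : x < d /\ x < s.
  have : x < Num.min d s by rewrite /x; lra.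
  by rewrite lt_min => /andP.
have x0 : 0 < x by rewrite /x; lra.
have h1 : `|f s - f x| <= M * (s - x).
  apply: (@mvt_le R f df) => [|y /andP[xy ys]|y /andP[xy ys]]; first exact: ltW.
    by apply: fd; rewrite ys (lt_le_trans x0).
  by apply: dM; rewrite ys (lt_le_trans x0).
have h2 : `|f x| <= e by apply: Hd; rewrite x0.
have h3 := ler_normD (f s - f x) (f x); rewrite subrK in h3.
have h4 : 0 <= M * x by rewrite mulr_ge0// ltW.
lra.
Qed.

End OneSided.

Section BoundaryLimits.
Context {R : realType}.
Local Notation E := ('cV[R]_2).
Variables (Om Gam : set E) (L : R) (gam nrm : R -> E) (k : R -> R).
Hypothesis F : frame Om Gam L gam nrm k.
Let L0 := frame_L F.
Local Notation tg t := (rot90 (nrm t)).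
Local Notation X := (tube gam nrm).

Lemma tube_near t t0 s : 0 <= s -> `|X t s - gam t0| <= 2 * `|t - t0| + s.
Proof.
move=> s0; apply: le_trans (norm_le_enorm _) _.
have -> : X t s - gam t0 = (gam t - gam t0) + (- s) *: nrm t.
  by apply: col2P; rewrite !mxE; ring.
apply: le_trans (enorm_triangle _ _) _.
rewrite enormZ normrN (ger0_norm s0) (enorm_unit (frame_unit F t)) mulr1.
by rewrite lerD2r; exact: (gam_lipschitz F).
Qed.

(** Limits at the points of the curve from inside the domain are uniform along
the curve. *)
Lemma tube_uniform_limit (V : normedModType R) (Phi : E -> V) (psi : R -> V) :
  (forall t, Phi z @[z --> within Om (nbhs (gam t))] --> psi t) ->
  continuous psi -> (forall t, psi (t + L) = psi t) ->
  forall e : R, 0 < e -> exists2 d : R, 0 < d & forall t s, 0 < s < d ->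
    `|Phi (X t s) - psi t| <= e.
Proof.
move=> lim cpsi psiL e e0.
apply: (@uniform_periodic R L (fun t d => forall s, 0 < s < d -> `|Phi (X t s) - psi t| <= e) L0).
- by move=> t d; rewrite /tube (frame_gamL F) (frame_nrmL F) psiL.
- move=> t d d' d'0 d'd H s /andP[s0 sd]; apply: H; rewrite s0.
  exact: lt_le_trans d'd.
move=> t0; have [s1 s10 Hin] := tube_inside F.
have e2 : 0 < e / 2 by rewrite divr_gt0.
have /cvgrPdist_le /(_ _ e2) := lim t0.
rewrite near_withinE => /near_ballP [d1 d10 H1].
have [d2 d20 H2] := (@continuous_atP R R^o V _ _).1 (cpsi t0) _ e2.
exists (Num.min (Num.min s1 d2) (d1 / 4)); first by rewrite !lt_min s10 d20 divr_gt0.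
move=> t; rewrite !lt_min => /andP[/andP[_ h2] h3] s.
rewrite !lt_min => /andP[s0 /andP[/andP[h4 _] h5]].
have O : Om (X t s) by apply: Hin; rewrite s0.
have := H1 (X t s); have := tube_near t t0 (ltW s0).
move=> a1 a2; have {}a2 := a2 _ O.
have a3 : `|psi t0 - Phi (X t s)| <= e / 2 by apply: a2; apply: le_lt_trans a1 _; lra.
have -> : Phi (X t s) - psi t = (psi t0 - psi t) - (psi t0 - Phi (X t s)).
  by rewrite opprB [RHS]addrC [RHS]addrA subrK.
apply: le_trans (ler_normB _ _) _; rewrite distrC.
by have := H2 t h2; lra.
Qed.

Lemma is_derive_tube_s (t s : R) : is_derive s 1 (fun s => X t s) (- nrm t).
Proof.
have -> : (fun s => X t s) = (fun s => gam t + s *: (- nrm t)).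
  by apply/funext => u; rewrite /tube scalerN.
exact: is_derive_line.
Qed.

Lemma is_derive_tube_t (t s : R) :
  is_derive t 1 (fun t => X t s) ((1 - s * k t) *: tg t).
Proof.
have -> : (1 - s * k t) *: tg t = tg t - s *: (k t *: tg t).
  by rewrite scalerA scalerBl scale1r.
apply: is_deriveB; first exact: (frame_dgam F).
by apply: is_deriveZ; exact: (frame_dnrm F).
Qed.

Variable g : E -> E -> R.
Hypothesis oOm : open Om.
Hypothesis gC3 : Ck 3 (Om `*` Om) (fun wz : E * E => g wz.1 wz.2).
Local Notation rho := (rhofun g).
Hypothesis rho_lim : forall t,
  [/\ rho z @[z --> within Om (nbhs (gam t))] --> (0 : R),
      grad rho z @[z --> within Om (nbhs (gam t))] --> - (2 *: nrm t) &
      hess rho z @[z --> within Om (nbhs (gam t))] --> (- (2 * k t))%:M].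

Definition rhoN t s := dot (grad rho (X t s)) (nrm t).
Definition rhoT t s := dot (grad rho (X t s)) (tg t).

Lemma is_derive_dot_grad_rho (x y : R -> E) (u : R) (x' y' : E) :
  Om (x u) -> is_derive u 1 x x' -> is_derive u 1 y y' ->
  is_derive u 1 (fun s => dot (grad rho (x s)) (y s))
    (dot (hess rho (x u) *m x') (y u) + dot (grad rho (x u)) y').
Proof.
move=> O dx dy; apply: is_derive_dot => //; apply/is_derive_col => i.
have -> : (hess rho (x u) *m x') i 0 = dot (grad (fun y => grad rho y i 0) (x u)) x'.
  by rewrite mxE sum_ord2 /dot !mxE.
apply: is_derive_grad => //.
exact: sdiff_differentiable (grad_rho_sdiff oOm gC3 i O).
Qed.

Lemma entry_le_norm (m n : nat) (A : 'M[R]_(m, n)) i j : `|A i j| <= `|A|.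
Proof.
rewrite [leRHS]/Num.Def.normr/= mx_normrE.
by apply: le_trans; last exact: (le_bigmax _ _ (i, j)).
Qed.

Lemma quad_near_scalar (H : 'M[R]_2) (a e : R) (x y : E) :
  `|H - a%:M| <= e -> dot x x = 1 -> dot y y = 1 ->
  `|dot (H *m x) y - a * dot x y| <= 4 * e.
Proof.
move=> He x1 y1; set D := H - a%:M.
have -> : dot (H *m x) y - a * dot x y =
  (D 0 0 * (x 0 0 * y 0 0) + D 0 1 * (x 1 0 * y 0 0)) +
  (D 1 0 * (x 0 0 * y 1 0) + D 1 1 * (x 1 0 * y 1 0)).
  by rewrite /dot !mxE !sum_ord2 /= !mulr1n !mulr0n; ring.
have B i j i' j' : `|D i j * (x i' 0 * y j' 0)| <= e.
  have h1 : `|D i j| <= e := le_trans (entry_le_norm D i j) He.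
  have h2 : `|x i' 0 * y j' 0| <= 1.
    by rewrite normrM -[1]mulr1; apply: ler_pM => //; exact: unit_coord.
  by rewrite normrM -[e]mulr1; exact: ler_pM.
have := ler_normD (D 0 0 * (x 0 0 * y 0 0) + D 0 1 * (x 1 0 * y 0 0))
  (D 1 0 * (x 0 0 * y 1 0) + D 1 1 * (x 1 0 * y 1 0)).
have := ler_normD (D 0 0 * (x 0 0 * y 0 0)) (D 0 1 * (x 1 0 * y 0 0)).
have := ler_normD (D 1 0 * (x 0 0 * y 1 0)) (D 1 1 * (x 1 0 * y 1 0)).
have := B 0 0 0 0; have := B 0 1 1 0; have := B 1 0 0 1; have := B 1 1 1 1.
lra.
Qed.

Let dot_tn t : dot (tg t) (nrm t) = 0.
Proof. by rewrite /dot !rot90E; ring. Qed.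
Let dot_nt t : dot (nrm t) (tg t) = 0.
Proof. by rewrite /dot !rot90E; ring. Qed.
Let unit_n t : dot (nrm t) (nrm t) = 1 := frame_unit F t.
Let unit_t t : dot (tg t) (tg t) = 1 := unit_tg F t.

Definition dsN t s := - dot (hess rho (X t s) *m nrm t) (nrm t).
Definition dsT t s := - dot (hess rho (X t s) *m nrm t) (tg t).
Definition dtN t s :=
  (1 - s * k t) * dot (hess rho (X t s) *m tg t) (nrm t) + k t * rhoT t s.
Definition dtT t s :=
  (1 - s * k t) * dot (hess rho (X t s) *m tg t) (tg t) - k t * rhoN t s.

Lemma tube_derivatives t (s : R) : Om (X t s) ->
  [/\ is_derive s 1 (fun s => rhoN t s) (dsN t s),
      is_derive s 1 (fun s => rhoT t s) (dsT t s),
      is_derive s 1 (fun s => rho (X t s)) (- rhoN t s) &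
   [/\ is_derive t 1 (fun t => rhoN t s) (dtN t s),
      is_derive t 1 (fun t => rhoT t s) (dtT t s) &
      is_derive t 1 (fun t => rho (X t s)) ((1 - s * k t) * rhoT t s)]].
Proof.
move=> O; have dr := sdiff_differentiable (rhofun_sdiff oOm gC3 O).
have ds := is_derive_tube_s t s; have dt := is_derive_tube_t t s.
have mulN (H : 'M[R]_2) x y : dot (H *m - x) y = - dot (H *m x) y.
  by rewrite mulmxN /dot !mxE; ring.
have mulZ (H : 'M[R]_2) (a : R) x y : dot (H *m (a *: x)) y = a * dot (H *m x) y.
  by rewrite -scalemxAr /dot !mxE; ring.
have dotZ (a : R) x y : dot x (a *: y) = a * dot x y by rewrite /dot !mxE; ring.
have dotN (x y : E) : dot x (- y) = - dot x y by rewrite /dot !mxE; ring.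
have dot0 (x : E) : dot x 0 = 0 by rewrite /dot !mxE; ring.
split.
- rewrite /dsN -mulN -[dot (_ *m _) _]addr0 -(dot0 (grad rho (X t s))).
  exact: (@is_derive_dot_grad_rho (fun s => X t s) (fun=> nrm t) s _ _ O ds (is_derive_cst (nrm t) s 1)).
- rewrite /dsT -mulN -[dot (_ *m _) _]addr0 -(dot0 (grad rho (X t s))).
  exact: (@is_derive_dot_grad_rho (fun s => X t s) (fun=> tg t) s _ _ O ds (is_derive_cst (tg t) s 1)).
- rewrite /rhoN -dotN.
  exact: (@is_derive_grad R rho (fun s => X t s) s _ dr ds).
split.
- rewrite /dtN -mulZ /rhoT -dotZ.
  exact: (@is_derive_dot_grad_rho (fun t => X t s) nrm t _ _ O dt (frame_dnrm F t)).
- rewrite /dtT -mulZ /rhoN -(mulNr (k t) (dot _ _)) -dotZ.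
  exact: (@is_derive_dot_grad_rho (fun t => X t s) (fun t => tg t) t _ _ O dt (is_derive_tg F t)).
- rewrite /rhoT -dotZ.
  exact: (@is_derive_grad R rho (fun t => X t s) t _ dr dt).
Qed.

Lemma rho_boundary_limits (e : R) : 0 < e -> exists2 d : R, 0 < d &
  forall t s, 0 < s < d ->
  [/\ Om (X t s), `|rho (X t s)| <= e, `|rhoN t s + 2| <= e & `|rhoT t s| <= e] /\
  [/\ `|dsN t s - 2 * k t| <= e, `|dsT t s| <= e, `|dtN t s| <= e & `|dtT t s| <= e].
Proof.
move=> e0; have [dk [Km Km0 [Dk cdk kM dkM]]] := curvature_bounds F.
have kc : continuous k by move=> t; exact: is_derive_continuous (Dk t).
have nc : continuous nrm by move=> t; exact: is_derive_continuous (frame_dnrm F t).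
pose m := 16 + 16 * Km; have m0 : 0 < m by rewrite /m; lra.
pose e1 := e / m; have e10 : 0 < e1 by rewrite divr_gt0.
have [s1 s10 Hin] := tube_inside F.
have [d1 d10 H1] := @tube_uniform_limit R^o rho (fun=> 0)
  (fun t => let: And3 h _ _ := rho_lim t in h) (fun t => cvg_cst _) (fun=> erefl) _ e10.
have [||d2 d20 H2] := @tube_uniform_limit E (grad rho) (fun t => - (2 *: nrm t))
  (fun t => let: And3 _ h _ := rho_lim t in h) _ _ _ e10.
- move=> t; apply: cvgN; apply: (continuousZ (s := fun=> 2)); first exact: cvg_cst.
  exact: nc.
- by move=> t; rewrite (frame_nrmL F).
have [||d3 d30 H3] := @tube_uniform_limit 'M[R]_2 (hess rho) (fun t => (- (2 * k t))%:M)
  (fun t => let: And3 _ _ h := rho_lim t in h) _ _ _ e10.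
- have -> : (fun t => (- (2 * k t))%:M : 'M[R]_2) = (fun t => (- (2 * k t)) *: (1%:M : 'M[R]_2)).
    by apply/funext => t; rewrite scalemx1.
  move=> t; apply: (continuousZ (s := fun t => - (2 * k t)) (f := fun=> 1%:M)); last exact: cvg_cst.
  by apply: cvgN; apply: cvgM; [exact: cvg_cst|exact: kc].
- by move=> t; rewrite (frame_kL F).
pose d := Num.min (Num.min s1 (Num.min d1 d2)) (Num.min d3 (Num.min (1 / (Km * Km + Km + 1)) (e1 / (Km * Km + Km + 1)))).
have KK : 0 < Km * Km + Km + 1 by rewrite !addr_gt0// mulr_gt0.
exists d; first by rewrite !lt_min s10 d10 d20 d30 !divr_gt0.
move=> t s /andP[s0]; rewrite !lt_min => /andP[/andP[a1 /andP[a2 a3]] /andP[a4 /andP[a6 a5]]].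
have O : Om (X t s) by apply: Hin; rewrite s0.
have h1 : `|rho (X t s)| <= e1 by have := H1 t s; rewrite s0 a2 subr0; apply.
have h2 : `|grad rho (X t s) - - (2 *: nrm t)| <= e1 by apply: H2; rewrite s0.
have h3 : `|hess rho (X t s) - (- (2 * k t))%:M| <= e1 by apply: H3; rewrite s0.
have e1e : 16 * e1 + 16 * (Km * e1) = e by rewrite /e1 /m; field; rewrite gt_eqF.
have Ke1 : 0 <= Km * e1 by rewrite mulr_ge0// ltW.
have kb := kM t.
have sK : s * (Km * Km + Km + 1) <= e1 by rewrite -ler_pdivlMr// ltW.
have sK1 : s * (Km * Km + Km + 1) <= 1 by rewrite -ler_pdivlMr// ltW.
have KK0 : 0 <= s * (Km * Km) by rewrite !mulr_ge0// ltW.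
have kk : `|k t| * `|k t| <= Km * Km by apply: ler_pM.
have skk : `|s * k t| * (2 * `|k t|) <= 2 * e1.
  rewrite normrM (gtr0_norm s0) -mulrA [`|k t| * _]mulrCA.
  have : s * (`|k t| * `|k t|) <= s * (Km * Km) by rewrite ler_pM2l.
  have : 0 <= s * Km by rewrite mulr_ge0// ltW.
  lra.
have vdot (v n : E) : dot n n = 1 -> `|v| <= e1 -> `|dot v n| <= 2 * e1.
  move=> n1 ve; apply: le_trans (dot_le _ _) _; rewrite (enorm_unit n1) mulr1.
  by apply: le_trans (enorm_le_norm _) _; rewrite ler_pM2l.
have N : `|rhoN t s + 2| <= 2 * e1.
  have := vdot _ _ (unit_n t) h2.
  suff -> : dot (grad rho (X t s) - - (2 *: nrm t)) (nrm t) = rhoN t s + 2 by [].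
  have -> : dot (grad rho (X t s) - - (2 *: nrm t)) (nrm t) =
    rhoN t s + 2 * dot (nrm t) (nrm t) by rewrite /rhoN; move: (grad rho _) => v; rewrite /dot !mxE; ring.
  by rewrite unit_n mulr1.
have T : `|rhoT t s| <= 2 * e1.
  have := vdot _ _ (unit_t t) h2; suff -> : rhoT t s = dot (grad rho (X t s) - - (2 *: nrm t)) (tg t) by [].
  by rewrite /rhoT; move: (grad rho _) => v; rewrite /dot !mxE /=; ring.
have q1 := quad_near_scalar h3 (unit_n t) (unit_n t).
have q2 := quad_near_scalar h3 (unit_n t) (unit_t t).
have q3 := quad_near_scalar h3 (unit_t t) (unit_n t).
have q4 := quad_near_scalar h3 (unit_t t) (unit_t t).
rewrite unit_n in q1; rewrite dot_nt in q2; rewrite dot_tn in q3; rewrite unit_t in q4.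
have sk1 : `|1 - s * k t| <= 2.
  have : `|s * k t| <= s * Km by rewrite normrM (gtr0_norm s0) ler_pM2l.
  have := ler_normB 1 (s * k t); rewrite normr1; lra.
have prod2 (x : R) : `|x| <= 4 * e1 -> `|(1 - s * k t) * x| <= 8 * e1.
  move=> hx; rewrite normrM (_ : 8 * e1 = 2 * (4 * e1)); last by ring.
  exact: ler_pM.
have kT (x : R) : `|x| <= 2 * e1 -> `|k t * x| <= 2 * (Km * e1).
  by move=> hx; rewrite normrM mulrCA; exact: ler_pM.
clear H1 H2 H3 Hin kM dkM Dk kc cdk nc vdot.
split; split=> //.
- by apply: le_trans h1 _; lra.
- by apply: le_trans N _; lra.
- by apply: le_trans T _; lra.
- have -> : dsN t s - 2 * k t = - (dot (hess rho (X t s) *m nrm t) (nrm t) - - (2 * k t) * 1).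
    by rewrite /dsN; ring.
  by rewrite normrN; apply: le_trans q1 _; lra.
- have -> : dsT t s = - (dot (hess rho (X t s) *m nrm t) (tg t) - - (2 * k t) * 0).
    by rewrite /dsT; ring.
  by rewrite normrN; apply: le_trans q2 _; lra.
- have -> : dtN t s = (1 - s * k t) * (dot (hess rho (X t s) *m tg t) (nrm t) - - (2 * k t) * 0)
    + k t * rhoT t s by rewrite /dtN; ring.
  apply: le_trans (ler_normD _ _) _; have := prod2 _ q3; have := kT _ T; lra.
- have -> : dtT t s = (1 - s * k t) * (dot (hess rho (X t s) *m tg t) (tg t) - - (2 * k t) * 1)
    - k t * (rhoN t s + 2) + s * k t * (2 * k t) by rewrite /dtT; ring.
  have := prod2 _ q4; have := kT _ N; move: skk.
  rewrite -[X in X * `|k t|](@ger0_norm _ 2)// -[`|2| * `|k t|]normrM -normrM.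
  move=> b1 b2 b3; apply: le_trans (ler_normD _ _) _.
  have b4 := ler_normB ((1 - s * k t) * (dot (hess rho (X t s) *m tg t) (tg t) - - (2 * k t) * 1)) (k t * (rhoN t s + 2)).
  lra.
Qed.

Lemma rho_expansions (e : R) : 0 < e -> exists2 d : R, 0 < d & forall t s, 0 < s < d ->
  [/\ `|rhoN t s + 2 - 2 * k t * s| <= e * s, `|rhoT t s| <= e * s &
      `|rho (X t s) - 2 * s + k t * s ^+ 2| <= e * s ^+ 2].
Proof.
move=> e0; have [dk [Km Km0 [_ _ kM _]]] := curvature_bounds F.
have [d d0 Hd] := rho_boundary_limits e0; exists d => // t s /andP[s0 sd].
have dom x : 0 < x <= s -> 0 < x < d by move=> /andP[-> xs]; exact: le_lt_trans sd.
have dlin (c x : R) : is_derive x 1 (fun s => c * s) c.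
  by rewrite -[X in is_derive _ _ _ X]mulr1; exact: (@is_deriveZ _ _ _ id c x 1 1).
have small (e' : R) : 0 < e' -> exists2 d', 0 < d' & forall x, 0 < x < d' ->
   [/\ `|rho (X t x)| <= e' / 2, `|rhoN t x + 2| <= e' / 2, `|rhoT t x| <= e' / 2,
       `|2 * k t * x| <= e' / 2 & `|2 * x| <= e' / 2].
  move=> e'0; have e2 : 0 < e' / 2 by rewrite divr_gt0.
  have [d1 d10 H1] := rho_boundary_limits e2.
  exists (Num.min d1 (e' / 2 / (2 * Km + 2))).
    by rewrite lt_min d10 divr_gt0// addr_gt0// mulr_gt0.
  move=> x /andP[x0]; rewrite lt_min => /andP[x1 x2].
  have [[_ a1 a2 a3] _] := H1 t x (introT andP (conj x0 x1)).
  have Kx : 0 <= Km * x by rewrite mulr_ge0// ltW.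
  have xK : x * (2 * Km + 2) <= e' / 2.
    by rewrite -ler_pdivlMr ?addr_gt0 ?mulr_gt0// ltW.
  have kx : `|k t| * x <= Km * x by rewrite ler_pM2r.
  split=> //; rewrite !normrM (gtr0_norm x0) (@ger0_norm _ 2)//; last by lra.
  by rewrite -mulrA; lra.
have RN x : 0 < x <= s -> `|rhoN t x + 2 - 2 * k t * x| <= e * x.
  move=> /andP[x0 xs].
  apply: (@mvt_right R (fun y => rhoN t y + 2 - 2 * k t * y) (fun y => dsN t y + 0 - 2 * k t)) => //.
  - exact: ltW.
  - move=> y /andP[y0 yx]; have [[inO _ _ _] _] := Hd t y (dom y (introT andP (conj y0 (le_trans yx xs)))).
    have [D1 _ _ _] := tube_derivatives inO.
    by apply: is_deriveB; apply: is_deriveD; exact: is_derive_cst.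
  - move=> y /andP[y0 yx]; have [_ [h _ _ _]] := Hd t y (dom y (introT andP (conj y0 (le_trans yx xs)))).
    by rewrite addr0.
  - move=> e' /small [d' d'0 H']; exists d' => // y /H' [_ a2 _ a4 _].
    by apply: le_trans (ler_normB _ _) _; lra.
split.
- by apply: RN; rewrite s0 lexx.
- apply: (@mvt_right R (rhoT t) (dsT t)) => //.
  - exact: ltW.
  - move=> y ys; have [[inO _ _ _] _] := Hd t y (dom y ys).
    by have [_ D2 _ _] := tube_derivatives inO.
  - by move=> y ys; have [_ [_ h _ _]] := Hd t y (dom y ys).
  - move=> e' e'0; have [d' d'0 H'] := small e' e'0; exists d' => // y /H' [_ _ a3 _ _].
    by apply: le_trans a3 _; lra.
- rewrite (_ : e * s ^+ 2 = e * s * s); last by ring.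
  rewrite expr2.
  apply: (@mvt_right R (fun y => rho (X t y) - 2 * y + k t * (y * y))
     (fun y => - rhoN t y - 2 + k t * (y * 1 + 1 * y))) => //.
  - by rewrite mulr_ge0// ltW.
  - move=> y ys; have [[inO _ _ _] _] := Hd t y (dom y ys).
    have [_ _ D3 _] := tube_derivatives inO.
    have idd : is_derive y 1 (fun x : R => x) (1 : R) by exact: is_derive_id.
    have q : is_derive y 1 (fun y => k t * (y * y)) (k t * (y * 1 + 1 * y)).
      by have M2 := is_deriveM1 idd idd; exact: is_deriveZ.
    exact: (is_deriveD (is_deriveB D3 (dlin 2 y)) q).
  - move=> y /andP[y0 ys].
    have -> : - rhoN t y - 2 + k t * (y * 1 + 1 * y) = - (rhoN t y + 2 - 2 * k t * y) by ring.
    rewrite normrN; apply: le_trans (RN y _) _; first by rewrite y0.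
    by rewrite ler_pM2l.
  - move=> e' e'0; have e4 : 0 < e' / 2 by rewrite divr_gt0.
    have [d' d'0 H'] := small _ e4; exists (Num.min d' 1); first by rewrite lt_min d'0 ltr01.
    move=> y /andP[y0]; rewrite lt_min => /andP[yd y1].
    have [a1 _ _ a4 a5] := H' y (introT andP (conj y0 yd)).
    have a6 : `|k t * (y * y)| <= `|2 * k t * y|.
      rewrite !normrM (gtr0_norm y0) (@ger0_norm _ 2)//.
      have kk : 0 <= `|k t| * y by rewrite mulr_ge0// ltW.
      have : `|k t| * y * y <= `|k t| * y * 1 by rewrite ler_wpM2l// ltW.
      lra.
    apply: le_trans (ler_normD _ _) _; have := ler_normB (rho (X t y)) (2 * y); lra.
Qed.

Lemma lipschitz_two (f ft fs : R -> R -> R) (A B t1 t2 s1 s2 : R) :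
  (forall t : R, Num.min t2 t1 <= t <= Num.max t2 t1 ->
     is_derive t 1 (fun t => f t s1) (ft t s1) /\ `|ft t s1| <= A) ->
  (forall s : R, Num.min s2 s1 <= s <= Num.max s2 s1 ->
     is_derive s 1 (fun s => f t2 s) (fs t2 s) /\ `|fs t2 s| <= B) ->
  `|f t1 s1 - f t2 s2| <= A * `|t1 - t2| + B * `|s1 - s2|.
Proof.
move=> Ht Hs; rewrite -(subrK (f t2 s1) (f t1 s1)) -addrA.
apply: le_trans (ler_normD _ _) _; apply: lerD.
  apply: (@mvt_le_sym R (fun t => f t s1) (fun t => ft t s1)) => t ht;
  by have [] := Ht t ht.
apply: (@mvt_le_sym R (fun s => f t2 s) (fun s => fs t2 s)) => s hs;
by have [] := Hs s hs.
Qed.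

Lemma between_in (a b x l u : R) : l < a < u -> l < b < u ->
  Num.min a b <= x <= Num.max a b -> l < x < u.
Proof.
move=> /andP[la au] /andP[lb bu] /andP[]; rewrite ge_min le_max => h1 h2.
by apply/andP; split; [case/orP: h1 => h|case/orP: h2 => h]; lra.
Qed.

Lemma rho_lipschitz : exists2 C : R, 0 < C & forall e : R, 0 < e ->
  exists2 d : R, 0 < d & forall t1 t2 s1 s2, 0 < s1 < d -> 0 < s2 < d ->
  [/\ `|rhoN t1 s1 - rhoN t2 s2| <= e * `|t1 - t2| + C * `|s1 - s2|,
      `|rhoT t1 s1 - rhoT t2 s2| <= e * (`|t1 - t2| + `|s1 - s2|) &
      `|(rho (X t1 s1) - 2 * s1) - (rho (X t2 s2) - 2 * s2)| <=
         e * s1 * `|t1 - t2| + e * `|s1 - s2|].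
Proof.
have [dk [Km Km0 [_ _ kM _]]] := curvature_bounds F.
exists (2 * Km + 1); first by rewrite addr_gt0// mulr_gt0.
move=> e e0; pose e1 := Num.min (e / 2) 1.
have e10 : 0 < e1 by rewrite lt_min divr_gt0//=.
have [e1e e11] : e1 <= e / 2 /\ e1 <= 1 by rewrite /e1 !ge_min !lexx orbT.
have [d1 d10 H1] := rho_boundary_limits e10; have [d2 d20 H2] := rho_expansions e10.
exists (Num.min (Num.min d1 d2) (1 / Km)); first by rewrite !lt_min d10 d20 divr_gt0.
move=> t1 t2 s1 s2 hs1 hs2.
have lt1 s : 0 < s < Num.min (Num.min d1 d2) (1 / Km) -> [/\ 0 < s, 0 < s < d1, 0 < s < d2 & s * Km <= 1].
  move=> /andP[s0]; rewrite !lt_min => /andP[/andP[-> ->] h]; rewrite s0; split=> //.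
  by move: h; rewrite ltr_pdivlMr// => /ltW.
have btw s : Num.min s2 s1 <= s <= Num.max s2 s1 -> 0 < s < d1.
  by move=> /(between_in hs2 hs1) /lt1 [].
have [s10 s1d1 s1d2 s1K] := lt1 _ hs1.
have e12 : e1 <= e by lra.
have sk t : `|1 - s1 * k t| <= 2.
  have : `|s1 * k t| <= s1 * Km by rewrite normrM (gtr0_norm s10) ler_pM2l.
  have := ler_normB 1 (s1 * k t); rewrite normr1; lra.
split.
- apply: (@lipschitz_two rhoN dtN dsN) => [t _|s /btw sd].
    have [[inO _ _ _] [_ _ h _]] := H1 t s1 s1d1; have [_ _ _ [D _ _]] := tube_derivatives inO.
    by split=> //; exact: le_trans e12.
  have [[inO _ _ _] [h _ _ _]] := H1 t2 s sd; have [D _ _ _] := tube_derivatives inO.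
  split=> //; rewrite -(subrK (2 * k t2) (dsN t2 s)).
  apply: le_trans (ler_normD _ _) _; have := kM t2.
  rewrite (normrM 2) (@ger0_norm _ 2)//; lra.
- rewrite mulrDr; apply: (@lipschitz_two rhoT dtT dsT) => [t _|s /btw sd].
    have [[inO _ _ _] [_ _ _ h]] := H1 t s1 s1d1; have [_ _ _ [_ D _]] := tube_derivatives inO.
    by split=> //; exact: le_trans e12.
  have [[inO _ _ _] [_ h _ _]] := H1 t2 s sd; have [_ D _ _] := tube_derivatives inO.
  by split=> //; exact: le_trans e12.
- apply: (@lipschitz_two (fun t s => rho (X t s) - 2 * s)
     (fun t s => (1 - s * k t) * rhoT t s - 0) (fun t s => - rhoN t s - 2 * 1)) => [t _|s /btw sd].
    have [[inO _ _ _] _] := H1 t s1 s1d1; have [_ _ _ [_ _ D]] := tube_derivatives inO.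
    split; first by apply: is_deriveB; exact: is_derive_cst.
    rewrite subr0 normrM; have [_ h _] := H2 t s1 s1d2.
    apply: (@le_trans _ _ (2 * (e1 * s1))); first exact: ler_pM.
    by rewrite mulrA ler_pM2r//; lra.
  have [[inO _ h _] _] := H1 t2 s sd; have [_ _ D _] := tube_derivatives inO.
  split.
    apply: is_deriveB; apply: (@is_deriveZ _ _ _ id 2 s 1 1); exact: is_derive_id.
  have -> : - rhoN t2 s - 2 * 1 = - (rhoN t2 s + 2) by ring.
  by rewrite normrN; exact: le_trans e12.
Qed.

End BoundaryLimits.

(*PART 13*)
Section GreenRegularity.
Context {R : realType}.
Local Notation E := ('cV[R]_2).
Variables (Om : set E) (g : E -> E -> R).
Hypothesis oOm : open Om.
Hypothesis gC3 : Ck 3 (Om `*` Om) (fun wz : E * E => g wz.1 wz.2).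
Hypothesis gsym : forall w z, Om w -> Om z -> g w z = g z w.
Let g2 := fun wz : E * E => g wz.1 wz.2.

Definition offdiag : set (E * E) := [set p | [/\ Om p.1, Om p.2 & p.1 != p.2]].

Definition G2 (p : E * E) : R := Gfun g p.1 p.2.

Lemma sdiff_ln (x : R) : 0 < x -> sdiff (@ln R : R^o -> R^o) x.
Proof.
move=> x0; apply: (@sdiff_C1 R (@ln R) (fun y => y^-1) x x x0).
  move=> y; rewrite ltr_norml => /andP[h _]; apply: is_derive1_ln; lra.
apply: (@continuousV _ _ id); last exact: cvg_id.
by rewrite gt_eqF.
Qed.

Lemma sdiff_dot (V : normedModType R) (x y : V -> E) (p : V) : sdiff x p -> sdiff y p ->
  sdiff (fun q => dot (x q) (y q) : R^o) p.
Proof.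
by move=> sx sy; apply: (@sdiffD R V R^o); apply: sdiffM; exact: sdiff_coord.
Qed.

Let delta_sdiff (p : E * E) : sdiff (fun q : E * E => q.1 - q.2) p.
Proof. by apply: sdiffB; [exact: sdiff_fst|exact: sdiff_snd]. Qed.

Let delta_neq0 p : offdiag p -> 0 < dot (p.1 - p.2) (p.1 - p.2).
Proof. by move=> [_ _ h]; apply: dot_gt0; rewrite subr_eq0. Qed.

Lemma ln_enorm (x : E) : 0 < dot x x -> ln (enorm x) = 2^-1 * ln (dot x x).
Proof.
move=> x0; have e0 : 0 < enorm x by rewrite enormE sqrtr_gt0.
by rewrite -enorm_sq lnXn// -[_ *+ 2]mulr_natr; field.
Qed.

Lemma offdiag_near p : offdiag p -> \forall q \near p, offdiag q.
Proof.
move=> op; have d0 := delta_neq0 op.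
have n1 : \forall q \near p, Om q.1 /\ Om q.2.
  have := open_UU oOm; rewrite openE => H.
  have : nbhs p (Om `*` Om) by apply: H; case: op.
  by apply: filterS => -[a b] [].
have n2 : \forall q \near p, 0 < dot (q.1 - q.2) (q.1 - q.2).
  have c := sdiff_continuous (sdiff_dot (delta_sdiff p) (delta_sdiff p)).
  exact: (@cvgr_gt R _ (nbhs p) _ (fun q : E * E => dot (q.1 - q.2) (q.1 - q.2)) _ c 0 d0).
apply: filterS2 n1 n2 => q [h1 h2] h3; split=> //.
apply: contraTneq h3 => ->; rewrite subrr /dot !mxE mulr0 addr0 ltxx//.
Qed.

Let lnd (q : E * E) : R := - (4 * pi)^-1 * ln (dot (q.1 - q.2) (q.1 - q.2)).

Let G2_near p : offdiag p -> \forall q \near p, lnd q - g2 q = G2 q.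
Proof.
move=> /offdiag_near; apply: filterS => q oq.
rewrite /G2 /Gfun ln_enorm; last exact: delta_neq0.
congr (_ - _); rewrite /lnd mulrA; congr (_ * _).
rewrite mulNr -invfM; congr (- _^-1); ring.
Qed.

Let lnd_sdiff p : offdiag p -> sdiff (lnd : E * E -> R^o) p.
Proof.
move=> op; apply: sdiffM; first exact: (@sdiff_cst R _ R^o).
apply: (@sdiff_comp R _ R^o R^o (@ln R) (fun q : E * E => dot (q.1 - q.2) (q.1 - q.2))).
  by apply: sdiff_ln; exact: delta_neq0.
exact: sdiff_dot.
Qed.

Lemma G2_sdiff p : offdiag p -> sdiff (G2 : E * E -> R^o) p.
Proof.
move=> op; apply: sdiff_near (G2_near op) _.
apply: (@sdiffB R _ R^o); first exact: lnd_sdiff.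
by apply: (g_sdiff oOm gC3); case: op.
Qed.

Let dlnd (v q : E * E) : R :=
  - (2 * pi)^-1 * (dot (q.1 - q.2) (v.1 - v.2) * (dot (q.1 - q.2) (q.1 - q.2))^-1).

Let lnd_derive p v : offdiag p -> 'D_v lnd p = dlnd v p.
Proof.
move=> op; have d0 := delta_neq0 op.
have dl := sdiff_differentiable (lnd_sdiff op).
have l1 : is_derive (0 : R) 1 (fun s : R => lnd (p + s *: v)) ('d lnd p v).
  have := @is_derive_comp R _ _ lnd (fun s => p + s *: v) 0 v.
  by rewrite scale0r addr0; apply=> //; exact: is_derive_line.
pose x (s : R) : E := (p.1 - p.2) + s *: (v.1 - v.2).
have dx : is_derive (0 : R) 1 x (v.1 - v.2) by exact: is_derive_line.
have x0 : x 0 = p.1 - p.2 by rewrite /x scale0r addr0.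
have l2 := is_derive_dot dx dx.
have lnd' : is_derive (dot (x 0) (x 0)) 1 (@ln R) ((dot (x 0) (x 0))^-1).
  by apply: is_derive1_ln; rewrite x0.
have l3 := @is_derive1_comp R (@ln R) (fun s => dot (x s) (x s)) 0 _ _ lnd' l2.
have l4 := is_deriveZ (- (4 * pi)^-1) l3.
rewrite deriveE// -(@derive_val _ _ _ _ _ _ _ l1).
have -> : (fun s => lnd (p + s *: v)) = (fun s => (- (4 * pi)^-1) *: (@ln R \o (fun s => dot (x s) (x s))) s).
  apply/funext => s; rewrite /lnd /=; congr (_ * ln (dot _ _));
  by rewrite /x scalerBr addrACA opprD.
rewrite (@derive_val _ _ _ _ _ _ _ l4) x0 /dlnd.
have scaleE (a b : R) : a *: b = a * b by [].
rewrite scaleE.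
have -> : dot (v.1 - v.2) (p.1 - p.2) = dot (p.1 - p.2) (v.1 - v.2).
  by rewrite /dot; ring.
move: d0; set D := dot (p.1 - p.2) (p.1 - p.2) => d0.
have pi0 : (pi : R) != 0 by rewrite gt_eqF// pi_gt0.
have D0 : D != 0 by rewrite gt_eqF.
move: (pi : R) pi0 => c c0.
by field; rewrite D0 c0.
Qed.

Lemma G2_derive_near v p : offdiag p ->
  \forall q \near p, dlnd v q - 'D_v g2 q = 'D_v G2 q.
Proof.
move=> /offdiag_near; apply: filterS => q oq.
have dl := sdiff_differentiable (lnd_sdiff oq).
have dg : differentiable g2 q by apply: gC3.1; case: oq.
have <- : 'D_v (lnd - g2) q = 'D_v G2 q.
  by apply: near_eq_derive; exact: G2_near.
by rewrite deriveB ?lnd_derive//; exact: diff_derivable.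
Qed.

Lemma DG2_sdiff v p : offdiag p -> sdiff ('D_v G2 : E * E -> R^o) p.
Proof.
move=> op; apply: sdiff_near (G2_derive_near v op) _.
apply: (@sdiffB R _ R^o); last by apply: (Dg_sdiff oOm gC3); case: op.
apply: sdiffM; first exact: (@sdiff_cst R _ R^o).
apply: sdiffM; first by apply: sdiff_dot => //; exact: sdiff_cst.
by apply: sdiffV; [rewrite gt_eqF// delta_neq0|exact: sdiff_dot].
Qed.

Lemma partial1 (f : E * E -> R) v w z :
  'D_v (fun y => f (y, z)) w = 'D_((v, 0)) f (w, z).
Proof.
rewrite /derive.
suff -> : (fun h : R => h^-1 *: (((fun y => f (y, z)) \o shift w) (h *: v) - f (w, z))) =
  (fun h : R => h^-1 *: ((f \o shift (w, z)) (h *: ((v, 0) : E * E)) - f (w, z))) by [].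
apply/funext => s; rewrite /shift /=; congr (_ *: (f _ - _)).
by congr (_, _); rewrite /= scaler0 add0r.
Qed.

Lemma partial2 (f : E * E -> R) v w z :
  'D_v (fun y => f (w, y)) z = 'D_((0, v)) f (w, z).
Proof.
rewrite /derive.
suff -> : (fun h : R => h^-1 *: (((fun y => f (w, y)) \o shift z) (h *: v) - f (w, z))) =
  (fun h : R => h^-1 *: ((f \o shift (w, z)) (h *: ((0, v) : E * E)) - f (w, z))) by [].
apply/funext => s; rewrite /shift /=; congr (_ *: (f _ - _)).
by congr (_, _); rewrite /= scaler0 add0r.
Qed.

Lemma grad1E w z i : grad1 g w z i 0 = 'D_((delta_mx i 0, 0)) G2 (w, z).
Proof. by rewrite /grad1 mxE -partial1. Qed.

Lemma grad1_sdiff p i : offdiag p -> sdiff (fun q => grad1 g q.1 q.2 i 0 : R^o) p.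
Proof.
move=> op; apply: sdiff_near (DG2_sdiff (delta_mx i 0, 0) op).
by apply/near_ballP; exists 1 => // -[w z] _ /=; rewrite grad1E.
Qed.

Let diff_slice1 (f : E * E -> R) w z : sdiff (f : _ -> R^o) (w, z) ->
  differentiable (fun y => f (y, z)) w.
Proof.
move=> sf; apply: (@sdiff_differentiable R E R^o).
apply: (@sdiff_comp R E _ R^o f (fun y => (y, z))) => //.
by apply: sdiff_pair; [exact: sdiff_id|exact: sdiff_cst].
Qed.

Let diff_slice2 (f : E * E -> R) w z : sdiff (f : _ -> R^o) (w, z) ->
  differentiable (fun y => f (w, y)) z.
Proof.
move=> sf; apply: (@sdiff_differentiable R E R^o).
apply: (@sdiff_comp R E _ R^o f (fun y => (w, y))) => //.
by apply: sdiff_pair; [exact: sdiff_cst|exact: sdiff_id].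
Qed.

Lemma is_derive_dot_grad1_l (x y : R -> E) (u : R) (x' y' z : E) :
  offdiag (x u, z) -> is_derive u 1 x x' -> is_derive u 1 y y' ->
  is_derive u 1 (fun s => dot (grad1 g (x s) z) (y s))
    (dot (hess1 g (x u) z *m x') (y u) + dot (grad1 g (x u) z) y').
Proof.
move=> O dx dy; apply: is_derive_dot => //; apply/is_derive_col => i.
have -> : (hess1 g (x u) z *m x') i 0 = dot (grad (fun y => grad1 g y z i 0) (x u)) x'.
  by rewrite mxE sum_ord2 /dot !mxE.
apply: is_derive_grad => //.
exact: (diff_slice1 (f := fun q => grad1 g q.1 q.2 i 0) (grad1_sdiff i O)).
Qed.

Lemma is_derive_dot_grad1_r (x : R -> E) (u : R) (x' y w : E) :
  offdiag (w, x u) -> is_derive u 1 x x' ->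
  is_derive u 1 (fun s => dot (grad1 g w (x s)) y) (dot (grad2grad1 g w (x u) *m x') y).
Proof.
move=> O dx.
have -> : dot (grad2grad1 g w (x u) *m x') y =
  dot (grad2grad1 g w (x u) *m x') y + dot (grad1 g w (x u)) 0.
  by move: (grad1 g _ _) (_ *m _) => a b; rewrite /dot !mxE; ring.
apply: is_derive_dot.
apply/is_derive_col => i.
have -> : (grad2grad1 g w (x u) *m x') i 0 = dot (grad (fun y => grad1 g w y i 0) (x u)) x'.
  by rewrite mxE sum_ord2 /dot !mxE.
apply: is_derive_grad => //.
exact: (diff_slice2 (f := fun q => grad1 g q.1 q.2 i 0) (grad1_sdiff i O)).
Qed.

Lemma Gfun_sym w z : Om w -> Om z -> Gfun g w z = Gfun g z w.
Proof.
by move=> Ow Oz; rewrite /Gfun gsym// -enormN opprB.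
Qed.

Lemma is_derive_G_l (x : R -> E) (u : R) (x' z : E) : offdiag (x u, z) ->
  is_derive u 1 x x' ->
  is_derive u 1 (fun s => Gfun g (x s) z) (dot (grad1 g (x u) z) x').
Proof.
move=> O dx; apply: (@is_derive_grad R (fun y => Gfun g y z)) => //.
exact: (diff_slice1 (f := G2) (G2_sdiff O)).
Qed.

Lemma grad_G_r w z : offdiag (w, z) -> grad (Gfun g w) z = grad1 g z w.
Proof.
move=> [/= Ow Oz _]; apply/matrixP => i j; rewrite !mxE.
apply: near_eq_derive; have : nbhs z Om by exact: open_nbhs_nbhs.
by apply: filterS => y Oy; rewrite Gfun_sym.
Qed.

Lemma is_derive_G_r (x : R -> E) (u : R) (x' w : E) : offdiag (w, x u) ->
  is_derive u 1 x x' ->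
  is_derive u 1 (fun s => Gfun g w (x s)) (dot (grad1 g (x u) w) x').
Proof.
move=> O dx; rewrite -grad_G_r//; apply: is_derive_grad => //.
exact: (diff_slice2 (f := G2) (G2_sdiff O)).
Qed.

(** Along a pair of moving points. *)
Lemma is_derive_G (x y : R -> E) (u : R) (x' y' : E) : offdiag (x u, y u) ->
  is_derive u 1 x x' -> is_derive u 1 y y' ->
  is_derive u 1 (fun s => Gfun g (x s) (y s))
    (dot (grad1 g (x u) (y u)) x' + dot (grad1 g (y u) (x u)) y').
Proof.
move=> O dx dy; have dG := sdiff_differentiable (G2_sdiff O).
have dxy : is_derive u 1 (fun s => (x s, y s)) (x', y').
  apply/is_deriveP => e e0.
  have [d1 d10 H1] := (is_deriveP _ _ _).1 dx e e0.
  have [d2 d20 H2] := (is_deriveP _ _ _).1 dy e e0.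
  exists (Num.min d1 d2); first by rewrite lt_min d10.
  move=> s; rewrite lt_min prod_normE ge_max => /andP[/H1 h1 /H2 h2].
  by apply/andP.
have := is_derive_comp dG dxy.
suff -> : 'd G2 (x u, y u) (x', y') =
  dot (grad1 g (x u) (y u)) x' + dot (grad1 g (y u) (x u)) y' by [].
have -> : (x', y') = (x', 0) + (0, y') by congr (_, _); rewrite /= ?addr0 ?add0r.
rewrite linearD -!deriveE// -partial1 -partial2 -(grad_G_r O); congr (_ + _).
  rewrite deriveE; last exact: (diff_slice1 (f := G2) (G2_sdiff O)).
  by rewrite diff_grad//; exact: (diff_slice1 (f := G2) (G2_sdiff O)).
rewrite deriveE; last exact: (diff_slice2 (f := G2) (G2_sdiff O)).
by rewrite diff_grad//; exact: (diff_slice2 (f := G2) (G2_sdiff O)).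
Qed.

End GreenRegularity.

(*PART 14*)
Section GreenBounds.
Context {R : realType}.
Local Notation E := ('cV[R]_2).
Variables (Om Gam : set E) (L : R) (gam nrm : R -> E) (k : R -> R).
Hypothesis F : frame Om Gam L gam nrm k.
Let L0 := frame_L F.
Local Notation tg t := (rot90 (nrm t)).
Local Notation X := (tube gam nrm).
Variable g : E -> E -> R.
Hypothesis oOm : open Om.
Hypothesis gC3 : Ck 3 (Om `*` Om) (fun wz : E * E => g wz.1 wz.2).
Hypothesis gsym : forall w z, Om w -> Om z -> g w z = g z w.

(** The second part of the decay assumption, read along the normals. *)
Definition green_decay : Prop := forall eps : R, 0 < eps ->
  exists C : R, exists2 eta : R, 0 < eta & 0 < C /\ forall w t s,
    Om w -> 0 < s < eta -> eps <= enorm (w - X t s) ->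
    exists a : E,
    [/\ enorm (grad1 g w (X t s)) <= C * s, enorm (hess1 g w (X t s)) <= C * s,
        enorm a <= C & enorm (grad2grad1 g w (X t s) - a *m (nrm t)^T) <= C * s].
Hypothesis Hdecay : green_decay.

Lemma green_decay_of (nu : E -> E) (delta : R) (p : E -> E) : 0 < delta ->
  nrm = nu \o gam -> orthogonal_projection (collar Om Gam delta) Gam p ->
  assumption_Aii g Om Gam nu delta p -> green_decay.
Proof.
move=> delta0 nE Hp Aii eps /Aii [C [eta [a [eta0 H]]]].
have [s0 s00 Hdist] := tube_distE F; have [s1 s10 Hin] := tube_inside F.
exists (`|C| + 1), (Num.min (Num.min eta s0) (Num.min s1 delta)).
  by rewrite !lt_min eta0 s00 s10.
have C1 : C <= `|C| + 1 by apply: le_trans (ler_norm C) _; rewrite lerDl.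
split; first by rewrite ltr_wpDl.
move=> w t s Ow /andP[spos]; rewrite !lt_min => /andP[/andP[h1 h2] /andP[h3 h4]] far.
have dE : distE Gam (X t s) = s by apply: Hdist; rewrite !ltW.
have OX : Om (X t s) by apply: Hin; rewrite spos.
have cX : collar Om Gam delta (X t s) by split=> //; rewrite dE ltW.
have [_ _ pu] := Hp _ cX.
have Gt : Gam (gam t) by apply/(Gam_gam F); exists t.
have pE : gam t = p (X t s).
  apply: pu => //; rewrite dE.
  have -> : X t s - gam t = - (s *: nrm t) by apply: col2P; rewrite !mxE; ring.
  by rewrite enormN enormZ (enorm_unit (frame_unit F t)) mulr1 gtr0_norm.
have hd : distE Gam (X t s) < eta by rewrite dE.
have [] := H w (X t s) Ow cX far hd.
rewrite dE -pE => a1 a2 a3.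
have Cs : C * s <= (`|C| + 1) * s by rewrite ler_pM2r.
exists (a w (X t s)); split.
- apply: le_trans Cs; apply: le_trans a1; by rewrite lerDl enorm_ge0.
- apply: le_trans Cs; apply: le_trans a1; by rewrite lerDr enorm_ge0.
- exact: le_trans C1.
- by have nt : nu (gam t) = nrm t by [rewrite nE]; rewrite nt in a3; exact: le_trans a3 Cs.
Qed.

Definition far (sep t t' : R) : Prop := sep <= t' - t <= L - sep.

Lemma far_sym sep t t' : far sep t t' -> far sep t' (t + L).
Proof. by rewrite /far => /andP[? ?]; apply/andP; split; lra. Qed.

Lemma far_between_l sep a b x u : far sep a x -> far sep b x ->
  Num.min a b <= u <= Num.max a b -> far sep u x.
Proof.
rewrite /far => /andP[p1 p2] /andP[p3 p4] /andP[]; rewrite ge_min le_max.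
by move=> /orP[] q1 /orP[] q2; apply/andP; split; lra.
Qed.

Lemma far_between_r sep a b x u : far sep x a -> far sep x b ->
  Num.min a b <= u <= Num.max a b -> far sep x u.
Proof.
rewrite /far => /andP[p1 p2] /andP[p3 p4] /andP[]; rewrite ge_min le_max.
by move=> /orP[] q1 /orP[] q2; apply/andP; split; lra.
Qed.

Lemma between_dist (t u v e : R) : `|u - t| <= e ->
  Num.min t u <= v <= Num.max t u -> `|v - t| <= e.
Proof.
rewrite !ler_norml => /andP[p1 p2] /andP[]; rewrite ge_min le_max.
by move=> /orP[] q1 /orP[] q2; apply/andP; split; lra.
Qed.

Lemma telescope4 (a b c d e A B C D : R) : `|a - b| <= A -> `|b - c| <= B ->
  `|c - d| <= C -> `|d - e| <= D -> `|a - e| <= A + B + C + D.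
Proof.
move=> h1 h2 h3 h4; apply: le_trans (ler_distD d _ _) (lerD _ h4).
by apply: le_trans (ler_distD c _ _) (lerD _ h3); apply: le_trans (ler_distD b _ _) (lerD h1 h2).
Qed.

Lemma tubeL t s : X (t + L) s = X t s.
Proof. by rewrite /tube (frame_gamL F) (frame_nrmL F). Qed.

Lemma dotDl (x y z : E) : dot (x + y) z = dot x z + dot y z.
Proof. by rewrite /dot !mxE; ring. Qed.

Lemma dotNl (x y : E) : dot (- x) y = - dot x y.
Proof. by rewrite /dot !mxE; ring. Qed.

Lemma dotZl (c : R) (x y : E) : dot (c *: x) y = c * dot x y.
Proof. by rewrite /dot !mxE; ring. Qed.

Lemma dotC (x y : E) : dot x y = dot y x.
Proof. by rewrite /dot mulrC [x 1 0 * _]mulrC. Qed.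

Lemma quad_le (A : 'M[R]_2) (x y : E) (M : R) : enorm A <= M ->
  enorm x <= 1 -> enorm y <= 1 -> `|dot (A *m x) y| <= 4 * M.
Proof.
move=> AM x1 y1.
have -> : dot (A *m x) y =
  (A 0 0 * (x 0 0 * y 0 0) + A 0 1 * (x 1 0 * y 0 0)) +
  (A 1 0 * (x 0 0 * y 1 0) + A 1 1 * (x 1 0 * y 1 0)).
  by rewrite /dot !mxE !sum_ord2 /=; ring.
have Aij i j : `|A i j| <= M.
  apply: le_trans AM; rewrite -sqrtr_sqr ler_sqrt; last first.
    by rewrite sumr_ge0// => i' _; rewrite sumr_ge0// => j' _; rewrite sqr_ge0.
  rewrite (bigD1 i)//= (bigD1 j)//= -addrA lerDl addr_ge0//.
    by rewrite sumr_ge0// => j' _; rewrite sqr_ge0.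
  by rewrite sumr_ge0// => i' _; rewrite sumr_ge0// => j' _; rewrite sqr_ge0.
have B i j i' j' : `|A i j * (x i' 0 * y j' 0)| <= M.
  have h2 : `|x i' 0 * y j' 0| <= 1.
    rewrite normrM -[1]mulr1; apply: ler_pM => //.
      exact: le_trans (coord_le_enorm x i') x1.
    exact: le_trans (coord_le_enorm y j') y1.
  by rewrite normrM -[M]mulr1; exact: ler_pM.
have := ler_normD (A 0 0 * (x 0 0 * y 0 0) + A 0 1 * (x 1 0 * y 0 0))
  (A 1 0 * (x 0 0 * y 1 0) + A 1 1 * (x 1 0 * y 1 0)).
have := ler_normD (A 0 0 * (x 0 0 * y 0 0)) (A 0 1 * (x 1 0 * y 0 0)).
have := ler_normD (A 1 0 * (x 0 0 * y 1 0)) (A 1 1 * (x 1 0 * y 1 0)).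
have := B 0 0 0 0; have := B 0 1 1 0; have := B 1 0 0 1; have := B 1 1 1 1.
lra.
Qed.

(** Points of the two normals at parameters that are far apart. *)
Lemma green_far (sep : R) : 0 < sep -> exists C : R, exists2 d : R, 0 < d & 0 < C /\
  forall t t' s s', far sep t t' -> 0 < s < d -> 0 < s' < d ->
  [/\ s <= 1, `|s * k t| <= 1 / 2, `|s' * k t'| <= 1 / 2, offdiag Om (X t s, X t' s') &
   exists a : E,
    [/\ enorm (grad1 g (X t s) (X t' s')) <= C * s',
        enorm (hess1 g (X t s) (X t' s')) <= C * s',
        enorm a <= C &
        enorm (grad2grad1 g (X t s) (X t' s') - a *m (nrm t')^T) <= C * s']].
Proof.
move=> sep0; have [c c0 Hc] := curve_separated F sep0.
have c2 : 0 < c / 2 by rewrite divr_gt0.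
have [C [eta eta0 [C0 H]]] := Hdecay c2.
have [dk [Km Km0 [_ _ kM _]]] := curvature_bounds F.
have [s1 s10 Hin] := tube_inside F.
exists C, (Num.min (Num.min eta s1) (Num.min (Num.min 1 (c / 4)) (1 / (2 * Km)))).
  by rewrite !lt_min eta0 s10 ltr01 !divr_gt0// mulr_gt0.
split=> // t t' s s' ft /andP[sp]; rewrite !lt_min.
move=> /andP[/andP[h1 h2] /andP[/andP[h3 h4] h5]] /andP[sp' /andP[/andP[h1' h2'] /andP[/andP[h3' h4'] h5']]].
have OX : Om (X t s) by apply: Hin; rewrite sp.
have OX' : Om (X t' s') by apply: Hin; rewrite sp'.
have sepX : c / 2 <= enorm (X t s - X t' s').
  have h := Hc t (t' - t) ft; rewrite subrKC in h.
  have := enorm_triangleB (gam t' - gam t) (gam t' - gam t + (X t s - X t' s')).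
  have -> : gam t' - gam t - (gam t' - gam t + (X t s - X t' s')) = - (X t s - X t' s').
    by apply: col2P; rewrite !mxE; ring.
  rewrite enormN.
  have -> : gam t' - gam t + (X t s - X t' s') = s' *: nrm t' + (- s) *: nrm t.
    by apply: col2P; rewrite !mxE; ring.
  have := enorm_triangle (s' *: nrm t') ((- s) *: nrm t).
  rewrite !enormZ !(enorm_unit (frame_unit F _)) !mulr1 normrN (gtr0_norm sp) (gtr0_norm sp').
  lra.
have kb (u x : R) : 0 < x -> x < 1 / (2 * Km) -> `|x * k u| <= 1 / 2.
  move=> x0; rewrite ltr_pdivlMr ?mulr_gt0// => h.
  have : `|x * k u| <= x * Km by rewrite normrM (gtr0_norm x0) ler_pM2l.
  lra.
split; [exact: ltW|exact: kb|exact: kb| |].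
  split=> //=; apply: contraTneq sepX => ->.
  by rewrite subrr enormE /dot !mxE mulr0 addr0 sqrtr0 -ltNge.
by apply: H => //; rewrite sp'.
Qed.

Section MovingDirection.
Variables (ev ev' : R -> E) (Km : R).
Hypothesis Dev : forall t : R, is_derive t 1 ev (ev' t).
Hypothesis ev1 : forall t, enorm (ev t) = 1.
Hypothesis evK : forall t, enorm (ev' t) <= Km.

Definition greenE t s t' s' := dot (grad1 g (X t s) (X t' s')) (ev t).

Lemma green_derivatives (sep : R) : 0 < sep -> exists C : R, exists2 d : R, 0 < d & 0 < C /\
  forall t t' s s' : R, far sep t t' -> 0 < s < d -> 0 < s' < d ->
  exists Dt Ds Dt' Ds' : R,
  [/\ `|greenE t s t' s'| <= C * s',
      is_derive t 1 (fun u => greenE u s t' s') Dt /\ `|Dt| <= C * s',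
      is_derive s 1 (fun u => greenE t u t' s') Ds /\ `|Ds| <= C * s',
      is_derive t' 1 (fun u => greenE t s u s') Dt' /\ `|Dt'| <= C * s' &
      is_derive s' 1 (fun u => greenE t s t' u) Ds' /\ `|Ds'| <= C].
Proof.
move=> sep0; have [C [d d0 [C0 H]]] := green_far sep0.
have Km0 : 0 <= Km by apply: le_trans (enorm_ge0 (ev' 0)) (evK 0).
have KC : 0 <= Km * C by rewrite mulr_ge0// ltW.
exists (8 * C + Km * C), (Num.min d 1); first by rewrite lt_min d0 ltr01.
split; first by rewrite ltr_wpDr// mulr_gt0.
move=> t t' s s' ft /andP[sp]; rewrite !lt_min => /andP[sd _] /andP[sp' /andP[sd' s1']].
have [s1 sk sk' O [a [b1 b2 b3 b4]]] := H t t' s s' ft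
  (introT andP (conj sp sd)) (introT andP (conj sp' sd')).
have ne := enorm_unit (frame_unit F _); have te := enorm_unit (unit_tg F _).
have Cs : 0 <= C * s' by rewrite mulr_ge0// ltW.
have KCs : 0 <= Km * C * s' by rewrite mulr_ge0// ltW.
have fac (u x : R) : `|x * k u| <= 1 / 2 -> forall z M, `|z| <= M -> `|(1 - x * k u) * z| <= 2 * M.
  move=> hx z M hz; rewrite normrM; apply: ler_pM => //.
  by have := ler_normB 1 (x * k u); rewrite normr1; lra.
have mulZ (A : 'M[R]_2) (c0 : R) x y : dot (A *m (c0 *: x)) y = c0 * dot (A *m x) y.
  by rewrite -scalemxAr dotZl.
have mulN (A : 'M[R]_2) (x : E) y : dot (A *m - x) y = - dot (A *m x) y.
  by rewrite mulmxN dotNl.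
have nle (x : E) : enorm x = 1 -> enorm x <= 1 by move=> ->.
have le1 u := nle _ (ev1 u); have nle1 u := nle _ (enorm_unit (frame_unit F u)).
have tle1 u := nle _ (enorm_unit (unit_tg F u)).
have gE (y : E) (M : R) : enorm y <= M -> `|dot (grad1 g (X t s) (X t' s')) y| <= C * s' * M.
  move=> hy; apply: le_trans (dot_le _ _) _; apply: ler_pM => //; exact: enorm_ge0.
have d1 := is_derive_dot_grad1_l (x := fun u => X u s) (u := t) oOm gC3 O (is_derive_tube_t F t s) (Dev t).
have d2 := is_derive_dot_grad1_l (x := X t) (u := s) oOm gC3 O (is_derive_tube_s gam nrm t s) (is_derive_cst (ev t) s 1).
have d3 := is_derive_dot_grad1_r (x := fun u => X u s') (u := t') oOm gC3 (ev t) O (is_derive_tube_t F t' s').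
have d4 := is_derive_dot_grad1_r (x := X t') (u := s') oOm gC3 (ev t) O (is_derive_tube_s gam nrm t' s').
(* the mixed derivative only sees the normal component of the second point *)
have M (y : E) : grad2grad1 g (X t s) (X t' s') *m y =
   (grad2grad1 g (X t s) (X t' s') - a *m (nrm t')^T) *m y + dot (nrm t') y *: a.
  rewrite mulmxBl -mulmxA (_ : (nrm t')^T *m y = (dot (nrm t') y)%:M); last first.
    by apply/matrixP => i j; rewrite !ord1 mxE sum_ord2 !mxE /dot /= mulr1n.
  by rewrite scalar_mxC mul_scalar_mx subrK.
have nt : dot (nrm t') (tg t') = 0 by rewrite /dot !rot90E; ring.
have q1 := quad_le b2 (tle1 t) (le1 t); have q2 := quad_le b2 (nle1 t) (le1 t).
have q3 := quad_le b4 (tle1 t') (le1 t); have q4 := quad_le b4 (nle1 t') (le1 t).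
have g0 : `|greenE t s t' s'| <= C * s' * 1 := gE _ _ (le1 t).
exists (dot (hess1 g (X t s) (X t' s') *m ((1 - s * k t) *: tg t)) (ev t) + dot (grad1 g (X t s) (X t' s')) (ev' t)),
  (dot (hess1 g (X t s) (X t' s') *m (- nrm t)) (ev t) + dot (grad1 g (X t s) (X t' s')) 0),
  (dot (grad2grad1 g (X t s) (X t' s') *m ((1 - s' * k t') *: tg t')) (ev t)),
  (dot (grad2grad1 g (X t s) (X t' s') *m (- nrm t')) (ev t)).
split.
- by apply: le_trans g0 _; rewrite mulrDl; lra.
- split; first exact: d1.
  rewrite mulZ; apply: le_trans (ler_normD _ _) _.
  have := fac t s sk _ _ q1; have := gE _ _ (evK t); lra.
- split; first exact: d2.
  have -> : dot (grad1 g (X t s) (X t' s')) 0 = 0.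
    by move: (grad1 g _ _) => v; rewrite /dot !mxE; ring.
  by rewrite addr0 mulN normrN; apply: le_trans q2 _; lra.
- split; first exact: d3.
  rewrite mulZ M nt scale0r addr0; have := fac t' s' sk' _ _ q3; lra.
- split; first exact: d4.
  rewrite mulN normrN M (frame_unit F) scale1r dotDl.
  apply: le_trans (ler_normD _ _) _.
  have h := dot_le a (ev t); rewrite ev1 mulr1 in h.
  have : C * s' <= C * 1 by rewrite ler_pM2l// ltW.
  lra.
Qed.

Lemma green_lipschitz (sep : R) : 0 < sep -> exists C : R, exists2 d : R, 0 < d & 0 < C /\
  forall t1 t1' t2 t2' s1 s1' s2 s2' sm : R,
  far sep t1 t1' -> far sep t2 t1' -> far sep t2 t2' -> sm < d ->
  0 < s1 <= sm -> 0 < s1' <= sm -> 0 < s2 <= sm -> 0 < s2' <= sm ->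
  `|greenE t1 s1 t1' s1' - greenE t2 s2 t2' s2'| <=
    C * (sm * (`|t1 - t2| + `|s1 - s2| + `|t1' - t2'|) + `|s1' - s2'|).
Proof.
move=> sep0; have [C [d d0 [C0 H]]] := green_derivatives sep0.
exists C, d => //; split=> // t1 t1' t2 t2' s1 s1' s2 s2' sm f11 f21 f22 smd h1 h1' h2 h2'.
have rng x : 0 < x <= sm -> 0 < x < d by move=> /andP[-> xs]; exact: le_lt_trans smd.
have btw x y u : 0 < x <= sm -> 0 < y <= sm -> Num.min x y <= u <= Num.max x y -> 0 < u <= sm.
  move=> /andP[p1 p2] /andP[p3 p4] /andP[]; rewrite ge_min le_max.
  by move=> /orP[] q1 /orP[] q2; apply/andP; split; lra.
have Csm x : 0 < x <= sm -> C * x <= C * sm by move=> /andP[_ ?]; rewrite ler_pM2l.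
have mvt (f : R -> R) a b M : (forall x : R, Num.min a b <= x <= Num.max a b ->
    exists2 l, is_derive x 1 f l & `|l| <= M) -> `|f b - f a| <= M * `|b - a|.
  move=> Hf.
  have ex x : exists l, Num.min a b <= x <= Num.max a b -> is_derive x 1 f l /\ `|l| <= M.
    have [/Hf [l l1 l2]|nx] := boolP (Num.min a b <= x <= Num.max a b); first by exists l.
    by exists 0.
  have [df Hdf] := choice ex.
  by apply: (@mvt_le_sym R f df) => x /Hdf [].
have e1 : `|greenE t1 s1 t1' s1' - greenE t2 s1 t1' s1'| <= C * sm * `|t1 - t2|.
  apply: (mvt (fun u => greenE u s1 t1' s1')) => x hx.
  have [Dt [_ [_ [_ [_ [q1 q2] _ _ _]]]]] := H x t1' s1 s1' (far_between_l f21 f11 hx) (rng _ h1) (rng _ h1').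
  by exists Dt => //; apply: le_trans q2 _; exact: Csm.
have e2 : `|greenE t2 s1 t1' s1' - greenE t2 s2 t1' s1'| <= C * sm * `|s1 - s2|.
  apply: (mvt (fun u => greenE t2 u t1' s1')) => x hx.
  have [_ [Ds [_ [_ [_ _ [q1 q2] _ _]]]]] := H t2 t1' x s1' f21 (rng _ (btw _ _ _ h2 h1 hx)) (rng _ h1').
  by exists Ds => //; apply: le_trans q2 _; exact: Csm.
have e3 : `|greenE t2 s2 t1' s1' - greenE t2 s2 t2' s1'| <= C * sm * `|t1' - t2'|.
  apply: (mvt (fun u => greenE t2 s2 u s1')) => x hx.
  have [_ [_ [Dt' [_ [_ _ _ [q1 q2] _]]]]] := H t2 x s2 s1' (far_between_r f22 f21 hx) (rng _ h2) (rng _ h1').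
  by exists Dt' => //; apply: le_trans q2 _; exact: Csm.
have e4 : `|greenE t2 s2 t2' s1' - greenE t2 s2 t2' s2'| <= C * `|s1' - s2'|.
  apply: (mvt (fun u => greenE t2 s2 t2' u)) => x hx.
  have [_ [_ [_ [Ds' [_ _ _ _ [q1 q2]]]]]] := H t2 t2' s2 x f22 (rng _ h2) (rng _ (btw _ _ _ h2' h1' hx)).
  by exists Ds'.
apply: le_trans (telescope4 e1 e2 e3 e4) _.
by rewrite le_eqVlt; apply/orP; left; apply/eqP; clear; ring.
Qed.

End MovingDirection.

(** The tangential component is smaller by one order: by symmetry of G, its
normal derivative in the second variable is again a tangential derivative of
the gradient, now in the variable that approaches the curve, and the mixed
second derivative is almost purely normal in that variable. *)
Lemma green_tangential (sep : R) : 0 < sep -> exists C : R, exists2 d : R, 0 < d & 0 < C /\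
  forall t t' s s' : R, far sep t t' -> 0 < s < d -> 0 < s' < d ->
    `|dot (grad1 g (X t s) (X t' s')) (tg t)| <= C * (s * s').
Proof.
move=> sep0; have sep2 : 0 < sep / 2 by rewrite divr_gt0.
have [dk [Km Km0 [_ _ kM _]]] := curvature_bounds F.
have nK t : enorm (k t *: tg t) <= Km by rewrite enormZ (enorm_unit (unit_tg F t)) mulr1.
have [C1 [d1 d10 [C10 H1]]] := @green_derivatives nrm (fun t => k t *: tg t) Km
  (frame_dnrm F) (fun t => enorm_unit (frame_unit F t)) nK _ sep2.
have [C2 [d2 d20 [C20 H2]]] := green_far sep2.
pose C := 2 * C1; have C0 : 0 < C by rewrite mulr_gt0.
exists C, (Num.min d1 d2); first by rewrite lt_min d10.
split=> // t t' s s' ft /andP[sp]; rewrite lt_min => /andP[sd1 sd2] /andP[sp'].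
rewrite lt_min => /andP[sd1' sd2'].
pose D (u x : R) := Gfun g (X u s) (X t' x) - Gfun g (X t s) (X t' x).
have farn u : `|u - t| <= sep / 2 -> far (sep / 2) u t'.
  by move: ft; rewrite /far ler_norml => /andP[? ?] /andP[? ?]; apply/andP; split; lra.
have tt : `|t - t| <= sep / 2 by rewrite subrr normr0 ltW.
have hs : 0 < s < d2 by rewrite sp.
have dG (u x : R) : `|u - t| <= sep / 2 -> 0 < x <= s' ->
  [/\ offdiag Om (X u s, X t' x), `|1 - s * k u| <= 2 &
     `|dot (grad1 g (X u s) (X t' x)) ((1 - s * k u) *: tg u)| <= 2 * (C2 * x)].
  move=> hu /andP[x0 xs].
  have [_ sk _ O [a [b1 _ _ _]]] := H2 u t' s x (farn _ hu) hs (introT andP (conj x0 (le_lt_trans xs sd2'))).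
  have sk2 : `|1 - s * k u| <= 2.
    by have := ler_normB 1 (s * k u); rewrite normr1; lra.
  split=> //; apply: le_trans (dot_le _ _) _.
  rewrite enormZ (enorm_unit (unit_tg F u)) mulr1 mulrC.
  by apply: ler_pM => //; exact: enorm_ge0.
have Dsmall u x : `|u - t| <= sep / 2 -> 0 < x <= s' -> `|D u x| <= 2 * (C2 * x) * `|u - t|.
  move=> hu hx.
  apply: (@mvt_le_sym R (fun u => Gfun g (X u s) (X t' x))
    (fun u => dot (grad1 g (X u s) (X t' x)) ((1 - s * k u) *: tg u))) => v /(between_dist hu) hv.
    have [inO _ _] := dG v x hv hx.
    exact: (is_derive_G_l (x := fun u => X u s) (u := v) oOm gC3 inO (is_derive_tube_t F v s)).
  by have [] := dG v x hv hx.
have Dder (u x : R) : `|u - t| <= sep / 2 -> 0 < x <= s' ->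
  exists2 l, is_derive x 1 (D u) l & `|l| <= C1 * s * `|u - t|.
  move=> hu hx; have [Ou _ _] := dG u x hu hx; have [Ot _ _] := dG t x tt hx.
  have du := is_derive_G_r (x := X t') (u := x) oOm gC3 gsym Ou (is_derive_tube_s gam nrm t' x).
  have dt := is_derive_G_r (x := X t') (u := x) oOm gC3 gsym Ot (is_derive_tube_s gam nrm t' x).
  exists (dot (grad1 g (X t' x) (X u s)) (- nrm t') - dot (grad1 g (X t' x) (X t s)) (- nrm t')).
    exact: is_deriveB.
  have hx1 : 0 < x < d1 by move: hx => /andP[-> xs]; exact: le_lt_trans sd1'.
  have hs1 : 0 < s < d1 by rewrite sp.
  have -> : dot (grad1 g (X t' x) (X u s)) (- nrm t') - dot (grad1 g (X t' x) (X t s)) (- nrm t') =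
    - (greenE nrm t' x (u + L) s - greenE nrm t' x (t + L) s).
    by rewrite /greenE !tubeL; move: (grad1 g _ _) (grad1 g _ _) => v w; rewrite /dot !mxE; ring.
  rewrite normrN.
  have ex v : exists l, `|v - t| <= sep / 2 ->
      is_derive v 1 (fun v => greenE nrm t' x (v + L) s) l /\ `|l| <= C1 * s.
    have [hv|_] := boolP (`|v - t| <= sep / 2); last by exists 0.
    have [_ [_ [Dt' [_ [_ _ _ [q1 q2] _]]]]] := H1 t' (v + L) x s (far_sym (farn _ hv)) hx1 hs1.
    by exists Dt' => _; split=> //; exact: (@is_derive_shift1 R (fun v => greenE nrm t' x v s) v L Dt' q1).
  have [df Hdf] := choice ex.
  apply: (@mvt_le_sym R (fun v => greenE nrm t' x (v + L) s) df) => v /(between_dist hu) hv;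
  by have [] := Hdf v hv.
have Dbound u : `|u - t| <= sep / 2 -> `|D u s'| <= C1 * s * `|u - t| * s'.
  move=> hu.
  have ex x : exists l, 0 < x <= s' -> is_derive x 1 (D u) l /\ `|l| <= C1 * s * `|u - t|.
    have [hx|_] := boolP (0 < x <= s'); last by exists 0.
    by have [l l1 l2] := Dder u x hu hx; exists l.
  have [df Hdf] := choice ex.
  apply: (@mvt_right R (D u) df s' (C1 * s * `|u - t|)) => //.
  - by rewrite !mulr_ge0// ltW.
  - by move=> x /Hdf [].
  - by move=> x /Hdf [].
  - move=> e e0; have q0 : 0 < 2 * C2 * (`|u - t| + 1) by rewrite !mulr_gt0// ltr_wpDl.
    exists (Num.min s' (e / (2 * C2 * (`|u - t| + 1)))); first by rewrite lt_min sp' divr_gt0.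
    move=> x /andP[x0]; rewrite lt_min => /andP[xs xe].
    have hx : 0 < x <= s' by rewrite x0 ltW.
    apply: le_trans (Dsmall u x hu hx) _; move: xe; rewrite ltr_pdivlMr// => xe.
    have : 0 <= 2 * C2 * x by rewrite !mulr_ge0// ltW.
    lra.
have hs' : 0 < s' <= s' by rewrite sp' lexx.
have [Ot sk2 _] := dG t s' tt hs'.
pose l := dot (grad1 g (X t s) (X t' s')) ((1 - s * k t) *: tg t).
have dl : is_derive t 1 (fun u => Gfun g (X u s) (X t' s')) l.
  exact: (is_derive_G_l (x := fun u => X u s) (u := t) oOm gC3 Ot (is_derive_tube_t F t s)).
have lb : `|l| <= C1 * s * s'.
  apply/ler_addgt0Pr => e e0.
  have [d3 d30 H3] := (is_deriveP _ _ _).1 dl e e0.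
  pose h := Num.min d3 (sep / 2) / 2.
  have m0 : 0 < Num.min d3 (sep / 2) by rewrite lt_min d30.
  have h0 : 0 < h by rewrite divr_gt0.
  have [hd3 hsep] : h < d3 /\ h < sep / 2.
    have : h < Num.min d3 (sep / 2) by rewrite /h; lra.
    by rewrite lt_min => /andP.
  have th : t + h - t = h by rewrite addrAC subrr add0r.
  have nh : `|t + h - t| = h by rewrite th gtr0_norm.
  have b1 : `|D (t + h) s' - h * l| <= e * h.
    by have := H3 (t + h); rewrite nh th; apply.
  have b2 : `|D (t + h) s'| <= C1 * s * h * s'.
    by have := Dbound (t + h); rewrite nh; apply; exact: ltW.
  have b3 := ler_normB (D (t + h) s') (D (t + h) s' - h * l).
  rewrite opprB addrC subrK normrM (gtr0_norm h0) in b3.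
  rewrite -(ler_pM2l h0); lra.
have [_ sk _ _ _] := H2 t t' s s' (farn _ tt) hs (introT andP (conj sp' sd2')).
have lE : l = (1 - s * k t) * dot (grad1 g (X t s) (X t' s')) (tg t).
  by rewrite /l; move: (grad1 g _ _) => v; rewrite /dot !mxE /=; ring.
rewrite lE normrM in lb.
set z := `|dot _ _| in lb *.
have sk3 : 1 / 2 <= `|1 - s * k t|.
  have := ler_norm (1 - s * k t); have := ler_norm (s * k t); lra.
have : 1 / 2 * z <= `|1 - s * k t| * z by rewrite ler_wpM2r// normr_ge0.
rewrite /C; lra.
Qed.

End GreenBounds.

(*PART 15*)
Section SmallCoefficients.
Context {R : realType}.
Local Notation S := (R * R * R)%type.
Local Notation P := (R * (S * S))%type.
Variable a : R.
Implicit Types (f g : P -> R) (q : S * S).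

Definition base2 (t : R) : S * S := (base t, base (t + a)).

Definition bounds f (M c eta : R) : Prop := forall r t q1 q2, 0 < r < eta ->
  `|q1 - base2 t| <= eta -> `|q2 - base2 t| <= eta ->
  `|f (r, q1)| <= M /\ `|f (r, q1) - f (r, q2)| <= c * `|q1 - q2|.

(** Near the circular motion and for small r, a coefficient is tame if it is
bounded and Lipschitz, vanishing if moreover it is small, and tiny if its
Lipschitz constant is small as well. *)
Definition tame f := exists2 c : R, 0 < c & exists2 eta, 0 < eta & bounds f c c eta.
Definition vanishing f := exists2 c : R, 0 < c & forall M, 0 < M ->
  exists2 eta, 0 < eta & bounds f M c eta.
Definition tiny f := forall c : R, 0 < c -> exists2 eta, 0 < eta & bounds f c c eta.

Lemma bounds_le f M c eta M' c' eta' : M <= M' -> c <= c' -> eta' <= eta ->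
  bounds f M c eta -> bounds f M' c' eta'.
Proof.
move=> MM cc ee H r t q1 q2 /andP[r0 re] h1 h2.
have [| | |k1 k2] := H r t q1 q2; first by rewrite r0 (lt_le_trans re).
- exact: le_trans ee.
- exact: le_trans ee.
- split; first exact: le_trans MM.
  by apply: le_trans k2 _; rewrite ler_wpM2r.
Qed.

Lemma boundsD f g M c M' c' eta : bounds f M c eta -> bounds g M' c' eta ->
  bounds (fun p => f p + g p) (M + M') (c + c') eta.
Proof.
move=> Hf Hg r t q1 q2 r0 h1 h2; have [f1 f2] := Hf _ _ _ _ r0 h1 h2.
have [g1 g2] := Hg _ _ _ _ r0 h1 h2; split.
  by apply: le_trans (ler_normD _ _) _; exact: lerD.
rewrite opprD addrACA mulrDl; apply: le_trans (ler_normD _ _) _; exact: lerD.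
Qed.

Lemma boundsM f g M c M' c' eta : bounds f M c eta -> bounds g M' c' eta ->
  bounds (fun p => f p * g p) (M * M') (M * c' + M' * c) eta.
Proof.
move=> Hf Hg r t q1 q2 r0 h1 h2; have [f1 f2] := Hf _ _ _ _ r0 h1 h2.
have [g1 g2] := Hg _ _ _ _ r0 h1 h2; have [g3 _] := Hg _ _ _ _ r0 h2 h1.
split; first by rewrite normrM; exact: ler_pM.
have -> : f (r, q1) * g (r, q1) - f (r, q2) * g (r, q2) =
  f (r, q1) * (g (r, q1) - g (r, q2)) + g (r, q2) * (f (r, q1) - f (r, q2)) by ring.
rewrite mulrDl -!mulrA; apply: le_trans (ler_normD _ _) _; rewrite !normrM.
by apply: lerD; apply: ler_pM.
Qed.

Lemma tiny_tame f : tiny f -> tame f.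
Proof. by move=> /(_ 1 ltr01) H; exists 1. Qed.

Lemma vanishing_tame f : vanishing f -> tame f.
Proof.
move=> [c c0 /(_ c c0) H]; by exists c.
Qed.

Lemma tame_cst (b : R) : tame (fun=> b).
Proof.
exists (`|b| + 1); first by rewrite ltr_wpDl.
exists 1 => // r t q1 q2 _ _ _; rewrite lerDl ler01; split=> //.
by rewrite subrr normr0 mulr_ge0// addr_ge0.
Qed.

Lemma tameD f g : tame f -> tame g -> tame (fun p => f p + g p).
Proof.
move=> [c c0 [e e0 Hf]] [c' c'0 [e' e'0 Hg]]; exists (c + c'); first exact: addr_gt0.
exists (Num.min e e'); first by rewrite lt_min e0.
by apply: boundsD; [apply: bounds_le Hf|apply: bounds_le Hg] => //; rewrite ge_min lexx ?orbT.
Qed.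

Lemma tameM f g : tame f -> tame g -> tame (fun p => f p * g p).
Proof.
move=> [c c0 [e e0 Hf]] [c' c'0 [e' e'0 Hg]].
have cc := mulr_gt0 c0 c'0.
exists (c * c' + c' * c); first by rewrite addr_gt0// mulrC.
exists (Num.min e e'); first by rewrite lt_min e0.
have := @boundsM f g c c c' c' (Num.min e e').
move=> H; have {}H := H (bounds_le (lexx _) (lexx _) _ Hf) (bounds_le (lexx _) (lexx _) _ Hg).
apply: bounds_le (H _ _) => //; last 2 first.
- by rewrite ge_min lexx.
- by rewrite ge_min lexx orbT.
by rewrite lerDl mulrC ltW.
Qed.

Lemma tinyD f g : tiny f -> tiny g -> tiny (fun p => f p + g p).
Proof.
move=> Hf Hg c c0; have c2 : 0 < c / 2 by rewrite divr_gt0.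
have [e e0 {}Hf] := Hf _ c2; have [e' e'0 {}Hg] := Hg _ c2.
exists (Num.min e e'); first by rewrite lt_min e0.
rewrite [c]splitr; apply: boundsD; [apply: bounds_le Hf|apply: bounds_le Hg] => //;
by rewrite ge_min lexx ?orbT.
Qed.

Lemma tinyM f g : tiny f -> tame g -> tiny (fun p => f p * g p).
Proof.
move=> Hf [M M0 [e' e'0 Hg]] c c0.
have c2 : 0 < c / (2 * M) by rewrite divr_gt0// mulr_gt0.
have [e e0 {}Hf] := Hf _ c2.
exists (Num.min e e'); first by rewrite lt_min e0.
have := @boundsM f g _ _ M M (Num.min e e').
move=> H; have {}H := H _ _ (bounds_le (lexx _) (lexx _) _ Hf) (bounds_le (lexx _) (lexx _) _ Hg).
have E : c / (2 * M) * M + M * (c / (2 * M)) = c by field; rewrite gt_eqF.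
rewrite E in H; apply: bounds_le (H _ _) => //; last 2 first.
- by rewrite ge_min lexx.
- by rewrite ge_min lexx orbT.
by rewrite -[leRHS]E lerDl ltW// mulr_gt0.
Qed.

Lemma vanishingM f g : vanishing f -> vanishing g -> tiny (fun p => f p * g p).
Proof.
move=> [C C0 Hf] [C' C'0 Hg] c c0; pose M := Num.min 1 (c / (1 + C + C')).
have CC : 0 < 1 + C + C' by rewrite !addr_gt0.
have M0 : 0 < M by rewrite lt_min ltr01 divr_gt0.
have [e e0 {}Hf] := Hf _ M0; have [e' e'0 {}Hg] := Hg _ M0.
exists (Num.min e e'); first by rewrite lt_min e0.
have H := @boundsM f g _ _ _ _ (Num.min e e') (bounds_le (lexx _) (lexx _) _ Hf)
  (bounds_le (lexx _) (lexx _) _ Hg).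
have Mc : M * (1 + C + C') <= c by rewrite -ler_pdivlMr// /M ge_min lexx orbT.
have M1 : M <= 1 by rewrite /M ge_min lexx.
have MC : 0 < M * C by rewrite mulr_gt0.
have MC' : 0 < M * C' by rewrite mulr_gt0.
have MM : M * M <= M by rewrite -[leRHS]mulr1 ler_pM2l.
apply: bounds_le (H _ _) => //; last 2 first.
- by rewrite ge_min lexx.
- by rewrite ge_min lexx orbT.
- by move: Mc M1 MC MC' MM; clear; lra.
- by move: Mc M1 MC MC' MM M0; clear; lra.
Qed.

Lemma tiny_ext f g : f = g -> tiny f -> tiny g.
Proof. by move=> ->. Qed.

Lemma tiny_fst : tiny (fun p => p.1).
Proof.
move=> c c0; exists c => // r t q1 q2 /andP[r0 rc] _ _; split=> /=.
  by rewrite gtr0_norm// ltW.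
by rewrite subrr normr0 mulr_ge0// ltW.
Qed.

Lemma pair_norms (x : S * S) (M : R) : `|x| <= M ->
  [/\ `|x.1.1.1| <= M, `|x.1.1.2| <= M, `|x.1.2| <= M, `|x.2.1.1| <= M & `|x.2.1.2| <= M].
Proof.
rewrite prod_normE ge_max => /andP[/prod3_normP[? ? ?] /prod3_normP[? ? ?]]; by split.
Qed.

(* coordinates of a pair of states close to the circular motion *)
Lemma near_base (q : S * S) (t e : R) : `|q - base2 t| <= e ->
  [/\ `|q.1.1.1 - t| <= e, `|q.1.1.2 - 1| <= e, `|q.1.2 - 1| <= e,
      `|q.2.1.1 - (t + a)| <= e & `|q.2.1.2 - 1| <= e].
Proof. by move=> /pair_norms. Qed.

Lemma vanishing_level : vanishing (fun p => p.2.1.2 - 1).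
Proof.
exists 1 => // M M0; exists M => // r t q1 q2 _ /near_base [_ _ h _ _] _; split=> //=.
have [_ _ + _ _] := pair_norms (lexx `|q1 - q2|); rewrite mul1r => h2.
by rewrite opprD addrACA subrr addr0.
Qed.

Lemma tame_level_inv : tame (fun p => (p.2.1.2)^-1).
Proof.
exists 4 => //; exists (1 / 2); first by [].
move=> r t q1 q2 _ /near_base [_ _ h1 _ _] /near_base [_ _ h2 _ _] /=.
have hm (x : R) : `|x - 1| <= 1 / 2 -> 1 / 2 <= x.
  by rewrite ler_norml => /andP[? _]; lra.
have m1 := hm _ h1; have m2 := hm _ h2.
have p1 : 0 < q1.1.2 by apply: lt_le_trans m1.
have p2 : 0 < q2.1.2 by apply: lt_le_trans m2.
have i1 : q1.1.2^-1 <= 2 by rewrite invf_ple ?posrE//; move: m1; lra.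
have i2 : q2.1.2^-1 <= 2 by rewrite invf_ple ?posrE//; move: m2; lra.
split; first by rewrite gtr0_norm ?invr_gt0//; move: i1; lra.
have -> : q1.1.2^-1 - q2.1.2^-1 = (q1.1.2^-1 * q2.1.2^-1) * (q2.1.2 - q1.1.2).
  by field; rewrite !gt_eqF.
have [_ _ + _ _] := pair_norms (lexx `|q1 - q2|) => /= h.
rewrite normrM distrC; apply: ler_pM => //.
rewrite gtr0_norm ?mulr_gt0 ?invr_gt0//.
have -> : 4 = 2 * 2 :> R by ring.
by apply: ler_pM => //; rewrite ltW// invr_gt0.
Qed.

End SmallCoefficients.

(*PART 16*)
Section Coefficients.
Context {R : realType}.
Local Notation E := ('cV[R]_2).
Local Notation S := (R * R * R)%type.
Local Notation P := (R * (S * S))%type.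
Variables (Om Gam : set E) (L : R) (gam nrm : R -> E) (k : R -> R).
Hypothesis F : frame Om Gam L gam nrm k.
Let L0 := frame_L F.
Local Notation tg t := (rot90 (nrm t)).
Local Notation X := (tube gam nrm).
Variable g : E -> E -> R.
Hypothesis oOm : open Om.
Hypothesis gC3 : Ck 3 (Om `*` Om) (fun wz : E * E => g wz.1 wz.2).
Hypothesis gsym : forall w z, Om w -> Om z -> g w z = g z w.
Local Notation rho := (rhofun g).
Hypothesis rho_lim : forall t,
  [/\ rho z @[z --> within Om (nbhs (gam t))] --> (0 : R),
      grad rho z @[z --> within Om (nbhs (gam t))] --> - (2 *: nrm t) &
      hess rho z @[z --> within Om (nbhs (gam t))] --> (- (2 * k t))%:M].
Hypothesis Hdecay : green_decay Om gam nrm g.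
Local Notation rhoN := (rhoN gam nrm g).
Local Notation rhoT := (rhoT gam nrm g).

(** The state (th, sg, m) describes the point of the normal at parameter th
whose distance to the curve is r * sg, and m is the value of rho / (2 r). *)
Definition depth (p : P) : R := p.1 * p.2.1.1.2.
Definition depth' (p : P) : R := p.1 * p.2.2.1.2.
Definition cJ (p : P) : R := (1 - depth p * k p.2.1.1.1)^-1.
Definition cB1 (p : P) : R :=
  (rho (X p.2.1.1.1 (depth p)) - 2 * depth p) * (2 * p.1)^-1.
Definition cB2 (p : P) : R := (rhoN p.2.1.1.1 (depth p) + 2) * (- 1 / 2).
Definition cB3 (p : P) : R := rhoT p.2.1.1.1 (depth p).
Definition cG (ev : R -> E) (p : P) : R :=
  greenE gam nrm g ev p.2.1.1.1 (depth p) p.2.2.1.1 (depth' p).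

Lemma depth_bounds a r t (q : S * S) e : 0 < r -> e <= 1 / 2 -> `|q - base2 a t| <= e ->
  [/\ 0 < depth (r, q), depth (r, q) <= 2 * r, 0 < depth' (r, q) & depth' (r, q) <= 2 * r].
Proof.
move=> r0 e2 /near_base [_ h1 _ _ h2]; rewrite /depth /depth' /=.
have rng (x : R) : `|x - 1| <= e -> 0 < x <= 2.
  by rewrite ler_norml => /andP[? ?]; apply/andP; split; lra.
have /andP[a1 a2] := rng _ h1; have /andP[b1 b2] := rng _ h2.
by rewrite !mulr_gt0//; split=> //; rewrite mulrC ler_pM2r.
Qed.

Lemma depth_lip r (q1 q2 : S * S) : 0 < r ->
  `|depth (r, q1) - depth (r, q2)| <= r * `|q1 - q2| /\
  `|depth' (r, q1) - depth' (r, q2)| <= r * `|q1 - q2|.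
Proof.
move=> r0; have [_ h1 _ _ h2] := pair_norms (lexx `|q1 - q2|).
by rewrite /depth /depth' /= -!mulrBr !normrM (gtr0_norm r0) !ler_pM2l.
Qed.

Section OneBody.
Variable a : R.

Lemma tiny_cB1 : tiny a cB1.
Proof.
have [dk [Km Km0 [_ _ kM _]]] := curvature_bounds F.
move=> c c0; have c4 : 0 < c / 4 by rewrite divr_gt0.
have [d1 d10 H1] := rho_expansions F oOm gC3 rho_lim ltr01.
have [C C0 /(_ _ c4) [d2 d20 H2]] := rho_lipschitz F oOm gC3 rho_lim.
pose B := 2 * (1 + Km); have B0 : 0 < B by rewrite mulr_gt0// addr_gt0.
pose eta := Num.min (Num.min (d1 / 2) (d2 / 2)) (Num.min (1 / 2) (c / B)).
exists eta; first by rewrite /eta !lt_min !divr_gt0.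
move=> r t q1 q2 /andP[r0]; rewrite !lt_min => /andP[/andP[rd1 rd2] /andP[r2 rc]] h1 h2.
have e2 : eta <= 1 / 2 by rewrite /eta !ge_min lexx orbT.
have [s0 sr _ _] := depth_bounds r0 e2 h1; have [s0' sr' _ _] := depth_bounds r0 e2 h2.
have [D1 _] := depth_lip q1 q2 r0.
have [D2 _ _ _ _] := pair_norms (lexx `|q1 - q2|).
have r20 : 0 < 2 * r by rewrite mulr_gt0.
have e (x : R) : `|x * (2 * r)^-1| = `|x| / (2 * r).
  by rewrite normrM normfV (gtr0_norm r20).
split; rewrite /cB1 /= ?[(r, q1).2]/(q1) ?[(r, q2).2]/(q2).
  rewrite e ler_pdivrMr//.
  have sd1 : 0 < depth (r, q1) < d1 by rewrite s0; lra.
  have [_ _ h3] := H1 q1.1.1.1 _ sd1.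
  have h4 := ler_normB (rho (X q1.1.1.1 (depth (r, q1))) - 2 * depth (r, q1) +
    k q1.1.1.1 * depth (r, q1) ^+ 2) (k q1.1.1.1 * depth (r, q1) ^+ 2).
  rewrite addrK in h4; apply: le_trans h4 _.
  have h5 : `|k q1.1.1.1 * depth (r, q1) ^+ 2| <= Km * depth (r, q1) ^+ 2.
    by rewrite normrM (ger0_norm (sqr_ge0 _)) ler_wpM2r// sqr_ge0.
  have h6 : depth (r, q1) ^+ 2 <= (2 * r) ^+ 2 by rewrite ler_pXn2r// nnegrE ltW.
  have h7 : (1 + Km) * depth (r, q1) ^+ 2 <= (1 + Km) * (2 * r) ^+ 2.
    by rewrite ler_pM2l// addr_gt0.
  apply: (@le_trans _ _ ((1 + Km) * (2 * r) ^+ 2)).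
    by rewrite mulrDl mul1r in h7 *; apply: le_trans (lerD h3 h5) _; rewrite mul1r.
  have -> : (1 + Km) * (2 * r) ^+ 2 = (r * B) * (2 * r) by rewrite /B; ring.
  by rewrite ler_pM2r// -ler_pdivlMr// ltW.
rewrite -mulrBl e ler_pdivrMr//.
have sd1 : 0 < depth (r, q1) < d2 by rewrite s0; lra.
have sd2 : 0 < depth (r, q2) < d2 by rewrite s0'; lra.
have [_ _ h3] := H2 q1.1.1.1 q2.1.1.1 _ _ sd1 sd2.
apply: le_trans h3 _.
have h4 : c / 4 * depth (r, q1) * `|q1.1.1.1 - q2.1.1.1| <= c / 4 * (2 * r) * `|q1 - q2|.
  apply: ler_pM => //; first by rewrite mulr_ge0// ltW.
  by rewrite ler_pM2l.
have h5 : c / 4 * `|depth (r, q1) - depth (r, q2)| <= c / 4 * (r * `|q1 - q2|).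
  by rewrite ler_pM2l.
apply: le_trans (lerD h4 h5) _.
have : 0 <= c * (r * `|q1 - q2|) by rewrite !mulr_ge0// ltW.
by lra.
Qed.

Lemma tiny_cB2 : tiny a cB2.
Proof.
have [dk [Km Km0 [_ _ kM _]]] := curvature_bounds F.
move=> c c0.
have [d1 d10 H1] := rho_expansions F oOm gC3 rho_lim ltr01.
have [C C0 /(_ _ c0) [d2 d20 H2]] := rho_lipschitz F oOm gC3 rho_lim.
pose B := 1 + 2 * Km; have B0 : 0 < B by rewrite addr_gt0// mulr_gt0.
pose eta := Num.min (Num.min (Num.min (d1 / 2) (d2 / 2)) (Num.min (1 / 2) (c / B))) (c / C).
exists eta; first by rewrite /eta !lt_min !divr_gt0.
move=> r t q1 q2 /andP[r0]; rewrite !lt_min => /andP[/andP[/andP[rd1 rd2] /andP[r2 rc]] rC] h1 h2.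
have e2 : eta <= 1 / 2 by rewrite /eta !ge_min lexx ?orbT.
have [s0 sr _ _] := depth_bounds r0 e2 h1; have [s0' sr' _ _] := depth_bounds r0 e2 h2.
have [D1 _] := depth_lip q1 q2 r0.
have [D2 _ _ _ _] := pair_norms (lexx `|q1 - q2|).
have e (x : R) : `|x * (-1 / 2)| = `|x| / 2 by rewrite normrM mulN1r normrN (@gtr0_norm _ 2^-1).
rewrite /cB2 /= ?[(r, q1).2]/(q1) ?[(r, q2).2]/(q2) -mulrBl !e.
have sd1 : 0 < depth (r, q1) < d1 by rewrite s0; lra.
have sd2 : 0 < depth (r, q1) < d2 by rewrite s0; lra.
have sd3 : 0 < depth (r, q2) < d2 by rewrite s0'; lra.
split.
  have [h3 _ _] := H1 q1.1.1.1 _ sd1.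
  have h4 := ler_normD (rhoN q1.1.1.1 (depth (r, q1)) + 2 - 2 * k q1.1.1.1 * depth (r, q1))
    (2 * k q1.1.1.1 * depth (r, q1)); rewrite subrK in h4.
  have h5 : `|2 * k q1.1.1.1 * depth (r, q1)| <= 2 * Km * depth (r, q1).
    rewrite normrM (gtr0_norm s0) ler_pM2r// normrM (@gtr0_norm _ 2)//.
    by rewrite ler_pM2l.
  have h6 : B * depth (r, q1) <= B * (2 * r) by rewrite ler_pM2l.
  rewrite ltr_pdivlMr// mulrC in rc.
  by rewrite /B in h6 rc; move: h3 h4 h5 h6 rc; lra.
have [h3 _ _] := H2 q1.1.1.1 q2.1.1.1 _ _ sd2 sd3.
have -> : rhoN q1.1.1.1 (depth (r, q1)) + 2 - (rhoN q2.1.1.1 (depth (r, q2)) + 2) =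
  rhoN q1.1.1.1 (depth (r, q1)) - rhoN q2.1.1.1 (depth (r, q2)) by ring.
have h4 : c * `|q1.1.1.1 - q2.1.1.1| <= c * `|q1 - q2| by rewrite ler_pM2l.
have h5 : C * `|depth (r, q1) - depth (r, q2)| <= C * r * `|q1 - q2|.
  by rewrite -mulrA ler_pM2l.
have h6 : C * r * `|q1 - q2| <= c * `|q1 - q2|.
  by rewrite ler_wpM2r// mulrC -ler_pdivlMr// ltW.
by move: h3 h4 h5 h6; lra.
Qed.

Lemma tiny_cB3 : tiny a cB3.
Proof.
move=> c c0; have c2 : 0 < c / 2 by rewrite divr_gt0.
have [d1 d10 H1] := rho_expansions F oOm gC3 rho_lim c0.
have [C C0 /(_ _ c2) [d2 d20 H2]] := rho_lipschitz F oOm gC3 rho_lim.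
pose eta := Num.min (Num.min (d1 / 2) (d2 / 2)) (1 / 2).
exists eta; first by rewrite /eta !lt_min !divr_gt0.
move=> r t q1 q2 /andP[r0]; rewrite !lt_min => /andP[/andP[rd1 rd2] r2] h1 h2.
have e2 : eta <= 1 / 2 by rewrite /eta !ge_min lexx ?orbT.
have [s0 sr _ _] := depth_bounds r0 e2 h1; have [s0' sr' _ _] := depth_bounds r0 e2 h2.
have [D1 _] := depth_lip q1 q2 r0.
have [D2 _ _ _ _] := pair_norms (lexx `|q1 - q2|).
rewrite /cB3 /= ?[(r, q1).2]/(q1) ?[(r, q2).2]/(q2).
have sd1 : 0 < depth (r, q1) < d1 by rewrite s0; lra.
have sd2 : 0 < depth (r, q1) < d2 by rewrite s0; lra.
have sd3 : 0 < depth (r, q2) < d2 by rewrite s0'; lra.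
split.
  have [_ h3 _] := H1 q1.1.1.1 _ sd1.
  apply: le_trans h3 _; rewrite -[leRHS]mulr1 ler_pM2l//; lra.
have [_ h3 _] := H2 q1.1.1.1 q2.1.1.1 _ _ sd2 sd3.
apply: le_trans h3 _.
have h4 : r * `|q1 - q2| <= 1 * `|q1 - q2| by rewrite ler_wpM2r//; lra.
have -> : c * `|q1 - q2| = c / 2 * (`|q1 - q2| + `|q1 - q2|) by field.
rewrite ler_pM2l//; apply: lerD => //; apply: le_trans D1 _; by rewrite mul1r in h4.
Qed.

Lemma tiny_bend : tiny a (fun p => depth p * k p.2.1.1.1).
Proof.
have [dk [Km Km0 [kd _ kM dkM]]] := curvature_bounds F.
have -> : (fun p => depth p * k p.2.1.1.1) = (fun p : P => p.1 * (p.2.1.1.2 * k p.2.1.1.1)).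
  by apply/funext => p; rewrite mulrA.
apply: tinyM; first exact: tiny_fst.
apply: tameM.
  exists 2 => //; exists 1 => // r t q1 q2 _ /near_base [_ h1 _ _ _] _ /=.
  have [_ h2 _ _ _] := pair_norms (lexx `|q1 - q2|).
  split; last by apply: le_trans h2 _; rewrite ler_peMl// ler1n.
  by have := ler_normD (q1.1.1.2 - 1) 1; rewrite subrK normr1; lra.
exists Km => //; exists 1 => // r t q1 q2 _ _ _ /=; split=> //.
have [h2 _ _ _ _] := pair_norms (lexx `|q1 - q2|).
apply: le_trans (_ : Km * `|q1.1.1.1 - q2.1.1.1| <= _); last by rewrite ler_pM2l.
by apply: (@mvt_le_sym R k dk) => u _.
Qed.

Lemma tame_inv (f : P -> R) : tiny a f -> tame a (fun p => (1 - f p)^-1).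
Proof.
have half0 : 0 < 1 / 2 :> R by [].
move=> /(_ _ half0) [eta eta0 H]; exists 2 => //; exists eta => // r t q1 q2 r0 h1 h2.
have [f1 f12] := H r t q1 q2 r0 h1 h2; have [f2 _] := H r t q2 q1 r0 h2 h1.
have lo x : `|x| <= 1 / 2 :> R -> 1 / 2 <= 1 - x by move=> /ler_normlP[]; lra.
have g1 := lo _ f1; have g2 := lo _ f2.
have p1 : 0 < 1 - f (r, q1) by apply: lt_le_trans g1.
have p2 : 0 < 1 - f (r, q2) by apply: lt_le_trans g2.
have i1 : (1 - f (r, q1))^-1 <= 2 by rewrite invf_ple ?posrE//; move: g1; lra.
have i2 : (1 - f (r, q2))^-1 <= 2 by rewrite invf_ple ?posrE//; move: g2; lra.
split; first by rewrite gtr0_norm// invr_gt0.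
have -> : (1 - f (r, q1))^-1 - (1 - f (r, q2))^-1 =
  (1 - f (r, q1))^-1 * (1 - f (r, q2))^-1 * (f (r, q1) - f (r, q2)).
  by field; rewrite !gt_eqF.
rewrite normrM gtr0_norm ?mulr_gt0 ?invr_gt0//.
apply: (@le_trans _ _ (2 * 2 * (1 / 2 * `|q1 - q2|))).
  apply: ler_pM => //; first by rewrite mulr_ge0// invr_ge0 ltW.
  by apply: ler_pM => //; rewrite invr_ge0 ltW.
by move: (normr_ge0 (q1 - q2)); lra.
Qed.

Lemma tiny_near (f h : P -> R) (e0 : R) : 0 < e0 ->
  (forall r t (q : S * S), 0 < r < e0 -> `|q - base2 a t| <= e0 -> f (r, q) = h (r, q)) ->
  tiny a f -> tiny a h.
Proof.
move=> e00 fh Hf c /Hf [e ep H]; exists (Num.min e e0); first by rewrite lt_min ep.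
move=> r t q1 q2 /andP[r0]; rewrite !lt_min !le_min => /andP[re re0] /andP[h1 h1'] /andP[h2 h2'].
by rewrite -!(fh r t)// ?r0//; apply: (H r t) => //; rewrite r0.
Qed.

Lemma tame_cJ : tame a cJ.
Proof. exact: tame_inv tiny_bend. Qed.

Lemma tiny_cJ : tiny a (fun p => cJ p - 1).
Proof.
have half0 : 0 < 1 / 2 :> R by [].
have [e0 e00 H] := tiny_bend half0.
apply: (tiny_near e00) (tinyM tiny_bend tame_cJ) => r t q r0 hq.
have [f1 _] := H r t q q r0 hq hq; rewrite /cJ.
have : 1 - depth (r, q) * k q.1.1.1 != 0 by move: f1 => /ler_normlP[] /= ? ?; rewrite gt_eqF//; lra.
move=> h /=; field; exact: h.
Qed.

End OneBody.

Section TwoBody.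
Variables (a sep : R).
Hypothesis sep0 : 0 < sep.
Hypothesis asep : 2 * sep <= a <= L - 2 * sep.

Lemma near_far t (q q' : S * S) e : e <= sep / 2 -> `|q - base2 a t| <= e ->
  `|q' - base2 a t| <= e -> far L sep q.1.1.1 q'.2.1.1.
Proof.
move=> es /near_base [h1 _ _ _ _] /near_base [_ _ _ h2 _].
move: asep => /andP[a1 a2]; move: h1 h2; rewrite !ler_norml => /andP[? ?] /andP[? ?].
by rewrite /far; apply/andP; split; lra.
Qed.

Lemma tiny_cG (ev ev' : R -> E) (Km : R) :
  (forall t : R, is_derive t 1 ev (ev' t)) -> (forall t, enorm (ev t) = 1) ->
  (forall t, enorm (ev' t) <= Km) -> tiny a (cG ev).
Proof.
move=> Dev ev1 evK c c0.
have [C1 [d1 d10 [C10 H1]]] := green_derivatives F oOm gC3 Hdecay Dev ev1 evK sep0.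
have [C2 [d2 d20 [C20 H2]]] := green_lipschitz F oOm gC3 Hdecay Dev ev1 evK sep0.
pose eta := Num.min (Num.min (Num.min (d1 / 2) (d2 / 2)) (Num.min (1 / 2) (sep / 2)))
  (Num.min (c / (2 * C1)) (c / (7 * C2))).
exists eta; first by rewrite /eta !lt_min !divr_gt0// ?mulr_gt0.
move=> r t q1 q2 /andP[r0]; rewrite !lt_min.
move=> /andP[/andP[/andP[rd1 rd2] /andP[r2 rs]] /andP[rC1 rC2]] h1 h2.
have e2 : eta <= 1 / 2 by rewrite /eta !ge_min lexx ?orbT.
have es : eta <= sep / 2 by rewrite /eta !ge_min lexx ?orbT.
have [s0 sr s0' sr'] := depth_bounds r0 e2 h1; have [z0 zr z0' zr'] := depth_bounds r0 e2 h2.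
have [D1 D1'] := depth_lip q1 q2 r0.
have [D2 _ _ D2' _] := pair_norms (lexx `|q1 - q2|).
have f11 := near_far es h1 h1; have f21 := near_far es h2 h1.
have f22 := near_far es h2 h2; rewrite /cG /=.
have lt1 x d : 0 < x -> x <= 2 * r -> r < d / 2 -> 0 < x < d.
  by move=> x0 x1 x2; rewrite x0; move: x1 x2; lra.
split.
  have [Dt [_ [_ [_ [h _ _ _ _]]]]] := H1 _ _ _ _ f11 (lt1 _ _ s0 sr rd1) (lt1 _ _ s0' sr' rd1).
  apply: le_trans h _; rewrite mulrC -ler_pdivlMr//; apply: le_trans sr' _.
  have -> : c / C1 = 2 * (c / (2 * C1)) by field; rewrite gt_eqF.
  by rewrite ler_pM2l// ltW.
have rd : 2 * r < d2 by move: rd2; lra.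
have i x : 0 < x -> x <= 2 * r -> 0 < x <= 2 * r by move=> ->.
have h := H2 _ _ _ _ _ _ _ _ _ f11 f21 f22 rd (i _ s0 sr) (i _ s0' sr') (i _ z0 zr) (i _ z0' zr').
apply: le_trans h _; set D := `|q1 - q2|.
apply: (@le_trans _ _ (C2 * (2 * r * (D + D + D) + r * D))).
  rewrite ler_pM2l//; apply: lerD => //; rewrite ler_pM2l ?mulr_gt0//.
  apply: lerD => //; apply: lerD => //; apply: le_trans D1 _.
  by rewrite ler_piMl//; move: r2; lra.
have -> : C2 * (2 * r * (D + D + D) + r * D) = (r * (7 * C2)) * D by ring.
apply: ler_wpM2r; first exact: normr_ge0.
by rewrite -ler_pdivlMr ?mulr_gt0// ltW.
Qed.

Lemma tiny_cGn : tiny a (cG nrm).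
Proof.
have [dk [Km Km0 [_ _ kM _]]] := curvature_bounds F.
apply: (@tiny_cG nrm (fun t => k t *: tg t) Km (frame_dnrm F)) => t.
  exact: enorm_unit (frame_unit F t).
by rewrite enormZ (enorm_unit (unit_tg F t)) mulr1.
Qed.

Lemma tiny_cGt : tiny a (cG (fun t => tg t)).
Proof.
have [dk [Km Km0 [_ _ kM _]]] := curvature_bounds F.
apply: (@tiny_cG _ (fun t => - k t *: nrm t) Km (is_derive_tg F)) => t.
  exact: enorm_unit (unit_tg F t).
by rewrite enormZ (enorm_unit (frame_unit F t)) mulr1 normrN.
Qed.

End TwoBody.

End Coefficients.

(*PART 17*)
Section Kernel.
Context {R : realType}.
Local Notation E := ('cV[R]_2).
Local Notation S := (R * R * R)%type.
Local Notation P := (R * (S * S))%type.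
Variables (Om Gam : set E) (L : R) (gam nrm : R -> E) (k : R -> R).
Hypothesis F : frame Om Gam L gam nrm k.
Let L0 := frame_L F.
Local Notation tg t := (rot90 (nrm t)).
Local Notation X := (tube gam nrm).
Variable g : E -> E -> R.
Hypothesis oOm : open Om.
Hypothesis gC3 : Ck 3 (Om `*` Om) (fun wz : E * E => g wz.1 wz.2).
Hypothesis gsym : forall w z, Om w -> Om z -> g w z = g z w.
Local Notation rho := (rhofun g).
Hypothesis rho_lim : forall t,
  [/\ rho z @[z --> within Om (nbhs (gam t))] --> (0 : R),
      grad rho z @[z --> within Om (nbhs (gam t))] --> - (2 *: nrm t) &
      hess rho z @[z --> within Om (nbhs (gam t))] --> (- (2 * k t))%:M].
Hypothesis Hdecay : green_decay Om gam nrm g.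
Local Notation rhoN := (rhoN gam nrm g).
Local Notation rhoT := (rhoT gam nrm g).
Local Notation depth := (@depth R).
Local Notation depth' := (@depth' R).
Local Notation cJ := (cJ k).
Local Notation cB1 := (cB1 gam nrm g).
Local Notation cB2 := (cB2 gam nrm g).
Local Notation cB3 := (cB3 gam nrm g).
Local Notation Gn := (cG gam nrm g nrm).
Local Notation Gt := (cG gam nrm g (fun t => tg t)).
Variable n : nat.

Definition tau (j : 'I_n.+1) : R := j%:R * L / n.+1%:R.

Definition q_self (p : P) : R := cJ p * (1 + cB2 p) * (p.2.1.2)^-1 - 2 + p.2.1.2.
Definition q_pair (p : P) : R := p.1 * (- (4 * pi) * cJ p * Gn p).
Definition e_pair (p : P) : R := - (2 * pi) * (cB3 p * Gn p + 2 * (1 + cB2 p) * Gt p).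

Definition rkernel (i : 'I_3) (j : 'I_n.+1) (p : P) : R :=
  if j == ord0 then
    (if i == 0 then q_self p else if i == 1 then 0 else cB1 p)
  else (if i == 0 then q_pair p else if i == 1 then e_pair p else 0).

Let tubeL' t s : X (t + L) s = X t s.
Proof. exact: tubeL F t s. Qed.

Lemma kernel_periodic i j p : rkernel i j (p + (0, ((L, 0, 0), (L, 0, 0)))) = rkernel i j p.
Proof.
move: p => [r [[[th sg] m] [[th' sg'] m']]].
have -> : ((r, ((th, sg, m), (th', sg', m'))) + (0, ((L, 0, 0), (L, 0, 0))) : P) =
  (r, ((th + L, sg, m), (th' + L, sg', m'))).
  by congr (_, ((_, _, _), (_, _, _))); rewrite /= addr0.
have cGE ev : (forall t, ev (t + L) = ev t) ->
    cG gam nrm g ev (r, ((th + L, sg, m), (th' + L, sg', m'))) =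
    cG gam nrm g ev (r, ((th, sg, m), (th', sg', m'))).
  by move=> evL; rewrite /cG /greenE /= !tubeL' evL.
have rE : rot90 (nrm (th + L)) = rot90 (nrm th) by rewrite (frame_nrmL F).
rewrite /rkernel /q_self /q_pair /e_pair /cJ /cB1 /cB2 /cB3 /Submission.rhoN /Submission.rhoT /= !tubeL'.
rewrite (frame_kL F) (frame_nrmL F) !cGE//.
  by move=> t; rewrite (frame_nrmL F).
exact: frame_nrmL F.
Qed.

Definition sep : R := L / (4 * n.+1%:R).

Lemma sep_gt0 : 0 < sep.
Proof. by rewrite divr_gt0// mulr_gt0// ltr0n. Qed.

Lemma tau_sep (j : 'I_n.+1) : j != ord0 -> 2 * sep <= tau j <= L - 2 * sep.
Proof.
move=> j0; have N0 : 0 < n.+1%:R :> R by rewrite ltr0n.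
have j1 : 1 <= j%:R :> R by rewrite ler1n lt0n.
have j2 : j%:R <= n.+1%:R - 1 :> R.
  by rewrite lerBrDr -natr1 lerD2r ler_nat -ltnS.
have E1 : 2 * sep = L / n.+1%:R / 2 by rewrite /sep; field; rewrite gt_eqF.
have E2 : tau j = j%:R * (L / n.+1%:R) by rewrite /tau mulrA.
have E3 : L = n.+1%:R * (L / n.+1%:R) by field; rewrite gt_eqF.
have x0 : 0 < L / n.+1%:R by rewrite divr_gt0.
rewrite E1 E2 [X in X - _]E3; move: (L / n.+1%:R) x0 => x x0.
have h1 : x <= j%:R * x by rewrite ler_peMl// ltW.
have h2 : j%:R * x <= (n.+1%:R - 1) * x by rewrite ler_pM2r.
by apply/andP; split; move: h1 h2; lra.
Qed.

Lemma tiny0 a : tiny a (fun=> 0 : R).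
Proof.
by move=> c c0; exists 1 => // r t q1 q2 _ _ _; rewrite subrr normr0; split;
  [exact: ltW|rewrite mulr_ge0// ltW].
Qed.

Lemma tame_B2 a : tame a (fun p => 1 + cB2 p).
Proof.
apply: tameD; first exact: tame_cst.
exact: tiny_tame (tiny_cB2 F oOm gC3 rho_lim a).
Qed.

Lemma tiny_q_self a : tiny a q_self.
Proof.
have h0 : 0 < 1 / 2 :> R by [].
have h : tiny a (fun p : P => ((cJ p - 1) * (1 + cB2 p) + (cB2 p +
    (p.2.1.2 - 1) * (p.2.1.2 - 1))) * (p.2.1.2)^-1).
  apply: tinyM (tame_level_inv a); apply: tinyD.
    apply: tinyM (tame_B2 a); exact: tiny_cJ F a.
  apply: tinyD; first exact: (tiny_cB2 F oOm gC3 rho_lim a).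
  exact: vanishingM (vanishing_level a) (vanishing_level a).
apply: (tiny_near h0) h => r t q r0 /near_base [_ _ hm _ _]; rewrite /q_self /=.
have m0 : q.1.2 != 0 by move: hm => /ler_normlP[] ? ?; rewrite gt_eqF//; lra.
by move: (cJ _) (cB2 _) m0 => x y m0; field.
Qed.

Lemma tiny_pairs (j : 'I_n.+1) : j != ord0 ->
  tiny (tau j) q_pair /\ tiny (tau j) e_pair.
Proof.
move=> /tau_sep js.
have hn := tiny_cGn F oOm gC3 Hdecay sep_gt0 js.
have ht := tiny_cGt F oOm gC3 Hdecay sep_gt0 js.
split.
  apply: tinyM (tiny_fst _) _; apply: tameM (tiny_tame hn).
  by apply: tameM; [exact: tame_cst|exact: tame_cJ F _].
have -> : e_pair = (fun p => (cB3 p * Gn p + Gt p * (2 * (1 + cB2 p))) * (- (2 * pi))).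
  by apply/funext => p; rewrite /e_pair; ring.
apply: tinyM (tame_cst _ _); apply: tinyD.
  exact: tinyM (tiny_cB3 F oOm gC3 rho_lim _) (tiny_tame hn).
by apply: tinyM ht _; apply: tameM; [exact: tame_cst|exact: tame_B2].
Qed.

Lemma tiny_kernel i j : tiny (tau j) (rkernel i j).
Proof.
rewrite /rkernel; have [j0|j0] := eqVneq j ord0.
  have h := tiny_cB1 F oOm gC3 rho_lim (tau j).
  have [_|_] := eqVneq i 0; first exact: tiny_q_self.
  by have [_|_] := eqVneq i 1; first exact: tiny0.
have [h1 h2] := tiny_pairs j0.
by case: (i == 0) => //; case: (i == 1) => //; exact: tiny0.
Qed.

Lemma kernel_lipschitz : sources_lipschitz tau rkernel.
Proof.
move=> c c0.
have [|ij|eta eta0 H] := @common_radius R ('I_3 * 'I_n.+1)%type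
  (fun ij eta => bounds (tau ij.2) (rkernel ij.1 ij.2) c c eta).
- by move=> ij d d' _ d'd; exact: bounds_le.
- exact: tiny_kernel.
exists eta => // r i j t y1 y1' y2 y2' r0 h1 h2 h1' h2'.
have nb (y y' : S) : `|y - base t| <= eta -> `|y' - base (t + tau j)| <= eta ->
    `|(y, y') - base2 (tau j) t| <= eta.
  by move=> h h'; rewrite prod_normE ge_max; apply/andP; split.
have [_ h] := H (i, j) r t (y1, y1') (y2, y2') r0 (nb _ _ h1 h1') (nb _ _ h2 h2').
by rewrite prod_normE in h.
Qed.

Lemma kernel_small : sources_small tau rkernel.
Proof.
move=> c c0.
have [|ij|eta eta0 H] := @common_radius R ('I_3 * 'I_n.+1)%type
  (fun ij eta => bounds (tau ij.2) (rkernel ij.1 ij.2) c c eta).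
- by move=> ij d d' _ d'd; exact: bounds_le.
- exact: tiny_kernel.
exists eta => // r i j t r0.
have h0 : `|base2 (tau j) t - base2 (tau j) t| <= eta by rewrite subrr normr0 ltW.
by have [] := H (i, j) r t (base2 (tau j) t) (base2 (tau j) t) r0 h0 h0.
Qed.

End Kernel.

(*PART 18*)
Section Projections.
Context {R : realType} {V W Z : normedModType R}.

Lemma sdiff_proj1 (f : V -> W * Z) (p : V) : sdiff f p -> sdiff (fun x => (f x).1) p.
Proof. by move=> sf; apply: (sdiff_comp (f := fun y : W * Z => y.1) (sdiff_fst (f p)) sf). Qed.

Lemma sdiff_proj2 (f : V -> W * Z) (p : V) : sdiff f p -> sdiff (fun x => (f x).2) p.
Proof. by move=> sf; apply: (sdiff_comp (f := fun y : W * Z => y.2) (sdiff_snd (f p)) sf). Qed.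

End Projections.

Section KernelRegularity.
Context {R : realType}.
Local Notation E := ('cV[R]_2).
Local Notation S := (R * R * R)%type.
Local Notation P := (R * (S * S))%type.
Variables (Om Gam : set E) (L : R) (gam nrm : R -> E) (k : R -> R).
Hypothesis F : frame Om Gam L gam nrm k.
Let L0 := frame_L F.
Local Notation tg t := (rot90 (nrm t)).
Local Notation X := (tube gam nrm).
Variable g : E -> E -> R.
Hypothesis oOm : open Om.
Hypothesis gC3 : Ck 3 (Om `*` Om) (fun wz : E * E => g wz.1 wz.2).
Hypothesis gsym : forall w z, Om w -> Om z -> g w z = g z w.
Local Notation rho := (rhofun g).
Hypothesis rho_lim : forall t,
  [/\ rho z @[z --> within Om (nbhs (gam t))] --> (0 : R),
      grad rho z @[z --> within Om (nbhs (gam t))] --> - (2 *: nrm t) &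
      hess rho z @[z --> within Om (nbhs (gam t))] --> (- (2 * k t))%:M].
Hypothesis Hdecay : green_decay Om gam nrm g.
Local Notation rhoN := (rhoN gam nrm g).
Local Notation rhoT := (rhoT gam nrm g).
Local Notation depth := (@depth R).
Local Notation depth' := (@depth' R).
Local Notation cJ := (cJ k).
Local Notation cB1 := (cB1 gam nrm g).
Local Notation cB2 := (cB2 gam nrm g).
Local Notation cB3 := (cB3 gam nrm g).
Local Notation Gn := (cG gam nrm g nrm).
Local Notation Gt := (cG gam nrm g (fun t => tg t)).
Variable n : nat.
Local Notation tau := (@tau R L n).
Local Notation rkernel := (@rkernel R gam nrm k g n).
Local Notation q_self := (q_self gam nrm k g).
Local Notation q_pair := (q_pair gam nrm k g).
Local Notation e_pair := (e_pair gam nrm g).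

Definition position (p : P) : E := X p.2.1.1.1 (depth p).
Definition position' (p : P) : E := X p.2.2.1.1 (depth' p).

Definition regular (p : P) : Prop :=
  [/\ Om (position p), 1 - depth p * k p.2.1.1.1 != 0, p.2.1.2 != 0 & p.1 != 0].

Lemma coords_sdiff (p : P) :
  [/\ sdiff (fun p : P => p.1 : R^o) p, sdiff (fun p : P => p.2.1.1.1 : R^o) p,
      sdiff (fun p : P => p.2.1.1.2 : R^o) p, sdiff (fun p : P => p.2.1.2 : R^o) p &
      sdiff (fun p : P => p.2.2.1.1 : R^o) p /\ sdiff (fun p : P => p.2.2.1.2 : R^o) p].
Proof.
have s0 : sdiff (fun p : P => p) p by exact: sdiff_id.
have s2 := @sdiff_proj2 R P R^o (S * S)%type _ p s0.
have s21 := @sdiff_proj1 R P S S _ p s2; have s22 := @sdiff_proj2 R P S S _ p s2.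
have t1 := @sdiff_proj1 R P (R^o * R^o)%type R^o _ p s21.
have t2 := @sdiff_proj1 R P (R^o * R^o)%type R^o _ p s22.
split.
- exact: (@sdiff_proj1 R P R^o (S * S)%type _ p s0).
- exact: (@sdiff_proj1 R P R^o R^o _ p t1).
- exact: (@sdiff_proj2 R P R^o R^o _ p t1).
- exact: (@sdiff_proj2 R P (R^o * R^o)%type R^o _ p s21).
- split; first exact: (@sdiff_proj1 R P R^o R^o _ p t2).
  exact: (@sdiff_proj2 R P R^o R^o _ p t2).
Qed.

Lemma depth_sdiff p : sdiff (fun p => depth p : R^o) p /\ sdiff (fun p => depth' p : R^o) p.
Proof.
have [s1 _ s3 _ [_ s5]] := coords_sdiff p.
by split; apply: sdiffM.
Qed.

Lemma curve_sdiff (t : R) :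
  [/\ sdiff (gam : R^o -> E) t, sdiff (nrm : R^o -> E) t & sdiff (k : R^o -> R^o) t].
Proof.
have [dk [Km Km0 [kd ck _ _]]] := curvature_bounds F.
have cn s : {for s, continuous nrm} := is_derive_continuous (frame_dnrm F s).
have ci (x : R -> E) i s : {for s, continuous x} -> {for s, continuous (fun s => x s i 0)}.
  move=> cx; apply: (@continuous_comp _ _ _ x (fun u : E => u i 0)) => //.
  exact: coord_continuous.
split.
- apply: sdiff_col => i.
  apply: (@sdiff_C1 R (fun t => gam t i 0) (fun t => tg t i 0) t 1) => //.
    by move=> x _; exact: (is_derive_col _ _ _).1 (frame_dgam F x) i.
  by apply: ci; exact: is_derive_continuous (is_derive_tg F t).
- apply: sdiff_col => i.
  apply: (@sdiff_C1 R (fun t => nrm t i 0) (fun t => (k t *: tg t) i 0) t 1) => //.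
    by move=> x _; exact: (is_derive_col _ _ _).1 (frame_dnrm F x) i.
  apply: ci; apply: (continuousZ (s := k) (f := fun t => tg t)).
    exact: is_derive_continuous (kd t).
  exact: is_derive_continuous (is_derive_tg F t).
- by apply: (@sdiff_C1 R k dk t 1) => //; exact: ck.
Qed.

Lemma frame_sdiff (p : P) :
  [/\ sdiff position p, sdiff position' p, sdiff (fun p : P => nrm p.2.1.1.1) p,
      sdiff (fun p : P => k p.2.1.1.1 : R^o) p & sdiff (fun p : P => tg p.2.1.1.1) p].
Proof.
have [_ sth _ _ [sth' _]] := coords_sdiff p; have [sd sd'] := depth_sdiff p.
have [g1 n1 k1] := curve_sdiff p.2.1.1.1; have [g2 n2 _] := curve_sdiff p.2.2.1.1.
have c1 (W : normedModType R) (f : R^o -> W) (sf : sdiff f p.2.1.1.1) :=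
  @sdiff_comp R P R^o W f (fun p : P => p.2.1.1.1) p sf sth.
have c2 (W : normedModType R) (f : R^o -> W) (sf : sdiff f p.2.2.1.1) :=
  @sdiff_comp R P R^o W f (fun p : P => p.2.2.1.1) p sf sth'.
have sn := c1 _ _ n1; split.
- by apply: sdiffB; [exact: c1 _ _ g1|apply: sdiffZ].
- by apply: sdiffB; [exact: c2 _ _ g2|apply: sdiffZ => //; exact: c2 _ _ n2].
- exact: sn.
- exact: c1 _ _ k1.
- apply: sdiff_col => i; case: (ord2P i) => ->.
    apply: (@sdiff_near _ _ _ (fun p : P => - nrm p.2.1.1.1 1 0 : R^o)).
      by apply/near_ballP; exists 1 => // y _; rewrite rot90E.
    by apply: sdiffN; exact: sdiff_coord sn.
  apply: (@sdiff_near _ _ _ (fun p : P => nrm p.2.1.1.1 0 0 : R^o)).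
    by apply/near_ballP; exists 1 => // y _; rewrite rot90E.
  exact: sdiff_coord sn.
Qed.

Lemma self_sdiff p : regular p ->
  [/\ sdiff (fun p => cJ p : R^o) p, sdiff (fun p => cB1 p : R^o) p,
      sdiff (fun p => cB2 p : R^o) p, sdiff (fun p => cB3 p : R^o) p &
      sdiff (fun p => grad rho (position p)) p].
Proof.
move=> [OX J0 m0 r0]; have [sr sth _ sm _] := coords_sdiff p; have [sd _] := depth_sdiff p.
have [sX _ sn sk st] := frame_sdiff p.
have c (b : R) := @sdiff_cst R P R^o b p.
have sg : sdiff (fun p => grad rho (position p)) p.
  by apply: sdiff_col => i; exact: (sdiff_comp (g := position) (grad_rho_sdiff oOm gC3 i OX) sX).
split.
- apply: sdiffV => //; apply: sdiffB; first exact: c.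
  by apply: sdiffM.
- apply: sdiffM.
    apply: sdiffB; first exact: (sdiff_comp (g := position) (rhofun_sdiff oOm gC3 OX) sX).
    by apply: sdiffM; [exact: c|].
  apply: sdiffV; first by rewrite mulf_neq0// pnatr_eq0.
  by apply: sdiffM; [exact: c|].
- apply: sdiffM; last exact: c.
  by apply: sdiffD; [exact: sdiff_dot sg sn|exact: c].
- exact: sdiff_dot sg st.
- exact: sg.
Qed.

Lemma pair_sdiff p : offdiag Om (position p, position' p) ->
  [/\ sdiff (fun p => Gn p : R^o) p, sdiff (fun p => Gt p : R^o) p &
      sdiff (fun p => grad1 g (position p) (position' p)) p].
Proof.
move=> inO; have [sX sX' sn _ st] := frame_sdiff p.
have sg : sdiff (fun p => grad1 g (position p) (position' p)) p.
  apply: sdiff_col => i.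
  exact: (sdiff_comp (f := fun q : E * E => grad1 g q.1 q.2 i 0 : R^o)
    (g := fun p => (position p, position' p)) (grad1_sdiff oOm gC3 i inO) (sdiff_pair sX sX')).
by split=> //; [exact: sdiff_dot sg sn|exact: sdiff_dot sg st].
Qed.

Lemma kernel_sdiff (i : 'I_3) (j : 'I_n.+1) p : regular p ->
  (j != ord0 -> offdiag Om (position p, position' p)) ->
  sdiff (rkernel i j : P -> R^o) p.
Proof.
move=> rp; have [sJ s1 s2 s3 _] := self_sdiff rp; have [_ _ m0 _] := rp.
have [sr _ _ sm _] := coords_sdiff p; have c (b : R) := @sdiff_cst R P R^o b p.
rewrite /rkernel; have [_ _|_ /(_ isT) /pair_sdiff [sn st _]] := eqVneq j ord0.
  have [_|_] := eqVneq i 0.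
    apply: (@sdiffD R P R^o) => //; apply: (@sdiffB R P R^o); last exact: c.
    apply: sdiffM; last exact: sdiffV.
    by apply: sdiffM => //; apply: (@sdiffD R P R^o) => //; exact: c.
  by have [_|_] := eqVneq i 1; [exact: c|].
have [_|_] := eqVneq i 0.
  by apply: sdiffM => //; apply: sdiffM => //; apply: sdiffM => //; exact: c.
have [_|_] := eqVneq i 1; last exact: c.
apply: sdiffM; first exact: c.
apply: (@sdiffD R P R^o); first exact: sdiffM.
apply: sdiffM => //; apply: sdiffM; first exact: c.
by apply: (@sdiffD R P R^o) => //; exact: c.
Qed.

(** All points of the construction stay in the region of regularity. *)
Lemma regular_near : exists2 eta : R, 0 < eta & forall r t (j : 'I_n.+1) (q : S * S),
  0 < r < eta -> `|q - base2 (tau j) t| <= eta ->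
  regular (r, q) /\ (j != ord0 -> offdiag Om (position (r, q), position' (r, q))).
Proof.
have half0 : 0 < 1 / 2 :> R by [].
have [|j|e0 e00 H] := @common_radius R 'I_n.+1 (fun j eta => bounds (tau j)
   (fun p : P => depth p * k p.2.1.1.1) (1 / 2) (1 / 2) eta).
- by move=> j d d' _ d'd; exact: bounds_le.
- exact: (tiny_bend F (tau j) half0).
have [s1 s10 Hin] := tube_inside F.
have sp := sep_gt0 F n.
have [C [d d0 [C0 Hf]]] := green_far F Hdecay sp.
pose eta := Num.min (Num.min (1 / 2) (s1 / 2)) (Num.min (Num.min e0 (sep L n / 2)) (d / 2)).
have [l1 l2 l3 l4 l5] : [/\ eta <= 1 / 2, eta <= s1 / 2, eta <= e0, eta <= sep L n / 2 & eta <= d / 2].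
  by rewrite /eta !ge_min !lexx ?orbT.
exists eta; first by rewrite /eta !lt_min e00 !divr_gt0.
move=> r t j q /andP[r0 re] hq.
have [z0 zr z0' zr'] := depth_bounds r0 l1 hq.
have [_ _ hm _ _] := near_base hq.
have ltd (x D : R) : eta <= D / 2 -> 0 < x -> x <= 2 * r -> 0 < x < D.
  by move=> h -> h'; move: re h h'; lra.
have hq0 : `|q - base2 (tau j) t| <= e0 by apply: le_trans l3.
have r0e : 0 < r < e0 by rewrite r0 (lt_le_trans re).
split.
  split.
  - exact: Hin (ltd _ _ l2 z0 zr).
  - have [h _] := H j r t q q r0e hq0 hq0.
    by move: h => /ler_normlP[] /= ? ?; rewrite gt_eqF//; lra.
  - by move: hm => /ler_normlP[] ? ?; rewrite gt_eqF//; move: l1; lra.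
  - by rewrite gt_eqF.
move=> /(tau_sep F) js; have f := near_far js l4 hq hq.
by have [_ _ _ inO _] := Hf _ _ _ _ f (ltd _ _ l5 z0 zr) (ltd _ _ l5 z0' zr').
Qed.

Lemma kernel_smooth : sources_smooth tau rkernel.
Proof.
have [eta eta0 H] := regular_near; exists eta => // r i j t y y' r0 h h'.
have hq : `|(y, y') - base2 (tau j) t| <= eta.
  by rewrite prod_normE ge_max; apply/andP; split.
by have [h1 h2] := H r t j (y, y') r0 hq; exact: kernel_sdiff.
Qed.

End KernelRegularity.

(*PART 19*)
Section Sizes.
Context {R : realType}.
Local Notation E := ('cV[R]_2).
Local Notation S := (R * R * R)%type.
Local Notation P := (R * (S * S))%type.
Variables (Om Gam : set E) (L : R) (gam nrm : R -> E) (k : R -> R).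
Hypothesis F : frame Om Gam L gam nrm k.
Let L0 := frame_L F.
Local Notation tg t := (rot90 (nrm t)).
Local Notation X := (tube gam nrm).
Variable g : E -> E -> R.
Hypothesis oOm : open Om.
Hypothesis gC3 : Ck 3 (Om `*` Om) (fun wz : E * E => g wz.1 wz.2).
Hypothesis gsym : forall w z, Om w -> Om z -> g w z = g z w.
Local Notation rho := (rhofun g).
Hypothesis rho_lim : forall t,
  [/\ rho z @[z --> within Om (nbhs (gam t))] --> (0 : R),
      grad rho z @[z --> within Om (nbhs (gam t))] --> - (2 *: nrm t) &
      hess rho z @[z --> within Om (nbhs (gam t))] --> (- (2 * k t))%:M].
Hypothesis Hdecay : green_decay Om gam nrm g.
Local Notation rhoN := (rhoN gam nrm g).
Local Notation rhoT := (rhoT gam nrm g).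
Local Notation depth := (@depth R).
Local Notation depth' := (@depth' R).
Local Notation cJ := (cJ k).
Local Notation cB1 := (cB1 gam nrm g).
Local Notation cB2 := (cB2 gam nrm g).
Local Notation cB3 := (cB3 gam nrm g).
Local Notation Gn := (cG gam nrm g nrm).
Local Notation Gt := (cG gam nrm g (fun t => tg t)).
Variable n : nat.
Local Notation tau := (@tau R L n).
Local Notation rkernel := (@rkernel R gam nrm k g n).
Local Notation q_self := (q_self gam nrm k g).
Local Notation q_pair := (q_pair gam nrm k g).
Local Notation e_pair := (e_pair gam nrm g).

Lemma self_sizes (e : R) : 0 < e -> exists2 d : R, 0 < d & forall a r t (q : S * S),
  0 < r < d -> `|q - base2 a t| <= 1 / 2 ->
  [/\ `|cJ (r, q) * (1 + cB2 (r, q)) - 1| <= e * r, `|cB3 (r, q)| <= e * r,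
      `|cB1 (r, q) + k q.1.1.1 * q.1.1.2 ^+ 2 * r / 2| <= e * r,
      `|cJ (r, q)| <= 2 & `|1 + cB2 (r, q)| <= 2].
Proof.
move=> e0; have e2 : 0 < e / 2 by rewrite divr_gt0.
have [dk [Km Km0 [_ _ kM _]]] := curvature_bounds F.
have [d d0 H] := rho_expansions F oOm gC3 rho_lim e2.
exists (Num.min (Num.min (d / 2) (1 / (4 * Km))) (1 / e)).
  by rewrite !lt_min !divr_gt0// mulr_gt0.
move=> a r t q /andP[r0]; rewrite !lt_min => /andP[/andP[rd rK] re] hq.
have [z0 zr _ _] := depth_bounds r0 (lexx _) hq.
have zd : 0 < depth (r, q) < d by rewrite z0; move: rd zr; lra.
have [h1 h2 h3] := H q.1.1.1 _ zd.
have ez : e / 2 * depth (r, q) <= e * r.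
  by apply: (@le_trans _ _ (e / 2 * (2 * r))); [rewrite ler_pM2l|rewrite le_eqVlt; apply/orP; left; apply/eqP; field].
have xb : `|depth (r, q) * k q.1.1.1| <= 1 / 2.
  rewrite normrM (gtr0_norm z0); apply: (@le_trans _ _ (2 * r * Km)).
    by apply: ler_pM => //; exact: ltW.
  by move: rK; rewrite ltr_pdivlMr ?mulr_gt0//; lra.
have J2 : 1 / 2 <= 1 - depth (r, q) * k q.1.1.1.
  by move: xb => /ler_normlP[]; lra.
have Jp : 0 < 1 - depth (r, q) * k q.1.1.1 by apply: lt_le_trans J2.
have Jb : `|cJ (r, q)| <= 2.
  rewrite /cJ /= gtr0_norm ?invr_gt0// invf_ple ?posrE//; last by move: J2; lra.
split=> //.
- have -> : cJ (r, q) * (1 + cB2 (r, q)) - 1 =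
    cJ (r, q) * ((rhoN q.1.1.1 (depth (r, q)) + 2 - 2 * k q.1.1.1 * depth (r, q)) * (- 1 / 2)).
    rewrite /cJ /cB2 /=; move: Jp; move: (rhoN _ _) => x Jp.
    by move: (depth _) (k _) Jp => y z Jp; field; rewrite gt_eqF.
  rewrite normrM; apply: (@le_trans _ _ (2 * (e / 2 * depth (r, q) / 2))).
    apply: ler_pM => //; rewrite normrM mulN1r normrN (@gtr0_norm _ 2^-1)//.
    by rewrite ler_pM2r.
  by move: ez; lra.
- exact: le_trans ez.
- have r2 : 0 < 2 * r by rewrite mulr_gt0.
  have -> : cB1 (r, q) + k q.1.1.1 * q.1.1.2 ^+ 2 * r / 2 =
    (rho (X q.1.1.1 (depth (r, q))) - 2 * depth (r, q) + k q.1.1.1 * depth (r, q) ^+ 2) *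
    (2 * r)^-1.
    rewrite /cB1 /=; move: (rho _) => x; rewrite /Submission.depth /=.
    by move: (k _) => y; field; rewrite gt_eqF.
  rewrite normrM normfV (gtr0_norm r2) ler_pdivrMr//; apply: le_trans h3 _.
  rewrite expr2 mulrA; apply: (@le_trans _ _ (e * r * depth (r, q))).
    by rewrite ler_pM2r.
  by rewrite ler_pM2l// mulr_gt0.
- have er : e * r <= 1 by rewrite mulrC -ler_pdivlMr// ltW.
  have h4 := ler_normD (rhoN q.1.1.1 (depth (r, q)) + 2 - 2 * k q.1.1.1 * depth (r, q))
    (2 * k q.1.1.1 * depth (r, q)); rewrite subrK in h4.
  have h4' : `|2 * k q.1.1.1 * depth (r, q)| <= 1.
    rewrite -mulrA [k _ * _]mulrC normrM (@gtr0_norm _ 2)//; move: xb; lra.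
  have h5 := ler_normD 1 (cB2 (r, q)); rewrite normr1 in h5.
  have h6 : `|cB2 (r, q)| = `|rhoN q.1.1.1 (depth (r, q)) + 2| / 2.
    by rewrite /cB2 normrM mulN1r normrN (@gtr0_norm _ 2^-1).
  by rewrite h6 in h5; move: h1 h4 h4' h5 ez er; lra.
Qed.

Lemma pair_sizes : exists C : R, exists2 d : R, 0 < d & 0 < C /\ forall (j : 'I_n.+1) r t (q : S * S),
  j != ord0 -> 0 < r < d -> `|q - base2 (tau j) t| <= d ->
  `|Gn (r, q)| <= C * r /\ `|Gt (r, q)| <= C * r ^+ 2.
Proof.
have sp := sep_gt0 F n.
have [C1 [d1 d10 [C10 H1]]] := green_far F Hdecay sp.
have [C2 [d2 d20 [C20 H2]]] := green_tangential F oOm gC3 gsym Hdecay sp.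
pose d := Num.min (Num.min (d1 / 2) (d2 / 2)) (Num.min (1 / 2) (sep L n / 2)).
have [l1 l2 l3 l4] : [/\ d <= d1 / 2, d <= d2 / 2, d <= 1 / 2 & d <= sep L n / 2].
  by rewrite /d !ge_min !lexx ?orbT.
exists (2 * C1 + 4 * C2), d; first by rewrite /d !lt_min !divr_gt0.
split; first by rewrite addr_gt0// mulr_gt0.
move=> j r t q j0 /andP[r0 rd] hq; have js := tau_sep F j0.
have f := near_far js l4 hq hq; have [z0 zr z0' zr'] := depth_bounds r0 l3 hq.
have ltd (x D : R) : d <= D / 2 -> 0 < x -> x <= 2 * r -> 0 < x < D.
  by move=> h -> h'; move: rd h h'; lra.
have [_ _ _ _ [_ [b1 _ _ _]]] := H1 _ _ _ _ f (ltd _ _ l1 z0 zr) (ltd _ _ l1 z0' zr').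
have b2 := H2 _ _ _ _ f (ltd _ _ l2 z0 zr) (ltd _ _ l2 z0' zr').
have c1r : 0 < C1 * r by rewrite mulr_gt0.
have c2r : 0 < C2 * r by rewrite mulr_gt0.
split; rewrite /cG /greenE /=.
  apply: le_trans (dot_le _ _) _; rewrite (enorm_unit (frame_unit F _)) mulr1.
  apply: le_trans b1 _; apply: (@le_trans _ _ (C1 * (2 * r))); first by rewrite ler_pM2l.
  by move: c1r c2r; lra.
apply: le_trans b2 _; apply: (@le_trans _ _ (C2 * (2 * r * (2 * r)))).
  by rewrite ler_pM2l//; apply: ler_pM => //; exact: ltW.
rewrite -subr_ge0 (_ : _ - _ = 2 * (C1 * r ^+ 2)); last by ring.
by rewrite mulr_ge0// mulr_ge0 ?sqr_ge0// ltW.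
Qed.

(** The kernel is of order r, and the phase and level sources of order o(r) as
soon as the level m is within O(r) of 1. *)
Lemma kernel_sizes : exists C : R, exists2 d : R, 0 < d & 0 < C /\
  (forall i (j : 'I_n.+1) r t, 0 < r < d -> `|rkernel i j (r, base2 (tau j) t)| <= C * r) /\
  forall (M e : R), 0 < M -> 0 < e -> exists2 d' : R, 0 < d' & forall i (j : 'I_n.+1) r t (q : S * S),
    i != 2 -> 0 < r < d' -> `|q - base2 (tau j) t| <= d -> `|q.1.2 - 1| <= M * r ->
    `|rkernel i j (r, q)| <= e * r.
Proof.
have [dk [Km Km0 [_ _ kM _]]] := curvature_bounds F.
have [d1 d10 H1] := self_sizes ltr01.
have [C2 [d2 d20 [C20 H2]]] := pair_sizes.
pose p4 : R := 4 * pi; have p40 : 0 < p4 by rewrite mulr_gt0// pi_gt0.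
(* sizes of the pair terms *)
have Hpair j r t (q : S * S) : j != ord0 -> 0 < r < Num.min 1 (Num.min d1 d2) ->
    `|q - base2 (tau j) t| <= Num.min (1 / 2) d2 ->
    `|q_pair (r, q)| <= 2 * p4 * C2 * r ^+ 2 /\ `|e_pair (r, q)| <= 3 * p4 * C2 * r ^+ 2.
  move=> j0 /andP[r0]; rewrite !lt_min => /andP[r1 /andP[rd1 rd2]].
  rewrite le_min => /andP[hq hq2].
  have [||h1 h2] := H2 j r t q j0; rewrite ?r0//.
  have [||_ b2 _ b4 b5] := H1 (tau j) r t q; rewrite ?r0//.
  have sz : 0 <= C2 * r ^+ 2 by rewrite mulr_ge0 ?sqr_ge0// ltW.
  split.
    rewrite /q_pair /= normrM (gtr0_norm r0) normrM normrM normrN (gtr0_norm p40).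
    have -> : 2 * p4 * C2 * r ^+ 2 = r * (p4 * 2 * (C2 * r)) by ring.
    rewrite ler_pM2l//; apply: ler_pM => //.
      by rewrite mulr_ge0// ltW.
    by rewrite ler_pM2l.
  have -> : e_pair (r, q) = - (p4 / 2) * (cB3 (r, q) * Gn (r, q) + 2 * (1 + cB2 (r, q)) * Gt (r, q)).
    by rewrite /e_pair /p4; move: (pi : R) (cB3 _) (Gn _) (cB2 _) (Gt _) => x y z u v; field.
  rewrite normrM normrN (@gtr0_norm _ (p4 / 2)) ?divr_gt0//.
  have -> : 3 * p4 * C2 * r ^+ 2 = p4 / 2 * (6 * (C2 * r ^+ 2)) by field.
  rewrite ler_pM2l ?divr_gt0//; apply: le_trans (ler_normD _ _) _.
  have e1 : `|cB3 (r, q) * Gn (r, q)| <= C2 * r ^+ 2.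
    by rewrite normrM expr2 mulrCA mulrC; rewrite mul1r in b2; rewrite mulrC; apply: ler_pM.
  have e2 : `|2 * (1 + cB2 (r, q)) * Gt (r, q)| <= 2 * 2 * (C2 * r ^+ 2).
    rewrite normrM; apply: ler_pM => //; rewrite normrM (@gtr0_norm _ 2)//.
    by rewrite ler_pM2l.
  by move: e1 e2 sz; lra.
pose D := 3 * p4 * C2; have pC0 : 0 < p4 * C2 by exact: mulr_gt0.
have D0 : 0 < D by rewrite /D -[3 * p4 * C2]mulrA mulr_gt0.
have Dr r : 2 * p4 * C2 * r ^+ 2 <= D * r ^+ 2.
  apply: ler_wpM2r; first exact: sqr_ge0.
  rewrite /D -[2 * p4 * C2]mulrA -[3 * p4 * C2]mulrA.
  by apply: ler_wpM2r; [exact: ltW|rewrite ler_nat].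
pose d := Num.min (Num.min 1 (Num.min d1 d2)) (Num.min (1 / 2) d2).
have [l1 l2] : d <= Num.min 1 (Num.min d1 d2) /\ d <= Num.min (1 / 2) d2.
  by split; rewrite /d ge_min lexx ?orbT.
have l3 : d <= 1 / 2 by apply: le_trans l2 _; rewrite ge_min lexx.
have l4 : d <= 1 by apply: le_trans l1 _; rewrite ge_min lexx.
have l5 : d <= d1 by apply: le_trans l1 _; rewrite !ge_min lexx !orbT.
have d0 : 0 < d by rewrite !lt_min d10 d20 ltr01 divr_gt0.
clearbody d.
exists (1 + Km + D), d => //; split; first by rewrite !addr_gt0.
split.
  move=> i j r t /andP[r0 rd].
  have hb : `|base2 (tau j) t - base2 (tau j) t| = 0 by rewrite subrr normr0.
  have Dr0 : 0 <= D * r by rewrite ltW// mulr_gt0.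
  have Kr0 : 0 <= Km * r by rewrite ltW// mulr_gt0.
  rewrite /rkernel; have [_|j0] := eqVneq j ord0.
    have [||a1 _ a3 _ _] := H1 (tau j) r t (base2 (tau j) t); rewrite ?r0 ?hb//.
      exact: lt_le_trans l5.
    have [_|_] := eqVneq i 0.
      have -> : q_self (r, base2 (tau j) t) = cJ (r, base2 (tau j) t) * (1 + cB2 (r, base2 (tau j) t)) - 1.
        by rewrite /q_self /= invr1 mulr1; move: (cJ _ * _) => x; ring.
      by apply: le_trans a1 _; lra.
    have [_|_] := eqVneq i 1; first by rewrite normr0; lra.
    have a4 := ler_normB (cB1 (r, base2 (tau j) t) + k t * 1 ^+ 2 * r / 2) (k t * 1 ^+ 2 * r / 2).
    rewrite addrK in a4; apply: le_trans a4 _.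
    have a5 : `|k t * 1 ^+ 2 * r / 2| <= Km * r.
      rewrite expr1n mulr1 normrM normrM (gtr0_norm r0) (@gtr0_norm _ 2^-1)//.
      have : `|k t| * r <= Km * r by rewrite ler_pM2r.
      by move: (normr_ge0 (k t)) Kr0; lra.
    by move: a3 a5; rewrite /=; lra.
  have [h1 h2] : `|q_pair (r, base2 (tau j) t)| <= D * r /\ `|e_pair (r, base2 (tau j) t)| <= D * r.
    have [||h1 h2] := Hpair j r t (base2 (tau j) t) j0.
    - by rewrite r0 (lt_le_trans rd).
    - by rewrite hb; apply: le_trans l2; exact: ltW.
    have h3 : D * r ^+ 2 <= D * r.
      by rewrite ler_pM2l// expr2 ger_pMl//; move: rd l4; lra.
    by split; [apply: le_trans h1 (le_trans (Dr r) h3)|exact: le_trans h2 h3].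
  have [_|_] := eqVneq i 0; first by move: h1; lra.
  by have [_|_] := eqVneq i 1; [move: h2; lra|rewrite normr0; lra].
move=> M e M0 e0; have e4 : 0 < e / 4 by rewrite divr_gt0.
have [d3 d30 H3] := self_sizes e4.
pose d' := Num.min (Num.min d d3) (Num.min (e / (4 * M ^+ 2)) (e / D)).
have M2 : 0 < M ^+ 2 by rewrite exprn_gt0.
exists d'; first by rewrite !lt_min d0 d30 !divr_gt0// mulr_gt0.
move=> i j r t q i2 /andP[r0]; rewrite !lt_min => /andP[/andP[rd rd3] /andP[rM rD]] hq hm.
have er0 : 0 <= e * r by rewrite ltW// mulr_gt0.
rewrite /rkernel; have [_|j0] := eqVneq j ord0.
  have [||a1 _ _ _ _] := H3 (tau j) r t q; rewrite ?r0//; first exact: le_trans l3.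
  have [_|i0] := eqVneq i 0; last first.
    have [_|i1] := eqVneq i 1; first by rewrite normr0.
    by case: i i0 i1 i2 => [[|[|[|m]]] hi].
  have [_ _ h1 _ _] := near_base hq.
  have m2 : 1 / 2 <= q.1.2 by move: (le_trans h1 l3) => /ler_normlP[]; lra.
  have mp : 0 < q.1.2 by apply: lt_le_trans m2.
  have -> : q_self (r, q) = (cJ (r, q) * (1 + cB2 (r, q)) - 1 + (q.1.2 - 1) ^+ 2) * q.1.2^-1.
    by rewrite /q_self /=; move: (cJ _ * _) => x; field; rewrite gt_eqF.
  have i2' : q.1.2^-1 <= 2 by rewrite invf_ple ?posrE//; move: m2; lra.
  rewrite normrM [X in _ * X]gtr0_norm ?invr_gt0//.
  have h2 : `|(q.1.2 - 1) ^+ 2| <= M ^+ 2 * r * r.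
    by rewrite normrX -mulrA -expr2 -exprMn ler_pXn2r ?nnegrE// mulr_ge0// ltW.
  have h3 : M ^+ 2 * r <= e / 4.
    have : r * (4 * M ^+ 2) <= e by rewrite -ler_pdivlMr ?mulr_gt0// ltW.
    by lra.
  have h4 : M ^+ 2 * r * r <= e / 4 * r by rewrite ler_pM2r.
  apply: (@le_trans _ _ ((e / 4 * r + e / 4 * r) * 2)).
    apply: ler_pM => //; first by rewrite invr_ge0 ltW.
    by apply: le_trans (ler_normD _ _) _; apply: lerD => //; exact: le_trans h4.
  by lra.
have h3 : D * r ^+ 2 <= e * r.
  by rewrite expr2 mulrA ler_pM2r// mulrC -ler_pdivlMr// ltW.
have [||h1 h2] := Hpair j r t q j0.
- by rewrite r0 (lt_le_trans rd).
- exact: le_trans l2.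
have [_|_] := eqVneq i 0; first exact: le_trans h1 (le_trans (Dr r) h3).
by have [_|_] := eqVneq i 1; [exact: le_trans h3|rewrite normr0].
Qed.

End Sizes.

(*PART 20*)
Section ImplicitDerivative.
Context {R : realType}.

(** A continuous solution y of f (x s, y s) = h s is differentiable where the
second partial derivative of f does not vanish. *)
Lemma implicit_derivative (f : R * R -> R) (x y h : R -> R) (t x' h' a b : R) :
  sdiff (f : (R^o * R^o)%type -> R^o) (x t, y t) ->
  is_derive (x t) 1 (fun v => f (v, y t)) a -> is_derive (y t) 1 (fun v => f (x t, v)) b ->
  b != 0 -> is_derive t 1 x x' -> is_derive t 1 h h' -> {for t, continuous y} ->
  (forall s, f (x s, y s) = h s) -> is_derive t 1 y ((h' - a * x') / b).
Proof.
move=> [A [lA [C bA] HA]] fa fb b0 dx dh cy E.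
have lin0 := linear_scal lA.
have partial (v : R * R) (c : R -> R * R) s (l : R) : (forall w, c w - c s = (w - s) *: v) ->
    c s = (x t, y t) -> is_derive s 1 (fun w => f (c w)) l -> A v = l.
  move=> cl cs dl.
  have dA : is_derive s 1 (fun w => f (c w)) (A v).
    have vp : 0 < `|v| + 1 by rewrite ltr_wpDl.
    apply/is_deriveP => e e0; have [d d0 Hd] := HA _ (divr_gt0 e0 vp).
    exists (d / (`|v| + 1)); first exact: divr_gt0.
    move=> w; rewrite ltr_pdivlMr// => wd.
    have nc : `|c w - c s| <= `|w - s| * (`|v| + 1).
      by rewrite cl normrZ ler_wpM2l// lerDl.
    have := Hd (c w) (c s); rewrite -cs subrr normr0 cl lin0 => H.
    rewrite -cl in H; apply: le_trans (H _ d0) _; first exact: le_lt_trans wd.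
    apply: le_trans (_ : e / (`|v| + 1) * (`|w - s| * (`|v| + 1)) <= _).
      by rewrite ler_pM2l ?divr_gt0.
    by rewrite le_eqVlt; apply/orP; left; apply/eqP; field; rewrite gt_eqF.
  by rewrite -(@derive_val _ _ _ _ _ _ _ dl) (@derive_val _ _ _ _ _ _ _ dA).
have Aa : A (1, 0) = a.
  apply: (partial _ (fun w => (w, y t)) (x t)) => // w.
  by congr (_, _); rewrite /= ?subrr ?mulr0 ?mulr1 ?scaler0//; exact: esym (mulr1 _).
have Ab : A (0, 1) = b.
  apply: (partial _ (fun w => (x t, w)) (y t)) => // w.
  by congr (_, _); rewrite /= ?subrr ?mulr0 ?mulr1 ?scaler0//; exact: esym (mulr1 _).
have AE u v : A (u, v) = u * a + v * b.
  have -> : (u, v) = u *: (1, 0) + v *: (0, 1) :> (R^o * R^o)%type.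
    by congr (_, _); rewrite /= /GRing.scale /= ?mulr1 ?mulr0 ?addr0 ?add0r.
  by rewrite lA lin0 Aa Ab.
have b1 : 0 < `|b| by rewrite normr_gt0.
(* first, y is Lipschitz at t *)
have est (e : R) : 0 < e -> exists2 d : R, 0 < d & forall s, `|s - t| < d ->
    `|(h s - h t) - (x s - x t) * a - (y s - y t) * b| <= e * (`|x s - x t| + `|y s - y t|).
  move=> e0; have [d d0 Hd] := HA e e0; have dh0 : 0 < d / 2 by rewrite divr_gt0.
  have [d1 d10 H1] := (@continuous_atP R R^o R^o _ _).1 (is_derive_continuous dx) _ dh0.
  have [d2 d20 H2] := (@continuous_atP R R^o R^o _ _).1 cy _ dh0.
  exists (Num.min d1 d2); first by rewrite lt_min d10.
  move=> s; rewrite lt_min => /andP[/H1 s1 /H2 s2].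
  have dd : d / 2 < d by rewrite ltr_pdivrMr// mulr2n mulrDr mulr1 ltrDl.
  have := Hd (x s, y s) (x t, y t); rewrite subrr normr0 => H.
  have {}H := H _ d0.
  have nE : `|((x s, y s) - (x t, y t) : (R^o * R^o)%type)| = Num.max `|x s - x t| `|y s - y t|.
    by rewrite prod_normE.
  have mle : Num.max `|x s - x t| `|y s - y t| <= `|x s - x t| + `|y s - y t|.
    by rewrite ge_max lerDl lerDr !normr_ge0.
  have {}H : `|f (x s, y s) - f (x t, y t) - A ((x s, y s) - (x t, y t))| <=
     e * `|((x s, y s) - (x t, y t) : (R^o * R^o)%type)|.
    by apply: H; rewrite nE gt_max !(le_lt_trans _ dd).
  rewrite nE in H; apply: le_trans (_ : e * Num.max `|x s - x t| `|y s - y t| <= _); last first.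
    by rewrite ler_pM2l.
  apply: le_trans H; rewrite !E.
  have -> : (x s, y s) - (x t, y t) = (x s - x t, y s - y t) :> (R^o * R^o)%type by [].
  by rewrite AE opprD addrA.
have Lx (e : R) : 0 < e -> exists2 d : R, 0 < d & forall s, `|s - t| < d ->
   [/\ `|x s - x t - (s - t) * x'| <= e * `|s - t|, `|h s - h t - (s - t) * h'| <= e * `|s - t| &
      `|(h s - h t) - (x s - x t) * a - (y s - y t) * b| <= e * (`|x s - x t| + `|y s - y t|)].
  move=> e0; have [d1 d10 H1] := (is_deriveP _ _ _).1 dx e e0.
  have [d2 d20 H2] := (is_deriveP _ _ _).1 dh e e0; have [d3 d30 H3] := est e e0.
  exists (Num.min d1 (Num.min d2 d3)); first by rewrite !lt_min d10 d20.
  by move=> s; rewrite !lt_min => /andP[s1 /andP[s2 s3]]; split; [exact: H1|exact: H2|exact: H3].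
pose B := `|x'| + `|h'| + `|a| + 2.
have B0 : 0 < B by rewrite /B ltr_wpDl// !addr_ge0.
have Xb s (e : R) : e <= 1 -> `|x s - x t - (s - t) * x'| <= e * `|s - t| ->
    `|x s - x t| <= (1 + `|x'|) * `|s - t|.
  move=> e1 h1; rewrite -(subrK ((s - t) * x') (x s - x t)).
  apply: le_trans (ler_normD _ _) _; rewrite [leRHS]mulrDl normrM [`|s - t| * _]mulrC lerD2r.
  by apply: le_trans h1 _; rewrite ler_wpM2r.
pose K := 2 / `|b| * ((1 + `|a|) * (1 + `|x'|) + 1 + `|h'| + 1).
have K0 : 0 < K.
  apply: mulr_gt0; first by rewrite divr_gt0.
  have h1 : 0 <= 1 + `|a| by rewrite addr_ge0.
  have h2 : 0 <= 1 + `|x'| by rewrite addr_ge0.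
  by have := mulr_ge0 h1 h2; move: (normr_ge0 h'); lra.
have Yb : exists2 d : R, 0 < d & forall s, `|s - t| < d -> `|y s - y t| <= K * `|s - t|.
  have e0 : 0 < Num.min 1 (`|b| / 2) by rewrite lt_min ltr01 divr_gt0.
  have [d d0 H] := Lx _ e0; exists d => // s /H [h1 h2 h3].
  set e := Num.min 1 _ in e0 h1 h2 h3.
  have e1 : e <= 1 by rewrite /e ge_min lexx.
  have eb : e <= `|b| / 2 by rewrite /e ge_min lexx orbT.
  have x1 := Xb s e e1 h1.
  have n1 : `|h s - h t| <= (1 + `|h'|) * `|s - t|.
    rewrite -(subrK ((s - t) * h') (h s - h t)).
    apply: le_trans (ler_normD _ _) _; rewrite [leRHS]mulrDl normrM [`|s - t| * _]mulrC lerD2r.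
    by apply: le_trans h2 _; rewrite ler_wpM2r.
  set u := `|s - t| in x1 n1 *; set X := `|x s - x t| in x1 h3; set Y := `|y s - y t| in h3 *.
  have n2 : `|y s - y t| * `|b| <= `|h s - h t| + X * `|a| + e * (X + Y).
    rewrite -normrM /X -normrM.
    have -> : (y s - y t) * b = (h s - h t) - (x s - x t) * a -
       ((h s - h t) - (x s - x t) * a - (y s - y t) * b) by ring.
    apply: le_trans (ler_normB _ _) _; apply: lerD => //; exact: ler_normB.
  have X0 : 0 <= X by exact: normr_ge0.
  have Y0 : 0 <= Y by exact: normr_ge0.
  have u0 : 0 <= u by exact: normr_ge0.
  have q1 : e * X <= X by rewrite ler_piMl.
  have q2 : e * Y <= `|b| / 2 * Y by rewrite ler_wpM2r.
  have q3 : X * (1 + `|a|) <= (1 + `|x'|) * u * (1 + `|a|) by rewrite ler_wpM2r// addr_ge0.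
  have q4 : Y * (`|b| / 2) <= ((1 + `|a|) * (1 + `|x'|) + 1 + `|h'|) * u.
    by rewrite -/Y in n2; move: n1 n2 q1 q2 q3; lra.
  have -> : Y = 2 / `|b| * (Y * (`|b| / 2)) by field; rewrite gt_eqF.
  rewrite /K -[leRHS]mulrA ler_pM2l ?divr_gt0//; apply: le_trans q4 _.
  by rewrite ler_wpM2r// lerDl.
apply/is_deriveP => e e0; have [d1 d10 H1] := Yb.
pose e' := Num.min 1 (e * `|b| / (1 + `|a| + (1 + `|x'|) + K)).
have D0 : 0 < 1 + `|a| + (1 + `|x'|) + K.
  by rewrite ltr_wpDl// !addr_ge0.
have e'0 : 0 < e' by rewrite lt_min ltr01 divr_gt0// mulr_gt0.
have [d2 d20 H2] := Lx e' e'0.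
exists (Num.min d1 d2); first by rewrite lt_min d10.
move=> s; rewrite lt_min => /andP[/H1 y1 /H2 [h1 h2 h3]].
have e'1 : e' <= 1 by rewrite /e' ge_min lexx.
have x1 := Xb s e' e'1 h1.
have -> : y s - y t - (s - t) *: ((h' - a * x') / b : R^o) =
  b^-1 * ((h s - h t - (s - t) * h') - (x s - x t - (s - t) * x') * a -
    ((h s - h t) - (x s - x t) * a - (y s - y t) * b)).
  by rewrite /GRing.scale /=; field.
rewrite normrM normfV -(ler_pM2l b1) mulrA divff ?gt_eqF// mul1r.
apply: le_trans (ler_normB _ _) _.
apply: le_trans (lerD (ler_normB _ _) (lexx _)) _.
rewrite [`|_ * a|]normrM.
set u := `|s - t| in x1 y1 h1 h2 *.
have u0 : 0 <= u by exact: normr_ge0.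
have q1 : `|x s - x t - (s - t) * x'| * `|a| <= e' * u * `|a| by rewrite ler_wpM2r.
have q2 : e' * (`|x s - x t| + `|y s - y t|) <= e' * ((1 + `|x'|) * u + K * u).
  by rewrite ler_pM2l// lerD.
have q3 : e' * (1 + `|a| + (1 + `|x'|) + K) <= e * `|b|.
  by rewrite -ler_pdivlMr// /e' ge_min lexx orbT.
have q4 : e' * (1 + `|a| + (1 + `|x'|) + K) * u <= e * `|b| * u by rewrite ler_wpM2r.
by move: h2 h3 q1 q2 q4; lra.
Qed.

End ImplicitDerivative.

(*PART 21*)
Section ForgetThird.
Context {R : realType}.
Variables (L : R) (L0 : 0 < L).

(** The phase and the level do not involve the third source. *)
Lemma phase_level_le (u : 'I_3 * R -> R) (M t : R) : loops L u ->
  (forall x, x.1 != 2 -> `|u x| <= M) ->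
  `|phase L u t| <= dev_const L * M /\ `|mdev L u t| <= dev_const L * M.
Proof.
move=> Xu uM; pose w (x : 'I_3 * R) := if x.1 == 2 then 0 else u x.
have M0 : 0 <= M by apply: le_trans (uM (0, 0) _).
have Xw : loops L w.
  move=> i; rewrite /w /=; case: (i == 2); last exact: Xu.
  by split=> // s; exact: cvg_cst.
have wM x : `|w x| <= M.
  by rewrite /w; have [_|] := eqVneq x.1 2; [rewrite normr0|exact: uM].
have := dev_le L0 t Xw wM => /prod3_normP [h1 _ h3].
by split; [exact: h1|exact: h3].
Qed.

End ForgetThird.

Section ReducedOrbit.
Context {R : realType}.
Local Notation E := ('cV[R]_2).
Local Notation S := (R * R * R)%type.
Local Notation P := (R * (S * S))%type.
Variables (Om Gam : set E) (L : R) (gam nrm : R -> E) (k : R -> R).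
Hypothesis F : frame Om Gam L gam nrm k.
Let L0 := frame_L F.
Local Notation tg t := (rot90 (nrm t)).
Local Notation X := (tube gam nrm).
Variable g : E -> E -> R.
Hypothesis oOm : open Om.
Hypothesis gC3 : Ck 3 (Om `*` Om) (fun wz : E * E => g wz.1 wz.2).
Hypothesis gsym : forall w z, Om w -> Om z -> g w z = g z w.
Local Notation rho := (rhofun g).
Hypothesis rho_lim : forall t,
  [/\ rho z @[z --> within Om (nbhs (gam t))] --> (0 : R),
      grad rho z @[z --> within Om (nbhs (gam t))] --> - (2 *: nrm t) &
      hess rho z @[z --> within Om (nbhs (gam t))] --> (- (2 * k t))%:M].
Hypothesis Hdecay : green_decay Om gam nrm g.
Local Notation rhoN := (rhoN gam nrm g).
Local Notation rhoT := (rhoT gam nrm g).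
Local Notation depth := (@depth R).
Local Notation depth' := (@depth' R).
Local Notation cJ := (cJ k).
Local Notation cB1 := (cB1 gam nrm g).
Local Notation cB2 := (cB2 gam nrm g).
Local Notation cB3 := (cB3 gam nrm g).
Local Notation Gn := (cG gam nrm g nrm).
Local Notation Gt := (cG gam nrm g (fun t => tg t)).
Variable n : nat.
Local Notation tau := (@tau R L n).
Local Notation rkernel := (@rkernel R gam nrm k g n).
Local Notation q_self := (q_self gam nrm k g).
Local Notation q_pair := (q_pair gam nrm k g).
Local Notation e_pair := (e_pair gam nrm g).

Local Notation sources := (sources L tau rkernel).
Local Notation orb := (orb L).
Local Notation dev := (dev L).

Definition place (r : R) (u : 'I_3 * R -> R) (j : 'I_n.+1) (t : R) : P :=
  (r, (orb u t, orb u (t + tau j))).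

Lemma place_near r u j t (e : R) : (forall t, `|dev u t| <= e) ->
  `|(place r u j t).2 - base2 (tau j) t| <= e.
Proof.
move=> de; rewrite prod_normE ge_max /=; apply/andP; split.
  by rewrite /Submission.orb addrAC subrr add0r.
by rewrite /Submission.orb addrAC subrr add0r.
Qed.

Lemma reduced_orbit (eta : R) : 0 < eta ->
  exists (rb : R) (u : R -> 'I_3 * R -> R), [/\ 0 < rb,
   forall r, 0 < r < rb ->
    [/\ loops L (u r), forall x, sources r (u r) x = u r x,
        forall t, `|dev (u r) t| <= eta,
        forall j t, regular Om gam nrm k (place r (u r) j t) /\
          (j != ord0 -> offdiag Om (position gam nrm (place r (u r) j t),
                                    position' gam nrm (place r (u r) j t))) &
        exists y, usd (W := R^o) u r y],
   exists2 C : R, 0 < C & forall r x, 0 < r < rb -> `|u r x| <= C * r &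
   forall e : R, 0 < e -> exists2 d : R, 0 < d & forall r x, 0 < r < rb -> r < d ->
     x.1 != 2 -> `|u r x| <= e * r].
Proof.
move=> eta0; have [e1 e10 Hreg] := regular_near F Hdecay n.
have [C [d [d0 [C0 [Hb Hs]]]]] := kernel_sizes F oOm gC3 gsym rho_lim Hdecay n.
pose et := Num.min eta (Num.min e1 d).
have et0 : 0 < et by rewrite !lt_min eta0 e10.
have [l1 l2 l3] : [/\ et <= eta, et <= e1 & et <= d].
  by rewrite /et !ge_min !lexx ?orbT.
have [rb [u [rb0 Hu]]] := @delay_fixed_point R L n.+1 tau rkernel L0
  (kernel_periodic F g (n := n)) et (kernel_lipschitz F oOm gC3 rho_lim Hdecay n)
  (kernel_small F oOm gC3 rho_lim Hdecay n)
  (kernel_smooth F oOm gC3 Hdecay n) et0.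
pose rb' := Num.min rb (Num.min e1 d).
have rng r : 0 < r < rb' -> [/\ 0 < r < rb, 0 < r < e1 & 0 < r < d].
  by move=> /andP[-> ]; rewrite !lt_min => /andP[-> /andP[-> ->]].
pose N : R := n.+1%:R; have N0 : 0 < N by rewrite ltr0n.
pose C' := 2 * (N * C); have C'0 : 0 < C' by rewrite !mulr_gt0.
have ub r x : 0 < r < rb' -> `|u r x| <= C' * r.
  move=> /rng [h1 _ h3]; have [_ _ _ H _] := Hu r h1.
  have -> : C' * r = 2 * (N * (C * r)) by rewrite /C'; ring.
  apply: H => -[i t]; rewrite /Submission.sources /=.
  apply: le_trans (ler_norm_sum _ _ _) _.
  apply: (@le_trans _ _ (\sum_(j < n.+1) C * r)).
    by apply: ler_sum => j _; rewrite /Submission.orb !dev0// !addr0; exact: Hb.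
  by rewrite sumr_const card_ord -(mulr_natl (C * r)).
exists rb', u; split.
- by rewrite !lt_min rb0 e10.
- move=> r rr; have [h1 h2 h3] := rng r rr; have [Xu fix_u du _ uy] := Hu r h1.
  split=> //.
    by move=> t; apply: le_trans (du t) _.
  move=> j t; apply: Hreg h2 _; apply: le_trans l2; exact: place_near.
- by exists C'.
move=> e e0; pose M := dev_const L * C'.
have M0 : 0 < M by rewrite mulr_gt0// dev_const_gt0.
have [d' d'0 Hd'] := Hs M (e / N) M0 (divr_gt0 e0 N0).
exists d' => // r [i t] rr rd' i2; have [h1 h2 h3] := rng r rr.
have [Xu fix_u du _ _] := Hu r h1.
rewrite -fix_u /Submission.sources /=; apply: le_trans (ler_norm_sum _ _ _) _.
have -> : e * r = \sum_(j < n.+1) e / N * r.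
  by rewrite sumr_const card_ord -(mulr_natl (e / N * r)) -/N; field; rewrite gt_eqF.
apply: ler_sum => j _; apply: (Hd' i j r t) => //.
- by case/andP: rr => ->.
- by apply: le_trans l3; exact: (place_near r j t du).
- rewrite /= /Submission.orb /= addrAC subrr add0r.
  have := dev_le L0 t Xu (fun x => ub r x rr) => /prod3_normP [_ _].
  by rewrite /M -mulrA.
Qed.

Section OneOrbit.
Variables (r : R) (u : 'I_3 * R -> R).
Hypothesis r0 : 0 < r.
Hypothesis Xu : loops L u.
Hypothesis fix_u : forall x, sources r u x = u x.
Hypothesis reg : forall j t, regular Om gam nrm k (place r u j t) /\
  (j != ord0 -> offdiag Om (position gam nrm (place r u j t), position' gam nrm (place r u j t))).
Let p j t := place r u j t.
Let th t := (orb u t).1.1.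
Let sg t := (orb u t).1.2.
Let lev t := (orb u t).2.
Definition drift : R := mean L (fun t => u (1, t)).

Definition angular_speed t : R := cJ (p ord0 t) * (1 + cB2 (p ord0 t)) * (lev t)^-1 +
  \sum_(j < n.+1 | j != ord0) q_pair (p j t).

Lemma is_derive_th (t : R) : is_derive t 1 th (angular_speed t).
Proof.
have -> : angular_speed t = 1 + (u (0, t) + (-1) * adev L u t -
   mean L (fun t => u (0, t) + (-1) * adev L u t)).
  have [cq _] := Xu 0; rewrite mean_lin//; last exact: adev_continuous.
  rewrite -fix_u /Submission.sources /= (bigD1 ord0)//=.
  rewrite (eq_bigr (fun j => q_pair (p j t))); last by move=> j /negbTE j0; rewrite /rkernel j0.
  have -> : rkernel 0 ord0 (r, (orb u t, orb u (t + tau ord0))) =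
    cJ (p ord0 t) * (1 + cB2 (p ord0 t)) * (lev t)^-1 - 2 + lev t by [].
  rewrite /angular_speed; move: (\sum_(_ < _ | _) _) (cJ _ * _ * _) => s A.
  have -> : lev t = 1 + (mean L (fun t => u (0, t)) + adev L u t - mean L (adev L u)) by [].
  by ring.
apply: is_deriveD.
by apply: is_derive_osc; exact: phase_source_continuous.
Qed.

Lemma is_derive_lev (t : R) : is_derive t 1 lev
  (\sum_(j < n.+1 | j != ord0) e_pair (p j t) - drift).
Proof.
have -> : \sum_(j < n.+1 | j != ord0) e_pair (p j t) = u (1, t).
  rewrite -fix_u /Submission.sources /= [RHS](bigD1 ord0)//= add0r.
  by apply: eq_bigr => j /negbTE j0; rewrite /rkernel j0.
have -> : lev = (fun s => (1 + (mean L (fun t => u (0, t)) - mean L (adev L u))) + 1 * adev L u s).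
  by apply/funext => s; rewrite /lev /Submission.orb /= /mdev; ring.
have -> : u (1, t) - drift = 0 + 1 * (u (1, t) - drift) by ring.
apply: is_deriveDM.
by apply: is_derive_osc; case: (Xu 1).
Qed.

Lemma level_eq t : rho (X (th t) (r * sg t)) = 2 * r * lev t.
Proof.
have E : sg t + cB1 (p ord0 t) = lev t.
  have -> : cB1 (p ord0 t) = u (2, t).
    rewrite -fix_u /Submission.sources /= (bigD1 ord0)//= big1 ?addr0// => j /negbTE j0.
    by rewrite /rkernel j0.
  by rewrite /sg /lev /Submission.orb /=; ring.
rewrite -E (_ : cB1 (p ord0 t) = (rho (X (th t) (r * sg t)) - 2 * (r * sg t)) * (2 * r)^-1)//.
by move: (rho _) => x; move: (sg t) => y; field; rewrite gt_eqF.
Qed.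

End OneOrbit.

End ReducedOrbit.

(*PART 22*)
Section MovingFrame.
Context {R : realType}.
Local Notation E := ('cV[R]_2).

Lemma is_derive_scale (f : R -> R) (r y l : R) : is_derive (r * y) 1 f l ->
  is_derive y 1 (fun v => f (r * v)) (r * l).
Proof.
move=> df; have dr : is_derive y 1 (fun v : R => r * v) r.
  apply/is_deriveP => e e0; exists 1 => // s _.
  by rewrite -mulrBr [_ *: _]mulrC subrr normr0 mulr_ge0// ltW.
by have := @is_derive1_comp R f (fun v => r * v) y _ _ df dr; rewrite mulrC.
Qed.

Lemma is_derive_mulc (f : R -> R) (c t l : R) : is_derive t 1 f l ->
  is_derive t 1 (fun s => c * f s) (c * l).
Proof. by move=> df; exact: is_deriveZ. Qed.

Lemma is_derive_along (c : R -> E) (x : R -> R) (t x' : R) (c' : E) :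
  is_derive (x t) 1 c c' -> is_derive t 1 x x' ->
  is_derive t 1 (fun s => c (x s)) (x' *: c').
Proof.
move=> /is_derive_col dc dx; apply/is_derive_col => i; rewrite mxE mulrC.
exact: (@is_derive1_comp R (fun v => c v i 0) x t _ _ (dc i) dx).
Qed.

Lemma rot90_frame (n F : E) : dot n n = 1 ->
  - rot90 F = dot F (rot90 n) *: n - dot F n *: rot90 n.
Proof.
move=> n1; apply: col2P; rewrite ![in LHS]mxE ![in RHS]mxE /dot !rot90E /=.
- have -> : - - F 1 0 = F 1 0 * dot n n by rewrite n1; ring.
  by rewrite /dot; ring.
- have -> : - F 0 0 = - F 0 0 * dot n n by rewrite n1; ring.
  by rewrite /dot; ring.
Qed.

Variables (Om Gam : set E) (L : R) (gam nrm : R -> E) (k : R -> R).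
Hypothesis F : frame Om Gam L gam nrm k.
Local Notation X := (tube gam nrm).

Lemma is_derive_tube (x y : R -> R) (t x' y' : R) :
  is_derive t 1 x x' -> is_derive t 1 y y' ->
  is_derive t 1 (fun s => X (x s) (y s))
    (((1 - y t * k (x t)) * x') *: rot90 (nrm (x t)) - y' *: nrm (x t)).
Proof.
move=> dx dy.
have dg := is_derive_along (frame_dgam F (x t)) dx.
have dn := is_derive_along (frame_dnrm F (x t)) dx.
apply/is_derive_col => i.
have -> : (fun s => X (x s) (y s) i 0) = (fun s => gam (x s) i 0 - y s * nrm (x s) i 0).
  by apply/funext => s; rewrite /tube !mxE.
have dgi := (is_derive_col _ _ _).1 dg i; have dni := (is_derive_col _ _ _).1 dn i.
have -> : (((1 - y t * k (x t)) * x') *: rot90 (nrm (x t)) - y' *: nrm (x t)) i 0 =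
  (x' *: rot90 (nrm (x t))) i 0 -
  (y t * (x' *: (k (x t) *: rot90 (nrm (x t)))) i 0 + nrm (x t) i 0 * y').
  by move: (rot90 _) => w; move: (nrm _) => m; rewrite !mxE; ring.
apply: is_deriveB; exact: is_deriveM.
Qed.

End MovingFrame.

Section Velocity.
Context {R : realType}.
Local Notation E := ('cV[R]_2).
Local Notation S := (R * R * R)%type.
Local Notation P := (R * (S * S))%type.
Variables (Om Gam : set E) (L : R) (gam nrm : R -> E) (k : R -> R).
Hypothesis F : frame Om Gam L gam nrm k.
Let L0 := frame_L F.
Local Notation tg t := (rot90 (nrm t)).
Local Notation X := (tube gam nrm).
Variable g : E -> E -> R.
Hypothesis oOm : open Om.
Hypothesis gC3 : Ck 3 (Om `*` Om) (fun wz : E * E => g wz.1 wz.2).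
Hypothesis gsym : forall w z, Om w -> Om z -> g w z = g z w.
Local Notation rho := (rhofun g).
Hypothesis rho_lim : forall t,
  [/\ rho z @[z --> within Om (nbhs (gam t))] --> (0 : R),
      grad rho z @[z --> within Om (nbhs (gam t))] --> - (2 *: nrm t) &
      hess rho z @[z --> within Om (nbhs (gam t))] --> (- (2 * k t))%:M].
Hypothesis Hdecay : green_decay Om gam nrm g.
Local Notation rhoN := (rhoN gam nrm g).
Local Notation rhoT := (rhoT gam nrm g).
Local Notation depth := (@depth R).
Local Notation depth' := (@depth' R).
Local Notation cJ := (cJ k).
Local Notation cB1 := (cB1 gam nrm g).
Local Notation cB2 := (cB2 gam nrm g).
Local Notation cB3 := (cB3 gam nrm g).
Local Notation Gn := (cG gam nrm g nrm).
Local Notation Gt := (cG gam nrm g (fun t => tg t)).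
Variable n : nat.
Local Notation tau := (@tau R L n).
Local Notation rkernel := (@rkernel R gam nrm k g n).
Local Notation q_self := (q_self gam nrm k g).
Local Notation q_pair := (q_pair gam nrm k g).
Local Notation e_pair := (e_pair gam nrm g).

Local Notation sources := (sources L tau rkernel).
Local Notation orb := (orb L).
Local Notation dev := (dev L).

Local Notation place := (@place R L n).
Local Notation position := (position gam nrm).
Local Notation position' := (position' gam nrm).
Variables (r : R) (u : 'I_3 * R -> R).
Hypothesis r0 : 0 < r.
Hypothesis Xu : loops L u.
Hypothesis fix_u : forall x, sources r u x = u x.
Hypothesis reg : forall j t, regular Om gam nrm k (place r u j t) /\
  (j != ord0 -> offdiag Om (position (place r u j t), position' (place r u j t))).
Local Notation p j t := (place r u j t).
Local Notation th t := (orb u t).1.1.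
Local Notation sg t := (orb u t).1.2.
Local Notation lev t := (orb u t).2.
Hypothesis rhoN_neg : forall t, rhoN (th t) (r * sg t) < 0.

Definition trajectory (t : R) : E := X (th t) (r * sg t).

Definition force (t : R) : E := (2 * lev t)^-1 *: grad rho (trajectory t) +
  (4 * pi * r) *: \sum_(j < n.+1 | j != ord0) grad1 g (trajectory t) (trajectory (t + tau j)).

Local Notation drift := (@drift R L u).
Local Notation angular_speed := (@angular_speed R L gam nrm k g n r u).

Definition depth_speed (t : R) : R :=
  r * ((2 * r * (\sum_(j < n.+1 | j != ord0) e_pair (p j t) - drift) -
   (1 - r * sg t * k (th t)) * rhoT (th t) (r * sg t) * angular_speed t) /
   (r * - rhoN (th t) (r * sg t))).

Lemma level_set_sdiff (x y : R) : Om (X x (r * y)) ->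
  sdiff (fun q : (R^o * R^o)%type => rho (X q.1 (r * q.2)) : R^o) (x, y).
Proof.
move=> OX; have s1 := @sdiff_fst R R^o R^o (x, y); have s2 := @sdiff_snd R R^o R^o (x, y).
have [gs ns _] := curve_sdiff F x.
have c1 (f : R^o -> E) (sf : sdiff f x) :=
  @sdiff_comp R (R^o * R^o)%type R^o E f (fun q => q.1) (x, y) sf s1.
have sr : sdiff (fun q : (R^o * R^o)%type => (r * q.2 : R^o)) (x, y).
  by apply: (@sdiffM R (R^o * R^o)%type) => //; exact: (@sdiff_cst R (R^o * R^o)%type R^o).
have sX : sdiff (fun q : (R^o * R^o)%type => X q.1 (r * q.2)) (x, y).
  apply: sdiffB; first exact: c1.
  by apply: (@sdiffZ R (R^o * R^o)%type) => //; exact: c1.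
have sh : sdiff (rho : E -> R^o) (X x (r * y)) by exact: rhofun_sdiff OX.
exact: (@sdiff_comp R (R^o * R^o)%type E R^o rho (fun q => X q.1 (r * q.2)) (x, y) sh sX).
Qed.

Lemma is_derive_depth (t : R) :
  is_derive t 1 (fun s => r * sg s) (depth_speed t).
Proof.
have [[OX _ _ _] _] := reg ord0 t.
have co : {for t, continuous (orb u)} by exact: (orb_continuous Xu).
have csg : {for t, continuous (fun s => sg s : R)}.
  apply/(@continuous_atP R R^o R^o) => e e0.
  have [d d0 Hd] := (@continuous_atP R R^o S _ _).1 co e e0.
  by exists d => // s /Hd /prod3_normP [_ h _].
have dsg : is_derive t 1 (fun s => sg s)
  ((2 * r * (\sum_(j < n.+1 | j != ord0) e_pair (p j t) - drift) -
   (1 - r * sg t * k (th t)) * rhoT (th t) (r * sg t) * angular_speed t) /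
   (r * - rhoN (th t) (r * sg t))).
  have [_ _ ds [_ _ dt]] := tube_derivatives F oOm gC3 OX.
  pose f (q : R * R) := rho (X q.1 (r * q.2)).
  have sf : sdiff (f : (R^o * R^o)%type -> R^o) (th t, sg t).
    exact: level_set_sdiff OX.
  have b0 : r * - rhoN (th t) (r * sg t) != 0.
    by rewrite mulf_neq0 ?gt_eqF// oppr_gt0.
  have dh : is_derive t 1 (fun s => 2 * r * lev s)
      (2 * r * (\sum_(j < n.+1 | j != ord0) e_pair (p j t) - drift)).
    have d := is_derive_lev Xu fix_u t.
    exact: (@is_derive_mulc R (fun s => lev s) (2 * r) t _ d).
  have fb := is_derive_scale (f := fun v => rho (X (th t) v)) ds.
  exact: (@implicit_derivative R f (fun s => th s) (fun s => sg s) (fun s => 2 * r * lev s)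
    t _ _ _ _ sf dt fb b0 (is_derive_th Xu fix_u t) dh csg (level_eq r0 fix_u)).
exact: (@is_derive_mulc R (fun s => sg s) r t _ dsg).
Qed.

Lemma velocity_eq (t : R) :
  - rot90 (force t) + (drift * (2 * r / - rhoN (th t) (r * sg t))) *: nrm (th t) =
  ((1 - r * sg t * k (th t)) * angular_speed t) *: tg (th t) - depth_speed t *: nrm (th t).
Proof.
pose SGn := \sum_(j < n.+1 | j != ord0) Gn (p j t).
pose SGt := \sum_(j < n.+1 | j != ord0) Gt (p j t).
have dotS (x : E) : dot (\sum_(j < n.+1 | j != ord0) grad1 g (trajectory t) (trajectory (t + tau j))) x =
   \sum_(j < n.+1 | j != ord0) dot (grad1 g (trajectory t) (trajectory (t + tau j))) x.
  by elim/big_rec2: _ => [|j y1 y2 _ <-]; [rewrite /dot !mxE !mul0r addr0|rewrite dotDl].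
have FX x : dot (force t) x = (2 * lev t)^-1 * dot (grad rho (trajectory t)) x +
  4 * pi * r * \sum_(j < n.+1 | j != ord0) dot (grad1 g (trajectory t) (trajectory (t + tau j))) x.
  by rewrite /force dotDl !dotZl dotS.
have Fn : dot (force t) (nrm (th t)) = (2 * lev t)^-1 * rhoN (th t) (r * sg t) + 4 * pi * r * SGn.
  exact: FX.
have Ft : dot (force t) (tg (th t)) = (2 * lev t)^-1 * rhoT (th t) (r * sg t) + 4 * pi * r * SGt.
  exact: FX.
have [[_ J0 m0 _] _] := reg ord0 t; rewrite /= in J0 m0.
have Sq : \sum_(j < n.+1 | j != ord0) q_pair (p j t) = - (4 * pi) * r * cJ (p ord0 t) * SGn.
  rewrite /SGn mulr_sumr; apply: eq_bigr => j _; rewrite /q_pair.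
  have -> : cJ (p j t) = cJ (p ord0 t) by [].
  have -> : (p j t).1 = r by [].
  by move: (cJ _) (Gn _) => x y; ring.
have Se : \sum_(j < n.+1 | j != ord0) e_pair (p j t) =
  - (2 * pi) * (rhoT (th t) (r * sg t) * SGn - rhoN (th t) (r * sg t) * SGt).
  rewrite /SGn /SGt !mulr_sumr -sumrB mulr_sumr; apply: eq_bigr => j _; rewrite /e_pair.
  have -> : cB2 (p j t) = (rhoN (th t) (r * sg t) + 2) * (- 1 / 2) by [].
  have -> : cB3 (p j t) = rhoT (th t) (r * sg t) by [].
  by move: (rhoN _ _) (rhoT _ _) (Gn _) (Gt _) => x y z w; field.
rewrite (rot90_frame _ (frame_unit F (th t))) Fn Ft /depth_speed Se /Submission.angular_speed Sq.
have -> : cB2 (p ord0 t) = (rhoN (th t) (r * sg t) + 2) * (- 1 / 2) by [].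
have -> : cJ (p ord0 t) = (1 - r * sg t * k (th t))^-1 by [].
have J0' : 1 - r * sg t * k (th t) != 0 by [].
have m0' : lev t != 0 by [].
have N0 := rhoN_neg t.
have H (a b c A B : R) (w y : E) : a + c = - A -> - b = B ->
    a *: w - b *: y + c *: w = B *: y - A *: w.
  by move=> e1 e2; rewrite addrAC -scalerDl e1 -scaleNr e2 addrC scaleNr.
clear Ft Fn FX dotS Sq Se J0 m0; clearbody SGn SGt.
have r1 : r != 0 by rewrite gt_eqF.
have N1 : rhoN (th t) (r * sg t) != 0 by rewrite lt_eqF.
apply: H.
  move: (rhoN _ _) N1 => N N1; move: (rhoT _ _) => T; move: (k _) J0' => kk J0'.
  move: drift (pi : R) => lam pp.
  by move: (sg t) (lev t) J0' m0' => x z J0' m0'; field; rewrite J0' m0' N1 r1.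
move: (rhoN _ _) N1 => N N1; move: (k _) J0' => kk J0'.
move: (pi : R) => pp.
by move: (sg t) (lev t) J0' m0' => x z J0' m0'; field; rewrite J0' m0'.
Qed.

Lemma velocity (t : R) : is_derive t 1 trajectory
  (- rot90 (force t) + (drift * (2 * r / - rhoN (th t) (r * sg t))) *: nrm (th t)).
Proof.
have dv := is_derive_tube F (is_derive_th Xu fix_u t) (is_derive_depth t).
by rewrite velocity_eq; exact: dv.
Qed.

Lemma force_normal (t : R) :
  dot (force t) (nrm (th t)) = - ((1 - r * sg t * k (th t)) * angular_speed t).
Proof.
have h := congr1 (fun v => dot v (tg (th t))) (velocity_eq t).
have nt : dot (nrm (th t)) (tg (th t)) = 0 by rewrite /dot !rot90E; ring.
rewrite /= !dotDl !dotNl !dotZl nt !mulr0 addr0 oppr0 addr0 (unit_tg F) mulr1 in h.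
rewrite -h opprK; move: (force t) (nrm (th t)) => f m.
by rewrite /dot !rot90E; ring.
Qed.

End Velocity.

(*PART 23*)
Section HamiltonianGradient.
Context {R : realType}.
Local Notation E := ('cV[R]_2).
Variables (Om : set E) (g : E -> E -> R).
Hypothesis oOm : open Om.
Hypothesis gC3 : Ck 3 (Om `*` Om) (fun wz : E * E => g wz.1 wz.2).
Hypothesis gsym : forall w z, Om w -> Om z -> g w z = g z w.

Lemma is_derive_bigsum (I : Type) (s : seq I) (Q : pred I) (f : I -> R -> R) (df : I -> R) (t : R) :
  (forall i, Q i -> is_derive t 1 (f i) (df i)) ->
  is_derive t 1 (fun u => \sum_(i <- s | Q i) f i u) (\sum_(i <- s | Q i) df i).
Proof.
move=> H; elim: s => [|i s IH].
  rewrite big_nil (_ : (fun u => _) = fun=> 0); first exact: is_derive_cst.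
  by apply/funext => u; rewrite big_nil.
rewrite big_cons; have [Qi|nQi] := boolP (Q i).
  rewrite (_ : (fun u => _) = fun u => f i u + \sum_(j <- s | Q j) f j u).
    by apply: is_deriveD => //; exact: H.
  by apply/funext => u; rewrite big_cons Qi.
rewrite (_ : (fun u => _) = fun u => \sum_(j <- s | Q j) f j u)//.
by apply/funext => u; rewrite big_cons (negbTE nQi).
Qed.

Lemma dot_suml (I : Type) (s : seq I) (Q : pred I) (v : I -> E) (x : E) :
  dot (\sum_(i <- s | Q i) v i) x = \sum_(i <- s | Q i) dot (v i) x.
Proof.
by elim/big_rec2: _ => [|j y1 y2 _ <-]; [rewrite /dot !mxE !mul0r addr0|rewrite dotDl].
Qed.

Variable m : nat.

Definition columns (c : 'I_m -> E) : 'M[R]_(2, m) := \matrix_(i, j) c j i 0.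

Lemma col_columns c j : col j (columns c) = c j.
Proof. by apply: col2P; rewrite !mxE. Qed.

(** The gradient of the Hamiltonian in the position of the j-th point. *)
Definition pull (c : 'I_m -> E) (j : 'I_m) : E :=
  2 *: \sum_(k < m | k != j) grad1 g (c j) (c k) - grad (hfun g) (c j).

Lemma is_derive_HOm (c : 'I_m -> R -> E) (c' : 'I_m -> E) (t : R) :
  (forall j, Om (c j t)) -> (forall j k, k != j -> offdiag Om (c j t, c k t)) ->
  (forall j, is_derive t 1 (c j) (c' j)) ->
  is_derive t 1 (fun s => HOm g (columns (fun j => c j s)))
    (\sum_(j < m) dot (pull (c^~ t) j) (c' j)).
Proof.
move=> inO off dc.
have -> : \sum_(j < m) dot (pull (c^~ t) j) (c' j) =
  \sum_(j < m) \sum_(k < m | k != j)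
     (dot (grad1 g (c j t) (c k t)) (c' j) + dot (grad1 g (c k t) (c j t)) (c' k)) -
  \sum_(j < m) dot (grad (hfun g) (c j t)) (c' j).
  pose A := \sum_(j < m) \sum_(k < m | k != j) dot (grad1 g (c j t) (c k t)) (c' j).
  have E1 : \sum_(j < m) \sum_(k < m | k != j) dot (grad1 g (c k t) (c j t)) (c' k) = A.
    rewrite (exchange_big_dep predT)//=; apply: eq_bigr => j _; apply: eq_bigl => i.
    by rewrite /= ?andbT eq_sym.
  have -> : \sum_(j < m) \sum_(k < m | k != j)
     (dot (grad1 g (c j t) (c k t)) (c' j) + dot (grad1 g (c k t) (c j t)) (c' k)) = A + A.
    by rewrite -{2}E1 -big_split; apply: eq_bigr => j _; rewrite big_split.
  rewrite /A -big_split -sumrB; apply: eq_bigr => j _.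
  by rewrite /pull dotDl dotNl dotZl dot_suml /=; congr (_ - _); ring.
have -> : (fun s => HOm g (columns (fun j => c j s))) = (fun s =>
  \sum_(j < m) \sum_(k < m | k != j) Gfun g (c j s) (c k s) - \sum_(j < m) hfun g (c j s)).
  apply/funext => s; rewrite /HOm; congr (_ - _).
    by apply: eq_bigr => j _; apply: eq_bigr => i _; rewrite !col_columns.
  by apply: eq_bigr => j _; rewrite col_columns.
apply: is_deriveB.
  apply: is_derive_bigsum => j _; apply: is_derive_bigsum => i ij.
  exact: (is_derive_G (x := c j) (y := c i) (u := t) oOm gC3 gsym (off j i ij) (dc j) (dc i)).
apply: is_derive_bigsum => j _.
apply: (@is_derive_grad R (hfun g) (c j) t) => //.
exact: sdiff_differentiable (hfun_sdiff oOm gC3 (inO j)).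
Qed.

Lemma derive_line (V : normedModType R) (f : V -> R) (x v : V) :
  'D_v f x = 'D_1 (fun s : R => f (x + s *: v)) 0.
Proof.
rewrite /derive; apply: (congr1 (fun F : R -> R^o => lim (F h @[h --> (0 : R)^']))).
apply/funext => s /=.
by rewrite scale0r !addr0 /GRing.scale /= mulr1 [x + _]addrC.
Qed.

Lemma grad_col_HOm (z : 'M[R]_(2, m)) (j : 'I_m) : FN Om z ->
  grad_col (@HOm R g m) j z = pull (fun k => col k z) j.
Proof.
move=> [inO dist].
have D i : grad_col (@HOm R g m) j z i 0 = pull (fun k => col k z) j i 0.
  rewrite /grad_col mxE derive_line.
  pose c (k : 'I_m) (s : R) := if k == j then col j z + s *: delta_mx i 0 else col k z.
  pose c' (k : 'I_m) : E := if k == j then delta_mx i 0 else 0.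
  have c0 k : c k 0 = col k z.
    by rewrite /c; have [->|//] := eqVneq k j; rewrite scale0r addr0.
  have cE : c^~ 0 = (fun k => col k z) by apply/funext => k; exact: c0.
  have -> : (fun s : R => HOm g (set_col z j (col j z + s *: delta_mx i 0))) =
      (fun s => HOm g (columns (fun k => c k s))).
    apply/funext => s; congr (HOm g _); apply/matrixP => a b; rewrite /set_col [LHS]mxE [RHS]mxE /c.
    by have [_|_] := eqVneq b j => //; rewrite mxE.
  have dH : is_derive (0 : R) 1 (fun s => HOm g (columns (fun k => c k s)))
      (\sum_(k < m) dot (pull (c^~ 0) k) (c' k)).
    apply: is_derive_HOm => [k|k l lk|k]; rewrite ?c0//.
    - by split=> //=; rewrite eq_sym; exact: dist.
    - rewrite /c /c'; have [_|_] := eqVneq k j; first exact: is_derive_line.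
      exact: is_derive_cst.
  rewrite (@derive_val _ _ _ _ _ _ _ dH) (bigD1 j)//= big1 ?addr0.
    rewrite /c' eqxx cE; move: (pull _ _) => v.
    by case: (ord2P i) => ->; rewrite /dot !mxE /=; ring.
  move=> k /negbTE kj; rewrite /c' kj; move: (pull _ _) => v.
  by rewrite /dot !mxE; ring.
by apply: col2P; exact: D.
Qed.

End HamiltonianGradient.

(*PART 24*)
Section Translate.
Context {R : realType}.

Lemma is_derive_translate (W : normedModType R) (f : R -> W) (t c : R) (df : W) :
  is_derive (t + c) 1 f df -> is_derive t 1 (fun s => f (s + c)) df.
Proof.
move=> /is_deriveP H; apply/is_deriveP => e /H [d d0 Hd]; exists d => // s sd.
have E : s + c - (t + c) = s - t by rewrite opprD addrACA subrr addr0.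
by have := Hd (s + c); rewrite E; exact.
Qed.

Lemma is_derive_dilate (W : normedModType R) (f : R -> W) (t c : R) (df : W) :
  is_derive (c * t) 1 f df -> is_derive t 1 (fun s => f (c * s)) (c *: df).
Proof.
move=> /is_deriveP H; apply/is_deriveP => e e0.
have c0 : 0 < `|c| + 1 by rewrite ltr_wpDl.
have [d d0 Hd] := H _ (divr_gt0 e0 c0); exists (d / (`|c| + 1)); first exact: divr_gt0.
move=> s; rewrite ltr_pdivlMr// => sd.
have E : c * s - c * t = c * (s - t) by ring.
have h : `|c * s - c * t| <= `|s - t| * (`|c| + 1).
  by rewrite E normrM mulrC ler_wpM2l// lerDl.
rewrite scalerA [(s - t) * c]mulrC -E; apply: le_trans (Hd _ (le_lt_trans h sd)) _.
apply: le_trans (_ : e / (`|c| + 1) * (`|s - t| * (`|c| + 1)) <= _).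
  by rewrite ler_pM2l// divr_gt0.
by rewrite le_eqVlt; apply/orP; left; apply/eqP; field; rewrite gt_eqF.
Qed.

End Translate.

Section Choreography.
Context {R : realType}.
Local Notation E := ('cV[R]_2).
Local Notation S := (R * R * R)%type.
Local Notation P := (R * (S * S))%type.
Variables (Om Gam : set E) (L : R) (gam nrm : R -> E) (k : R -> R).
Hypothesis F : frame Om Gam L gam nrm k.
Let L0 := frame_L F.
Local Notation tg t := (rot90 (nrm t)).
Local Notation X := (tube gam nrm).
Variable g : E -> E -> R.
Hypothesis oOm : open Om.
Hypothesis gC3 : Ck 3 (Om `*` Om) (fun wz : E * E => g wz.1 wz.2).
Hypothesis gsym : forall w z, Om w -> Om z -> g w z = g z w.
Local Notation rho := (rhofun g).
Hypothesis rho_lim : forall t,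
  [/\ rho z @[z --> within Om (nbhs (gam t))] --> (0 : R),
      grad rho z @[z --> within Om (nbhs (gam t))] --> - (2 *: nrm t) &
      hess rho z @[z --> within Om (nbhs (gam t))] --> (- (2 * k t))%:M].
Hypothesis Hdecay : green_decay Om gam nrm g.
Local Notation rhoN := (rhoN gam nrm g).
Local Notation rhoT := (rhoT gam nrm g).
Local Notation depth := (@depth R).
Local Notation depth' := (@depth' R).
Local Notation cJ := (cJ k).
Local Notation cB1 := (cB1 gam nrm g).
Local Notation cB2 := (cB2 gam nrm g).
Local Notation cB3 := (cB3 gam nrm g).
Local Notation Gn := (cG gam nrm g nrm).
Local Notation Gt := (cG gam nrm g (fun t => tg t)).
Variable n : nat.
Local Notation tau := (@tau R L n).
Local Notation rkernel := (@rkernel R gam nrm k g n).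
Local Notation q_self := (q_self gam nrm k g).
Local Notation q_pair := (q_pair gam nrm k g).
Local Notation e_pair := (e_pair gam nrm g).

Local Notation sources := (sources L tau rkernel).
Local Notation orb := (orb L).
Local Notation dev := (dev L).

Local Notation place := (@place R L n).
Local Notation position := (position gam nrm).
Local Notation position' := (position' gam nrm).
Variables (r : R) (u : 'I_3 * R -> R).
Hypothesis r0 : 0 < r.
Hypothesis Xu : loops L u.
Hypothesis fix_u : forall x, sources r u x = u x.
Hypothesis reg : forall j t, regular Om gam nrm k (place r u j t) /\
  (j != ord0 -> offdiag Om (position (place r u j t), position' (place r u j t))).
Local Notation p j t := (place r u j t).
Local Notation th t := (orb u t).1.1.
Local Notation sg t := (orb u t).1.2.
Local Notation lev t := (orb u t).2.
Hypothesis rhoN_neg : forall t, rhoN (th t) (r * sg t) < 0.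

Local Notation trajectory := (@trajectory R L gam nrm r u).
Local Notation force := (@force R L gam nrm g n r u).
Local Notation drift := (@drift R L u).
Local Notation angular_speed := (@angular_speed R L gam nrm k g n r u).
Hypothesis J_pos : forall t, 0 < 1 - r * sg t * k (th t).
Hypothesis speed_pos : forall t, 0 < angular_speed t.

Lemma orb_shift t : [/\ th (t + L) = th t + L, sg (t + L) = sg t & lev (t + L) = lev t].
Proof.
have h := orb_periodic L0 t Xu; rewrite h.
by split=> //=; rewrite addr0.
Qed.

Lemma trajectory_periodic t : trajectory (t + L) = trajectory t.
Proof.
have [h1 h2 _] := orb_shift t.
by rewrite /Submission.trajectory h1 h2 (tubeL F).
Qed.

Lemma trajectory_tau t (i j : 'I_n.+1) :
  trajectory (t + tau i + tau j) = trajectory (t + tau (i + j)).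
Proof.
have per m x : trajectory (x + m%:R * L) = trajectory x.
  elim: m => [|m IH]; first by rewrite mul0r addr0.
  by rewrite -natr1 mulrDl mul1r addrA trajectory_periodic IH.
have N0 : n.+1%:R != 0 :> R by rewrite pnatr_eq0.
rewrite -[RHS](per ((i + j)%N %/ n.+1)%N); congr (trajectory _).
rewrite -!addrA; congr (_ + _); rewrite /Submission.tau.
have -> : nat_of_ord (i + j)%R = ((i + j)%N %% n.+1)%N by [].
have E : i%:R + j%:R = ((i + j)%N %/ n.+1)%:R * n.+1%:R + ((i + j)%N %% n.+1)%:R :> R.
  by rewrite -natrD -natrM -natrD -divn_eq.
have -> : i%:R * L / n.+1%:R + j%:R * L / n.+1%:R = (i%:R + j%:R) * (L / n.+1%:R) by ring.
rewrite E; move: (((i + j)%N %/ n.+1)%:R) => x; move: (((i + j)%N %% n.+1)%:R) => y.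
by move: (n.+1%:R) N0 => z z0; field.
Qed.

Lemma tau0 : tau ord0 = 0.
Proof. by rewrite /Submission.tau mul0r mul0r. Qed.

Lemma trajectory_off t (i j : 'I_n.+1) : j != i ->
  offdiag Om (trajectory (t + tau i), trajectory (t + tau j)).
Proof.
move=> ij; have ji0 : j - i != ord0 by rewrite subr_eq0.
have [_ /(_ ji0)] := reg (j - i) (t + tau i).
rewrite /Submission.position /Submission.position' /= -/(trajectory _).
have -> : X (th (t + tau i + tau (j - i))) (depth' (place r u (j - i) (t + tau i))) =
  trajectory (t + tau i + tau (j - i)) by [].
by rewrite trajectory_tau subrKC.
Qed.

Lemma trajectory_in t : Om (trajectory t).
Proof. by have [[]] := reg ord0 t. Qed.

Definition conf (s : R) : 'M[R]_(2, n.+1) := columns (fun j => trajectory (s + tau j)).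

Lemma force_pull (s : R) (j : 'I_n.+1) :
  force (s + tau j) = (2 * pi * r) *: pull g (fun k => trajectory (s + tau k)) j.
Proof.
have Q (a b c : R) (G S S' H : E) : S = S' -> b = 2 * c -> a *: G = - (c *: H) ->
    a *: G + b *: S = c *: (2 *: S' - H).
  by move=> -> -> ->; rewrite scalerBr scalerA addrC [2 * c]mulrC.
apply: Q; last 1 first.
- have lv := level_eq r0 fix_u (s + tau j).
  have [[_ _ m0 _] _] := reg ord0 (s + tau j); rewrite /= in m0.
  have OX := trajectory_in (s + tau j).
  have gE i : grad rho (trajectory (s + tau j)) i 0 =
    - (2 * pi) * rho (trajectory (s + tau j)) * grad (hfun g) (trajectory (s + tau j)) i 0.
    by rewrite !mxE (rhofun_derive oOm gC3).
  have gV : grad rho (trajectory (s + tau j)) =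
    (- (2 * pi) * rho (trajectory (s + tau j))) *: grad (hfun g) (trajectory (s + tau j)).
    by apply: col2P; rewrite gE [RHS]mxE.
  have rE : rho (trajectory (s + tau j)) = 2 * r * lev (s + tau j) by exact: lv.
  have cE : (2 * lev (s + tau j))^-1 * (- (2 * pi) * (2 * r * lev (s + tau j))) =
    - (2 * pi * r) by move: (pi : R) => y; field.
  by rewrite gV rE scalerA cE scaleNr.
- rewrite (reindex_inj (addrI (- j))) /=.
  apply: eq_big => [i|i _]; first by rewrite addrC subr_eq0.
  by rewrite trajectory_tau addrA subrr add0r.
- by ring.
Qed.

(** A drift of the level would make the Hamiltonian strictly monotone along a
closed orbit. *)
Lemma drift_eq0 : drift = 0.
Proof.
pose c t := 2 * r / - rhoN (th t) (r * sg t).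
have c0 t : 0 < c t by rewrite divr_gt0 ?mulr_gt0// oppr_gt0.
pose D s := \sum_(j < n.+1) dot (pull g (fun k => trajectory (s + tau k)) j)
   (- rot90 (force (s + tau j)) + (drift * c (s + tau j)) *: nrm (th (s + tau j))).
have dH (s : R) : is_derive s 1 (fun s => HOm g (conf s)) (D s).
  apply: (is_derive_HOm (c := fun j s => trajectory (s + tau j)) oOm gC3 gsym).
  - by move=> j; exact: trajectory_in.
  - by move=> j i ij; exact: trajectory_off.
  - move=> j; apply: is_derive_translate.
    exact: (velocity F oOm gC3 r0 Xu fix_u reg rhoN_neg (s + tau j)).
have DE s : D s = - drift * \sum_(j < n.+1) ((2 * pi * r)^-1 * c (s + tau j) *
    ((1 - r * sg (s + tau j) * k (th (s + tau j))) * angular_speed (s + tau j))).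
  rewrite mulr_sumr; apply: eq_bigr => j _.
  have pr : 2 * pi * r != 0 by rewrite gt_eqF// mulr_gt0// mulr_gt0// pi_gt0.
  have -> : pull g (fun k => trajectory (s + tau k)) j = (2 * pi * r)^-1 *: force (s + tau j).
    by rewrite force_pull scalerA mulVf// scale1r.
  have fn := force_normal F r0 reg rhoN_neg (s + tau j).
  move: (force _) (nrm _) fn => f m fn.
  have -> : dot ((2 * pi * r)^-1 *: f) (- rot90 f + (drift * c (s + tau j)) *: m) =
    (2 * pi * r)^-1 * (drift * c (s + tau j)) * dot f m.
    rewrite dotZl -[RHS]mulrA; congr (_ * _).
    by rewrite /dot !mxE /=; ring.
  by rewrite fn; ring.
have S0 s : 0 < \sum_(j < n.+1) ((2 * pi * r)^-1 * c (s + tau j) *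
    ((1 - r * sg (s + tau j) * k (th (s + tau j))) * angular_speed (s + tau j))).
  have T x : 0 < (2 * pi * r)^-1 * c x * ((1 - r * sg x * k (th x)) * angular_speed x).
    apply: mulr_gt0; last exact: mulr_gt0.
    by apply: mulr_gt0; [rewrite invr_gt0 !mulr_gt0// pi_gt0|exact: c0].
  rewrite (bigD1 ord0)//=; apply: ltr_pwDl; first exact: T.
  by apply: sumr_ge0 => j _; apply: ltW; exact: T.
have cL : conf L = conf 0.
  rewrite /conf; congr (columns _); apply/funext => j.
  by rewrite add0r [L + _]addrC trajectory_periodic.
apply/eqP; apply/negPn/negP => d0.
have := d0; rewrite neq_lt => /orP[dneg|dpos].
  have H : HOm g (conf 0) < HOm g (conf L).
    apply: (@increasing_lt R (fun s => HOm g (conf s)) D dH) => // s.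
    by rewrite DE pmulr_lgt0 ?S0// oppr_gt0.
  by rewrite cL ltxx in H.
have dH' (s : R) : is_derive s 1 (fun s => - HOm g (conf s)) (- D s) by exact: is_deriveN.
have H : - HOm g (conf 0) < - HOm g (conf L).
  apply: (@increasing_lt R (fun s => - HOm g (conf s)) (fun s => - D s) dH') => // s.
  by rewrite DE mulNr opprK; exact: mulr_gt0.
by rewrite cL ltxx in H.
Qed.

(** The time unit is chosen so that the force is the gradient of the
Hamiltonian. *)
Definition motion (t : R) : 'M[R]_(2, n.+1) := conf ((2 * pi * r)^-1 * t).

Lemma motion_solution : solution g Om motion.
Proof.
have pr : 2 * pi * r != 0 by rewrite gt_eqF// !mulr_gt0// pi_gt0.
move=> t; have FNt s : FN Om (conf s).
  split=> [j|i j ij]; rewrite !col_columns; first exact: trajectory_in.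
  by have [_ _] := trajectory_off s (j := j) (i := i) (introN eqP (fun e => elimN eqP ij (esym e))).
split; first exact: FNt.
move=> j; set s0 := (2 * pi * r)^-1 * t.
have -> : (fun s => col j (motion s)) = (fun s => trajectory ((2 * pi * r)^-1 * s + tau j)).
  by apply/funext => s; rewrite col_columns.
have dv := velocity F oOm gC3 r0 Xu fix_u reg rhoN_neg (s0 + tau j).
rewrite drift_eq0 mul0r scale0r addr0 force_pull in dv.
have dv' := is_derive_translate dv.
have -> : - rot90 (grad_col (@HOm R g n.+1) j (motion t)) =
   (2 * pi * r)^-1 *: - rot90 ((2 * pi * r) *: pull g (fun k => trajectory (s0 + tau k)) j).
  rewrite (grad_col_HOm oOm gC3 gsym j (FNt s0)).
  rewrite (_ : (fun k => col k (conf s0)) = (fun k => trajectory (s0 + tau k))); last first.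
    by apply/funext => k'; rewrite col_columns.
  move: (pull _ _ _) => w; have -> : rot90 ((2 * pi * r) *: w) = (2 * pi * r) *: rot90 w.
    by apply: col2P; rewrite ?[RHS]mxE !rot90E mxE// mulrN.
  by rewrite scalerN scalerA mulVf// scale1r.
exact: (is_derive_dilate (f := fun s => trajectory (s + tau j)) dv').
Qed.

Lemma col_motion j t : col j (motion t) = trajectory ((2 * pi * r)^-1 * t + tau j).
Proof. by rewrite col_columns. Qed.

Lemma motion_choreography (j : 'I_n.+1) t :
  col j (motion t) = col ord0 (motion (t + j%:R * (2 * pi * r * L) / n.+1%:R)).
Proof.
have pr : 2 * pi * r != 0 by rewrite gt_eqF// !mulr_gt0// pi_gt0.
rewrite !col_motion tau0 addr0; congr (trajectory _); rewrite /Submission.tau.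
have N0 : n.+1%:R != 0 :> R by rewrite pnatr_eq0.
by move: (n.+1%:R) N0 (2 * pi * r) pr => z z0 c c0; field; rewrite z0 c0.
Qed.

Lemma th_increasing s t : s < t -> th s < th t.
Proof.
exact: (@increasing_lt R (fun t => th t) angular_speed (is_derive_th Xu fix_u) speed_pos).
Qed.

Lemma motion_minimal_period : (forall S t, trajectory (t + S) = trajectory t ->
    exists m : int, th (t + S) = th t + m%:~R * L) ->
  minimal_period (2 * pi * r * L) motion.
Proof.
move=> inj; have p0 : 0 < 2 * pi * r by rewrite !mulr_gt0// pi_gt0.
have pr : 2 * pi * r != 0 by rewrite gt_eqF.
split; first exact: mulr_gt0.
  move=> t; rewrite /motion mulrDr mulKf//; rewrite /conf; congr (columns _).
  by apply/funext => j; rewrite addrAC trajectory_periodic.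
move=> S S0 per; pose S' := (2 * pi * r)^-1 * S.
have S'0 : 0 < S' by rewrite mulr_gt0// invr_gt0.
have pt t : trajectory (t + S') = trajectory t.
  have := congr1 (col ord0) (per (2 * pi * r * t)).
  by rewrite !col_motion tau0 !addr0 mulrDr mulKf.
have [m Hm] := inj S' 0 (pt 0).
have m0 : 0 < m%:~R * L by rewrite -(ltrDl (th 0)) -Hm; apply: th_increasing; rewrite ltrDl.
have m1 : L <= m%:~R * L.
  by rewrite ler_peMl ?(ltW L0)// ler1z; move: m0; rewrite pmulr_lgt0// ltr0z.
have : L <= S'.
  rewrite leNgt; apply/negP => SL.
  have : th (0 + S') < th (0 + L) by apply: th_increasing; rewrite ltrD2l.
  by have [-> _ _] := orb_shift 0; rewrite Hm ltrD2l ltNge m1.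
by rewrite /S' mulrC ler_pdivlMr// mulrC.
Qed.

End Choreography.

(*PART 25*)
Section UniformStrictDerivative.
Context {R : realType} (T : Type).

Lemma usd_lin (W : normedModType R) (u v : R -> T -> W) (r c : R) y z :
  usd u r y -> usd v r z ->
  usd (fun r t => u r t + c *: v r t) r (fun t => y t + c *: z t).
Proof.
move=> Hu Hv e e0; have c0 : 0 < 1 + `|c| by rewrite ltr_pwDl.
have e1 : 0 < e / (1 + `|c|) by rewrite divr_gt0.
have [d1 d10 H1] := Hu _ e1; have [d2 d20 H2] := Hv _ e1.
exists (Num.min d1 d2); first by rewrite lt_min d10.
move=> r1 r2; rewrite !lt_min => /andP[h1 h1'] /andP[h2 h2'] t.
have k1 := H1 r1 r2 h1 h2 t; have k2 := H2 r1 r2 h1' h2' t.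
have -> : u r1 t + c *: v r1 t - (u r2 t + c *: v r2 t) - (r1 - r2) *: (y t + c *: z t) =
  (u r1 t - u r2 t - (r1 - r2) *: y t) + c *: (v r1 t - v r2 t - (r1 - r2) *: z t).
  rewrite scalerDr [(r1 - r2) *: (c *: _)]scalerA [(r1 - r2) * c]mulrC -scalerA.
  rewrite ![c *: (_ - _)]scalerBr !opprD (addrACA (u r1 t)).
  by rewrite (addrACA (u r1 t - u r2 t)).
apply: le_trans (ler_normD _ _) _; rewrite normrZ.
apply: (@le_trans _ _ (e / (1 + `|c|) * `|r1 - r2| + `|c| * (e / (1 + `|c|) * `|r1 - r2|))).
  by apply: lerD => //; rewrite ler_wpM2l.
by rewrite le_eqVlt; apply/orP; left; apply/eqP; field; rewrite gt_eqF.
Qed.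

Lemma usd_cst (W : normedModType R) (w : T -> W) (r : R) : usd (fun=> w) r (fun=> 0).
Proof.
by move=> e e0; exists 1 => // r1 r2 _ _ t; rewrite subrr scaler0 subr0 normr0 mulr_ge0// ltW.
Qed.

Lemma usd_sum (W : normedModType R) (I : finType) (u : I -> R -> T -> W) (r : R) :
  (forall i, exists y, usd (u i) r y) ->
  exists y, usd (fun r t => \sum_i u i r t) r y.
Proof.
move=> /choice [y Hy].
have H s : usd (fun r t => \sum_(i <- s) u i r t) r (fun t => \sum_(i <- s) y i t).
  elim: s => [|i s IH].
    have := @usd_cst W (fun=> 0) r; congr (usd _ _ _).
      by apply/funext => r'; apply/funext => t; rewrite big_nil.
    by apply/funext => t; rewrite big_nil.
  have := @usd_lin W _ _ r 1 _ _ (Hy i) IH; congr (usd _ _ _).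
    by apply/funext => r'; apply/funext => t; rewrite big_cons scale1r.
  by apply/funext => t; rewrite big_cons scale1r.
by exists (fun t => \sum_i y i t); exact: H.
Qed.

Lemma usd_near (W : normedModType R) (u v : R -> T -> W) (r d0 : R) y : 0 < d0 ->
  (forall s, `|s - r| < d0 -> u s = v s) -> usd u r y -> usd v r y.
Proof.
move=> d00 uv Hu e /Hu [d dp H]; exists (Num.min d d0); first by rewrite lt_min dp.
move=> r1 r2; rewrite !lt_min => /andP[h1 h1'] /andP[h2 h2'] t.
by rewrite -!uv//; exact: H.
Qed.

Lemma usd_reparam (T' : Type) (W : normedModType R) (f : T' -> T) (u : R -> T -> W) (r : R) y :
  usd u r y -> usd (fun r t => u r (f t)) r (fun t => y (f t)).
Proof. by move=> Hu e /Hu [d d0 H]; exists d => // r1 r2 h1 h2 t; exact: H. Qed.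

(** Composition with a map whose strict derivatives along the family are
uniform. *)
Lemma usd_comp (V W : normedModType R) (K : V -> W) (p : R -> T -> V) (r B C : R)
    (A : T -> V -> W) (Y : T -> V) :
  usd p r Y -> (forall t, `|Y t| <= B) ->
  (forall t, linear (A t)) -> (forall t h, `|A t h| <= C * `|h|) ->
  (forall e : R, 0 < e -> exists2 d : R, 0 < d & forall t p1 p2,
     `|p1 - p r t| < d -> `|p2 - p r t| < d -> `|K p1 - K p2 - A t (p1 - p2)| <= e * `|p1 - p2|) ->
  usd (fun r t => K (p r t)) r (fun t => A t (Y t)).
Proof.
move=> Hp YB lA AC HK e e0.
pose B1 := `|B| + 1; pose C1 := `|C| + 1.
have B10 : 0 < B1 by rewrite /B1 ltr_wpDl.
have C10 : 0 < C1 by rewrite /C1 ltr_wpDl.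
have [d1 d10 H1] := HK _ (divr_gt0 e0 (mulr_gt0 (ltr0n R 2) B10 : 0 < 2 * B1)).
have [d2 d20 H2] := Hp _ (divr_gt0 e0 (mulr_gt0 (ltr0n R 2) C10 : 0 < 2 * C1)).
have [d3 d30 H3] := Hp 1 ltr01.
exists (Num.min d2 (Num.min d3 (d1 / B1))); first by rewrite !lt_min d20 d30 divr_gt0.
have lip s1 s2 t : `|s1 - r| < d3 -> `|s2 - r| < d3 -> `|p s1 t - p s2 t| <= B1 * `|s1 - s2|.
  move=> h1 h2; rewrite -(subrK ((s1 - s2) *: Y t) (p s1 t - p s2 t)).
  apply: le_trans (ler_normD _ _) _; rewrite /B1 mulrDl addrC; apply: lerD; last exact: H3.
  rewrite normrZ mulrC ler_wpM2r//; apply: le_trans (YB t) _; exact: ler_norm.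
move=> r1 r2; rewrite !lt_min => /andP[h1 /andP[h1' h1'']] /andP[h2 /andP[h2' h2'']] t.
have cl s : `|s - r| < d3 -> `|s - r| < d1 / B1 -> `|p s t - p r t| < d1.
  move=> k1 k2; apply: le_lt_trans (lip s r t k1 _) _; first by rewrite subrr normr0.
  by rewrite mulrC -ltr_pdivlMr.
have k1 := H1 t _ _ (cl _ h1' h1'') (cl _ h2' h2'').
have k2 := H2 r1 r2 h1 h2 t; have k3 := lip r1 r2 t h1' h2'.
have -> : K (p r1 t) - K (p r2 t) - (r1 - r2) *: A t (Y t) =
  (K (p r1 t) - K (p r2 t) - A t (p r1 t - p r2 t)) +
  A t (p r1 t - p r2 t - (r1 - r2) *: Y t).
  by rewrite (linear_sub (lA t) (p r1 t - p r2 t)) (linear_scal (lA t)) addrA subrK.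
apply: le_trans (ler_normD _ _) _.
have k4 : `|A t (p r1 t - p r2 t - (r1 - r2) *: Y t)| <= C1 * (e / (2 * C1) * `|r1 - r2|).
  apply: le_trans (AC _ _) _; apply: le_trans (_ : C1 * `|p r1 t - p r2 t - (r1 - r2) *: Y t| <= _).
    by rewrite ler_wpM2r// /C1; have := ler_norm C; lra.
  by rewrite ler_pM2l.
have k5 : e / (2 * B1) * `|p r1 t - p r2 t| <= e / (2 * B1) * (B1 * `|r1 - r2|).
  by rewrite ler_pM2l// divr_gt0// mulr_gt0.
apply: le_trans (lerD (le_trans k1 k5) k4) _.
by rewrite le_eqVlt; apply/orP; left; apply/eqP; field; rewrite !gt_eqF.
Qed.

(** The derivative depends continuously on the parameter. *)
Lemma usd_derivative_close (u : R -> T -> R) (r : R) y : usd (W := R^o) u r y ->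
  forall e : R, 0 < e -> exists2 d : R, 0 < d & forall s ys, `|s - r| < d ->
    usd (W := R^o) u s ys -> forall t, `|ys t - y t| <= e.
Proof.
move=> Hu e e0; have e2 : 0 < e / 2 by rewrite divr_gt0.
have [d d0 H] := Hu _ e2; exists d => // s ys sd Hs t.
have [d1 d10 H1] := Hs _ e2.
pose h := Num.min (d - `|s - r|) d1 / 2.
have m0 : 0 < Num.min (d - `|s - r|) d1 by rewrite lt_min d10 subr_gt0 sd.
have h0 : 0 < h by rewrite divr_gt0.
have [hd hd1] : h < d - `|s - r| /\ h < d1.
  have : h < Num.min (d - `|s - r|) d1 by rewrite /h; lra.
  by rewrite lt_min => /andP.
have sh : s + h - s = h by rewrite addrAC subrr add0r.
have k1 := H (s + h) s _ sd t; have k2 := H1 (s + h) s _ _ t.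
rewrite sh (gtr0_norm h0) in k1 k2.
have {}k1 : `|u (s + h) t - u s t - h *: (y t : R^o)| <= e / 2 * h.
  apply: k1; have -> : s + h - r = (s - r) + h by ring.
  by apply: le_lt_trans (ler_normD _ _) _; rewrite (gtr0_norm h0); lra.
have {}k2 : `|u (s + h) t - u s t - h *: (ys t : R^o)| <= e / 2 * h.
  by apply: k2 => //; rewrite subrr normr0.
rewrite -(ler_pM2l h0) -[in leLHS](gtr0_norm h0) -normrM mulrBr.
have -> : h * ys t - h * y t = (u (s + h) t - u s t - h * y t) - (u (s + h) t - u s t - h * ys t).
  by ring.
by apply: le_trans (ler_normB _ _) _; move: k1 k2; rewrite /GRing.scale /=; lra.
Qed.

Lemma usd_quotient (u : R -> T -> R) (r : R) y : usd (W := R^o) u r y ->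
  forall e : R, 0 < e -> exists2 d : R, 0 < d & forall h, `|h| < d -> h != 0 ->
    forall t, `|h^-1 * (u (r + h) t - u r t) - y t| <= e.
Proof.
move=> Hu e /Hu [d d0 H]; exists d => // h hd h0 t.
have rh : r + h - r = h by rewrite addrAC subrr add0r.
have := H (r + h) r; rewrite rh subrr normr0 => /(_ hd d0 t) k.
have nh : 0 < `|h| by rewrite normr_gt0.
rewrite -(ler_pM2l nh) -normrM [`|h| * e]mulrC; apply: le_trans k.
by rewrite mulrBr mulrA divff// mul1r.
Qed.

End UniformStrictDerivative.

Section DerivativeOfDerivative.
Context {R : realType}.

(** Difference quotients in the parameter and their time derivatives converge
uniformly, so the two derivatives commute. *)
Lemma usd_is_derive (w v : R -> R -> R) (r d0 : R) (y z : R -> R) : 0 < d0 ->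
  (forall s (t : R), `|s - r| < d0 -> is_derive t 1 (w s) (v s t)) ->
  (forall s, `|s - r| < d0 -> continuous (v s)) ->
  usd (W := R^o) w r y -> usd (W := R^o) v r z ->
  continuous z /\ forall t : R, is_derive t 1 y (z t).
Proof.
move=> d00 dw cv Hw Hv.
have r00 : `|r - r| < d0 by rewrite subrr normr0.
have pick (d : R) : 0 < d -> exists h, [/\ h != 0, `|h| < d & `|r + h - r| < d0].
  move=> dp; exists (Num.min d d0 / 2).
  have m0 : 0 < Num.min d d0 by rewrite lt_min dp.
  have : Num.min d d0 / 2 < Num.min d d0 by lra.
  rewrite lt_min => /andP[h1 h2]; have rh (h : R) : r + h - r = h by rewrite addrAC subrr add0r.
  by rewrite rh gtr0_norm ?divr_gt0//; split=> //; rewrite gt_eqF// divr_gt0.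
have cz : continuous z.
  move=> t; apply/(@continuous_atP R R^o R^o) => e e0.
  have e3 : 0 < e / 3 by rewrite divr_gt0.
  have [d dp H] := usd_quotient Hv e3; have [h [h0 hd hr]] := pick d dp.
  have cD : {for t, continuous (fun s => h^-1 * (v (r + h) s - v r s) : R)}.
    apply: cvgM; first exact: cvg_cst.
    by apply: (@cvgB _ R^o); exact: cv.
  have [d1 d10 H1] := (@continuous_atP R R^o R^o _ _).1 cD _ e3.
  exists d1 => // s /H1 k1; have k2 := H h hd h0 s; have k3 := H h hd h0 t.
  have -> : z s - z t = (h^-1 * (v (r + h) s - v r s) - h^-1 * (v (r + h) t - v r t)) -
    (h^-1 * (v (r + h) s - v r s) - z s) + (h^-1 * (v (r + h) t - v r t) - z t) by ring.
  apply: le_trans (ler_normD _ _) _; apply: le_trans (lerD (ler_normB _ _) (lexx _)) _.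
  by move: k1 k2 k3; lra.
split=> // t.
have dP s := is_derive_prim s cz.
suff E s : y s = y 0 + prim z s.
  have -> : y = (fun s => y 0 + 1 * prim z s) by apply/funext => s; rewrite mul1r.
  have -> : z t = 0 + 1 * z t by ring.
  exact: is_deriveDM.
apply/eqP; rewrite -subr_eq0 -normr_le0; apply/ler_addgt0Pr => e e0; rewrite add0r.
have q0 : 0 < 2 + `|s| by rewrite ltr_pwDl.
have e1 : 0 < e / (2 + `|s|) by rewrite divr_gt0.
have [d1 d10 H1] := usd_quotient Hw e1; have [d2 d20 H2] := usd_quotient Hv e1.
have dm : 0 < Num.min d1 d2 by rewrite lt_min d10.
have [h [h0 + hr]] := pick _ dm; rewrite lt_min => /andP[hd1 hd2].
pose D x := h^-1 * (w (r + h) x - w r x) + (-1) * prim z x.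
have dD (x : R) : is_derive x 1 D (h^-1 * (v (r + h) x - v r x) + (-1) * z x).
  apply: is_deriveDM => //.
  have dB : is_derive x 1 (fun x => w (r + h) x + (-1) * w r x) (v (r + h) x + (-1) * v r x).
    by apply: is_deriveDM; exact: dw.
  have := @is_deriveDM R (fun=> 0) _ h^-1 x 0 _ (is_derive_cst _ _ _) dB.
  rewrite add0r mulN1r; congr (is_derive _ _ _ _).
  by apply/funext => x'; rewrite add0r mulN1r.
have k1 : `|D s - D 0| <= e / (2 + `|s|) * `|s - 0|.
  apply: (@mvt_le_sym R D _ _ _ _ (fun x _ => dD x)) => x _; rewrite mulN1r; exact: H2.
have k2 := H1 h hd1 h0 s; have k3 := H1 h hd1 h0 0.
rewrite /D prim0 subr0 mulr0 addr0 in k1.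
have -> : y s - (y 0 + prim z s) = (h^-1 * (w (r + h) s - w r s) + -1 * prim z s -
   h^-1 * (w (r + h) 0 - w r 0)) - (h^-1 * (w (r + h) s - w r s) - y s) +
   (h^-1 * (w (r + h) 0 - w r 0) - y 0) by ring.
apply: le_trans (ler_normD _ _) _; apply: le_trans (lerD (ler_normB _ _) (lexx _)) _.
have -> : e = e / (2 + `|s|) * `|s| + e / (2 + `|s|) + e / (2 + `|s|).
  by field; rewrite gt_eqF.
by apply: lerD => //; apply: lerD.
Qed.

End DerivativeOfDerivative.

Section C1Family.
Context {R : realType} {m n : nat}.
Variables (T rb : R) (w v : R -> R -> 'M[R]_(m, n)).
Hypothesis T0 : 0 < T.
Hypothesis loop_w : forall r, 0 < r < rb -> C1loop T (w r) (v r).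
Hypothesis usd_w : forall r i j, 0 < r < rb -> exists y, usd (W := R^o) (fun r t => w r t i j) r y.
Hypothesis usd_v : forall r i j, 0 < r < rb -> exists y, usd (W := R^o) (fun r t => v r t i j) r y.

Lemma C1_family : exists dF : R -> R -> 'M[R]_(m, n), forall r, 0 < r < rb ->
  [/\ H1 T (dF r),
      H1norm T (fun t => h^-1 *: (w (r + h) t - w r t) - dF r t) @[h --> 0^'] --> 0%E &
      H1norm T (fun t => dF s t - dF r t) @[s --> r] --> 0%E].
Proof.
have ex (q : R * 'I_m * 'I_n) : exists yz : (R -> R) * (R -> R), 0 < q.1.1 < rb ->
    usd (W := R^o) (fun r t => w r t q.1.2 q.2) q.1.1 yz.1 /\
    usd (W := R^o) (fun r t => v r t q.1.2 q.2) q.1.1 yz.2.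
  have [rr|_] := boolP (0 < q.1.1 < rb); last by exists (fun=> 0, fun=> 0).
  have [y Hy] := usd_w q.1.2 q.2 rr; have [z Hz] := usd_v q.1.2 q.2 rr.
  by exists (y, z).
have [f Hf] := choice ex.
pose dF r t : 'M[R]_(m, n) := \matrix_(i, j) (f (r, i, j)).1 t.
pose ddF r t : 'M[R]_(m, n) := \matrix_(i, j) (f (r, i, j)).2 t.
have inside r : 0 < r < rb -> exists2 d : R, 0 < d & forall s, `|s - r| < d -> 0 < s < rb.
  move=> /andP[r0 rb0]; exists (Num.min r (rb - r)); first by rewrite lt_min r0 subr_gt0.
  by move=> s; rewrite lt_min !ltr_norml => /andP[/andP[? ?] /andP[? ?]]; apply/andP; split; lra.
have CdF r : 0 < r < rb -> C1loop T (dF r) (ddF r).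
  move=> rr; have [d d0 Hd] := inside r rr.
  have H i j : continuous (f (r, i, j)).2 /\
      forall t : R, is_derive t 1 (f (r, i, j)).1 ((f (r, i, j)).2 t).
    have [Hw Hv] := Hf (r, i, j) rr.
    apply: (@usd_is_derive R (fun r t => w r t i j) (fun r t => v r t i j) r d) => //.
    - by move=> s t /Hd ss; have [dw _ _] := loop_w ss; exact: dw.
    - by move=> s /Hd ss; have [_ cv _] := loop_w ss; exact: cv.
  split.
  - move=> i j t; rewrite /ddF mxE; have [_ D] := H i j.
    by rewrite (_ : (fun s => dF r s i j) = (f (r, i, j)).1)//; apply/funext => s; rewrite mxE.
  - move=> i j; have [c _] := H i j.
    by rewrite (_ : (fun t => ddF r t i j) = (f (r, i, j)).2)//; apply/funext => s; rewrite mxE.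
  - move=> t; apply/matrixP => i j; rewrite !mxE; have [Hw _] := Hf (r, i, j) rr.
    apply/eqP; rewrite -subr_eq0 -normr_le0; apply/ler_addgt0Pr => e e0; rewrite add0r.
    have e2 : 0 < e / 2 by rewrite divr_gt0.
    have [d1 d10 H1] := usd_quotient Hw e2.
    pose h := Num.min d d1 / 2; have m0 : 0 < Num.min d d1 by rewrite lt_min d0.
    have h0 : 0 < h by rewrite divr_gt0.
    have [hd hd1] : h < d /\ h < d1.
      have : h < Num.min d d1 by rewrite /h; lra.
      by rewrite lt_min => /andP.
    have hn : `|h| < d1 by rewrite gtr0_norm.
    have h0' : h != 0 by rewrite gt_eqF.
    have k1 := H1 h hn h0' t; have k2 := H1 h hn h0' (t + T).
    have rh : 0 < r + h < rb by apply: Hd; rewrite addrAC subrr add0r gtr0_norm.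
    have [_ _ p1] := loop_w rh; have [_ _ p2] := loop_w rr.
    rewrite /= p1 p2 in k2; move: k1 k2 => /=; set q := h^-1 * _.
    move=> k1 k2; have := ler_normB (q - (f (r, i, j)).1 t) (q - (f (r, i, j)).1 (t + T)).
    by rewrite opprB addrC subrKA => h3; apply: le_trans h3 _; lra.
have finite_e (Q : 'I_m * 'I_n -> R -> Prop) : (forall ij d d', 0 < d' -> d' <= d -> Q ij d -> Q ij d') ->
    (forall ij, exists2 d, 0 < d & Q ij d) -> exists2 d, 0 < d & forall ij, Q ij d.
  exact: common_radius.
exists dF => r rr; have [d0 d00 Hd0] := inside r rr; split.
- exact: C1loop_in_H1 T0 (CdF r rr).
- apply: (@cvg_H1norm R m n _ _ T _ (fun h t => h^-1 *: (v (r + h) t - v r t) - ddF r t)) => // e e0.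
  have [|ij|d dp Hd] := finite_e (fun ij d => forall h, `|h| < d -> h != 0 -> forall t,
      `|h^-1 * (w (r + h) t ij.1 ij.2 - w r t ij.1 ij.2) - (f (r, ij.1, ij.2)).1 t| <= e /\
      `|h^-1 * (v (r + h) t ij.1 ij.2 - v r t ij.1 ij.2) - (f (r, ij.1, ij.2)).2 t| <= e).
  + move=> ij d d' d'0 d'd H h hd; apply: H; exact: lt_le_trans d'd.
  + have [Hw Hv] := Hf (r, ij.1, ij.2) rr.
    have [d1 d10 H1] := usd_quotient Hw e0; have [d2 d20 H2] := usd_quotient Hv e0.
    exists (Num.min d1 d2); first by rewrite lt_min d10.
    by move=> h; rewrite lt_min => /andP[h1 h2] h3 t; split; [exact: H1|exact: H2].
  have near : \forall h \near (0 : R), h != 0 -> [/\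
      C1loop T (fun t => h^-1 *: (w (r + h) t - w r t) - dF r t)
        (fun t => h^-1 *: (v (r + h) t - v r t) - ddF r t),
      forall t i j, `|(h^-1 *: (w (r + h) t - w r t) - dF r t) i j| <= e &
      forall t i j, `|(h^-1 *: (v (r + h) t - v r t) - ddF r t) i j| <= e].
    apply/(@near_ballP R R^o); exists (Num.min d d0); first by rewrite lt_min dp.
    move=> h; rewrite subr0 lt_min => /andP[hd hd0] h0.
    have rh : 0 < r + h < rb by apply: Hd0; rewrite addrAC subrr add0r.
    have [dw1 cv1 p1] := loop_w rh; have [dw2 cv2 p2] := loop_w rr; have [dw3 cv3 p3] := CdF r rr.
    split; last 2 first.
    + by move=> t i j; rewrite !mxE; have [] := Hd (i, j) h hd h0 t.
    + by move=> t i j; rewrite !mxE; have [] := Hd (i, j) h hd h0 t.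
    split; last by move=> t; rewrite p1 p2 p3.
    + move=> i j t.
      have -> : (fun s => (h^-1 *: (w (r + h) s - w r s) - dF r s) i j) =
        (fun s => (-1) * dF r s i j + h^-1 * (w (r + h) s i j + (-1) * w r s i j)).
        by apply/funext => s; rewrite !mxE; ring.
      have -> : (h^-1 *: (v (r + h) t - v r t) - ddF r t) i j =
        (-1) * ddF r t i j + h^-1 * (v (r + h) t i j + (-1) * v r t i j) by rewrite !mxE; ring.
      exact: is_deriveDM.
    + move=> i j.
      have -> : (fun s => (h^-1 *: (v (r + h) s - v r s) - ddF r s) i j) =
        (fun s => (0 + (-1) * ddF r s i j) + h^-1 * (v (r + h) s i j + (-1) * v r s i j)).
        by apply/funext => s; rewrite !mxE; ring.
      apply: continuousDM; last by apply: continuousDM; [exact: cv1|exact: cv2].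
      by apply: continuousDM; [move=> t; exact: cvg_cst|exact: cv3].
  exact: near.
- apply: (@cvg_H1norm R m n _ _ T _ (fun s t => ddF s t - ddF r t)) => // e e0.
  have [|ij|d dp Hd] := finite_e (fun ij d => forall s, `|s - r| < d -> 0 < s < rb -> forall t,
      `|(f (s, ij.1, ij.2)).1 t - (f (r, ij.1, ij.2)).1 t| <= e /\
      `|(f (s, ij.1, ij.2)).2 t - (f (r, ij.1, ij.2)).2 t| <= e).
  + move=> ij d d' d'0 d'd H s sd; apply: H; exact: lt_le_trans d'd.
  + have [Hw Hv] := Hf (r, ij.1, ij.2) rr.
    have [d1 d10 H1] := usd_derivative_close Hw e0; have [d2 d20 H2] := usd_derivative_close Hv e0.
    exists (Num.min d1 d2); first by rewrite lt_min d10.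
    move=> s; rewrite lt_min => /andP[h1 h2] ss t; have [Hw' Hv'] := Hf (s, ij.1, ij.2) ss.
    by split; [exact: (H1 s _ h1 Hw')|exact: (H2 s _ h2 Hv')].
  apply/(@near_ballP R R^o); exists (Num.min d d0); first by rewrite lt_min dp.
  move=> s; rewrite lt_min => /andP[sd sd0]; have ss := Hd0 s sd0.
  have [dw1 cv1 p1] := CdF s ss; have [dw2 cv2 p2] := CdF r rr.
  split; last 2 first.
  + by move=> t i j; rewrite !mxE; have [] := Hd (i, j) s sd ss t.
  + by move=> t i j; rewrite !mxE; have [] := Hd (i, j) s sd ss t.
  split; last by move=> t; rewrite p1 p2.
  + move=> i j t.
    have -> : (fun x => (dF s x - dF r x) i j) = (fun x => dF s x i j + (-1) * dF r x i j).
      by apply/funext => x; rewrite ![in LHS]mxE ![in RHS]mxE; ring.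
    have -> : (ddF s t - ddF r t) i j = ddF s t i j + (-1) * ddF r t i j.
      by rewrite ![in LHS]mxE ![in RHS]mxE; ring.
    exact: is_deriveDM.
  + move=> i j.
    have -> : (fun x => (ddF s x - ddF r x) i j) = (fun x => ddF s x i j + (-1) * ddF r x i j).
      by apply/funext => x; rewrite ![in LHS]mxE ![in RHS]mxE; ring.
    by apply: continuousDM; [exact: cv1|exact: cv2].
Qed.

End C1Family.

(*PART 26*)
Section UsdLoops.
Context {R : realType}.
Variables (L : R) (L0 : 0 < L).
Local Notation S := (R * R * R)%type.
Local Notation P := (R * (S * S))%type.
Variables (u : R -> 'I_3 * R -> R) (r d0 : R) (y : 'I_3 * R -> R).
Hypothesis d00 : 0 < d0.
Hypothesis Xu : forall s, `|s - r| < d0 -> loops L (u s).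
Hypothesis Hu : usd (W := R^o) u r y.

Lemma usd_loops : loops L y.
Proof.
apply: loops_uniform_limit => e e0; have [d dp H] := usd_quotient Hu e0.
pose h := Num.min d d0 / 2; have m0 : 0 < Num.min d d0 by rewrite lt_min dp.
have h0 : 0 < h by rewrite divr_gt0.
have [hd hd0] : h < d /\ h < d0.
  have : h < Num.min d d0 by rewrite /h; lra.
  by rewrite lt_min => /andP.
have X1 : loops L (u (r + h)) by apply: Xu; rewrite addrAC subrr add0r gtr0_norm.
have X0 : loops L (u r) by apply: Xu; rewrite subrr normr0.
exists (fun x => (fun=> 0) x + h^-1 * (u (r + h) x + (-1) * u r x)).
  by apply: loops_lin; [exact: loops0|exact: loops_lin].
move=> x; rewrite add0r mulN1r; apply: H; first by rewrite gtr0_norm.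
by rewrite gt_eqF.
Qed.

Lemma usd_dev : usd (W := S) (fun r t => dev L (u r) t) r (dev L y).
Proof.
have Xy := usd_loops; have C0 := dev_const_gt0 L0.
move=> e e0; have [d dp H] := Hu (divr_gt0 e0 C0).
exists (Num.min d d0); first by rewrite lt_min dp.
move=> r1 r2; rewrite !lt_min => /andP[h1 h1'] /andP[h2 h2'] t.
have X1 := Xu h1'; have X2 := Xu h2'.
have X3 : loops L (fun x => u r2 x + (r1 - r2) * y x) by exact: loops_lin.
have X4 : loops L (fun x => u r1 x + (-1) * (u r2 x + (r1 - r2) * y x)) by exact: loops_lin.
have -> : dev L (u r1) t - dev L (u r2) t - (r1 - r2) *: dev L y t =
  dev L (fun x => u r1 x + (-1) * (u r2 x + (r1 - r2) * y x)) t.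
  rewrite (dev_lin (-1) t X1 X3) (dev_lin (r1 - r2) t X2 Xy) scaleN1r opprD addrA.
  by [].
have -> : e * `|r1 - r2| = dev_const L * (e / dev_const L * `|r1 - r2|).
  by field; rewrite gt_eqF.
apply: dev_le => // x; have := H r1 r2 h1 h2 x.
by rewrite mulN1r opprD addrA.
Qed.

Lemma usd_place n (j : 'I_n.+1) : usd (W := P) (fun r t => place L r (u r) j t) r
  (fun t => (1, (dev L y t, dev L y (t + tau L j)))).
Proof.
move=> e e0; have [d dp H] := usd_dev e0; exists d => // r1 r2 h1 h2 t.
have nn : 0 <= e * `|r1 - r2| by rewrite mulr_ge0// ltW.
have B s : orb L (u r1) s - orb L (u r2) s - (r1 - r2) *: dev L y s =
  dev L (u r1) s - dev L (u r2) s - (r1 - r2) *: dev L y s.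
  by rewrite /orb opprD addrACA subrr add0r.
have -> : place L r1 (u r1) j t - place L r2 (u r2) j t -
    (r1 - r2) *: ((1, (dev L y t, dev L y (t + tau L j))) : P) =
  (r1 - r2 - (r1 - r2) * 1, (orb L (u r1) t - orb L (u r2) t - (r1 - r2) *: dev L y t,
   orb L (u r1) (t + tau L j) - orb L (u r2) (t + tau L j) - (r1 - r2) *: dev L y (t + tau L j))) :> P.
  by [].
rewrite prod_normE ge_max; apply/andP; split; first by rewrite /= mulr1 subrr normr0.
by rewrite prod_normE ge_max !B; apply/andP; split; exact: H.
Qed.

Lemma place_continuous n (j : 'I_n.+1) r1 (v : 'I_3 * R -> R) : loops L v ->
  continuous (fun t => place L r1 v j t : P).
Proof.
move=> Xv t; have co := orb_continuous Xv.
apply/(@continuous_atP R R^o P) => e e0.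
have [d1 d10 H1] := (@continuous_atP R R^o S _ _).1 (co t) e e0.
have [d2 d20 H2] := (@continuous_atP R R^o S _ _).1 (co (t + tau L j)) e e0.
exists (Num.min d1 d2); first by rewrite lt_min d10.
move=> s; rewrite lt_min => /andP[h1 h2].
rewrite prod_normE ge_max; apply/andP; split; first by rewrite /= subrr normr0 ltW.
rewrite prod_normE ge_max; apply/andP; split; first exact: H1.
by apply: H2; rewrite opprD addrACA subrr addr0.
Qed.

Lemma usd_along n (j : 'I_n.+1) (K : P -> R) :
  (forall p, K (p + (0, ((L, 0, 0), (L, 0, 0)))) = K p) ->
  (forall t, sdiff (K : P -> R^o) (place L r (u r) j t)) ->
  exists z, usd (W := R^o) (fun r t => K (place L r (u r) j t)) r z.
Proof.
move=> Kper sK; have Xr : loops L (u r) by apply: Xu; rewrite subrr normr0.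
have Xy := usd_loops.
have cp : continuous (fun t => place L r (u r) j t : P) by exact: place_continuous.
have pL t : place L r (u r) j (t + L) = place L r (u r) j t + (0, ((L, 0, 0), (L, 0, 0))).
  rewrite /place [t + L + _]addrAC !(orb_periodic L0)//; congr (_, _) => /=.
  by rewrite addr0.
have [A [lA [C AC] HA]] := @strict_deriv_curve R P R^o K _ _ L L0 cp pL Kper sK.
have [M HM] : exists M, forall t, `|dev L y t| <= M.
  have [M HM] := @periodic_bounded R L (fun t => `|dev L y t|) L0
    (fun t => cvg_norm (dev_continuous Xy (x := t)))
    (fun t => congr1 (fun x : S => `|x|) (dev_periodic L0 t Xy)).
  by exists M => t; have := HM t; rewrite normr_id.
exists (fun t => A t (1, (dev L y t, dev L y (t + tau L j)))).
apply: (@usd_comp R R P R^o K _ r (Num.max 1 M) C A _ (usd_place j)) => // t.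
rewrite prod_normE ge_max; apply/andP; split; first by rewrite /= normr1 le_max lexx.
by rewrite prod_normE ge_max !le_max !HM !orbT.
Qed.

End UsdLoops.

Section OrbitFamily.
Context {R : realType}.
Local Notation E := ('cV[R]_2).
Local Notation S := (R * R * R)%type.
Local Notation P := (R * (S * S))%type.
Variables (Om Gam : set E) (L : R) (gam nrm : R -> E) (k : R -> R).
Hypothesis F : frame Om Gam L gam nrm k.
Let L0 := frame_L F.
Local Notation tg t := (rot90 (nrm t)).
Local Notation X := (tube gam nrm).
Variable g : E -> E -> R.
Hypothesis oOm : open Om.
Hypothesis gC3 : Ck 3 (Om `*` Om) (fun wz : E * E => g wz.1 wz.2).
Hypothesis gsym : forall w z, Om w -> Om z -> g w z = g z w.
Local Notation rho := (rhofun g).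
Hypothesis rho_lim : forall t,
  [/\ rho z @[z --> within Om (nbhs (gam t))] --> (0 : R),
      grad rho z @[z --> within Om (nbhs (gam t))] --> - (2 *: nrm t) &
      hess rho z @[z --> within Om (nbhs (gam t))] --> (- (2 * k t))%:M].
Hypothesis Hdecay : green_decay Om gam nrm g.
Local Notation rhoN := (rhoN gam nrm g).
Local Notation rhoT := (rhoT gam nrm g).
Local Notation depth := (@depth R).
Local Notation depth' := (@depth' R).
Local Notation cJ := (cJ k).
Local Notation cB1 := (cB1 gam nrm g).
Local Notation cB2 := (cB2 gam nrm g).
Local Notation cB3 := (cB3 gam nrm g).
Local Notation Gn := (cG gam nrm g nrm).
Local Notation Gt := (cG gam nrm g (fun t => tg t)).
Variable n : nat.
Local Notation tau := (@tau R L n).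
Local Notation rkernel := (@rkernel R gam nrm k g n).
Local Notation q_self := (q_self gam nrm k g).
Local Notation q_pair := (q_pair gam nrm k g).
Local Notation e_pair := (e_pair gam nrm g).

Local Notation sources := (sources L tau rkernel).
Local Notation orb := (orb L).
Local Notation dev := (dev L).

Variables (rb : R) (u : R -> 'I_3 * R -> R).
Local Notation place r j t := (@place R L n r (u r) j t).
Local Notation position := (position gam nrm).
Local Notation position' := (position' gam nrm).
Local Notation th r t := (orb (u r) t).1.1.
Local Notation sg r t := (orb (u r) t).1.2.
Local Notation lev r t := (orb (u r) t).2.
Local Notation trajectory r := (@trajectory R L gam nrm r (u r)).
Local Notation force r := (@force R L gam nrm g n r (u r)).
Local Notation speed r := (@angular_speed R L gam nrm k g n r (u r)).
Local Notation depth_speed r := (@depth_speed R L gam nrm k g n r (u r)).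
Hypothesis Xu : forall r, 0 < r < rb -> loops L (u r).
Hypothesis fix_u : forall r, 0 < r < rb -> forall x, sources r (u r) x = u r x.
Hypothesis reg : forall r, 0 < r < rb -> forall j t, regular Om gam nrm k (place r j t) /\
  (j != ord0 -> offdiag Om (position (place r j t), position' (place r j t))).
Hypothesis usd_u : forall r, 0 < r < rb -> exists y, usd (W := R^o) u r y.

Lemma usd_family (K : P -> R) (j : 'I_n.+1) r : 0 < r < rb ->
  (forall p, K (p + (0, ((L, 0, 0), (L, 0, 0)))) = K p) ->
  (forall t, sdiff (K : P -> R^o) (place r j t)) ->
  exists z, usd (W := R^o) (fun r t => K (place r j t)) r z.
Proof.
move=> rr Kper sK; have [y Hy] := usd_u rr.
have d00 : 0 < Num.min r (rb - r) by case/andP: rr => ? ?; rewrite lt_min subr_gt0; apply/andP.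
apply: (usd_along L0 d00 _ Hy) => // s; rewrite lt_min !ltr_norml => /andP[/andP[h1 h2] /andP[h3 h4]].
by apply: Xu; apply/andP; split; lra.
Qed.

Let shiftE (p : P) : position (p + (0, ((L, 0, 0), (L, 0, 0)))) = position p /\
  position' (p + (0, ((L, 0, 0), (L, 0, 0)))) = position' p.
Proof.
move: p => [r [[[x s] m] [[x' s'] m']]].
have -> : ((r, ((x, s, m), (x', s', m'))) + (0, ((L, 0, 0), (L, 0, 0))) : P) =
  (r, ((x + L, s, m), (x' + L, s', m'))).
  by congr (_, ((_, _, _), (_, _, _))); rewrite /= addr0.
by rewrite /Submission.position /Submission.position' /= !(tubeL F).
Qed.

Lemma usd_trajectory r i : 0 < r < rb ->
  exists z, usd (W := R^o) (fun r t => trajectory r t i 0) r z.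
Proof.
move=> rr; apply: (@usd_family (fun p => position p i 0) ord0 r rr).
  by move=> p; rewrite (shiftE p).1.
by move=> t; have [sX _ _ _ _] := frame_sdiff F (place r ord0 t); exact: sdiff_coord sX.
Qed.

Definition force_kernel (i : 'I_2) (j : 'I_n.+1) (p : P) : R :=
  if j == ord0 then (2 * p.2.1.2)^-1 * grad rho (position p) i 0
  else 4 * pi * p.1 * grad1 g (position p) (position' p) i 0.

Lemma force_kernelE r t i : force r t i 0 = \sum_j force_kernel i j (place r j t).
Proof.
rewrite (bigD1 ord0)//= /Submission.force [LHS]mxE [X in X + _]mxE [X in _ + X]mxE; congr (_ + _).
rewrite summxE mulr_sumr; apply: eq_bigr => j /negbTE j0.
by rewrite /force_kernel j0.
Qed.

Lemma force_kernel_sdiff r i j t : 0 < r < rb ->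
  sdiff (force_kernel i j : P -> R^o) (place r j t).
Proof.
move=> rr; have [rg off] := reg rr j t.
have [_ _ _ _ sg] := self_sdiff F oOm gC3 rg; have [_ _ m0 _] := rg.
have [sr _ _ sm _] := coords_sdiff (place r j t); have c (b : R) := @sdiff_cst R P R^o b (place r j t).
rewrite /force_kernel; have [j0|j0] := eqVneq j ord0.
  apply: sdiffM; last exact: sdiff_coord sg.
  apply: sdiffV; first by rewrite mulf_neq0// pnatr_eq0.
  by apply: sdiffM => //; exact: c.
have [_ _ s1] := pair_sdiff F oOm gC3 (off j0).
by apply: sdiffM; [apply: sdiffM => //; exact: c|exact: sdiff_coord s1].
Qed.

Lemma usd_force r i : 0 < r < rb ->
  exists z, usd (W := R^o) (fun r t => force r t i 0) r z.
Proof.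
move=> rr.
have [|z Hz] := @usd_sum R R R^o 'I_n.+1 (fun j r t => force_kernel i j (place r j t)) r; last first.
  exists z; apply: (usd_near (d0 := 1) _ _ Hz) => // s _.
  by apply/funext => t; rewrite force_kernelE.
move=> j; apply: (@usd_family (force_kernel i j) j r rr).
  by move=> p; rewrite /force_kernel (shiftE p).1 (shiftE p).2 /= !addr0.
by move=> t; exact: force_kernel_sdiff.
Qed.

Lemma continuous_bigsum (I : Type) (s : seq I) (f : I -> R -> R) :
  (forall i, continuous (f i)) -> continuous (fun t => \sum_(i <- s) f i t).
Proof.
move=> cf; elim: s => [|i s IH].
  suff -> : (fun t => \sum_(i <- [::]) f i t) = (fun=> 0) by move=> t; exact: cvg_cst.
  by apply/funext => t; rewrite big_nil.
suff -> : (fun t => \sum_(j <- i :: s) f j t) = (fun t => f i t + \sum_(j <- s) f j t).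
  by move=> t; apply: (@cvgD _ R^o); [exact: cf|exact: IH].
by apply/funext => t; rewrite big_cons.
Qed.

Lemma force_continuous r i : 0 < r < rb -> continuous (fun t => force r t i 0).
Proof.
move=> rr; have -> : (fun t => force r t i 0) = (fun t => \sum_j force_kernel i j (place r j t)).
  by apply/funext => t; exact: force_kernelE.
apply: continuous_bigsum => j t.
apply: (@continuous_comp R P R (fun t => place r j t) (force_kernel i j)).
  by apply: place_continuous; exact: Xu.
exact: (sdiff_continuous (force_kernel_sdiff i j t rr)).
Qed.

End OrbitFamily.

(*PART 27*)
Section Arithmetic.
Context {R : realFieldType}.
Implicit Types a b c e x y z N : R.

Lemma sixteenth x e : x <= e / 16 -> 16 * x <= e.
Proof. lra. Qed.

Lemma one_minus_bounds x : `|x| <= 1 / 2 -> 1 / 2 <= 1 - x <= 2.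
Proof. by rewrite ler_norml => /andP[? ?]; apply/andP; split; lra. Qed.

Lemma le_minus1 N : `|(N + 2) * (- 1 / 2)| <= 1 / 2 -> N <= - 1.
Proof. by rewrite ler_norml => /andP[? ?]; lra. Qed.

Lemma near_one_bounds x : `|x - 1| <= 1 / 2 -> 0 < x <= 2.
Proof. by rewrite ler_norml => /andP[? ?]; apply/andP; split; lra. Qed.

Lemma near_one_succ x : 0 < x <= 2 -> `|x + 1| <= 3.
Proof. by move=> /andP[? ?]; rewrite ler_norml; apply/andP; split; lra. Qed.

Lemma quarters c e y : c * y <= e / 4 -> c * (y * 3) + c * y <= e.
Proof. lra. Qed.

Lemma three_terms x y z e b : x <= e -> y <= e -> z <= e / 2 -> 0 <= e -> 16 * e <= b ->
  x + y + z <= b.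
Proof. lra. Qed.

Lemma two_plus_one x e : x <= 2 * e -> e <= 1 -> x + 1 <= 3.
Proof. lra. Qed.

Lemma two_terms x y e b : x <= 2 * e -> y <= 2 * e * 3 -> 0 <= e -> 16 * e <= b -> x + y <= b.
Proof. lra. Qed.

Lemma half_le x y : 0 <= y -> x <= y -> x / 2 <= y.
Proof. lra. Qed.

Lemma sum_position G T B c r e E : G <= 2 * T -> T <= E -> B <= r * (e + 2 * (c * E)) ->
  c * E * r <= c * E -> 0 < c * c * E -> 0 < c * E -> 0 < e * r -> E = e * r ->
  G + B <= 4 * E + 5 * (c * E) + 2 * (c * c * E).
Proof. lra. Qed.

Lemma sum_velocity B2 B3 s c r e : B2 <= (1 + c) * (2 * (c * (e * r))) ->
  B3 <= 2 * (e * r) + r * (2 * (c * e)) -> s <= e * r ->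
  0 < c * c * (e * r) -> 0 < c * (e * r) -> 0 < e * r ->
  B3 + (B2 + s) <= 4 * (e * r) + 5 * (c * (e * r)) + 2 * (c * c * (e * r)).
Proof. lra. Qed.

End Arithmetic.

Section OrbitEstimates.
Context {R : realType}.
Local Notation E := ('cV[R]_2).
Local Notation S := (R * R * R)%type.
Local Notation P := (R * (S * S))%type.
Variables (Om Gam : set E) (L : R) (gam nrm : R -> E) (k : R -> R).
Hypothesis F : frame Om Gam L gam nrm k.
Let L0 := frame_L F.
Local Notation tg t := (rot90 (nrm t)).
Local Notation X := (tube gam nrm).
Variable g : E -> E -> R.
Hypothesis oOm : open Om.
Hypothesis gC3 : Ck 3 (Om `*` Om) (fun wz : E * E => g wz.1 wz.2).
Hypothesis gsym : forall w z, Om w -> Om z -> g w z = g z w.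
Local Notation rho := (rhofun g).
Hypothesis rho_lim : forall t,
  [/\ rho z @[z --> within Om (nbhs (gam t))] --> (0 : R),
      grad rho z @[z --> within Om (nbhs (gam t))] --> - (2 *: nrm t) &
      hess rho z @[z --> within Om (nbhs (gam t))] --> (- (2 * k t))%:M].
Hypothesis Hdecay : green_decay Om gam nrm g.
Local Notation rhoN := (rhoN gam nrm g).
Local Notation rhoT := (rhoT gam nrm g).
Local Notation depth := (@depth R).
Local Notation depth' := (@depth' R).
Local Notation cJ := (cJ k).
Local Notation cB1 := (cB1 gam nrm g).
Local Notation cB2 := (cB2 gam nrm g).
Local Notation cB3 := (cB3 gam nrm g).
Local Notation Gn := (cG gam nrm g nrm).
Local Notation Gt := (cG gam nrm g (fun t => tg t)).
Variable n : nat.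
Local Notation tau := (@tau R L n).
Local Notation rkernel := (@rkernel R gam nrm k g n).
Local Notation q_self := (q_self gam nrm k g).
Local Notation q_pair := (q_pair gam nrm k g).
Local Notation e_pair := (e_pair gam nrm g).

Local Notation sources := (sources L tau rkernel).
Local Notation orb := (orb L).
Local Notation dev := (dev L).

Variables (rb : R) (u : R -> 'I_3 * R -> R).
Local Notation place r j t := (@place R L n r (u r) j t).
Local Notation position := (position gam nrm).
Local Notation position' := (position' gam nrm).
Local Notation th r t := (orb (u r) t).1.1.
Local Notation sg r t := (orb (u r) t).1.2.
Local Notation lev r t := (orb (u r) t).2.
Local Notation trajectory r := (@trajectory R L gam nrm r (u r)).
Local Notation force r := (@force R L gam nrm g n r (u r)).
Local Notation speed r := (@angular_speed R L gam nrm k g n r (u r)).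
Local Notation depth_speed r := (@depth_speed R L gam nrm k g n r (u r)).
Hypothesis Xu : forall r, 0 < r < rb -> loops L (u r).
Hypothesis fix_u : forall r, 0 < r < rb -> forall x, sources r (u r) x = u r x.
Hypothesis reg : forall r, 0 < r < rb -> forall j t, regular Om gam nrm k (place r j t) /\
  (j != ord0 -> offdiag Om (position (place r j t), position' (place r j t))).
Hypothesis u_bound : exists2 C : R, 0 < C & forall r x, 0 < r < rb -> `|u r x| <= C * r.
Hypothesis u_small : forall e : R, 0 < e -> exists2 d : R, 0 < d &
  forall r x, 0 < r < rb -> r < d -> x.1 != 2 -> `|u r x| <= e * r.

Lemma speedE r t : 0 < r < rb -> speed r t = 2 + u r (0, t) - lev r t.
Proof.
move=> rr; rewrite -(fix_u rr) /Submission.sources /= (bigD1 ord0)//=.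
rewrite (eq_bigr (fun j => q_pair (place r j t))); last first.
  by move=> j /negbTE j0; rewrite /Submission.rkernel j0.
have -> : rkernel 0 ord0 (r, (orb (u r) t, orb (u r) (t + tau ord0))) =
  cJ (place r ord0 t) * (1 + cB2 (place r ord0 t)) * (lev r t)^-1 - 2 + lev r t by [].
rewrite /Submission.angular_speed; move: (\sum_(_ < _ | _) _) (cJ _ * _ * _) => s A.
by rewrite (_ : lev r t = 1 + mdev L (u r) t)//; ring.
Qed.

Lemma level_sourceE r t : 0 < r < rb ->
  \sum_(j < n.+1 | j != ord0) e_pair (place r j t) = u r (1, t).
Proof.
move=> rr; rewrite -(fix_u rr) /Submission.sources /= [RHS](bigD1 ord0)//= add0r.
by apply: eq_bigr => j /negbTE j0; rewrite /Submission.rkernel j0.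
Qed.

Lemma place_close (d : R) : 0 < d -> exists2 d' : R, 0 < d' & forall r j t, 0 < r < rb -> r < d' ->
  `|(place r j t).2 - base2 (tau j) t| <= d.
Proof.
move=> d0; have [C C0 HC] := u_bound; have D0 := dev_const_gt0 L0.
have DC : 0 < dev_const L * C by exact: mulr_gt0.
exists (d / (dev_const L * C)); first exact: divr_gt0.
move=> r j t rr rd; apply: place_near => s.
apply: le_trans (dev_le L0 s (Xu rr) (fun x => HC r x rr)) _.
by rewrite mulrA mulrC -ler_pdivlMr// ltW.
Qed.

Lemma orbit_estimates (e : R) : 0 < e -> exists2 d : R, 0 < d & forall r t, 0 < r < rb -> r < d ->
  [/\ `|th r t - t| <= e * r, `|sg r t - (1 + k t * r / 2)| <= e * r & `|speed r t - 1| <= e * r] /\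
  [/\ 1 / 2 <= 1 - r * sg r t * k (th r t) <= 2, rhoN (th r t) (r * sg r t) <= -1,
      0 < sg r t <= 2 & drift L (u r) = 0 -> `|depth_speed r t| <= e * r].
Proof.
move=> e0; have D0 := dev_const_gt0 L0.
have half0 : 0 < 1 / 2 :> R by [].
have [dk [Km Km0 [kd _ kM dkM]]] := curvature_bounds F.
pose e1 := Num.min 1 (e / 16); have e10 : 0 < e1 by rewrite lt_min ltr01 divr_gt0.
have e11 : e1 <= 1 by rewrite /e1 ge_min lexx.
have e1e : e1 <= e / 16 by rewrite /e1 ge_min lexx orbT.
have [d1 d10 H1] := u_small (divr_gt0 e10 D0).
have [d2 d20 H2] := u_small e10.
have [d3 d30 H3] := self_sizes F oOm gC3 rho_lim e10.
have [d4 d40 H4] := tiny_bend F (tau (ord0 : 'I_n.+1)) half0.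
have [d5 d50 H5] := tiny_cB2 F oOm gC3 rho_lim (tau (ord0 : 'I_n.+1)) half0.
pose ee := Num.min (Num.min (1 / 2) (e1 / (4 * Km))) (Num.min d4 d5).
have ee0 : 0 < ee by rewrite !lt_min half0 d40 d50 divr_gt0// mulr_gt0.
have [l1 l2 l3 l4] : [/\ ee <= 1 / 2, ee <= e1 / (4 * Km), ee <= d4 & ee <= d5].
  by rewrite /ee !ge_min !lexx ?orbT.
clearbody e1 ee.
have [d6 d60 H6] := place_close ee0.
pose d := Num.min (Num.min (Num.min d1 d2) (Num.min d3 d4)) (Num.min (Num.min d5 d6) 1).
exists d; first by rewrite !lt_min d10 d20 d30 d40 d50 d60 ltr01.
move=> r t rr; rewrite !lt_min => /andP[/andP[/andP[r1 r2] /andP[r3 r4]] /andP[/andP[r5 r6] r7]].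
have r0 : 0 < r by case/andP: rr.
have near := H6 r ord0 t rr r6.
have n1 : `|th r t - t| <= ee by have [h _ _ _ _] := near_base near.
have n2 : `|sg r t - 1| <= ee by have [_ h _ _ _] := near_base near.
have near2 := le_trans near l1.
have r30 : 0 < r < d3 by rewrite r0.
have r40 : 0 < r < d4 by rewrite r0.
have r50 : 0 < r < d5 by rewrite r0.
have [p1 p2 p3 _ _] := H3 _ r t _ r30 near2.
have [q1 _] := H4 r t _ _ r40 (le_trans near l3) (le_trans near l3).
have [q2 _] := H5 r t _ _ r50 (le_trans near l4) (le_trans near l4).
have phl : `|phase L (u r) t| <= e1 * r /\ `|mdev L (u r) t| <= e1 * r.
  have := phase_level_le L0 t (Xu rr) (fun x => H1 r x rr r1).
  by rewrite (_ : dev_const L * (e1 / dev_const L * r) = e1 * r)//; field; rewrite gt_eqF.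
have [th1 lv1] : `|th r t - t| <= e1 * r /\ `|lev r t - 1| <= e1 * r.
  have [h1 h2] := phl; split.
    by rewrite (_ : th r t - t = phase L (u r) t)//= addrAC subrr add0r.
  by rewrite (_ : lev r t - 1 = mdev L (u r) t)//= addrAC subrr add0r.
have u0 := H2 r (0, t) rr r2 isT; have u1 := H2 r (1, t) rr r2 isT.
have er : 0 <= e1 * r by rewrite mulr_ge0// ltW.
have ere : 16 * (e1 * r) <= e * r.
  by rewrite mulrA ler_pM2r//; exact: sixteenth.
have sp : `|speed r t - 1| <= 2 * (e1 * r).
  rewrite speedE// (_ : 2 + u r (0, t) - lev r t - 1 = u r (0, t) - (lev r t - 1)); last by ring.
  by rewrite mulr_natl mulr2n; apply: le_trans (ler_normB _ _) _; exact: lerD.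
have Jb : 1 / 2 <= 1 - r * sg r t * k (th r t) <= 2.
  by apply: one_minus_bounds; exact: q1.
have Nb : rhoN (th r t) (r * sg r t) <= -1.
  by apply: le_minus1; exact: q2.
have sb : 0 < sg r t <= 2.
  exact: near_one_bounds (le_trans n2 l1).
split; split=> //.
- apply: le_trans th1 _; by apply: le_trans ere; rewrite ler_peMl// ler1n.
- have lE := level_eq r0 (fix_u rr) t.
  have bE : cB1 (place r ord0 t) = lev r t - sg r t.
    rewrite (_ : cB1 (place r ord0 t) = (rho (X (th r t) (r * sg r t)) - 2 * (r * sg r t)) * (2 * r)^-1)//.
    by rewrite lE; move: (lev r t) (sg r t) => x y; field; rewrite gt_eqF.
  have p3' : `|lev r t - sg r t + k (th r t) * sg r t ^+ 2 * r / 2| <= e1 * r by rewrite -bE; exact: p3.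
  have kl : `|k (th r t) - k t| <= Km * `|th r t - t|.
    by apply: (@mvt_le_sym R k dk) => x _.
  have kb := kM (th r t).
  have -> : sg r t - (1 + k t * r / 2) = (lev r t - 1) -
      (lev r t - sg r t + k (th r t) * sg r t ^+ 2 * r / 2) +
      (k (th r t) * ((sg r t - 1) * (sg r t + 1)) + (k (th r t) - k t)) * (r / 2).
    by move: (lev r t) (sg r t) (k (th r t)) (k t) => x y z w; field.
  apply: le_trans (ler_normD _ _) _; apply: le_trans (lerD (ler_normB _ _) (lexx _)) _.
  have m1 : `|k (th r t) * ((sg r t - 1) * (sg r t + 1)) + (k (th r t) - k t)| <= e1.
    apply: le_trans (ler_normD _ _) _; rewrite !normrM.
    have a1 : `|sg r t + 1| <= 3.
      exact: near_one_succ sb.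
    have a2 : `|sg r t - 1| * `|sg r t + 1| <= ee * 3 by apply: ler_pM.
    have a3 : `|k (th r t)| * (`|sg r t - 1| * `|sg r t + 1|) <= Km * (ee * 3).
      by apply: ler_pM => //; rewrite mulr_ge0.
    have a4 : Km * `|th r t - t| <= Km * ee by rewrite ler_pM2l.
    have a5 : Km * ee <= e1 / 4.
      apply: le_trans (_ : Km * (e1 / (4 * Km)) <= _); first by rewrite ler_pM2l.
      by rewrite le_eqVlt; apply/orP; left; apply/eqP; field; rewrite gt_eqF.
    by apply: le_trans (lerD a3 (le_trans kl a4)) _; exact: quarters a5.
  have m2 : `|(k (th r t) * ((sg r t - 1) * (sg r t + 1)) + (k (th r t) - k t)) * (r / 2)| <= e1 * r / 2.
    by rewrite normrM (@gtr0_norm _ (r / 2)) ?divr_gt0// -[leRHS]mulrA ler_pM2r ?divr_gt0.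
  exact: three_terms lv1 p3' m2 er ere.
- apply: le_trans sp _; by apply: le_trans ere; rewrite ler_wpM2r// ler_nat.
move=> dr; rewrite /Submission.depth_speed level_sourceE// dr subr0.
have p2' : `|rhoT (th r t) (r * sg r t)| <= e1 * r by exact: p2.
have sp' : `|speed r t| <= 3.
  have e1r : e1 * r <= 1.
    by rewrite -[leRHS]mulr1; apply: ler_pM => //; exact: ltW.
  have := ler_normD (speed r t - 1) 1; rewrite subrK normr1 => /le_trans; apply.
  exact: two_plus_one sp e1r.
have Jn : `|1 - r * sg r t * k (th r t)| <= 2.
  by case/andP: Jb => c1 c2; rewrite ger0_norm//; exact: le_trans c1.
move: (rhoN _ _) (rhoT _ _) (speed r t) (1 - _) Nb p2' sp' Jn => N T w J Nb p2' sp' Jn.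
have N1 : 1 <= - N by rewrite lerNr.
have Np : 0 < - N by apply: lt_le_trans N1.
have -> : r * ((2 * r * u r (1, t) - J * T * w) / (r * - N)) = (2 * r * u r (1, t) - J * T * w) / - N.
  have N0 : N != 0 by rewrite lt_eqF// -oppr_gt0.
  by field; rewrite N0 gt_eqF.
rewrite normrM normfV (gtr0_norm Np) ler_pdivrMr//.
apply: (@le_trans _ _ (e * r)); last by rewrite ler_peMr// mulr_ge0// ltW.
apply: le_trans (ler_normB _ _) _.
have a1 : `|2 * r * u r (1, t)| <= 2 * (e1 * r).
  rewrite normrM gtr0_norm ?mulr_gt0//; apply: (@le_trans _ _ (2 * r * (e1 * r))).
    by rewrite ler_pM2l// mulr_gt0.
  by rewrite ler_wpM2r// -[leRHS]mulr1 ler_pM2l// ltW.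
have a2 : `|J * T * w| <= 2 * (e1 * r) * 3.
  by rewrite !normrM; apply: ler_pM => //; exact: ler_pM.
exact: two_terms a1 a2 er ere.
Qed.

(** Expansions of the trajectory and of its velocity. *)
Lemma trajectory_expansions (e : R) : 0 < e -> exists2 d : R, 0 < d & forall r t, 0 < r < rb -> r < d ->
  (forall t, rhoN (th r t) (r * sg r t) < 0) -> drift L (u r) = 0 ->
  enorm (trajectory r t - (gam t - r *: nrm t)) <= e * r /\
  enorm (- rot90 (force r t) - (1 - r * k t) *: tg t) <= e * r.
Proof.
move=> e0; have [dk [Km Km0 [kd _ kM dkM]]] := curvature_bounds F.
pose D := 4 + 5 * Km + 2 * (Km * Km).
have KK : 0 < Km * Km by exact: mulr_gt0.
have D0 : 0 < D by rewrite /D; move: Km0 KK; lra.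
pose e1 := e / D; have e10 : 0 < e1 by exact: divr_gt0.
have eE : e = e1 * D by rewrite /e1 divfK// gt_eqF.
have [d1 d10 H1] := orbit_estimates e10.
exists (Num.min d1 (Num.min 1 (e1 / (e1 + Km)))).
  by rewrite !lt_min d10 ltr01 divr_gt0// addr_gt0.
move=> r t rr; rewrite !lt_min => /andP[/(H1 _ t rr) [[a1 a2 a3] [a4 _ a5 a6]] /andP[r1 r2]] rN dr.
have r0 : 0 < r by case/andP: rr.
have ds := a6 dr.
have rK : e1 * r + Km * r <= e1.
  by rewrite -mulrDl mulrC -ler_pdivlMr ?addr_gt0// ltW.
have e1r : 0 < e1 * r by exact: mulr_gt0.
have Kr : 0 < Km * r by exact: mulr_gt0.
have sd : `|sg r t - 1| <= e1.
  have h1 : `|k t * r / 2| <= Km * r.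
    rewrite normrM normrM (gtr0_norm r0) (@gtr0_norm _ 2^-1)//.
    have := kM t; rewrite -(ler_pM2r r0); exact: half_le (ltW Kr).
  have := ler_normD (sg r t - (1 + k t * r / 2)) (k t * r / 2).
  rewrite (_ : sg r t - (1 + k t * r / 2) + k t * r / 2 = sg r t - 1); last by ring.
  by move=> /le_trans; apply; apply: le_trans (lerD a2 h1) rK.
have gl := gam_lipschitz F t (th r t).
have tl := tg_lipschitz F kM t (th r t).
have nl : enorm (nrm (th r t) - nrm t) <= 2 * Km * `|th r t - t|.
  apply: (vec_lipschitz (frame_dnrm F)) => s i; rewrite mxE normrM -[leRHS]mulr1.
  by apply: ler_pM => //; apply: unit_coord; exact: unit_tg F s.
have kl : `|k (th r t) - k t| <= Km * `|th r t - t|.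
  by apply: (@mvt_le_sym R k dk) => x _.
have n1 s := enorm_unit (frame_unit F s); have t1 s := enorm_unit (unit_tg F s).
have Ke : 0 < Km * e1 by exact: mulr_gt0.
have Ker : 0 < Km * (e1 * r) by exact: mulr_gt0.
have KKer : 0 < Km * Km * (e1 * r) by exact: mulr_gt0.
have eDE : e * r = 4 * (e1 * r) + 5 * (Km * (e1 * r)) + 2 * (Km * Km * (e1 * r)).
  by rewrite eE /D; ring.
have Kt : Km * `|th r t - t| <= Km * (e1 * r) by rewrite ler_pM2l.
have err : Km * (e1 * r) * r <= Km * (e1 * r) by rewrite ler_piMr// ltW.
split.
  have -> : trajectory r t - (gam t - r *: nrm t) = (gam (th r t) - gam t) +
      - (r *: ((sg r t - 1) *: nrm (th r t) + (nrm (th r t) - nrm t))).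
    by rewrite /Submission.trajectory /tube; apply: col2P; rewrite !mxE; ring.
  apply: le_trans (enorm_triangle _ _) _; rewrite enormN enormZ (gtr0_norm r0).
  have b1 : enorm ((sg r t - 1) *: nrm (th r t) + (nrm (th r t) - nrm t)) <= e1 + 2 * (Km * (e1 * r)).
    apply: le_trans (enorm_triangle _ _) _; rewrite enormZ n1 mulr1.
    by apply: lerD => //; apply: le_trans nl _; move: Kt; lra.
  have b2 : r * enorm ((sg r t - 1) *: nrm (th r t) + (nrm (th r t) - nrm t)) <=
     r * (e1 + 2 * (Km * (e1 * r))) by rewrite ler_pM2l.
  rewrite eDE; exact: sum_position gl a1 b2 err KKer Ker e1r (erefl _).
have ve := velocity_eq F r0 (reg rr) rN t.
rewrite dr mul0r scale0r addr0 in ve; rewrite ve.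
set A := (1 - r * sg r t * k (th r t)) * speed r t; set s' := depth_speed r t in ds *.
have -> : A *: tg (th r t) - s' *: nrm (th r t) - (1 - r * k t) *: tg t =
   (A - (1 - r * k t)) *: tg (th r t) + ((1 - r * k t) *: (tg (th r t) - tg t) + (- s') *: nrm (th r t)).
  move: (rot90 _) (rot90 _) => x y; move: (nrm _) => z.
  by apply: col2P; rewrite !mxE; ring.
apply: le_trans (enorm_triangle _ _) _; rewrite enormZ t1 mulr1.
apply: le_trans (lerD (lexx _) (enorm_triangle _ _)) _; rewrite !enormZ n1 mulr1 normrN.
have b1 : `|1 - r * k t| <= 1 + Km.
  apply: le_trans (ler_normB _ _) _; rewrite normr1 lerD2l normrM (gtr0_norm r0) -[leRHS]mul1r.
  by apply: ler_pM => //; exact: ltW.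
have b2 : `|1 - r * k t| * enorm (tg (th r t) - tg t) <= (1 + Km) * (2 * (Km * (e1 * r))).
  apply: ler_pM => //; first exact: enorm_ge0.
  by apply: le_trans tl _; rewrite -mulrA ler_pM2l.
have b3 : `|A - (1 - r * k t)| <= 2 * (e1 * r) + r * (2 * (Km * e1)).
  have -> : A - (1 - r * k t) = (1 - r * sg r t * k (th r t)) * (speed r t - 1) -
     r * ((sg r t - 1) * k (th r t) + (k (th r t) - k t)) by rewrite /A; ring.
  apply: le_trans (ler_normB _ _) _; rewrite !normrM (gtr0_norm r0); apply: lerD.
    apply: ler_pM => //; case/andP: a4 => c1 c2; rewrite ger0_norm//; exact: le_trans c1.
  rewrite ler_pM2l//; apply: le_trans (ler_normD _ _) _; rewrite normrM.
  have c1 : `|sg r t - 1| * `|k (th r t)| <= e1 * Km by apply: ler_pM.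
  have c2 : Km * (e1 * r) <= Km * e1 by rewrite ler_pM2l// ler_piMr// ltW.
  by rewrite mulr_natl mulr2n [Km * e1]mulrC; apply: lerD => //; rewrite mulrC; exact: le_trans kl (le_trans Kt c2).
rewrite eDE; exact: sum_velocity b2 b3 ds KKer Ker e1r.
Qed.

End OrbitEstimates.

(*PART 28*)
Section FirstOrder.
Context {R : realFieldType}.

Lemma first_order (x r c : R) : x <= r -> 0 < r -> 0 < c -> x + r * 1 <= r * (2 + c).
Proof.
by move=> xr r0 c0; rewrite mulr1 mulrDr; have := mulr_gt0 r0 c0; lra.
Qed.

Lemma first_order' (x y r c : R) : x <= r -> y <= r * c -> 0 < r -> x + y <= r * (2 + c).
Proof. by move=> xr yr r0; rewrite mulrDr; lra. Qed.

End FirstOrder.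

Section LinearLoops.
Context {R : realType}.

Lemma near_right0 (Q : R -> Prop) (d : R) : 0 < d -> (forall r, 0 < r < d -> Q r) ->
  \forall r \near 0^'+, Q r.
Proof.
move=> d0 H; near=> r; apply: H; apply/andP; split; near: r; first exact: nbhs_right_gt.
exact: nbhs_right_lt.
Unshelve. all: by end_near. Qed.

Lemma cvg_near_punctured (f h : R -> \bar R) (l : \bar R) (d : R) : 0 < d ->
  (forall s, `|s| < d -> s != 0 -> f s = h s) ->
  f s @[s --> 0^'] --> l -> h s @[s --> 0^'] --> l.
Proof.
move=> d0 fh; apply: cvg_trans; apply: near_eq_cvg.
have near : \forall s \near (0 : R), s != 0 -> f s = h s.
  by apply/(@near_ballP R R^o); exists d => // s; rewrite subr0; exact: fh.
exact: near.
Qed.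

Context {m n : nat}.

Lemma H1norm_quotient_eq (T h : R) (x x' y y' z : R -> 'M[R]_(m, n)) : x = x' -> y = y' ->
  H1norm T (fun t => h^-1 *: (x t - y t) - z t) = H1norm T (fun t => h^-1 *: (x' t - y' t) - z t).
Proof. by move=> -> ->. Qed.

Lemma C1loop_lin (T k : R) (u du v dv : R -> 'M[R]_(m, n)) : C1loop T u du -> C1loop T v dv ->
  C1loop T (fun t => u t + k *: v t) (fun t => du t + k *: dv t).
Proof.
move=> [du1 cu pu] [dv1 cv pv]; split; last by move=> t; rewrite pu pv.
- move=> i j t; rewrite [X in is_derive _ _ _ X]mxE [X in is_derive _ _ _ (_ + X)]mxE.
  have -> : (fun s => (u s + k *: v s) i j) = (fun s => u s i j + k * v s i j).
    by apply/funext => s; rewrite !mxE.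
  exact: is_deriveDM.
- move=> i j.
  have -> : (fun s => (du s + k *: dv s) i j) = (fun s => du s i j + k * dv s i j).
    by apply/funext => s; rewrite !mxE.
  by apply: continuousDM; [exact: cu|exact: cv].
Qed.

Lemma C1loop0 (T : R) : C1loop T (fun=> 0 : 'M[R]_(m, n)) (fun=> 0).
Proof.
split=> //.
- move=> i j t; have -> : (fun _ : R => (0 : 'M[R]_(m, n)) i j) = (fun=> (0 : 'M[R]_(m, n)) i j) by [].
  by rewrite mxE; exact: is_derive_cst.
- by move=> i j t; exact: cvg_cst.
Qed.

Lemma Ck1_linear (U : set R) (c : R) : Ck 1 U (fun r : R => c * r).
Proof.
split=> [x _|v x _].
  apply: (@sdiff_differentiable R R^o R^o); apply: (@sdiffM R R^o).
    exact: (@sdiff_cst R R^o R^o).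
  exact: sdiff_id.
have -> : 'D_v (fun r : R => c * r) = fun=> c * v; last exact: cvg_cst.
apply/funext => y; rewrite derive_line.
have d : is_derive (0 : R) 1 (fun s : R => c * (y + s *: (v : R^o))) (c * v).
  apply: is_derive_mulc; exact: is_derive_line.
exact: (@derive_val _ _ _ _ _ _ _ d).
Qed.

Lemma columnsE (c : 'I_m -> 'cV[R]_2) i j : columns c i j = c j i 0.
Proof. by rewrite mxE. Qed.

End LinearLoops.

Section Family.
Context {R : realType}.
Local Notation E := ('cV[R]_2).
Local Notation S := (R * R * R)%type.
Local Notation P := (R * (S * S))%type.
Variables (Om Gam : set E) (L : R) (gam nrm : R -> E) (k : R -> R).
Hypothesis F : frame Om Gam L gam nrm k.
Let L0 := frame_L F.
Local Notation tg t := (rot90 (nrm t)).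
Local Notation X := (tube gam nrm).
Variable g : E -> E -> R.
Hypothesis oOm : open Om.
Hypothesis gC3 : Ck 3 (Om `*` Om) (fun wz : E * E => g wz.1 wz.2).
Hypothesis gsym : forall w z, Om w -> Om z -> g w z = g z w.
Local Notation rho := (rhofun g).
Hypothesis rho_lim : forall t,
  [/\ rho z @[z --> within Om (nbhs (gam t))] --> (0 : R),
      grad rho z @[z --> within Om (nbhs (gam t))] --> - (2 *: nrm t) &
      hess rho z @[z --> within Om (nbhs (gam t))] --> (- (2 * k t))%:M].
Hypothesis Hdecay : green_decay Om gam nrm g.
Local Notation rhoN := (rhoN gam nrm g).
Local Notation rhoT := (rhoT gam nrm g).
Local Notation depth := (@depth R).
Local Notation depth' := (@depth' R).
Local Notation cJ := (cJ k).
Local Notation cB1 := (cB1 gam nrm g).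
Local Notation cB2 := (cB2 gam nrm g).
Local Notation cB3 := (cB3 gam nrm g).
Local Notation Gn := (cG gam nrm g nrm).
Local Notation Gt := (cG gam nrm g (fun t => tg t)).
Variable n : nat.
Local Notation tau := (@tau R L n).
Local Notation rkernel := (@rkernel R gam nrm k g n).
Local Notation q_self := (q_self gam nrm k g).
Local Notation q_pair := (q_pair gam nrm k g).
Local Notation e_pair := (e_pair gam nrm g).

Local Notation sources := (sources L tau rkernel).
Local Notation orb := (orb L).
Local Notation dev := (dev L).

Variables (rb : R) (u : R -> 'I_3 * R -> R).
Local Notation place r j t := (@place R L n r (u r) j t).
Local Notation position := (position gam nrm).
Local Notation position' := (position' gam nrm).
Local Notation th r t := (orb (u r) t).1.1.
Local Notation sg r t := (orb (u r) t).1.2.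
Local Notation lev r t := (orb (u r) t).2.
Local Notation trajectory r := (@trajectory R L gam nrm r (u r)).
Local Notation force r := (@force R L gam nrm g n r (u r)).
Local Notation speed r := (@angular_speed R L gam nrm k g n r (u r)).
Local Notation depth_speed r := (@depth_speed R L gam nrm k g n r (u r)).
Hypothesis Xu : forall r, 0 < r < rb -> loops L (u r).
Hypothesis fix_u : forall r, 0 < r < rb -> forall x, sources r (u r) x = u r x.
Hypothesis reg : forall r, 0 < r < rb -> forall j t, regular Om gam nrm k (place r j t) /\
  (j != ord0 -> offdiag Om (position (place r j t), position' (place r j t))).
Hypothesis u_bound : exists2 C : R, 0 < C & forall r x, 0 < r < rb -> `|u r x| <= C * r.
Hypothesis u_small : forall e : R, 0 < e -> exists2 d : R, 0 < d &
  forall r x, 0 < r < rb -> r < d -> x.1 != 2 -> `|u r x| <= e * r.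

Hypothesis usd_u : forall r, 0 < r < rb -> exists y, usd (W := R^o) u r y.
Hypothesis rN : forall r, 0 < r < rb -> forall t, rhoN (th r t) (r * sg r t) < 0.
Hypothesis Jp : forall r, 0 < r < rb -> forall t, 0 < 1 - r * sg r t * k (th r t).
Hypothesis wp : forall r, 0 < r < rb -> forall t, 0 < speed r t.
Hypothesis inj : forall r, 0 < r < rb -> forall S t, trajectory r (t + S) = trajectory r t ->
  exists m : int, th r (t + S) = th r t + m%:~R * L.

Definition solution_family (r : R) : R -> 'M[R]_(2, n.+1) := @motion R L gam nrm n r (u r).
Let conf r := @conf R L gam nrm n r (u r).
Let dconf r (s : R) : 'M[R]_(2, n.+1) := columns (fun j => - rot90 (force r (s + tau j))).

Lemma no_drift r : 0 < r < rb -> drift L (u r) = 0.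
Proof.
move=> rr; have r0 : 0 < r by case/andP: rr.
exact: (drift_eq0 F oOm gC3 gsym r0 (Xu rr) (fix_u rr) (reg rr) (rN rr) (Jp rr) (wp rr)).
Qed.

Lemma trajectory_derive r (t : R) : 0 < r < rb -> is_derive t 1 (trajectory r) (- rot90 (force r t)).
Proof.
move=> rr; have r0 : 0 < r by case/andP: rr.
have := velocity F oOm gC3 r0 (Xu rr) (fix_u rr) (reg rr) (rN rr) t.
by rewrite no_drift// mul0r scale0r addr0.
Qed.

Lemma family_properties r : 0 < r < rb ->
  [/\ solution g Om (solution_family r),
     minimal_period (2 * pi * r * L) (solution_family r) &
     forall (j : 'I_n.+1) t, col j (solution_family r t) =
       col ord0 (solution_family r (t + j%:R * (2 * pi * r * L) / n.+1%:R))].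
Proof.
move=> rr; have r0 : 0 < r by case/andP: rr.
split.
- exact: (motion_solution F oOm gC3 gsym r0 (Xu rr) (fix_u rr) (reg rr) (rN rr) (Jp rr) (wp rr)).
- exact: (motion_minimal_period F r0 (Xu rr) (fix_u rr) (wp rr) (inj rr)).
- by move=> j t; apply: motion_choreography.
Qed.

Lemma velocity_entry_continuous r i : 0 < r < rb ->
  continuous (fun t => (- rot90 (force r t)) i 0).
Proof.
move=> rr; have c0 := force_continuous F oOm gC3 Xu reg.
case: (ord2P i) => ->.
  rewrite (_ : (fun t => _) = fun t => force r t 1 0); first exact: (c0 r 1 rr).
  by apply/funext => t; rewrite mxE rot90E opprK.
rewrite (_ : (fun t => _) = fun t => - force r t 0 0).
  by move=> t; apply: (@cvgN _ R^o); exact: (c0 r 0 rr).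
by apply/funext => t; rewrite mxE rot90E.
Qed.

Lemma trajectory_loop r : 0 < r < rb ->
  C1loop L (trajectory r) (fun t => - rot90 (force r t)).
Proof.
move=> rr; split.
- move=> i j t; rewrite !ord1.
  exact: (is_derive_col _ _ _).1 (trajectory_derive t rr) i.
- move=> i j; rewrite ord1; exact: velocity_entry_continuous.
- by move=> t; apply: (trajectory_periodic F); exact: Xu.
Qed.

Lemma conf_loop r (c T : R) : 0 < r < rb -> c * T = L ->
  C1loop T (fun s => conf r (c * s)) (fun s => c *: dconf r (c * s)).
Proof.
move=> rr cT; split.
- move=> i j t.
  have -> : (c *: dconf r (c * t)) i j = (c *: - rot90 (force r (c * t + tau j))) i 0.
    by rewrite [LHS]mxE [RHS]mxE columnsE.
  have -> : (fun s => conf r (c * s) i j) = (fun s => trajectory r (c * s + tau j) i 0).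
    by apply/funext => s; rewrite mxE.
  have d := is_derive_translate (trajectory_derive (c * t + tau j) rr).
  have d' := is_derive_dilate (f := fun s => trajectory r (s + tau j)) d.
  exact: (is_derive_col _ _ _).1 d' i.
- move=> i j t.
  have -> : (fun s => (c *: dconf r (c * s)) i j) =
      (fun s => c * (- rot90 (force r (c * s + tau j))) i 0).
    by apply/funext => s; rewrite mxE columnsE.
  apply: cvgM; first exact: cvg_cst.
  apply: (@continuous_comp R R R (fun s => c * s + tau j) (fun s => (- rot90 (force r s)) i 0)).
    by apply: (@cvgD _ R^o); [apply: cvgM; [exact: cvg_cst|exact: cvg_id]|exact: cvg_cst].
  exact: velocity_entry_continuous.
- move=> t; rewrite mulrDr cT /conf /Submission.conf; congr (columns _); apply/funext => j.
  by rewrite addrAC; apply: (trajectory_periodic F); exact: Xu.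
Qed.

Lemma family_C1 : C1_into_calH1 `]0, rb[ (fun r => (2 * pi * r * L, solution_family r)).
Proof.
have p0 : 0 < 2 * pi :> R by rewrite mulr_gt0// pi_gt0.
have pn : 2 * pi != 0 :> R by rewrite gt_eqF.
pose c : R := L / (2 * pi).
have cT : c * (2 * pi) = L by rewrite /c divfK.
pose w r s := conf r (c * s); pose v r s := c *: dconf r (c * s).
have chartE r : 0 < r < rb -> (chart (2 * pi * r * L, solution_family r)).2 = w r.
  move=> /andP[r0 _]; apply/funext => s; rewrite /chart /= /solution_family /motion /w.
  congr (conf r _); rewrite /c; move: (2 * pi) pn => x x0.
  by field; rewrite x0 gt_eqF.
have [|||dF HdF] := @C1_family R 2 n.+1 (2 * pi) rb w v p0.
- by move=> r rr; exact: conf_loop.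
- move=> r i j rr; have [z Hz] := usd_trajectory F n Xu usd_u i rr.
  have Hz' := usd_reparam (fun s => c * s + tau j) Hz; exists (fun s => z (c * s + tau j)).
  apply: (usd_near (d0 := 1) _ _ Hz') => // s _.
  by apply/funext => t; rewrite columnsE.
- move=> r i j rr.
  have [z Hz] : exists z, usd (W := R^o) (fun r t => (- rot90 (force r t)) i 0) r z.
    case: (ord2P i) => ->.
      have [z Hz] := usd_force F oOm gC3 Xu reg usd_u 1 rr; exists z.
      apply: (usd_near (d0 := 1) _ _ Hz) => // s _; apply/funext => t.
      by rewrite [RHS]mxE rot90E opprK.
    have [z Hz] := usd_force F oOm gC3 Xu reg usd_u 0 rr.
    exists (fun t => 0 + (-1) *: (z t : R^o)).
    apply: (usd_near (d0 := 1) _ _ (usd_lin (-1) (usd_cst (fun=> 0 : R^o) r) Hz)) => // s _.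
    by apply/funext => t; rewrite [RHS]mxE rot90E add0r scaleN1r.
  exists (fun s => 0 + c *: (z (c * s + tau j) : R^o)).
  have Hz' := usd_reparam (fun s => c * s + tau j) Hz.
  apply: (usd_near (d0 := 1) _ _ (usd_lin c (usd_cst (fun=> 0 : R^o) r) Hz')) => // s _.
  by apply/funext => t; rewrite /v add0r [RHS]mxE columnsE.
split.
- move=> r; rewrite /= in_itv /= => rr; have r0 : 0 < r by case/andP: rr.
  have T0 : 0 < 2 * pi * r * L by rewrite !mulr_gt0// pi_gt0.
  split=> //=.
  have cT' : (2 * pi * r)^-1 * (2 * pi * r * L) = L by rewrite mulKf// gt_eqF// mulr_gt0.
  exact: C1loop_in_H1 T0 (conf_loop rr cT').
- rewrite (_ : (fun r => _) = fun r : R => (2 * pi * L) * r); first exact: Ck1_linear.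
  by apply/funext => r /=; ring.
- exists dF => r; rewrite /= in_itv /= => rr; have [h1 h2 h3] := HdF r rr.
  split; [exact: h1| |exact: h3].
  have [d d0 Hd] : exists2 d : R, 0 < d & forall h, `|h| < d -> 0 < r + h < rb.
    case/andP: rr => r0 rb0; exists (Num.min r (rb - r)); first by rewrite lt_min r0 subr_gt0.
    by move=> h; rewrite lt_min !ltr_norml => /andP[/andP[? ?] /andP[? ?]]; apply/andP; split; lra.
  refine (@cvg_near_punctured _ _ _ _ d d0 _ h2) => h hd _.
  exact: H1norm_quotient_eq (esym (chartE _ (Hd h hd))) (esym (chartE _ rr)).
Qed.

Lemma first_point r t : 0 < r < rb -> col ord0 (solution_family r (2 * pi * r * t)) = trajectory r t.
Proof.
move=> /andP[r0 _]; have pr : 2 * pi * r != 0 by rewrite gt_eqF// !mulr_gt0// pi_gt0.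
by rewrite /solution_family col_motion tau0 addr0 mulKf.
Qed.

Lemma frame_loops : C1loop L gam (fun t => tg t) /\ C1loop L nrm (fun t => k t *: tg t).
Proof.
have [dk [Km Km0 [kd _ _ _]]] := curvature_bounds F.
have ct : continuous (fun t => tg t) by move=> t; exact: is_derive_continuous (is_derive_tg F t).
have ck : continuous (fun t => k t *: tg t).
  by move=> t; apply: (continuousZ (s := k) (f := fun t => tg t)); [exact: is_derive_continuous (kd t)|exact: ct].
have entry (x : R -> E) i j : continuous x -> continuous (fun t => x t i j).
  move=> cx t; apply: (@continuous_comp _ _ _ x (fun y : E => y i j)); first exact: cx.
  exact: coord_continuous.
split; split.
- by move=> i j t; rewrite ord1; exact: (is_derive_col _ _ _).1 (frame_dgam F t) i.
- by move=> i j; exact: entry.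
- exact: frame_gamL F.
- by move=> i j t; rewrite ord1; exact: (is_derive_col _ _ _).1 (frame_dnrm F t) i.
- by move=> i j; exact: entry.
- exact: frame_nrmL F.
Qed.

Hypothesis rb0 : 0 < rb.
Hypothesis expansions : forall e : R, 0 < e -> exists2 d : R, 0 < d & forall r t, 0 < r < rb -> r < d ->
  enorm (trajectory r t - (gam t - r *: nrm t)) <= e * r /\
  enorm (- rot90 (force r t) - (1 - r * k t) *: tg t) <= e * r.

Let v r t : E := col ord0 (solution_family r (2 * pi * r * t)).

Let vE r : 0 < r < rb -> v r = trajectory r.
Proof. by move=> rr; apply/funext => t; exact: first_point. Qed.

Lemma curve_limit : H1norm L (fun t => v r t - gam t) @[r --> 0^'+] --> 0%E.
Proof.
have [dk [Km Km0 [_ _ kM _]]] := curvature_bounds F; have [lg _] := frame_loops.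
apply: (@cvg_H1norm R 2 1 _ _ L _ (fun r t => - rot90 (force r t) - tg t)) => // e e0.
have [d d0 Hd] := expansions ltr01; have K2 : 0 < 2 + Km by rewrite addr_gt0.
apply: (near_right0 (d := Num.min (Num.min d rb) (e / (2 + Km)))).
  by rewrite !lt_min d0 rb0 divr_gt0.
move=> r /andP[r0]; rewrite !lt_min => /andP[/andP[rd rrb] re].
have rr : 0 < r < rb by rewrite r0.
have re' : r * (2 + Km) <= e by rewrite -ler_pdivlMr// ltW.
rewrite vE//; split.
- have := C1loop_lin (-1) (trajectory_loop rr) lg.
  rewrite (_ : (fun t => trajectory r t + -1 *: gam t) = (fun t => trajectory r t - gam t)); last first.
    by apply/funext => t; rewrite scaleN1r.
  rewrite (_ : (fun t => - rot90 (force r t) + -1 *: tg t) = (fun t => - rot90 (force r t) - tg t))//.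
  by apply/funext => t; rewrite scaleN1r.
- move=> t i j; rewrite ord1; apply: le_trans (coord_le_enorm _ i) _.
  have [h1 _] := Hd r t rr rd.
  have -> : trajectory r t - gam t = (trajectory r t - (gam t - r *: nrm t)) + (- r) *: nrm t.
    by rewrite scaleNr opprB addrCA [RHS]addrC addKr.
  apply: le_trans (enorm_triangle _ _) _; rewrite enormZ (enorm_unit (frame_unit F t)) normrN (gtr0_norm r0).
  by apply: le_trans re'; rewrite mul1r in h1; apply: first_order h1 r0 Km0.
- move=> t i j; rewrite ord1; apply: le_trans (coord_le_enorm _ i) _.
  have [_ h1] := Hd r t rr rd.
  have -> : - rot90 (force r t) - tg t = (- rot90 (force r t) - (1 - r * k t) *: tg t) + (- (r * k t)) *: tg t.
    by rewrite scalerBl scale1r scaleNr opprB addrCA [RHS]addrC addKr.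
  apply: le_trans (enorm_triangle _ _) _; rewrite enormZ (enorm_unit (unit_tg F t)) mulr1 normrN normrM (gtr0_norm r0).
  have h2 : r * `|k t| <= r * Km by rewrite ler_pM2l.
  by apply: le_trans re'; rewrite mul1r in h1; apply: first_order' h1 h2 r0.
Qed.

Lemma curve_first_order :
  H1norm L (fun t => r^-1 *: (v r t - (gam t - r *: nrm t))) @[r --> 0^'+] --> 0%E.
Proof.
have [lg ln] := frame_loops.
apply: (@cvg_H1norm R 2 1 _ _ L _
  (fun r t => r^-1 *: (- rot90 (force r t) - (1 - r * k t) *: tg t))) => // e e0.
have [d d0 Hd] := expansions e0.
apply: (near_right0 (d := Num.min d rb)); first by rewrite lt_min d0 rb0.
move=> r /andP[r0]; rewrite lt_min => /andP[rd rrb].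
have rr : 0 < r < rb by rewrite r0.
have bound (x : E) i : enorm x <= e * r -> `|(r^-1 *: x) i 0| <= e.
  move=> h; rewrite mxE normrM normfV (gtr0_norm r0) mulrC ler_pdivrMr//.
  exact: le_trans (coord_le_enorm x i) h.
rewrite vE//; split.
- have l1 := C1loop_lin (- r) lg ln; have l2 := C1loop_lin (-1) (trajectory_loop rr) l1.
  have := C1loop_lin r^-1 (C1loop0 (m := 2) (n := 1) L) l2.
  rewrite (_ : (fun t => 0 + r^-1 *: (trajectory r t + -1 *: (gam t + - r *: nrm t))) =
    (fun t => r^-1 *: (trajectory r t - (gam t - r *: nrm t)))); last first.
    by apply/funext => t; rewrite add0r scaleN1r scaleNr.
  rewrite (_ : (fun t => 0 + r^-1 *: (- rot90 (force r t) + -1 *: (tg t + - r *: (k t *: tg t)))) =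
    (fun t => r^-1 *: (- rot90 (force r t) - (1 - r * k t) *: tg t)))//.
  by apply/funext => t; rewrite add0r scaleN1r scalerA scalerBl scale1r mulNr scaleNr.
- by move=> t i j; rewrite ord1; apply: bound; have [] := Hd r t rr rd.
- by move=> t i j; rewrite ord1; apply: bound; have [] := Hd r t rr rd.
Qed.

Lemma velocity_first_order (e : R) : 0 < e -> \forall r \near 0^'+, forall t : R,
  enorm (derive1 (v r) t - (1 - r * k t) *: tg t) <= e * r.
Proof.
move=> e0; have [d d0 Hd] := expansions e0.
apply: (near_right0 (d := Num.min d rb)); first by rewrite lt_min d0 rb0.
move=> r /andP[r0]; rewrite lt_min => /andP[rd rrb] t; have rr : 0 < r < rb by rewrite r0.
rewrite vE// derive1E (@derive_val _ _ _ _ _ _ _ (trajectory_derive t rr)).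
by have [] := Hd r t rr rd.
Qed.

Lemma distance_second_order (e : R) : 0 < e ->
  (forall e : R, 0 < e -> exists2 d : R, 0 < d & forall r t, 0 < r < rb -> r < d ->
     `|sg r t - (1 + k t * r / 2)| <= e * r /\ 0 < sg r t <= 2) ->
  \forall r \near 0^'+, forall t : R,
    `|distE Gam (v r t) - (r + 2^-1 * k t * r ^+ 2)| <= e * r ^+ 2.
Proof.
move=> e0 /(_ e e0) [d d0 Hd]; have [s0 s00 Hdist] := tube_distE F.
apply: (near_right0 (d := Num.min (Num.min d rb) (s0 / 2))); first by rewrite !lt_min d0 rb0 divr_gt0.
move=> r /andP[r0]; rewrite !lt_min => /andP[/andP[rd rrb] rs] t; have rr : 0 < r < rb by rewrite r0.
have [h1 /andP[h2 h3]] := Hd r t rr rd.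
have hs : 0 <= r * sg r t <= s0.
  rewrite mulr_ge0 ?(ltW r0) ?(ltW h2)//=; apply: (@le_trans _ _ (r * 2)); first by rewrite ler_pM2l.
  by rewrite -ler_pdivlMr// ltW.
rewrite vE// /Submission.trajectory (Hdist _ _ hs).
have -> : r * sg r t - (r + 2^-1 * k t * r ^+ 2) = r * (sg r t - (1 + k t * r / 2)).
  by move: (sg r t) (k t) => x y; field.
by rewrite normrM (gtr0_norm r0) expr2 mulrA [e * r * r]mulrC ler_pM2l.
Qed.

End Family.

(*PART 29*)
Theorem theorem2p2 (R : realType) (N : nat) (hN : (0 < N)%N)
    (Om Gam : set 'cV[R]_2) (L : R)
    (nu : 'cV[R]_2 -> 'cV[R]_2) (kappa : 'cV[R]_2 -> R)
    (delta : R) (p : 'cV[R]_2 -> 'cV[R]_2)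
    (g : 'cV[R]_2 -> 'cV[R]_2 -> R)
    (hOm : open Om /\ connected Om)
    (hbd : boundary Om !=set0)
    (hGam : is_component Gam (boundary Om))
    (hclosed : closed Gam)
    (hC3 : C3_boundary Om Gam)
    (hL : circle_of_length Gam L)
    (hnu : exterior_unit_normal Om Gam nu)
    (hkappa : curvature Gam nu kappa)
    (hdelta : 0 < delta)
    (hp : orthogonal_projection (collar Om Gam delta) Gam p)
    (hkd : forall q, Gam q -> `|kappa q| < delta^-1)
    (hgsym : forall w z, Om w -> Om z -> g w z = g z w)
    (hgC3 : Ck 3 (Om `*` Om) (fun wz : 'cV[R]_2 * 'cV[R]_2 => g wz.1 wz.2))
    (hA : assumption_A g Om Gam nu kappa delta p) :
  exists (rbar : R) (z : R -> R -> 'M[R]_(2, N)),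
    let T (r : R) : R := 2 * pi * r * L in
    let v (r t : R) : 'cV[R]_2 := col (Ordinal hN) (z r (2 * pi * r * t)) in
    [/\ 0 < rbar,
        C1_into_calH1 `]0, rbar[ (fun r => (T r, z r)),
        forall r, 0 < r < rbar ->
          [/\ solution g Om (z r),
              minimal_period (T r) (z r) &
              forall (k : 'I_N) (t : R),
                col k (z r t)
                = col (Ordinal hN) (z r (t + k%:R * T r / N%:R))] &
        exists gam : R -> 'cV[R]_2,
          [/\ arclength_parametrization Gam L gam,
              H1norm L (fun t => v r t - gam t) @[r --> 0^'+] --> 0%E,
              H1norm L (fun t => r^-1 *:
                  (v r t - (gam t - r *: nu (gam t)))) @[r --> 0^'+] --> 0%E,
              forall eps : R, 0 < eps -> \forall r \near 0^'+, forall t : R,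
                enorm (derive1 (v r) t
                       - (1 - r * kappa (gam t)) *: rot90 (nu (gam t)))
                <= eps * r &
              forall eps : R, 0 < eps -> \forall r \near 0^'+, forall t : R,
                `|distE Gam (v r t) - (r + 2^-1 * kappa (gam t) * r ^+ 2)|
                <= eps * r ^+ 2]].
Proof.
case: N hN => // n hN; have -> : Ordinal hN = ord0 by exact: val_inj.
have [oOm _] := hOm.
have [gam [arc F]] := exists_frame oOm hGam hC3 hnu hkappa hL.
have L0 := frame_L F.
have [[_ Ai] Aii] := hA.
have rho_lim t : [/\ rhofun g z @[z --> within Om (nbhs (gam t))] --> (0 : R),
      grad (rhofun g) z @[z --> within Om (nbhs (gam t))] --> - (2 *: (nu \o gam) t) &
      hess (rhofun g) z @[z --> within Om (nbhs (gam t))] --> (- (2 * (kappa \o gam) t))%:M].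
  by apply: Ai; apply/(Gam_gam F); exists t.
have decay : green_decay Om gam (nu \o gam) g by exact: (green_decay_of F hdelta erefl hp Aii).
have half0 : 0 < 1 / 2 :> R by [].
have q0 : 0 < 1 / 4 :> R by [].
have [rb [u [rb0 Hu Hbound Hsmall]]] := reduced_orbit F oOm hgC3 hgsym rho_lim decay n half0.
have Xu r (rr : 0 < r < rb) : loops L (u r) by have [] := Hu r rr.
have fix_u r (rr : 0 < r < rb) := let: And5 _ f _ _ _ := Hu r rr in f.
have reg r (rr : 0 < r < rb) := let: And5 _ _ _ f _ := Hu r rr in f.
have usd_u r (rr : 0 < r < rb) := let: And5 _ _ _ _ f := Hu r rr in f.
have Est := orbit_estimates F oOm hgC3 rho_lim Xu fix_u Hbound Hsmall.
have [d1 d10 H1] := Est _ q0.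
have [s0 s00 Hdist] := tube_distE F; have [s1 s10 Hin] := tube_inside F.
pose rbar := Num.min (Num.min rb (Num.min d1 1)) (Num.min (s0 / 2) (Num.min (s1 / 2) (delta / 2))).
have rbar0 : 0 < rbar by rewrite !lt_min rb0 d10 ltr01 !divr_gt0.
have rng r : 0 < r < rbar -> [/\ 0 < r < rb, r < d1, r < 1 & [/\ r < s0 / 2, r < s1 / 2 & r < delta / 2]].
  by move=> /andP[-> ]; rewrite !lt_min => /andP[/andP[-> /andP[-> ->]] /andP[-> /andP[-> ->]]].
clearbody rbar.
have Xu' r : 0 < r < rbar -> loops L (u r) by move=> /rng [/Xu].
have fix' r : 0 < r < rbar -> _ := fun rr => fix_u r (let: And4 f _ _ _ := rng r rr in f).
have reg' r : 0 < r < rbar -> _ := fun rr => reg r (let: And4 f _ _ _ := rng r rr in f).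
have usd' r : 0 < r < rbar -> _ := fun rr => usd_u r (let: And4 f _ _ _ := rng r rr in f).
have rN r : 0 < r < rbar -> forall t, rhoN gam (nu \o gam) g (orb L (u r) t).1.1 (r * (orb L (u r) t).1.2) < 0.
  move=> /rng [rr rd _ _] t; have [_ [_ h _ _]] := H1 r t rr rd.
  by apply: le_lt_trans h _; rewrite oppr_lt0.
have Jp r : 0 < r < rbar -> forall t, 0 < 1 - r * (orb L (u r) t).1.2 * (kappa \o gam) (orb L (u r) t).1.1.
  move=> /rng [rr rd _ _] t; have [_ [/andP[h _] _ _ _]] := H1 r t rr rd.
  exact: lt_le_trans h.
have wp r : 0 < r < rbar -> forall t, 0 < angular_speed L gam (nu \o gam) (kappa \o gam) g n r (u r) t.
  move=> /rng [rr rd r1 _] t; have [[_ _ h] _] := H1 r t rr rd.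
  move: h => /ler_normlP [h _]; move: h r1; lra.
have inj r : 0 < r < rbar -> forall S t,
    trajectory L gam (nu \o gam) r (u r) (t + S) = trajectory L gam (nu \o gam) r (u r) t ->
    exists m : int, (orb L (u r) (t + S)).1.1 = (orb L (u r) t).1.1 + m%:~R * L.
  move=> /rng [rr rd r1 [rs0 rs1 rdel]] S t E; apply: (frame_inj F).
  have r0 : 0 < r by case/andP: rr.
  have foot x : gam (orb L (u r) x).1.1 = p (trajectory L gam (nu \o gam) r (u r) x).
    have [_ [_ _ /andP[h1 h2] _]] := H1 r x rr rd.
    rewrite /trajectory; set s := r * _; have sp : 0 < s by rewrite mulr_gt0.
    have s2 : s <= 2 * r by rewrite /s mulrC ler_pM2r.
    have dE : distE Gam (tube gam (nu \o gam) (orb L (u r) x).1.1 s) = s.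
      by apply: Hdist; rewrite (ltW sp) (le_trans s2)// -ler_pdivlMl// mulrC ltW.
    have OX : Om (tube gam (nu \o gam) (orb L (u r) x).1.1 s).
      by apply: Hin; rewrite sp (le_lt_trans s2)// -ltr_pdivlMl// mulrC.
    have cX : collar Om Gam delta (tube gam (nu \o gam) (orb L (u r) x).1.1 s).
      by split=> //; rewrite dE (le_trans s2)// -ler_pdivlMl// mulrC ltW.
    have [_ _ pu] := hp _ cX; apply: pu; first by apply/(Gam_gam F); exists (orb L (u r) x).1.1.
    rewrite dE /tube; set y := gam _.
    have -> : y - s *: (nu \o gam) (orb L (u r) x).1.1 - y = (- s) *: (nu \o gam) (orb L (u r) x).1.1.
      by rewrite addrAC subrr add0r scaleNr.
    by rewrite enormZ (enorm_unit (frame_unit F _)) mulr1 normrN gtr0_norm.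
  by rewrite !foot E.
have dr r (rr : 0 < r < rbar) : drift L (u r) = 0.
  exact: (no_drift F oOm hgC3 hgsym Xu' fix' reg' rN Jp wp rr).
have Hbound' : exists2 C : R, 0 < C & forall r x, 0 < r < rbar -> `|u r x| <= C * r.
  have [C C0 h] := Hbound; exists C => // r x /rng [rr _ _ _]; exact: h.
have Hsmall' (e : R) (e0 : 0 < e) : exists2 d : R, 0 < d &
    forall r x, 0 < r < rbar -> r < d -> x.1 != (2%R : 'I_3) -> `|u r x| <= e * r.
  have [d d0 h] := Hsmall e e0; exists d => // r x /rng [rr _ _ _]; exact: h.
have expansions (e : R) (e0 : 0 < e) := trajectory_expansions F oOm hgC3 rho_lim Xu' fix' reg' Hbound' Hsmall' e0.
have expansions' (e : R) : 0 < e -> exists2 d : R, 0 < d & forall r t, 0 < r < rbar -> r < d ->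
    enorm (trajectory L gam (nu \o gam) r (u r) t - (gam t - r *: (nu \o gam) t)) <= e * r /\
    enorm (- rot90 (force L gam (nu \o gam) g n r (u r) t)
           - (1 - r * (kappa \o gam) t) *: rot90 ((nu \o gam) t)) <= e * r.
  move=> /expansions [d d0 h]; exists d => // r t rr rd.
  exact: (h r t rr rd (rN r rr) (dr r rr)).
have depths (e : R) : 0 < e -> exists2 d : R, 0 < d & forall r t, 0 < r < rbar -> r < d ->
    `|(orb L (u r) t).1.2 - (1 + (kappa \o gam) t * r / 2)| <= e * r /\ 0 < (orb L (u r) t).1.2 <= 2.
  move=> /Est [d d0 h]; exists d => // r t /rng [rr _ _ _] rd.
  by have [[_ h1 _] [_ _ h2 _]] := h r t rr rd.
exists rbar, (solution_family L gam (nu \o gam) n u) => /=.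
split.
- exact: rbar0.
- apply: family_C1; [exact: F | exact: oOm | exact: hgC3 | exact: hgsym | exact: Xu' | exact: fix'
    | exact: reg' | exact: usd' | exact: rN | exact: Jp | exact: wp].
- move=> r rr; apply: family_properties;
    [exact: F | exact: oOm | exact: hgC3 | exact: hgsym | exact: Xu' | exact: fix'
    | exact: reg' | exact: rN | exact: Jp | exact: wp | exact: inj | exact: rr].
- exists gam; split.
  + exact: arc.
  + apply: curve_limit;
      [exact: F | exact: oOm | exact: hgC3 | exact: hgsym | exact: Xu' | exact: fix'
      | exact: reg' | exact: rN | exact: Jp | exact: wp | exact: rbar0 | exact: expansions'].
  + apply: (curve_first_order (nrm := nu \o gam));
      [exact: F | exact: oOm | exact: hgC3 | exact: hgsym | exact: Xu' | exact: fix'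
      | exact: reg' | exact: rN | exact: Jp | exact: wp | exact: rbar0 | exact: expansions'].
  + apply: (velocity_first_order (k := kappa \o gam) (nrm := nu \o gam));
      [exact: F | exact: oOm | exact: hgC3 | exact: hgsym | exact: Xu' | exact: fix'
      | exact: reg' | exact: rN | exact: Jp | exact: wp | exact: rbar0 | exact: expansions'].
  + move=> eps eps0; apply: (distance_second_order (k := kappa \o gam) (nrm := nu \o gam));
      [exact: F | exact: rbar0 | exact: eps0 | exact: depths].
Qed.
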